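(* Let $v\in L^p([0,\pi])$, $p>1$, be complex-valued. Then there is a Riesz basis (of $L^2([0,\pi])$) consisting of root functions of the operator $L_{Per^+}(v)$ (respectively $L_{Per^-}(v)$) if and only if $$\sup_{\gamma_n\neq 0}\frac{|\delta_n^{Neu}|}{|\gamma_n|}<\infty,$$ where the supremum is over (sufficiently large) even $n$ with $\gamma_n\ne0$ in the case of periodic boundary conditions $Per^+$ (respectively odd $n$ with $\gamma_n\neq 0$ in the case of antiperiodic boundary conditions $Per^-$).
   Context: Operators. For complex-valued $v\in L^1([0,\pi])$ let $Ly=-y''+v(x)y$ on $[0,\pi]$, with boundary conditions ($bc$): periodic $Per^+$: $y(0)=y(\pi),\ y'(0)=y'(\pi)$; antiperiodic $Per^-$: $y(0)=-y(\pi),\ y'(0)=-y'(\pi)$; Neumann $Neu$: $y'(0)=y'(\pi)=0$. $L_{bc}=L_{bc}(v)$ denotes the closed operator in $L^2([0,\pi])$ generated by $L$ on $\{f:\ f' \text{ absolutely continuous},\ f \text{ satisfies } (bc),\ Lf\in L^2([0,\pi])\}$. Root functions are eigenfunctions and associated (generalized eigen-) functions. Eigenvalues. Let $D_n=\{\lambda\in\mathbb{C}:|\lambda-n^2|<n/4\}$. For all sufficiently large $n\in\mathbb{N}$, $D_n$ contains exactly two eigenvalues (counted with algebraic multiplicity) $\lambda_n^-,\lambda_n^+$ of $L_{Per^+}$ if $n$ is even, respectively of $L_{Per^-}$ if $n$ is odd, and exactly one eigenvalue $\nu_n$ of $L_{Neu}$. They are labelled so that $\operatorname{Re}\lambda_n^-<\operatorname{Re}\lambda_n^+$,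 or $\operatorname{Re}\lambda_n^-=\operatorname{Re}\lambda_n^+$ and $\operatorname{Im}\lambda_n^-\le\operatorname{Im}\lambda_n^+$. Set $\gamma_n=\lambda_n^+-\lambda_n^-$ and $\delta_n^{Neu}=\lambda_n^+-\nu_n$ (defined for sufficiently large $n$). *)

(* Defs.v *)
From HB Require Import structures.
From mathcomp Require Import all_boot all_order all_algebra.
From mathcomp Require Import complex.
From mathcomp Require Import all_classical all_reals all_analysis.

Set Implicit Arguments.
Unset Strict Implicit.
Unset Printing Implicit Defensive.

Import Order.TTheory GRing.Theory Num.Theory.
Import numFieldNormedType.Exports.

Local Open Scope classical_set_scope.
Local Open Scope ring_scope.
Local Open Scope complex_scope.

(* [`|z|] on R[i] is itself R[i]-valued; [cabs z] is the modulus as a real. *)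
Notation cabs := (@Normc.normc _).

Section Defs.
Variable R : realType.
Local Notation C := R[i].
Local Notation mu := (@lebesgue_measure R).

Definition I0pi : set R := `[0, pi]%classic.

(** Functions on [0, pi] are represented by functions R -> C of which only the
    values on [I0pi] matter; elements of the spaces L^p are moreover only
    considered up to [aeq]. *)

Definition aeq (f g : R -> C) : Prop := ae_eq mu I0pi f g.

Definition cmeasurable (f : R -> C) : Prop :=
  measurable_fun I0pi (fun x => complex.Re (f x)) /\
  measurable_fun I0pi (fun x => complex.Im (f x)).

Definition inLp (p : R) (f : R -> C) : Prop :=
  cmeasurable f /\ (\int[mu]_(x in I0pi) (cabs (f x) `^ p)%:E < +oo)%E.

Definition inL2 (f : R -> C) : Prop := inLp 2 f.

Definition cintegral (f : R -> C) : C :=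
  (\int[mu]_(x in I0pi) complex.Re (f x))
    +i* (\int[mu]_(x in I0pi) complex.Im (f x)).

Definition inner (f g : R -> C) : C := cintegral (fun x => f x * (g x)^*%C).

Definition sqnorm (f : R -> C) : \bar R :=
  (\int[mu]_(x in I0pi) (cabs (f x) ^+ 2)%:E)%E.

(* Derivative relative to [0, pi], hence one-sided at the two end points. *)
Definition has_deriv (f : R -> C) (x : R) (l : C) : Prop :=
  cabs ((f t - f x) / (t - x)%:C - l) @[t --> within I0pi x^'] --> (0 : R).

Definition abs_continuous (f : R -> C) : Prop :=
  forall e : R, 0 < e -> exists2 d : R, 0 < d &
    forall (n : nat) (a b : 'I_n -> R),
      (forall i, [/\ 0 <= a i, a i <= b i & b i <= pi]) ->
      trivIset [set: 'I_n] (fun i => `]a i, b i[%classic) ->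
      \sum_(i < n) (b i - a i) < d ->
      \sum_(i < n) cabs (f (b i) - f (a i)) < e.

Inductive bcond := PerP | PerM | Neu.

Definition satisfies_bc (bc : bcond) (y y' : R -> C) : Prop :=
  match bc with
  | PerP => y 0 = y pi /\ y' 0 = y' pi
  | PerM => y 0 = - y pi /\ y' 0 = - y' pi
  | Neu  => y' 0 = 0 /\ y' pi = 0
  end.

(* The graph of the operator L_bc(v) in L^2([0, pi]): the pairs (f, h) with f
   in the domain and h = L f. Here y is the differentiable representative of
   the class of f, and y'' exists almost everywhere since y' is absolutely
   continuous. *)
Definition Lgraph (bc : bcond) (v : R -> C) (f h : R -> C) : Prop :=
  inL2 f /\ inL2 h /\
  exists y y' y'' : R -> C,
    [/\ aeq f y,
        (forall x, I0pi x -> has_deriv y x (y' x)),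
        abs_continuous y' /\ satisfies_bc bc y y',
        {ae mu, forall x, I0pi x -> has_deriv y' x (y'' x)}
      & aeq h (fun x => - y'' x + v x * y x)].

(* f belongs to the kernel of (L_bc(v) - lambda)^k. *)
Fixpoint in_ker_pow (bc : bcond) (v : R -> C) (lambda : C) (k : nat)
    (f : R -> C) : Prop :=
  match k with
  | 0%N => aeq f (fun=> 0)
  | k'.+1 => exists2 h, Lgraph bc v f h &
               in_ker_pow bc v lambda k' (fun x => h x - lambda * f x)
  end.

Definition in_root_space (bc : bcond) (v : R -> C) (lambda : C)
    (f : R -> C) : Prop :=
  exists k, in_ker_pow bc v lambda k f.

Definition root_function (bc : bcond) (v : R -> C) (f : R -> C) : Prop :=
  ~ aeq f (fun=> 0) /\ exists lambda, in_root_space bc v lambda f.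

(* The root space of lambda has dimension m; in particular m = 0 exactly when
   lambda is not an eigenvalue. *)
Definition alg_mult (bc : bcond) (v : R -> C) (lambda : C) (m : nat) : Prop :=
  exists e : 'I_m -> R -> C,
    [/\ forall i, in_root_space bc v lambda (e i),
        forall c : 'I_m -> C,
          aeq (fun x => \sum_(i < m) c i * e i x) (fun=> 0) ->
          forall i, c i = 0
      & forall f, in_root_space bc v lambda f ->
          exists c : 'I_m -> C, aeq f (fun x => \sum_(i < m) c i * e i x)].

Definition disc (n : nat) : set C :=
  [set z | cabs (z - n%:R ^+ 2) < n%:R / 4].

Definition per_of (n : nat) : bcond := if odd n then PerM else PerP.

(* Eigenvalues are counted with algebraic multiplicity: a double eigenvalue
   corresponds to lm = lp. *)
Definition disc_eigenvalues (v : R -> C) (n : nat) (lm lp nu : C) : Prop :=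
  [/\ [/\ disc n lm, disc n lp & disc n nu],
      forall z, disc n z -> alg_mult (per_of n) v z ((z == lm) + (z == lp))%N,
      forall z, disc n z -> alg_mult Neu v z (z == nu)
    & complex.Re lm < complex.Re lp \/
      (complex.Re lm = complex.Re lp /\ complex.Im lm <= complex.Im lp)].

Definition orthonormal_basis (e : nat -> R -> C) : Prop :=
  [/\ forall k, inL2 (e k),
      forall j k, inner (e j) (e k) = (j == k)%:R
    & forall f, inL2 f ->
        sqnorm (fun x => f x - \sum_(k < n) inner f (e k) * e k x)
          @[n --> \oo] --> 0%E].

Definition bounded_operator (A : (R -> C) -> R -> C) : Prop :=
  [/\ forall f, inL2 f -> inL2 (A f),
      forall (a b : C) f g, inL2 f -> inL2 g ->
        aeq (A (fun x => a * f x + b * g x)) (fun x => a * A f x + b * A g x)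
    & exists M : R, forall f, inL2 f -> (sqnorm (A f) <= M%:E * sqnorm f)%E].

Definition automorphism (A : (R -> C) -> R -> C) : Prop :=
  bounded_operator A /\
  exists2 B, bounded_operator B &
    forall f, inL2 f -> aeq (A (B f)) f /\ aeq (B (A f)) f.

(* A Riesz basis is the image of an orthonormal basis under a bounded operator
   with bounded inverse. *)
Definition riesz_basis (u : nat -> R -> C) : Prop :=
  (forall k, inL2 (u k)) /\
  exists e A, [/\ orthonormal_basis e, automorphism A
                & forall k, aeq (u k) (A (e k))].

Definition has_riesz_basis_of_root_functions (bc : bcond) (v : R -> C) : Prop :=
  exists2 u : nat -> R -> C, riesz_basis u & forall k, root_function bc v (u k).

End Defs.

Arguments I0pi {R}.

(* Main.v *)
Require Import Defs.
From HB Require Import structures.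
From mathcomp Require Import all_boot all_order all_algebra.
From mathcomp Require Import complex.
From mathcomp Require Import all_classical all_reals all_analysis.
From mathcomp Require Import measurable_realfun.
From mathcomp Require Import zify ring lra.
Import Order.TTheory GRing.Theory Num.Theory.
Import numFieldNormedType.Exports.

Set Implicit Arguments.
Unset Strict Implicit.
Unset Printing Implicit Defensive.

Local Open Scope classical_set_scope.
Local Open Scope ring_scope.
Local Open Scope complex_scope.

(** The operator L is symmetric for the bilinear form B(f, g) = \int f g.  For
    large n the root space E_n of the two (anti)periodic eigenvalues in D_n has a
    B-orthonormal basis (G, H) with G'(0) = 0, uniformly O(1/n)-close to the
    normalized cos nx and sin nx; there L = mu + [[al, b], [b, -al]] with
    mu = (lambda^+ + lambda^-)/2 and (gamma/2)^2 = al^2 + b^2.  As G also satisfies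
    the Neumann conditions, testing it against the Neumann eigenfunction gives
    nu - mu = al + O(1/n) b.  Hence delta/gamma is bounded if and only if
    (|al| + |b|)/|gamma| is, that is, if and only if the eigenvectors F of the
    2x2 block satisfy |F|^2 <= C |B(F, F)| uniformly in n.

    If a Riesz basis of root functions exists, some member of it is a multiple of F
    and the others are B-orthogonal to F, which gives that inequality.  Conversely,
    B-orthonormal bases of the spaces E_n, n >= M, made of root functions of bounded
    norm form a Bessel system which is its own B-dual; the B-orthogonal complement
    of these spaces is finite-dimensional, because they are close to those of the
    trigonometric basis, and it is invariant under the resolvent, hence spanned by
    root functions.  Together they form a Riesz basis, since both the system and its
    biorthogonal system are Bessel and the latter is total. *)

(** * Complex-valued functions on [0, pi] *)

(** The spectral data are given with the discs, so no contour integrals or Riesz projections are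
    needed: only the root functions have to be estimated. The obstacle is the radius n/4 of D_n. In
    y'' + n^2 y = (v - lambda + n^2) y the term lambda - n^2 may be of the order of n, and after
    division by n the first comparison of y with a trigonometric polynomial has an error that does
    not tend to 0. Started at the midpoint pi/2, this error is at most 41/100 of sup |y|; that is
    enough to test L against a trigonometric function and to get |lambda - n^2| = O(1). A second
    comparison, started at 0, then gains the factor 1/n. The explicit constants and the bound pi <=
    49/15 serve this bootstrap. Since B is not positive, F may be nearly isotropic, and the
    normalization B(F, F) = 1 may then blow up; the bound on the ratio is what controls it. The
    elements of L^2 are kept as functions, so the space carries a seminorm only and identities hold
    up to vectors of norm 0. *)

Section ComplexModulus.
Variable R : realType.
Local Notation C := R[i].
Local Notation Re := (@complex.Re R).
Local Notation Im := (@complex.Im R).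
Implicit Types z w : C.

Lemma cabs_normE z : (cabs z)%:C = `|z|.
Proof. by []. Qed.

Lemma cabs_ge0 z : 0 <= cabs z.
Proof. by rewrite -ler0c cabs_normE. Qed.

Lemma cabsM z w : cabs (z * w) = cabs z * cabs w.
Proof. exact: Normc.normcM. Qed.

Lemma cabsD z w : cabs (z + w) <= cabs z + cabs w.
Proof. exact: le_normcD. Qed.

Lemma cabsN z : cabs (- z) = cabs z.
Proof. exact: complex.normcN. Qed.

Lemma cabsB z w : cabs (z - w) <= cabs z + cabs w.
Proof. by rewrite -(cabsN w); exact: cabsD. Qed.

Lemma cabsC z w : cabs (z - w) = cabs (w - z).
Proof. by rewrite -cabsN opprB. Qed.

Lemma cabs0 : cabs (0 : C) = 0.
Proof. exact: Normc.normc0. Qed.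

Lemma cabs1 : cabs (1 : C) = 1.
Proof. exact: Normc.normc1. Qed.

Lemma cabsV z : cabs z^-1 = (cabs z)^-1.
Proof. exact: Normc.normcV. Qed.

Lemma cabs_eq0 z : (cabs z == 0) = (z == 0).
Proof.
apply/eqP/eqP => [|->]; [exact: Normc.eq0_normc|exact: cabs0].
Qed.

Lemma cabs_gt0 z : (0 < cabs z) = (z != 0).
Proof. by rewrite lt_def cabs_eq0 cabs_ge0 andbT. Qed.

Lemma cabs_real (x : R) : cabs x%:C = `|x|.
Proof. by rewrite /Normc.normc /= expr0n /= addr0 sqrtr_sqr. Qed.

Lemma cabsX z n : cabs (z ^+ n) = cabs z ^+ n.
Proof. by elim: n => [|n IH]; rewrite ?expr0 ?cabs1// !exprS cabsM IH. Qed.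

Lemma cabs_sqr z : cabs z ^+ 2 = Re z ^+ 2 + Im z ^+ 2.
Proof. by case: z => a b; rewrite /Normc.normc sqr_sqrtr // addr_ge0 ?sqr_ge0. Qed.

Lemma cabsJ z : cabs z^*%C = cabs z.
Proof. by case: z => a b; rewrite /Normc.normc /= sqrrN. Qed.

Lemma mul_conjc z : z * z^*%C = (cabs z ^+ 2)%:C.
Proof. by rewrite -sqr_normc -cabs_normE rmorphXn. Qed.

Lemma Re_le_cabs z : `|Re z| <= cabs z.
Proof.
by rewrite -[leLHS]sqrtr_sqr; case: z => a b; rewrite ler_wsqrtr// lerDl sqr_ge0.
Qed.

Lemma Im_le_cabs z : `|Im z| <= cabs z.
Proof.
by rewrite -[leLHS]sqrtr_sqr; case: z => a b; rewrite ler_wsqrtr// lerDr sqr_ge0.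
Qed.

Lemma cabs_le_ReIm z : cabs z <= `|Re z| + `|Im z|.
Proof.
rewrite -(@ler_pXn2r _ 2)// ?nnegrE ?cabs_ge0 ?addr_ge0//.
rewrite cabs_sqr sqrrD !real_normK ?num_real//.
by rewrite addrAC lerDl mulrn_wge0// mulr_ge0.
Qed.

Lemma cabs_sum (I : Type) (r : seq I) (P : pred I) (F : I -> C) :
  cabs (\sum_(i <- r | P i) F i) <= \sum_(i <- r | P i) cabs (F i).
Proof.
elim/big_ind2: _ => [|z x w y zx wy|//]; first by rewrite cabs0.
by rewrite (le_trans (cabsD _ _))// lerD.
Qed.

Lemma cabs_dist z w : `|cabs z - cabs w| <= cabs (z - w).
Proof.
rewrite ler_norml lerNl opprB !lerBlDr; apply/andP; split.
  by rewrite cabsC -{1}(subrK z w) cabsD.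
by rewrite -{1}(subrK w z) cabsD.
Qed.

(** Rotating by a phase reduces a bound on a modulus to a bound on a real part; integrals, inner
    products and values of functions are all estimated this way. *)
Lemma cphase z : exists2 u, cabs u = 1 & u * z = (cabs z)%:C.
Proof.
have [->|z0] := eqVneq z 0; first by exists 1; rewrite ?cabs1// mulr0 cabs0.
have az0 : cabs z != 0 by rewrite cabs_eq0.
exists (z^*%C / (cabs z)%:C).
  by rewrite cabsM cabsV cabsJ cabs_real ger0_norm ?cabs_ge0// divff.
rewrite mulrAC [_ * z]mulrC mul_conjc expr2 rmorphM /= mulfK//.
by rewrite fmorph_eq0.
Qed.

Lemma cReD z w : Re (z + w) = Re z + Re w. Proof. by case: z; case: w. Qed.
Lemma cImD z w : Im (z + w) = Im z + Im w. Proof. by case: z; case: w. Qed.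
Lemma cReN z : Re (- z) = - Re z. Proof. by case: z. Qed.
Lemma cImN z : Im (- z) = - Im z. Proof. by case: z. Qed.
Lemma cReM z w : Re (z * w) = Re z * Re w - Im z * Im w.
Proof. by case: z; case: w. Qed.
Lemma cImM z w : Im (z * w) = Re z * Im w + Im z * Re w.
Proof. by case: z => a b; case: w => c d /=; rewrite [b * c]mulrC. Qed.
Lemma cReJ z : Re z^*%C = Re z. Proof. by case: z. Qed.
Lemma cImJ z : Im z^*%C = - Im z. Proof. by case: z. Qed.
Lemma complex_eq z w : Re z = Re w -> Im z = Im w -> z = w.
Proof. by case: z => ? ?; case: w => ? ? /= -> ->. Qed.

End ComplexModulus.

(** * Integrals of complex-valued functions *)

Section ComplexIntegral.
Variable R : realType.
Local Notation C := R[i].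
Local Notation mu := (@lebesgue_measure R).
Local Notation Re := (@complex.Re R).
Local Notation Im := (@complex.Im R).
Implicit Types (D : set R) (f g : R -> C).

Definition cmeas D f := measurable_fun D (fun x => Re (f x)) /\
  measurable_fun D (fun x => Im (f x)).

Definition cI D f : C :=
  (\int[mu]_(x in D) Re (f x)) +i* (\int[mu]_(x in D) Im (f x)).

(** The L^1 seminorm over [D]; for the potential it is the constant [V] of the later estimates. *)
Definition nI D f : R := \int[mu]_(x in D) cabs (f x).

Definition rint D (h : R -> R) := mu.-integrable D (EFin \o h).

Definition cintble D f := rint D (fun x => Re (f x)) /\ rint D (fun x => Im (f x)).

Lemma eq_rint D (f g : R -> R) : measurable D -> {in D, f =1 g} ->
  rint D f -> rint D g.
Proof.
move=> mD fg; apply: (@eq_integrable _ _ _ mu D mD) => x Dx /=.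
by rewrite fg.
Qed.

Lemma rintD D (f g : R -> R) : measurable D -> rint D f -> rint D g ->
  rint D (fun x => f x + g x).
Proof. by move=> mD; exact: (@integrableD _ _ _ mu D mD). Qed.

Lemma rintZ D (f : R -> R) r : measurable D -> rint D f -> rint D (fun x => r * f x).
Proof. by move=> mD; exact: (@integrableZl _ _ _ mu D mD). Qed.

Lemma rint_norm D (f : R -> R) : rint D f -> rint D (fun x => `|f x|).
Proof. exact: (@integrable_norm _ _ _ mu). Qed.

Lemma rint_dom D (f h : R -> R) : measurable D -> measurable_fun D f ->
  (forall x, D x -> `|f x| <= h x) -> rint D h -> rint D f.
Proof.
move=> mD mf fh; apply: (@le_integrable _ _ _ mu D mD).
  exact/measurable_EFinP.
by move=> x Dx /=; rewrite lee_fin (le_trans (fh _ Dx)) ?ler_norm.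
Qed.

Lemma rintS D E (f : R -> R) : measurable D -> measurable E -> E `<=` D ->
  rint D f -> rint E f.
Proof. exact: (@integrableS _ _ _ mu). Qed.

Lemma cmeas_cst D c : cmeas D (fun=> c).
Proof. by split; exact: measurable_cst. Qed.

Lemma cmeasD D f g : cmeas D f -> cmeas D g -> cmeas D (fun x => f x + g x).
Proof.
move=> [f1 f2] [g1 g2]; split.
- by under eq_fun do rewrite cReD; exact: measurable_funD.
- by under eq_fun do rewrite cImD; exact: measurable_funD.
Qed.

Lemma cmeasM D f g : cmeas D f -> cmeas D g -> cmeas D (fun x => f x * g x).
Proof.
move=> [f1 f2] [g1 g2]; split.
- under eq_fun do rewrite cReM.
  by apply: measurable_funB; exact: measurable_funM.
- under eq_fun do rewrite cImM.
  by apply: measurable_funD; exact: measurable_funM.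
Qed.

Lemma cmeasN D f : cmeas D f -> cmeas D (fun x => - f x).
Proof.
move=> [f1 f2]; split.
- by under eq_fun do rewrite cReN; exact: measurable_funN.
- by under eq_fun do rewrite cImN; exact: measurable_funN.
Qed.

Lemma cmeasB D f g : cmeas D f -> cmeas D g -> cmeas D (fun x => f x - g x).
Proof. by move=> mf mg; apply: cmeasD => //; exact: cmeasN. Qed.

Lemma cmeasJ D f : cmeas D f -> cmeas D (fun x => (f x)^*%C).
Proof.
move=> [f1 f2]; split; first by under eq_fun do rewrite cReJ.
by under eq_fun do rewrite cImJ; exact: measurable_funN.
Qed.

Lemma measurable_sqrt_fun D (f : R -> R) : measurable D -> measurable_fun D f ->
  measurable_fun D (fun x => Num.sqrt (f x)).
Proof.
move=> mD mf; apply: (@measurable_comp _ _ _ _ _ _ setT (@Num.sqrt R)) => //.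
by apply: continuous_measurable_fun; exact: sqrt_continuous.
Qed.

Lemma cmeas_cabs D f : measurable D -> cmeas D f ->
  measurable_fun D (fun x => cabs (f x)).
Proof.
move=> mD [f1 f2].
have -> : (fun x => cabs (f x)) =
    (fun x => Num.sqrt (Re (f x) ^+ 2 + Im (f x) ^+ 2)).
  by apply/funext => x; case: (f x).
by apply: measurable_sqrt_fun => //; apply: measurable_funD;
  exact: measurable_funX.
Qed.

Lemma cintble_meas D f : cintble D f -> cmeas D f.
Proof.
move=> [] /integrableP[/measurable_EFinP mf _] /integrableP[/measurable_EFinP mg _].
by split.
Qed.

Lemma cintble_dom D f (h : R -> R) : measurable D -> cmeas D f ->
  rint D h -> (forall x, D x -> cabs (f x) <= h x) ->
  cintble D f.
Proof.
move=> mD [f1 f2] ih fh; split; apply: rint_dom ih => // x Dx.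
- exact: le_trans (Re_le_cabs _) (fh _ Dx).
- exact: le_trans (Im_le_cabs _) (fh _ Dx).
Qed.

Lemma cintble_cabs D f : measurable D -> cintble D f -> rint D (fun x => cabs (f x)).
Proof.
move=> mD /[dup] iF [i1 i2].
apply: (@rint_dom _ _ (fun x => `|Re (f x)| + `|Im (f x)|)) => //.
- by apply: cmeas_cabs => //; exact: cintble_meas.
- by move=> x Dx; rewrite ger0_norm ?cabs_ge0// cabs_le_ReIm.
- by apply: rintD => //; exact: rint_norm.
Qed.

Lemma cintbleD D f g : measurable D -> cintble D f -> cintble D g ->
  cintble D (fun x => f x + g x).
Proof.
move=> mD [f1 f2] [g1 g2]; split.
- by apply: (eq_rint mD _ (rintD mD f1 g1)) => x _; rewrite cReD.
- by apply: (eq_rint mD _ (rintD mD f2 g2)) => x _; rewrite cImD.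
Qed.

Lemma cintbleM_bdd D f g (M : R) : measurable D -> cmeas D f ->
  (forall x, D x -> cabs (f x) <= M) -> cintble D g ->
  cintble D (fun x => f x * g x).
Proof.
move=> mD mf fM ig; apply: (@cintble_dom _ _ (fun x => M * cabs (g x))) => //.
- by apply: cmeasM => //; exact: cintble_meas.
- by apply: rintZ => //; exact: cintble_cabs.
- by move=> x Dx; rewrite cabsM ler_wpM2r ?cabs_ge0// fM.
Qed.

Lemma cintbleZ D f c : measurable D -> cintble D f -> cintble D (fun x => c * f x).
Proof. by move=> mD; apply: (@cintbleM_bdd _ _ _ (cabs c)) => //; exact: cmeas_cst. Qed.

Lemma cintbleN D f : measurable D -> cintble D f -> cintble D (fun x => - f x).
Proof.
by move=> mD /(cintbleZ (-1) mD); under eq_fun do rewrite mulN1r.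
Qed.

Lemma cintbleB D f g : measurable D -> cintble D f -> cintble D g ->
  cintble D (fun x => f x - g x).
Proof. by move=> mD fi gi; apply: cintbleD => //; exact: cintbleN. Qed.

Lemma cintbleS D E f : measurable D -> measurable E -> E `<=` D ->
  cintble D f -> cintble E f.
Proof. by move=> mD mE ED [f1 f2]; split; apply: rintS ED _. Qed.

Lemma cI_D D f g : measurable D -> cintble D f -> cintble D g ->
  cI D (fun x => f x + g x) = cI D f + cI D g.
Proof.
move=> mD [f1 f2] [g1 g2]; apply: complex_eq; rewrite ?cReD ?cImD /=.
- by rewrite -RintegralD//; apply: eq_Rintegral => x _; rewrite cReD.
- by rewrite -RintegralD//; apply: eq_Rintegral => x _; rewrite cImD.
Qed.

Lemma cI_Z D f c : measurable D -> cintble D f ->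
  cI D (fun x => c * f x) = c * cI D f.
Proof.
move=> mD [f1 f2].
apply: complex_eq; rewrite ?cReM ?cImM /=.
- rewrite -!RintegralZl// -RintegralB//; [|exact: rintZ|exact: rintZ].
  by apply: eq_Rintegral => x _; rewrite cReM.
- rewrite -!RintegralZl// -RintegralD//; [|exact: rintZ|exact: rintZ].
  by apply: eq_Rintegral => x _; rewrite cImM.
Qed.

Lemma cI_N D f : measurable D -> cintble D f -> cI D (fun x => - f x) = - cI D f.
Proof.
move=> mD iF; under eq_fun do rewrite -mulN1r.
by rewrite cI_Z// mulN1r.
Qed.

Lemma cI_B D f g : measurable D -> cintble D f -> cintble D g ->
  cI D (fun x => f x - g x) = cI D f - cI D g.
Proof. by move=> mD fi gi; rewrite cI_D ?cI_N//; exact: cintbleN. Qed.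

Lemma nI_ge0 D f : 0 <= nI D f.
Proof. by apply: Rintegral_ge0 => x _; exact: cabs_ge0. Qed.

(** A phase makes the integral real and nonnegative, so that only a real part has to be bounded;
    splitting into real and imaginary parts would lose a constant. *)
Lemma cabs_cI D f : measurable D -> cintble D f -> cabs (cI D f) <= nI D f.
Proof.
move=> mD iF; have [u u1 uE] := cphase (cI D f).
have -> : cabs (cI D f) = Re (cI D (fun x => u * f x)) by rewrite cI_Z// uE.
have [iuf _] := cintbleZ u mD iF.
apply: le_trans (ler_norm _) _.
apply: le_trans (le_normr_Rintegral _ iuf) _ => //=.
apply: le_Rintegral => //.
- exact: rint_norm.
- exact: cintble_cabs.
- by move=> x _; rewrite (le_trans (Re_le_cabs _))// cabsM u1 mul1r.
Qed.

Lemma eq_cI D f g : {in D, f =1 g} -> cI D f = cI D g.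
Proof.
by move=> fg; congr (_ +i* _); apply: eq_Rintegral => x Dx; rewrite fg.
Qed.

Lemma eq_cintble D f g : measurable D -> {in D, f =1 g} -> cintble D f -> cintble D g.
Proof.
by move=> mD fg [f1 f2]; split;
  [apply: eq_rint f1|apply: eq_rint f2] => // x Dx; rewrite fg.
Qed.

Lemma nI_bdd D f g (M : R) : measurable D -> cmeas D f ->
  (forall x, D x -> cabs (f x) <= M) -> cintble D g ->
  nI D (fun x => f x * g x) <= M * nI D g.
Proof.
move=> mD mf fM ig; rewrite -RintegralZl//; last exact: cintble_cabs.
apply: le_Rintegral => //.
- by apply: cintble_cabs => //; apply: (@cintbleM_bdd _ _ _ M).
- by apply: rintZ => //; exact: cintble_cabs.
- by move=> x /= Dx; rewrite cabsM ler_wpM2r ?cabs_ge0// fM.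
Qed.

Lemma nI_D D f g : measurable D -> cintble D f -> cintble D g ->
  nI D (fun x => f x + g x) <= nI D f + nI D g.
Proof.
move=> mD fi gi; rewrite -RintegralD//; [|exact: cintble_cabs|exact: cintble_cabs].
apply: le_Rintegral => //.
- by apply: cintble_cabs => //; exact: cintbleD.
- by apply: rintD => //; exact: cintble_cabs.
- by move=> x _; exact: cabsD.
Qed.

Lemma ae_Rintegral D (f g : R -> R) : measurable D ->
  measurable_fun D f -> measurable_fun D g ->
  ae_eq mu D f g -> \int[mu]_(x in D) f x = \int[mu]_(x in D) g x.
Proof.
move=> mD mf mg fg; congr fine; apply: ae_eq_integral => //.
- exact/measurable_EFinP.
- exact/measurable_EFinP.
- by apply: filterS fg => x fg Dx /=; rewrite fg.
Qed.

Lemma ae_cI D f g : measurable D -> cmeas D f -> cmeas D g ->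
  ae_eq mu D f g -> cI D f = cI D g.
Proof.
move=> mD [f1 f2] [g1 g2] fg; congr (_ +i* _); apply: ae_Rintegral => //;
  by apply: filterS fg => x fg Dx; rewrite fg.
Qed.

End ComplexIntegral.

(** * Derivatives and absolutely continuous functions *)

Section HasDerivative.
Variable R : realType.
Local Notation C := R[i].
Local Notation mu := (@lebesgue_measure R).
Local Notation Re := (@complex.Re R).
Local Notation Im := (@complex.Im R).
Implicit Types (f g : R -> C) (x : R) (l m : C).

(** The quotient-free form of [has_deriv], with [t = x] allowed; the sum and product rules become
    plain estimates of remainders. *)
Definition hd f x l := forall e : R, 0 < e -> exists2 d : R, 0 < d &
  forall t, I0pi t -> `|t - x| < d ->
    cabs (f t - f x - l * (t - x)%:C) <= e * `|t - x|.

Lemma has_derivP f x l : has_deriv f x l <-> hd f x l.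
Proof.
split=> [/cvgrPdist_le H e e0|H].
- have /nbhs_ballP[d /= d0 Hd] := H _ e0.
  exists d => // t It td.
  have [->|tx] := eqVneq t x.
    by rewrite !subrr mulr0 subr0 normr0 mulr0 cabs0.
  have tx0 : t - x != 0 by rewrite subr_eq0.
  have := Hd t; rewrite /ball /= distrC => /(_ td tx It).
  rewrite sub0r normrN ger0_norm ?cabs_ge0// => H1.
  have -> : f t - f x - l * (t - x)%:C = ((f t - f x) / (t - x)%:C - l) * (t - x)%:C.
    rewrite mulrBl divfK//.
    by apply: contra tx0 => /eqP[->].
  by rewrite cabsM cabs_real ler_wpM2r.
- apply/cvgrPdist_le => e e0; have [d d0 Hd] := H _ e0.
  apply/nbhs_ballP; exists d => //= t; rewrite /ball /= distrC => td tx It.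
  rewrite sub0r normrN ger0_norm ?cabs_ge0//.
  have tx0 : t - x != 0 by rewrite subr_eq0.
  have txC : (t - x)%:C != 0 :> C by apply: contra tx0 => /eqP[->].
  have := Hd t It td.
  have -> : f t - f x - l * (t - x)%:C = ((f t - f x) / (t - x)%:C - l) * (t - x)%:C.
    by rewrite mulrBl divfK.
  by rewrite cabsM cabs_real ler_pM2r// normr_gt0.
Qed.

Lemma hd_cst c x : hd (fun=> c) x 0.
Proof.
move=> e e0; exists 1 => // t _ _.
by rewrite subrr mul0r subr0 cabs0 mulr_ge0// ltW.
Qed.

Lemma hd_incr f x l : hd f x l -> exists2 d : R, 0 < d &
  forall t, I0pi t -> `|t - x| < d -> cabs (f t - f x) <= (cabs l + 1) * `|t - x|.
Proof.
move=> /(_ _ ltr01)[d d0 H]; exists d => // t It td.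
rewrite -[f t - f x](subrK (l * (t - x)%:C)).
rewrite (le_trans (cabsD _ _))// cabsM cabs_real.
by have := H t It td; lra.
Qed.

Lemma hdD f g x l m : hd f x l -> hd g x m -> hd (fun t => f t + g t) x (l + m).
Proof.
move=> hf hg e e0; have e20 : 0 < e / 2 by lra.
have [d1 d10 H1] := hf _ e20; have [d2 d20 H2] := hg _ e20.
exists (Num.min d1 d2); first by rewrite lt_min d10.
move=> t It; rewrite lt_min => /andP[t1 t2].
have -> : f t + g t - (f x + g x) - (l + m) * (t - x)%:C =
  (f t - f x - l * (t - x)%:C) + (g t - g x - m * (t - x)%:C) by ring.
rewrite (le_trans (cabsD _ _))//.
by have := H1 _ It t1; have := H2 _ It t2; lra.
Qed.

Lemma hdM f g x l m : hd f x l -> hd g x m ->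
  hd (fun t => f t * g t) x (l * g x + f x * m).
Proof.
move=> hf hg e e0.
(* [M] dominates the factors in front of the two linear remainders. [K] bounds the product of the
   two increments, which is quadratic in [|t - x|]; the radius [d5] makes it at most half of the
   error. *)
pose M : R := cabs (f x) + cabs (g x) + 1.
have f0 := cabs_ge0 (f x); have g0 := cabs_ge0 (g x).
have M0 : 0 < M by rewrite /M; lra.
pose K : R := (cabs l + 1) * (cabs m + 1).
have K0 : 0 < K by rewrite /K mulr_gt0// ltr_wpDl// cabs_ge0.
have e1 : 0 < e / (2 * M) by rewrite divr_gt0// mulr_gt0.
have [d1 d10 H1] := hf _ e1; have [d2 d20 H2] := hg _ e1.
have [d3 d30 H3] := hd_incr hf; have [d4 d40 H4] := hd_incr hg.
pose d5 := e / (2 * K).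
have d50 : 0 < d5 by rewrite divr_gt0// mulr_gt0.
exists (Num.min (Num.min d1 d2) (Num.min d5 (Num.min d3 d4))).
  by rewrite !lt_min d10 d20 d30 d40 d50.
move=> t It; rewrite !lt_min => /andP[/andP[t1 t2] /and3P[t5 t3 t4]].
have -> : f t * g t - f x * g x - (l * g x + f x * m) * (t - x)%:C =
  (f t - f x - l * (t - x)%:C) * g x + f x * (g t - g x - m * (t - x)%:C)
  + (f t - f x) * (g t - g x) by ring.
rewrite (le_trans (cabsD _ _))// (le_trans (lerD (cabsD _ _) (lexx _)))// !cabsM.
set T : R := `|t - x| in t1 t2 t3 t4 t5 *.
have T0 : 0 <= T by rewrite /T.
apply: (@le_trans _ _ (e / (2 * M) * T * cabs (g x) + cabs (f x) * (e / (2 * M) * T)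
  + ((cabs l + 1) * T) * ((cabs m + 1) * T))).
  apply: lerD; first apply: lerD.
  - by rewrite ler_wpM2r// H1.
  - by rewrite ler_wpM2l// H2.
  - by rewrite ler_pM ?cabs_ge0// ?H3 ?H4.
have -> : e / (2 * M) * T * cabs (g x) + cabs (f x) * (e / (2 * M) * T) =
   (e / (2 * M) * (cabs (f x) + cabs (g x))) * T by ring.
have -> : (cabs l + 1) * T * ((cabs m + 1) * T) = (K * T) * T by rewrite /K; ring.
rewrite -mulrDl ler_wpM2r//.
have : e / (2 * M) * (cabs (f x) + cabs (g x)) <= e / 2.
  rewrite invfM mulrA -mulrA ler_piMr//; first lra.
  by rewrite mulrC ler_pdivrMr// mul1r /M; lra.
have : K * T <= e / 2.
  have : K * T <= K * d5 by rewrite ler_wpM2l// ltW.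
  suff -> : K * d5 = e / 2 by [].
  by rewrite /d5; field; rewrite gt_eqF.
lra.
Qed.

Lemma hdZ f x l c : hd f x l -> hd (fun t => c * f t) x (c * l).
Proof. by move=> hf; have := hdM (hd_cst c x) hf; rewrite mul0r add0r. Qed.

Lemma hdN f x l : hd f x l -> hd (fun t => - f t) x (- l).
Proof.
move=> /(hdZ (-1)); rewrite mulN1r.
by congr hd; apply/funext => t; rewrite mulN1r.
Qed.

Lemma hdB f g x l m : hd f x l -> hd g x m -> hd (fun t => f t - g t) x (l - m).
Proof. by move=> hf hg; apply: hdD => //; exact: hdN. Qed.

Lemma eq_hd f g x l : I0pi x -> (forall t, I0pi t -> f t = g t) -> hd f x l -> hd g x l.
Proof.
move=> Ix fg H e e0; have [d d0 Hd] := H _ e0.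
by exists d => // t It td; rewrite -!fg// Hd.
Qed.

Lemma hd_ReIm (u w : R -> R) x (a b : R) : derivable u x 1 -> derive1 u x = a ->
  derivable w x 1 -> derive1 w x = b ->
  hd (fun t => u t +i* w t) x (a +i* b).
Proof.
have key (h : R -> R) (c : R) : derivable h x 1 -> derive1 h x = c ->
    forall e : R, 0 < e -> exists2 d : R, 0 < d & forall t, `|t - x| < d ->
      `|h t - h x - c * (t - x)| <= e * `|t - x|.
  move=> dh hc e e0.
  have : (fun k => k^-1 *: ((h \o shift x) (k *: 1) - h x)) @ 0^' --> c.
    by rewrite -hc derive1E; exact: dh.
  move/cvgrPdist_le => /(_ _ e0)/nbhs_ballP[d /= d0 H]; exists d => // t td.
  have [->|tx] := eqVneq t x; first by rewrite !subrr mulr0 subr0 normr0 mulr0.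
  have tx0 : t - x != 0 by rewrite subr_eq0.
  have := H (t - x); rewrite /ball /= sub0r normrN => /(_ td tx0).
  rewrite /shift /= [_ *: 1]mulr1 subrK => H1.
  have -> : h t - h x - c * (t - x) = - (c - (t - x)^-1 *: (h t - h x)) * (t - x).
    by rewrite opprB mulrBl [_ *: _]mulrC divfK.
  by rewrite normrM normrN ler_wpM2r.
move=> du ua dw wb e e0; have e20 : 0 < e / 2 by lra.
have [d1 d10 H1] := key _ _ du ua _ e20.
have [d2 d20 H2] := key _ _ dw wb _ e20.
exists (Num.min d1 d2); first by rewrite lt_min d10.
move=> t It; rewrite lt_min => /andP[t1 t2].
apply: (le_trans (cabs_le_ReIm _)) => /=.
rewrite !(mulr0, subr0, addr0, add0r).
by have := H1 _ t1; have := H2 _ t2; lra.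
Qed.

End HasDerivative.

(** * Growth of a function outside an exceptional open set *)

Section Gauge.
Variable R : realType.
Local Notation C := R[i].
Local Notation mu := (@lebesgue_measure R).
Variables (F : R -> C) (U : set R) (a0 : R).

(* [chain x s]: the list s, read backwards, enumerates intervals contained in U
   from left to right between a0 and x. *)
Fixpoint chain (x : R) (s : seq (R * R)) : Prop :=
  if s is p :: s' then
    [/\ p.2 <= x, p.1 <= p.2, a0 <= p.1, `]p.1, p.2[%classic `<=` U & chain p.1 s']
  else True.

Definition vsum (s : seq (R * R)) : R := \sum_(p <- s) cabs (F p.2 - F p.1).

Lemma chain_le x y s : x <= y -> chain x s -> chain y s.
Proof. by case: s => //= p s xy [px *]; split => //; exact: le_trans xy. Qed.

Lemma chain_length x s : measurable U -> a0 <= x -> chain x s ->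
  ((\sum_(p <- s) (p.2 - p.1))%:E <= mu (U `&` `]a0, x[))%E.
Proof.
move=> mU; elim: s x => [|[a b] s IH] x ax /=.
  by rewrite big_nil => _; exact: measure_ge0.
case=> /= bx ab aa sub ch; rewrite big_cons /= EFinD.
apply: (@le_trans _ _ (mu `]a, b[%classic + mu (U `&` `]a0, a[))%E).
  apply: leeD; last exact: IH.
  rewrite lebesgue_measure_itv /= lte_fin; case: ltP => // ba.
  by rewrite lee_fin subr_le0.
rewrite -measureU//; last first.
- apply/seteqP; split => // z []; rewrite /= !in_itv /= => /andP[az _] [_].
  by move=> /andP[_ za]; have := lt_trans az za; rewrite ltxx.
- by apply: measurableI => //; exact: measurable_itv.
apply: le_measure; rewrite ?inE//.
- by apply: measurableU => //; apply: measurableI => //; exact: measurable_itv.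
- by apply: measurableI => //; exact: measurable_itv.
- move=> z [zab|[Uz]].
    split; first exact: sub.
    move: zab; rewrite /= !in_itv /= => /andP[az zb].
    by rewrite (le_lt_trans aa az) (lt_le_trans zb bx).
  rewrite /= !in_itv /= => /andP[az za]; split => //.
  by rewrite az (lt_le_trans za)// (le_trans ab bx).
Qed.

Lemma chain_nth x s i : chain x s -> (i < size s)%N ->
  let p := nth (0, 0) s i in [/\ a0 <= p.1, p.1 <= p.2, p.2 <= x & `]p.1, p.2[%classic `<=` U].
Proof.
elim: s x i => // [[a b]] s IH x [|i] /= [bx ab aa sub ch] // si.
have [? ? pa ?] := IH _ _ ch si.
by split => //; rewrite (le_trans pa) // (le_trans ab bx).
Qed.

Lemma chain_order x s i j : chain x s -> (i < j < size s)%N ->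
  (nth (0, 0) s j).2 <= (nth (0, 0) s i).1.
Proof.
elim: s x i j => [|[a b] s IH] x i j /=; first by rewrite ltn0 andbF.
case=> bx ab aa sub ch; case: j => [|j]; first by rewrite ltn0.
case: i => [|i] /=; last by rewrite !ltnS; exact: IH ch.
by rewrite ltnS => js; have [] := chain_nth ch js.
Qed.

Lemma chain_AC (e : R) : abs_continuous F -> 0 <= a0 -> 0 < e ->
  exists2 d : R, 0 < d & forall x s, x <= pi -> chain x s ->
    \sum_(p <- s) (p.2 - p.1) < d -> vsum s < e.
Proof.
move=> acF a00 e0; have [d d0 H] := acF _ e0; exists d => // x s xpi ch.
pose a (i : 'I_(size s)) := (nth (0, 0) s i).1.
pose b (i : 'I_(size s)) := (nth (0, 0) s i).2.
rewrite /vsum !(big_nth (0, 0)) !big_mkord; apply: (H _ a b).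
- move=> i; have [? ? ? _] := chain_nth ch (ltn_ord i); split => //.
  + exact: le_trans a00 _.
  + exact: le_trans xpi.
- apply/trivIsetP => i j _ _ ij.
  wlog : i j ij / (i < j)%N => [W|ltij].
    move: (ij); rewrite -val_eqE neq_ltn => /orP[|ji]; first exact: W.
    by rewrite setIC; apply: W => //; rewrite eq_sym.
  have bji : b j <= a i by apply: chain_order ch _; rewrite ltij ltn_ord.
  apply/seteqP; split => // z []; rewrite /= !in_itv /= => /andP[az _] /andP[_ zb].
  by have := lt_le_trans zb bji; rewrite ltNge (ltW az).
Qed.

Variables (X c : R).
Hypotheses (a0X : a0 <= X) (c0 : 0 <= c) (oU : open U).
Hypothesis Fgood : forall x, a0 <= x <= X -> ~ U x -> exists2 d : R, 0 < d &
  forall t, a0 <= t <= X -> `|t - x| < d -> cabs (F t - F x) <= c * `|t - x|.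

Let reach x := exists2 s, chain x s & cabs (F x - F a0) <= c * (x - a0) + vsum s.

(** Near a point of [U] the whole interval from [y] to [t] is added to the list; near any other
    point the increment is split at [x] and both halves are charged to the growth rate [c]. *)
Let step x : a0 <= x <= X -> exists2 d : R, 0 < d & forall y t,
  a0 <= y <= x -> x <= t <= X -> x - d < y -> t < x + d -> reach y -> reach t.
Proof.
move=> xI; have [Ux|nUx] := pselect (U x).
- have /nbhs_ballP[d /= d0 dU] : nbhs x U by exact: open_nbhs_nbhs.
  exists d => // y t /andP[ay yx] /andP[xt tX] dy td [s ch Hs].
  exists ((y, t) :: s).
    split => //=; first exact: le_trans xt.
    move=> z; rewrite /= in_itv /= => /andP[yz zt]; apply: dU.
    by rewrite /ball /= ltr_distlC; apply/andP; split; lra.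
  rewrite /vsum big_cons /= -/(vsum s).
  have -> : F t - F a0 = (F t - F y) + (F y - F a0) by ring.
  rewrite (le_trans (cabsD _ _))//.
  have : c * (y - a0) <= c * (t - a0) by rewrite ler_wpM2l// lerD2r (le_trans yx).
  lra.
- have [d d0 H] := Fgood xI nUx.
  exists d => // y t /andP[ay yx] /andP[xt tX] dy td [s ch Hs].
  exists s; first by apply: chain_le ch; exact: le_trans xt.
  have -> : F t - F a0 = (F t - F x) + - (F y - F x) + (F y - F a0) by ring.
  rewrite (le_trans (cabsD _ _))// (le_trans (lerD (cabsD _ _) (lexx _)))// cabsN.
  have := H t; have := H y.
  rewrite ler0_norm ?subr_le0// ger0_norm ?subr_ge0//.
  have yX : a0 <= y <= X by rewrite ay (le_trans yx (le_trans xt tX)).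
  have tX' : a0 <= t <= X by rewrite tX (le_trans ay (le_trans yx xt)).
  have yd : - (y - x) < d by lra.
  have td' : t - x < d by lra.
  by move=> /(_ yX yd) H1 /(_ tX' td') H2; lra.
Qed.

(* [a0, X] is exhausted from the left: outside the open set U, F grows at rate at
   most c, and inside U its increments are collected in vsum. *)
Lemma gauge : reach X.
Proof.
pose S := [set x | a0 <= x <= X /\ reach x].
have Sa0 : S a0.
  split; first by rewrite lexx.
  by exists [::] => //; rewrite /vsum big_nil !subrr cabs0 mulr0 addr0.
have supS : has_sup S.
  by split; [exists a0|exists X => x [/andP[]]].
pose s := sup S.
have as_ : a0 <= s by apply: ub_le_sup => //; case: supS.
have sX : s <= X by apply: ge_sup => [|x [/andP[]]//]; exists a0.
have [d d0 H] := step (introT andP (conj as_ sX)).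
have [y [yI ry] sy] := sup_adherent d0 supS.
have ys : y <= s by apply: ub_le_sup => //; case: supS.
have [ay _] := andP yI.
have [sXlt|Xs] := ltP s X; last first.
  have sE : s = X by apply/eqP; rewrite eq_le sX.
  rewrite -sE; apply: (H y s) => //.
  - by rewrite ay.
  - by rewrite lexx sE lexx.
  - by rewrite ltrDl.
pose t := Num.min X (s + d / 2).
have st : s < t by rewrite lt_min sXlt ltrDl divr_gt0.
have tX : t <= X by rewrite ge_min lexx.
have St : S t.
  split; first by rewrite tX (le_trans as_ (ltW st)).
  apply: (H y t) => //; first by rewrite ay.
  - by rewrite (ltW st).
  - by rewrite gt_min ltrD2l [X in _ || X](_ : _ = true) ?orbT//; lra.
have : t <= s by apply: ub_le_sup => //; case: supS.
by rewrite leNgt st.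
Qed.

End Gauge.

Section AbsolutelyContinuous.
Variable R : realType.
Local Notation C := R[i].
Local Notation mu := (@lebesgue_measure R).
Implicit Types (F G f g : R -> C).

Lemma I0piE (x : R) : I0pi x = (0 <= x <= pi) :> Prop.
Proof. by rewrite /I0pi /= in_itv. Qed.

Lemma measurable_I0pi : measurable (I0pi : set R).
Proof. exact: measurable_itv. Qed.

Lemma I0pi_0 : I0pi (0 : R).
Proof. by rewrite I0piE lexx pi_ge0. Qed.

Lemma I0pi_pi : I0pi (pi : R).
Proof. by rewrite I0piE lexx pi_ge0. Qed.

(** The covering argument with [U] empty: every interval of the chain is then degenerate and
    contributes nothing. *)
Lemma mean_value_bound F (f : R -> C) (M x y : R) : 0 <= M ->
  0 <= x -> x <= y -> y <= pi ->
  (forall z, I0pi z -> hd F z (f z)) -> (forall z, I0pi z -> cabs (f z) <= M) ->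
  cabs (F y - F x) <= M * (y - x).
Proof.
move=> M0 x0 xy ypi hF fM; apply/ler_addgt0Pr => e e0.
pose e' : R := e / (y - x + 1).
have yx0 : 0 < y - x + 1 by lra.
have e'0 : 0 < e' by rewrite divr_gt0.
have [|z zI _|s ch Hs] := @gauge R F set0 x y (M + e') xy _ open0.
- by rewrite addr_ge0// ltW.
- have Iz : I0pi z by rewrite I0piE; move/andP: zI => [? ?]; apply/andP; split; lra.
  have [d d0 H] := hF z Iz _ e'0; exists d => // t tI td.
  have It : I0pi t by rewrite I0piE; move/andP: tI => [? ?]; apply/andP; split; lra.
  rewrite -[F t - F z](subrK (f z * (t - z)%:C)) (le_trans (cabsD _ _))//.
  rewrite cabsM cabs_real mulrDl addrC lerD ?H// ler_wpM2r// fM//.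
- have v0 : vsum F s = 0.
    elim: s y {Hs e' yx0 e'0} xy ypi ch => [|[a b] s IH] y xy ypi.
      by rewrite /vsum big_nil.
    case=> /= bx ab aa sub ch; rewrite /vsum big_cons /= -/(vsum F s) (IH a)//; last lra.
    suff -> : a = b by rewrite subrr cabs0 addr0.
    apply/eqP; rewrite eq_le ab /= leNgt; apply/negP => ltab.
    by apply: (sub ((a + b) / 2)); rewrite /= in_itv /=; apply/andP; split; lra.
  move: Hs; rewrite v0 addr0 => /le_trans; apply.
  rewrite mulrDl lerD2l /e' mulrAC ler_pdivrMr// ler_pM2l//; lra.
Qed.

(** The exceptional null set is covered by an open set of small measure. Outside it [F] grows at an
    arbitrarily small rate, and inside it absolute continuity makes the sum of the increments
    small. *)
Lemma AC_zero_deriv F x : abs_continuous F ->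
  {ae mu, forall x, I0pi x -> hd F x 0} -> I0pi x -> F x = F 0.
Proof.
move=> acF [A [mA A0 NA]]; rewrite I0piE => /andP[x0 xpi].
apply/eqP; rewrite -subr_eq0 -cabs_eq0 eq_le cabs_ge0 andbT.
apply/ler_addgt0Pr => e e0; rewrite add0r.
pose e' := e / (2 * (x + 1)).
have x10 : 0 < 2 * (x + 1) by lra.
have e'0 : 0 < e' by rewrite divr_gt0.
have e20 : 0 < e / 2 by lra.
(* The chains are taken in the whole line because [d] has to be known before the open set of measure
   less than [d] is chosen. *)
have [d d0 Hd] := @chain_AC R F setT 0 (e / 2) acF (lexx _) e20.
have [U [oU AU mUA]] : exists U : set R, [/\ open U, A `<=` U & (mu U < d%:E)%E].
  have A0' : (mu A <= 0)%E by rewrite A0.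
  have Afin : (mu A < +oo)%E by exact: le_lt_trans A0' _.
  have [U [oU AU mUA]] := @lebesgue_regularity_outer R A d mA Afin d0.
  have mU : measurable U by exact: open_measurable.
  exists U; split => //; apply: le_lt_trans mUA.
  (* Outer regularity bounds the measure of [U] minus [A], and [A] itself is null. *)
  rewrite -[leRHS]adde0 -A0.
  have mUA : measurable (U `\` A) by exact: measurableD.
  apply: le_trans (measureU2 mu mUA mA); apply: le_measure; rewrite ?inE//.
    exact: measurableU.
  by move=> z Uz; have [Az|nAz] := pselect (A z); [right|left].
have [|z zI nU|s ch Hs] := @gauge R F U 0 x e' x0 _ oU.
- exact: ltW.
- have Iz : I0pi z by rewrite I0piE; move/andP: zI => [? ?]; apply/andP; split; lra.
  have hz : hd F z 0.
    have [//|nh] := pselect (hd F z 0); exfalso; apply: nU; apply: AU; apply: NA => /=.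
    by move=> H; apply: nh; exact: H.
  have [d1 d10 H] := hz _ e'0; exists d1 => // t tI td.
  have It : I0pi t by rewrite I0piE; move/andP: tI => [? ?]; apply/andP; split; lra.
  by have := H t It td; rewrite mul0r subr0.
- have vs : vsum F s < e / 2.
    apply: (Hd x) => //.
      by elim: s x {x0 xpi e' x10 e'0 Hs} ch => //= p s IH x [? ? ? _ ?]; split => //; exact: IH.
    rewrite -lte_fin; apply: le_lt_trans mUA.
    have mU : measurable U by exact: open_measurable.
    apply: (le_trans (chain_length mU x0 ch)); apply: le_measure; rewrite ?inE//.
    by apply: measurableI => //; exact: measurable_itv.
    suff : e' * x <= e / 2 by move: Hs vs; rewrite subr0; lra.
  rewrite /e' mulrAC ler_pdivrMr//.
  by have : 0 <= e / 2 * x; [rewrite mulr_ge0// ltW|lra].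
Qed.

End AbsolutelyContinuous.

(** * Uniform continuity and primitives *)

Section UniformlyContinuous.
Variable R : realType.
Local Notation C := R[i].
Local Notation mu := (@lebesgue_measure R).
Local Notation Re := (@complex.Re R).
Local Notation Im := (@complex.Im R).
Implicit Types (F G f g : R -> C).

Definition ucont F := forall e : R, 0 < e -> exists2 d : R, 0 < d &
  forall x y, I0pi x -> I0pi y -> `|y - x| < d -> cabs (F y - F x) < e.

Lemma AC_ucont F : abs_continuous F -> ucont F.
Proof.
move=> acF e e0; have [d d0 H] := acF _ e0; exists d => // x y.
wlog : x y / x <= y => [W|xy].
  by case/orP: (le_total x y) => xy Ix Iy xyd; [|rewrite cabsC]; apply: W => //; rewrite distrC.
rewrite !I0piE => /andP[x0 _] /andP[_ ypi].
rewrite ger0_norm ?subr_ge0// => xyd.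
have := H 1%N (fun=> x) (fun=> y); rewrite !big_ord1; apply => //.
by apply/trivIsetP => i j _ _; rewrite !ord1 eqxx.
Qed.

Lemma ucont_within F (u : R -> R) : ucont F ->
  (forall x y, `|u y - u x| <= cabs (F y - F x)) ->
  {within I0pi, continuous u}.
Proof.
move=> uF uu; apply/subspace_continuousP => x Ix.
apply/cvgrPdist_lt => e e0; have [d d0 H] := uF _ e0.
apply/nbhs_ballP; exists d => // y; rewrite /ball /= => xyd Iy.
by rewrite distrC (le_lt_trans (uu _ _))// H// distrC.
Qed.

Lemma ucont_meas F : ucont F -> cmeas I0pi F.
Proof.
move=> uF; split; apply: subspace_continuous_measurable_fun;
  try exact: measurable_I0pi; apply: (ucont_within uF) => x y.
- by rewrite -cReN -cReD Re_le_cabs.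
- by rewrite -cImN -cImD Im_le_cabs.
Qed.

Lemma ucont_max F : ucont F ->
  exists2 c, I0pi c & forall x, I0pi x -> cabs (F x) <= cabs (F c).
Proof.
move=> uF; have [] := @EVT_max R (fun x => cabs (F x)) 0 pi (pi_ge0 _).
  by apply: (ucont_within uF) => x y; exact: cabs_dist.
by move=> c Ic H; exists c => // x Ix; exact: H.
Qed.

Lemma ucont_bdd F : ucont F -> exists2 M : R, 0 <= M & forall x, I0pi x -> cabs (F x) <= M.
Proof.
by move=> /ucont_max[c Ic H]; exists (cabs (F c)) => //; exact: cabs_ge0.
Qed.

Lemma ucont_cst c : ucont (fun=> c).
Proof. by move=> e e0; exists 1 => // x y _ _ _; rewrite subrr cabs0. Qed.

Lemma ucontD F G : ucont F -> ucont G -> ucont (fun x => F x + G x).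
Proof.
move=> uF uG e e0; have e20 : 0 < e / 2 by lra.
have [d1 d10 H1] := uF _ e20; have [d2 d20 H2] := uG _ e20.
exists (Num.min d1 d2); first by rewrite lt_min d10.
move=> x y Ix Iy; rewrite lt_min => /andP[t1 t2].
rewrite opprD addrACA (le_lt_trans (cabsD _ _))//.
by have := H1 _ _ Ix Iy t1; have := H2 _ _ Ix Iy t2; lra.
Qed.

Lemma prod_incr F G (M : R) x y :
  cabs (F y) <= M -> cabs (G x) <= M ->
  cabs (F y * G y - F x * G x) <= M * cabs (F y - F x) + M * cabs (G y - G x).
Proof.
move=> FM GM.
have -> : F y * G y - F x * G x = (F y - F x) * G x + F y * (G y - G x) by ring.
by rewrite (le_trans (cabsD _ _))// !cabsM [_ * cabs (G x)]mulrC lerD// ler_wpM2r// cabs_ge0.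
Qed.

Lemma ucont_bdd2 F G : ucont F -> ucont G -> exists2 M : R, 0 < M &
  forall x, I0pi x -> cabs (F x) <= M /\ cabs (G x) <= M.
Proof.
move=> /ucont_bdd[M1 M10 H1] /ucont_bdd[M2 M20 H2]; exists (M1 + M2 + 1); first lra.
by move=> x Ix; have := H1 _ Ix; have := H2 _ Ix; split; lra.
Qed.

Lemma ucontM F G : ucont F -> ucont G -> ucont (fun x => F x * G x).
Proof.
move=> uF uG e e0; have [M M0 HM] := ucont_bdd2 uF uG.
have e20 : 0 < e / (2 * M) by rewrite divr_gt0// mulr_gt0.
have [d1 d10 H1] := uF _ e20; have [d2 d20 H2] := uG _ e20.
exists (Num.min d1 d2); first by rewrite lt_min d10.
move=> x y Ix Iy; rewrite lt_min => /andP[t1 t2].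
have [FM _] := HM _ Iy; have [_ GM] := HM _ Ix.
rewrite (le_lt_trans (prod_incr FM GM))//.
have := H1 _ _ Ix Iy t1; have := H2 _ _ Ix Iy t2.
rewrite -(ltr_pM2l M0) => k2; rewrite -(ltr_pM2l M0) => k1.
have eE : M * (e / (2 * M)) = e / 2 by field; rewrite gt_eqF.
by move: k1 k2; rewrite eE; lra.
Qed.

Lemma rint_cst (D : set R) (k : R) : measurable D -> D `<=` I0pi -> rint D (fun=> k).
Proof.
move=> mD sub; apply/integrableP; split; first exact/measurable_EFinP.
rewrite integral_cst//= lte_mul_pinfty ?lee_fin//.
apply: (@le_lt_trans _ _ (mu I0pi)); first by apply: le_measure; rewrite ?inE//; exact: measurable_I0pi.
by rewrite /I0pi lebesgue_measure_itv/=; case: ifP => _; rewrite ?ltry.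
Qed.

Lemma bdd_cintble F (M : R) : cmeas I0pi F -> (forall x, I0pi x -> cabs (F x) <= M) ->
  cintble I0pi F.
Proof.
move=> mF FM; apply: (@cintble_dom _ _ _ (fun=> M)) => //; first exact: measurable_I0pi.
by apply: rint_cst => //; exact: measurable_I0pi.
Qed.

Lemma ucont_cintble F : ucont F -> cintble I0pi F.
Proof.
move=> uF; have [M M0 HM] := ucont_bdd uF; apply: bdd_cintble HM; exact: ucont_meas.
Qed.

Lemma ucontM_cintble F f : ucont F -> cintble I0pi f -> cintble I0pi (fun x => F x * f x).
Proof.
move=> uF fi; have [M M0 HM] := ucont_bdd uF.
by apply: (cintbleM_bdd _ _ HM) => //; [exact: measurable_I0pi|exact: ucont_meas].
Qed.

Lemma AC_lipschitz F (M : R) : 0 <= M ->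
  (forall x y, 0 <= x -> x <= y -> y <= pi -> cabs (F y - F x) <= M * (y - x)) ->
  abs_continuous F.
Proof.
move=> M0 H e e0; exists (e / (M + 1)); first by rewrite divr_gt0//; lra.
move=> n a b ab _; rewrite ltr_pdivlMr; last lra.
apply: le_lt_trans.
apply: (@le_trans _ _ (\sum_(i < n) M * (b i - a i))).
  by apply: ler_sum => i _; have [? ? ?] := ab i; exact: H.
rewrite -mulr_sumr mulrC ler_wpM2l; [lra| |lra].
by apply: sumr_ge0 => i _; have [? ? ?] := ab i; lra.
Qed.

Lemma ACD F G : abs_continuous F -> abs_continuous G ->
  abs_continuous (fun x => F x + G x).
Proof.
move=> aF aG e e0; have e20 : 0 < e / 2 by lra.
have [d1 d10 H1] := aF _ e20; have [d2 d20 H2] := aG _ e20.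
exists (Num.min d1 d2); first by rewrite lt_min d10.
move=> n a b ab tr; rewrite lt_min => /andP[t1 t2].
have := H1 n a b ab tr t1; have := H2 n a b ab tr t2.
have : \sum_(i < n) cabs (F (b i) + G (b i) - (F (a i) + G (a i))) <=
  \sum_(i < n) cabs (F (b i) - F (a i)) + \sum_(i < n) cabs (G (b i) - G (a i)).
  by rewrite -big_split /=; apply: ler_sum => i _; rewrite opprD addrACA cabsD.
lra.
Qed.

Lemma ACM F G : abs_continuous F -> abs_continuous G ->
  abs_continuous (fun x => F x * G x).
Proof.
move=> aF aG e e0; have [M M0 HM] := ucont_bdd2 (AC_ucont aF) (AC_ucont aG).
have e20 : 0 < e / (2 * M) by rewrite divr_gt0// mulr_gt0.
have [d1 d10 H1] := aF _ e20; have [d2 d20 H2] := aG _ e20.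
exists (Num.min d1 d2); first by rewrite lt_min d10.
move=> n a b ab tr; rewrite lt_min => /andP[t1 t2].
have := H1 n a b ab tr t1; have := H2 n a b ab tr t2.
rewrite -(ltr_pM2l M0) => k2; rewrite -(ltr_pM2l M0) => k1.
have eE : M * (e / (2 * M)) = e / 2 by field; rewrite gt_eqF.
move: k1 k2; rewrite eE !mulr_sumr.
have : \sum_(i < n) cabs (F (b i) * G (b i) - F (a i) * G (a i)) <=
  \sum_(i < n) M * cabs (F (b i) - F (a i)) + \sum_(i < n) M * cabs (G (b i) - G (a i)).
  rewrite -big_split /=; apply: ler_sum => i _; have [a0 lab bp] := ab i.
  have Ia : I0pi (a i) by rewrite I0piE a0 (le_trans lab).
  have Ib : I0pi (b i) by rewrite I0piE bp (le_trans a0).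
  by apply: prod_incr; [have [] := HM _ Ib|have [] := HM _ Ia].
lra.
Qed.

Definition prim f x : C := cI `[0, x]%classic f.

Lemma sub_itvI0pi x y b1 b2 : 0 <= x -> y <= pi ->
  [set` Interval (BSide b1 x) (BSide b2 y)] `<=` (I0pi : set R).
Proof.
move=> x0 ypi z; rewrite I0piE /= itv_boundlr => /andP[].
case: b1; case: b2; rewrite !bnd_simp => p1 p2; apply/andP; split; try exact: le_trans p1;
  by [exact: le_trans p2 _|exact: le_trans (ltW p2) _|exact: le_trans x0 (ltW p1)].
Qed.

Lemma primB f x y : cintble I0pi f -> 0 <= x -> x <= y -> y <= pi ->
  prim f y - prim f x = cI `]x, y]%classic f.
Proof.
move=> [f1 f2] x0 xy ypi.
have sub : `[0, y]%classic `<=` (I0pi : set R) by exact: sub_itvI0pi.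
have mI := @measurable_I0pi R.
have my : measurable (`[0, y]%classic : set R) by exact: measurable_itv.
apply: complex_eq; rewrite ?cReD ?cReN ?cImD ?cImN /=;
  apply: (@Rintegral_itvB _ _ (BLeft 0) (BRight y) x); rewrite ?bnd_simp//.
- exact: rintS mI my sub f1.
- exact: rintS mI my sub f2.
Qed.

Lemma prim0 f : prim f 0 = 0.
Proof. by rewrite /prim set_itv1 /cI !Rintegral_set1. Qed.

Lemma primB_le f x y : cintble I0pi f -> 0 <= x -> x <= y -> y <= pi ->
  cabs (prim f y - prim f x) <= nI `[x, y]%classic f.
Proof.
move=> fi x0 xy ypi; rewrite primB//.
have mI := @measurable_I0pi R.
have m1 : measurable (`]x, y]%classic : set R) by exact: measurable_itv.
have fi1 : cintble `]x, y]%classic f.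
  by apply: cintbleS fi => //; exact: sub_itvI0pi.
rewrite (le_trans (cabs_cI m1 fi1))// /nI Rintegral_itv_obnd_cbnd//.
exact: cintble_cabs.
Qed.

End UniformlyContinuous.

(** * The fundamental theorem of calculus for absolutely continuous functions *)

Section FundamentalTheorem.
Variable R : realType.
Local Notation C := R[i].
Local Notation mu := (@lebesgue_measure R).
Local Notation Re := (@complex.Re R).
Local Notation Im := (@complex.Im R).
Implicit Types (F G f g : R -> C).

Lemma aeS (P Q : R -> Prop) : (forall x, P x -> Q x) ->
  {ae mu, forall x, P x} -> {ae mu, forall x, Q x}.
Proof. exact: (@filterS _ _ (ae_filter_ringOfSetsType mu)). Qed.

Lemma aeS2 (P Q S : R -> Prop) : (forall x, P x -> Q x -> S x) ->
  {ae mu, forall x, P x} -> {ae mu, forall x, Q x} -> {ae mu, forall x, S x}.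
Proof. exact: (@filterS2 _ _ (ae_filter_ringOfSetsType mu)). Qed.

Lemma ae_neq (a : R) : {ae mu, forall x, x != a}.
Proof.
exists [set a]; split => //; first exact: lebesgue_measure_set1.
by move=> x /= /negP; rewrite negbK => /eqP.
Qed.

Lemma EFin_Rintegral (D : set R) (h : R -> R) : measurable D -> rint D h ->
  (\int[mu]_(x in D) h x)%:E = (\int[mu]_(x in D) (h x)%:E)%E.
Proof. by move=> mD ih; rewrite fineK//; exact: integrable_fin_num ih. Qed.

Lemma rint_restrict (h : R -> R) : rint I0pi h -> rint setT (h \_ I0pi).
Proof.
move=> ih; rewrite /rint -restrict_EFin.
exact/(integrable_mkcond (mu := mu) _ (@measurable_I0pi R)).
Qed.

(** Absolute continuity of the integral of [|f|], applied to the union of the disjoint intervals,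
    whose measure is the sum of their lengths. *)
Lemma AC_prim f : cintble I0pi f -> abs_continuous (prim f).
Proof.
move=> fi e e0.
pose h := (fun x => cabs (f x)) \_ (I0pi : set R).
have mI := @measurable_I0pi R.
have ih : rint setT h by apply: rint_restrict; exact: cintble_cabs.
have [d [d0 Hd]] := integral_normr_continuous ih e0.
exists d => // n a b ab tr sumd.
pose F (i : 'I_n) := `]a i, b i[%classic : set R.
have mF i : measurable (F i) by exact: measurable_itv.
have trF : trivIset [set` index_enum 'I_n] F by apply: sub_trivIset tr.
pose A := \big[setU/set0]_(i <- index_enum 'I_n) F i.
have mA : measurable A by apply: bigsetU_measurable => i _.
have muA : mu A = (\sum_(i < n) (b i - a i))%:E.
  rewrite -[LHS]mul1e -[LHS](@integral_cst _ _ _ mu A mA 1).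
  rewrite (@ge0_integral_bigsetU _ _ _ mu _ F (cst 1%:E) (index_enum 'I_n) mF)//.
  - rewrite -sumEFin; apply: eq_bigr => i _.
    rewrite (@integral_cst _ _ _ mu (F i) (mF i) 1%:E) (@mul1e R (mu (F i))).
    rewrite lebesgue_measure_itv /= lte_fin; have [_ abi _] := ab i.
    case: ltP => // ba; congr (_%:E); apply/esym/eqP.
    by rewrite subr_eq0 eq_le abi ba.
  - exact: index_enum_uniq.
have subI i : F i `<=` (I0pi : set R).
  by have [? ? ?] := ab i; exact: sub_itvI0pi.
have Ad : (mu A < d%:E)%E by rewrite muA lte_fin.
apply: le_lt_trans (Hd A mA Ad).
rewrite -lee_fin EFin_Rintegral//; last first.
  by apply: rint_norm; apply: rintS ih.
rewrite (@ge0_integral_bigsetU _ _ _ mu _ F (fun x => `|h x|%:E) (index_enum 'I_n) mF)//.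
- rewrite -sumEFin; apply: lee_sum => i _.
  have [a0 abi bp] := ab i.
  apply: (@le_trans _ _ (nI (F i) f)%:E).
    rewrite lee_fin (le_trans (primB_le fi a0 abi bp))//.
    rewrite /nI -Rintegral_itv_bndo_bndc; last first.
      apply: rintS (cintble_cabs mI fi) => //; exact: sub_itvI0pi.
    rewrite -Rintegral_itv_obnd_cbnd//.
    by apply: rintS (cintble_cabs mI fi) => //; exact: subI.
  rewrite EFin_Rintegral//; last by apply: rintS (cintble_cabs mI fi) => //; exact: subI.
  apply: ge0_le_integral => //.
  - exact: mF.
  - by move=> x _; rewrite lee_fin cabs_ge0.
  - apply/measurable_EFinP; apply: cmeas_cabs; first exact: mF.
    by apply: cintble_meas; apply: cintbleS fi => //; exact: subI.
  - apply/measurable_EFinP; apply: measurableT_comp => //.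
    case/integrableP : ih => /measurable_EFinP mh _.
    by apply: measurable_funS mh.
  - move=> x Fx; rewrite lee_fin /h patchE mem_set; last exact: subI Fx.
    exact: ler_norm.
- exact: index_enum_uniq.
- apply/measurable_EFinP; apply: measurableT_comp => //.
  case/integrableP : ih => /measurable_EFinP mh _.
  by apply: measurable_funS mh.
Qed.

Lemma hd_prim f : cintble I0pi f -> {ae mu, forall x, I0pi x -> hd (prim f) x (f x)}.
Proof.
move=> [f1 f2].
have key (h : R -> R) : rint I0pi h -> {ae mu, forall x, 0 < x ->
    let H := fun y => \int[mu]_(t in `[0, y]) (h \_ I0pi) t in
    derivable H x 1 /\ derive1 H x = (h \_ I0pi) x}.
  move=> /rint_restrict ih.
  have loc : locally_integrable setT (h \_ (I0pi : set R)).
    by apply: open_integrable_locally => //; exact: openT.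
  have := @FTC1 R (h \_ (I0pi : set R)) (BLeft 0) _ loc.
  move=> /(_ _)/wrap[y|]; first by apply: rintS ih.
  by apply: aeS => x H x0; apply: H; rewrite lte_fin.
(* The differentiation theorem is available to the right of the base point 0 of the primitive; the
   point 0 is a null set. *)
apply: aeS2 (aeS2 _ (key _ f1) (key _ f2)) (ae_neq 0); last by move=> x; exact: conj.
move=> x [H1 H2] xn0 /[dup] Ix.
rewrite {1}I0piE => /andP[x0' xpi].
have x0 : 0 < x by rewrite lt_def xn0.
have [d1 e1] := H1 x0; have [d2 e2] := H2 x0.
have := hd_ReIm d1 e1 d2 e2.
rewrite !patchE mem_set//.
have -> : Re (f x) +i* Im (f x) = f x by case: (f x).
apply: eq_hd => // t; rewrite I0piE => /andP[t0 tpi].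
rewrite /prim /cI; congr (_ +i* _); apply: eq_Rintegral => z; rewrite inE /= => tz;
  rewrite patchE mem_set//; move: tz; rewrite in_itv /= I0piE => /andP[-> zt];
  exact: le_trans zt tpi.
Qed.

(** Carrying the derivative along with the function turns integration by parts into the product rule
    [acdM] followed by [acd_cI]. *)
Definition acd F f := [/\ abs_continuous F,
  {ae mu, forall x, I0pi x -> hd F x (f x)} & cintble I0pi f].

Lemma acd_prim f : cintble I0pi f -> acd (prim f) f.
Proof. by move=> fi; split => //; [exact: AC_prim|exact: hd_prim]. Qed.

Lemma acd_cst c : acd (fun=> c) (fun=> 0).
Proof.
split.
- by apply: (AC_lipschitz (lexx 0)) => x y _ _ _; rewrite subrr cabs0 mul0r.
- by apply: aeW => x _; exact: hd_cst.
- by apply: ucont_cintble; exact: ucont_cst.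
Qed.

Lemma acdD F f G g : acd F f -> acd G g ->
  acd (fun x => F x + G x) (fun x => f x + g x).
Proof.
move=> [aF dF iF] [aG dG iG]; split.
- exact: ACD.
- by apply: aeS2 dF dG => x HF HG Ix; apply: hdD; [exact: HF|exact: HG].
- by apply: cintbleD => //; exact: measurable_I0pi.
Qed.

Lemma acdM F f G g : acd F f -> acd G g ->
  acd (fun x => F x * G x) (fun x => f x * G x + F x * g x).
Proof.
move=> [aF dF iF] [aG dG iG]; split.
- exact: ACM.
- by apply: aeS2 dF dG => x HF HG Ix; apply: hdM; [exact: HF|exact: HG].
- apply: cintbleD; first exact: measurable_I0pi.
    rewrite (_ : (fun x => f x * G x) = (fun x => G x * f x)).
      by apply: ucontM_cintble => //; exact: AC_ucont.
    by apply/funext => x; rewrite mulrC.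
  by apply: ucontM_cintble => //; exact: AC_ucont.
Qed.

Lemma acdZ F f c : acd F f -> acd (fun x => c * F x) (fun x => c * f x).
Proof.
move=> /(acdM (acd_cst c)); rewrite (_ : (fun x => 0 * F x + c * f x) = (fun x => c * f x))//.
by apply/funext => x; rewrite mul0r add0r.
Qed.

Lemma acdN F f : acd F f -> acd (fun x => - F x) (fun x => - f x).
Proof.
move=> /(acdZ (-1)).
rewrite (_ : (fun x => -1 * F x) = (fun x => - F x)); last first.
  by apply/funext => x; rewrite mulN1r.
by rewrite (_ : (fun x => -1 * f x) = (fun x => - f x))//; apply/funext => x; rewrite mulN1r.
Qed.

Lemma acdB F f G g : acd F f -> acd G g ->
  acd (fun x => F x - G x) (fun x => f x - g x).
Proof. by move=> aF aG; apply: acdD => //; exact: acdN. Qed.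

Lemma acd_C1 F f : (forall x, I0pi x -> hd F x (f x)) -> ucont f -> acd F f.
Proof.
move=> hF uf; split.
- have [M M0 HM] := ucont_bdd uf; apply: (AC_lipschitz M0) => x y x0 xy ypi.
  exact: (mean_value_bound M0 x0 xy ypi hF HM).
- by apply: aeW => x; exact: hF.
- exact: ucont_cintble.
Qed.

Theorem acd_FTC F f x : acd F f -> I0pi x -> F x = F 0 + prim f x.
Proof.
move=> aF Ix; have [_ _ fi] := aF.
have [aG dG _] := acdB aF (acd_prim fi).
have dG' : {ae mu, forall x, I0pi x -> hd (fun x => F x - prim f x) x 0}.
  by apply: aeS dG => z + Iz => /(_ Iz); rewrite subrr.
have := AC_zero_deriv aG dG' Ix; rewrite prim0 subr0 => <-.
by rewrite subrK.
Qed.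

Corollary acd_cI F f : acd F f -> cI I0pi f = F pi - F 0.
Proof.
move=> aF; rewrite (acd_FTC aF (@I0pi_pi R)) addrAC subrr add0r.
by [].
Qed.

Lemma acd_zero F x : acd F (fun=> 0) -> I0pi x -> F x = F 0.
Proof. by move=> [aF dF _]; exact: AC_zero_deriv. Qed.

End FundamentalTheorem.

(** * Pre-Hilbert spaces and Riesz bases *)

(** Positivity is not definite, so that square-integrable functions themselves, rather than their
    classes, form an instance; equality of vectors is replaced by [null] of the difference. *)
Record prehilbert (R : realType) := PreHilbert {
  ph_sort :> lmodType R[i];
  ip : ph_sort -> ph_sort -> R[i];
  ip_lin : forall a x y z, ip (a *: x + y) z = a * ip x z + ip y z;
  ip_conj : forall x y, ip y x = (ip x y)^*%C;
  ip_ge0 : forall x, 0 <= complex.Re (ip x x) }.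

Section PreHilbertTheory.
Variables (R : realType) (H : prehilbert R).
Local Notation C := R[i].
Local Notation Re := (@complex.Re R).
Implicit Types (x y z : H) (a b c : C).

Definition nsq x : R := Re (ip x x).
Definition nrm x : R := Num.sqrt (nsq x).

Lemma ip0l x : ip 0 x = 0.
Proof. by have := ip_lin 1 0 0 x; rewrite scale1r addr0 mul1r; set t := ip 0 x => h;
  apply: (@addrI _ t); rewrite addr0 -h. Qed.

Lemma ipDl x y z : ip (x + y) z = ip x z + ip y z.
Proof. by rewrite -[x]scale1r ip_lin mul1r scale1r. Qed.

Lemma ipZl a x z : ip (a *: x) z = a * ip x z.
Proof. by rewrite -[a *: x]addr0 ip_lin ip0l addr0. Qed.

Lemma ipNl x z : ip (- x) z = - ip x z.
Proof. by rewrite -scaleN1r ipZl mulN1r. Qed.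

Lemma ipBl x y z : ip (x - y) z = ip x z - ip y z.
Proof. by rewrite ipDl ipNl. Qed.

Lemma ip0r x : ip x 0 = 0.
Proof. by rewrite ip_conj ip0l rmorph0. Qed.

Lemma ipDr x y z : ip x (y + z) = ip x y + ip x z.
Proof. by rewrite ip_conj ipDl rmorphD /= -!ip_conj. Qed.

Lemma ipZr a x z : ip x (a *: z) = a^*%C * ip x z.
Proof. by rewrite ip_conj ipZl rmorphM /= -ip_conj. Qed.

Lemma ipNr x z : ip x (- z) = - ip x z.
Proof. by rewrite ip_conj ipNl rmorphN /= -ip_conj. Qed.

Lemma ipBr x y z : ip x (y - z) = ip x y - ip x z.
Proof. by rewrite ipDr ipNr. Qed.

Lemma ip_suml (I : Type) (r : seq I) (P : pred I) (F : I -> H) z :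
  ip (\sum_(i <- r | P i) F i) z = \sum_(i <- r | P i) ip (F i) z.
Proof. by apply: (big_morph (fun x => ip x z)) => [x y|]; rewrite ?ipDl ?ip0l. Qed.

Lemma ip_sumr (I : Type) (r : seq I) (P : pred I) (F : I -> H) z :
  ip z (\sum_(i <- r | P i) F i) = \sum_(i <- r | P i) ip z (F i).
Proof. by apply: (big_morph (fun x => ip z x)) => [x y|]; rewrite ?ipDr ?ip0r. Qed.

Lemma ipxx x : ip x x = (nsq x)%:C.
Proof.
apply: complex_eq => //=; have := congr1 (@complex.Im R) (ip_conj x x).
by rewrite cImJ; lra.
Qed.

Lemma nsq_ge0 x : 0 <= nsq x. Proof. exact: ip_ge0. Qed.
Lemma nrm_ge0 x : 0 <= nrm x. Proof. exact: sqrtr_ge0. Qed.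
Lemma nrm_sqr x : nrm x ^+ 2 = nsq x.
Proof. by rewrite sqr_sqrtr// nsq_ge0. Qed.

Lemma nsqZ a x : nsq (a *: x) = cabs a ^+ 2 * nsq x.
Proof. by rewrite {1}/nsq ipZl ipZr mulrA mul_conjc ipxx -rmorphM. Qed.

Lemma nsqN x : nsq (- x) = nsq x.
Proof. by rewrite -scaleN1r nsqZ cabsN cabs1 expr1n mul1r. Qed.

Lemma nsqD x y : nsq (x + y) = nsq x + nsq y + 2 * Re (ip x y).
Proof.
rewrite /nsq ipDl !ipDr !cReD [ip y x]ip_conj cReJ; ring.
Qed.

Lemma nrmZ a x : nrm (a *: x) = cabs a * nrm x.
Proof. by rewrite /nrm nsqZ sqrtrM ?sqr_ge0// sqrtr_sqr ger0_norm// cabs_ge0. Qed.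

Lemma nrmN x : nrm (- x) = nrm x.
Proof. by rewrite /nrm nsqN. Qed.

Lemma nrmC x y : nrm (x - y) = nrm (y - x).
Proof. by rewrite -nrmN opprB. Qed.

Lemma nrm0 : nrm 0 = 0.
Proof. by rewrite /nrm /nsq ip0l sqrtr0. Qed.

Lemma cauchy_schwarz x y : cabs (ip x y) <= nrm x * nrm y.
Proof.
rewrite -(@ler_pXn2r _ 2) ?nnegrE ?mulr_ge0 ?cabs_ge0 ?nrm_ge0// exprMn !nrm_sqr.
set p := cabs (ip x y).
have [u u1 uE] := cphase (ip x y).
have key (t : R) : 0 <= nsq x - 2 * t * p + t ^+ 2 * nsq y.
  have := nsq_ge0 (u *: x + (- t)%:C *: y).
  rewrite nsqD !nsqZ u1 cabs_real normrN expr1n mul1r ipZl ipZr.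
  rewrite (_ : ((- t)%:C)^*%C = (- t)%:C); last by rewrite /= oppr0.
  rewrite mulrCA uE cReM /= !mulr0 subr0 real_normK ?num_real//.
  by rewrite (_ : 2 * (- t * _) = - (2 * t * p)); [lra|rewrite /p; ring].
(* With a seminorm, [nsq y = 0] does not give [y = 0]; but then [key] is affine in [t] and forces
   [p = 0]. Otherwise the minimizing [t = p / nsq y] is inserted. *)
have [y0|y0] := eqVneq (nsq y) 0.
  have p0 : 0 <= p by exact: cabs_ge0.
  have [->|pn0] := eqVneq p 0; first by rewrite expr0n /= mulr_ge0// nsq_ge0.
  have := key ((nsq x + 1) / p); rewrite y0 mulr0 addr0 -mulrA divfK//.
  by have := nsq_ge0 x; lra.
have yp : 0 < nsq y by rewrite lt_def y0 nsq_ge0.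
have := key (p / nsq y).
have -> : nsq x - 2 * (p / nsq y) * p + (p / nsq y) ^+ 2 * nsq y =
  (nsq x * nsq y - p ^+ 2) / nsq y by field.
by rewrite pmulr_lge0 ?invr_gt0// subr_ge0.
Qed.

Lemma nrmD x y : nrm (x + y) <= nrm x + nrm y.
Proof.
rewrite -(@ler_pXn2r _ 2) ?nnegrE ?addr_ge0 ?nrm_ge0// sqrrD !nrm_sqr nsqD.
have := cauchy_schwarz x y; have := Re_le_cabs (ip x y); have := ler_norm (Re (ip x y)).
by rewrite -mulr_natl; lra.
Qed.

Lemma nrmB x y : nrm (x - y) <= nrm x + nrm y.
Proof. by rewrite -(nrmN y) nrmD. Qed.

Definition null x := nrm x = 0.

Lemma null_nsq x : null x <-> nsq x = 0.
Proof.
by rewrite /null; split => [x0|]; [rewrite -nrm_sqr x0 expr0n|rewrite /nrm => ->; exact: sqrtr0].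
Qed.

Lemma nullP x : nrm x <= 0 -> null x.
Proof. by move=> x0; apply/eqP; rewrite eq_le x0 nrm_ge0. Qed.

Lemma null0 : null 0. Proof. exact: nrm0. Qed.

Lemma nullD x y : null x -> null y -> null (x + y).
Proof. by move=> x0 y0; apply: nullP; rewrite (le_trans (nrmD _ _))// x0 y0 addr0. Qed.

Lemma nullZ a x : null x -> null (a *: x).
Proof. by rewrite /null nrmZ => ->; rewrite mulr0. Qed.

Lemma nullN x : null x -> null (- x).
Proof. by rewrite /null nrmN. Qed.

Lemma nullC x y : null (x - y) -> null (y - x).
Proof. by move=> /nullN; rewrite opprB. Qed.

Lemma null_trans y x z : null (x - y) -> null (y - z) -> null (x - z).
Proof. by move=> h1 h2; have := nullD h1 h2; rewrite addrA subrK. Qed.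

Lemma null_sum (I : Type) (r : seq I) (P : pred I) (F : I -> H) :
  (forall i, P i -> null (F i)) -> null (\sum_(i <- r | P i) F i).
Proof. by move=> F0; elim/big_rec: _ => [|i x Pi x0]; [exact: null0|apply: nullD => //; exact: F0]. Qed.

Lemma ip_nulll x y : null x -> ip x y = 0.
Proof.
move=> x0; apply/eqP; rewrite -cabs_eq0 eq_le cabs_ge0 andbT.
by rewrite (le_trans (cauchy_schwarz _ _))// x0 mul0r.
Qed.

Lemma ip_eql x y z : null (x - y) -> ip x z = ip y z.
Proof. by move=> xy; apply/eqP; rewrite -subr_eq0 -ipBl ip_nulll. Qed.

Lemma nrm_eq x y : null (x - y) -> nrm x = nrm y.
Proof.
have key u w : null (u - w) -> nrm u <= nrm w.
  by move=> uw; rewrite -[u](subrK w) (le_trans (nrmD _ _))// uw add0r.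
by move=> xy; apply/eqP; rewrite eq_le !key//; exact: nullC.
Qed.

Definition hconv (u : nat -> H) l := forall e : R, 0 < e ->
  exists N, forall n, (N <= n)%N -> nrm (u n - l) < e.

Definition hcomplete := forall u : nat -> H,
  (forall e : R, 0 < e -> exists N, forall m n, (N <= m)%N -> (N <= n)%N ->
    nrm (u m - u n) < e) -> exists l, hconv u l.

Lemma conv_unique u l m : hconv u l -> hconv u m -> null (l - m).
Proof.
move=> ul um; apply: nullP; apply/ler_addgt0Pr => e e0.
have e20 : 0 < e / 2 by lra.
have [N1 H1] := ul _ e20; have [N2 H2] := um _ e20.
have := H1 (maxn N1 N2) (leq_maxl _ _); have := H2 (maxn N1 N2) (leq_maxr _ _).
move: (u _) => v h1 h2; rewrite (_ : l - m = (v - m) - (v - l)); last first.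
  by rewrite opprB [in RHS]addrC addrA subrK.
by have := nrmB (v - m) (v - l); lra.
Qed.

Lemma convD u v l m : hconv u l -> hconv v m -> hconv (fun n => u n + v n) (l + m).
Proof.
move=> ul um e e0; have e20 : 0 < e / 2 by lra.
have [N1 H1] := ul _ e20; have [N2 H2] := um _ e20.
exists (maxn N1 N2) => n; rewrite geq_max => /andP[n1 n2].
rewrite opprD addrACA; have := nrmD (u n - l) (v n - m).
by have := H1 _ n1; have := H2 _ n2; lra.
Qed.

Lemma convZ u l a : hconv u l -> hconv (fun n => a *: u n) (a *: l).
Proof.
move=> ul e e0; have a0 := cabs_ge0 a.
have e' : 0 < e / (cabs a + 1) by rewrite divr_gt0//; lra.
have [N HN] := ul _ e'; exists N => n /HN.
rewrite -scalerBr nrmZ ltr_pdivlMr; last lra.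
by have := nrm_ge0 (u n - l); rewrite mulrDr mulr1 mulrC; lra.
Qed.

Lemma eq_conv u v l : (forall n, null (u n - v n)) -> hconv u l -> hconv v l.
Proof.
move=> uv ul e /ul[N HN]; exists N => n /HN.
suff -> : nrm (u n - l) = nrm (v n - l) by [].
by apply: nrm_eq; rewrite opprB addrA subrK.
Qed.

Lemma conv_null u l m : hconv u l -> null (l - m) -> hconv u m.
Proof.
move=> ul lm e /ul[N HN]; exists N => n /HN.
suff -> : nrm (u n - l) = nrm (u n - m) by [].
apply: nrm_eq; rewrite opprB addrC addrA subrK.
exact: nullC.
Qed.

Lemma conv_bound u l (M : R) : hconv u l -> (forall n, nrm (u n) <= M) -> nrm l <= M.
Proof.
move=> ul uM; apply/ler_addgt0Pr => e e0; have [N HN] := ul _ e0.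
have := HN N (leqnn N); have := uM N; have := nrmB (u N) (u N - l).
by rewrite subKr; lra.
Qed.

Lemma ip_conv u l x : hconv u l -> forall e : R, 0 < e ->
  exists N, forall n, (N <= n)%N -> cabs (ip (u n) x - ip l x) < e.
Proof.
move=> ul e e0; have x0 := nrm_ge0 x.
have e' : 0 < e / (nrm x + 1) by rewrite divr_gt0//; lra.
have [N HN] := ul _ e'; exists N => n /HN.
rewrite ltr_pdivlMr; last lra.
rewrite -ipBl; have := cauchy_schwarz (u n - l) x; have := nrm_ge0 (u n - l).
by rewrite mulrDr mulr1; lra.
Qed.

Lemma ip_conv_eq u l x c : hconv u l ->
  (exists N, forall n, (N <= n)%N -> ip (u n) x = c) -> ip l x = c.
Proof.
move=> ul [N1 H1]; apply/eqP; rewrite -subr_eq0 -cabs_eq0 eq_le cabs_ge0 andbT.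
apply/ler_addgt0Pr => e e0; have [N2 H2] := ip_conv x ul e0.
have := H2 (maxn N1 N2) (leq_maxr _ _); rewrite H1 ?leq_maxl// cabsC add0r.
exact: ltW.
Qed.

Section Series.
Variable u : nat -> H.

Definition bessel (K : R) := forall x n, \sum_(k < n) cabs (ip x (u k)) ^+ 2 <= K * nsq x.

(** Duality between analysis and synthesis: the norm of a combination is written through its own
    coefficients against the [u k], which the Bessel inequality bounds by that same norm. *)
Lemma bessel_dual (K : R) : 0 < K -> bessel K -> forall (c : nat -> C) m n,
  nsq (\sum_(m <= k < n) c k *: u k) <= K * \sum_(m <= k < n) cabs (c k) ^+ 2.
Proof.
move=> K0 bu c m n; set y := \sum_(m <= k < n) _.
have yE : nsq y = Re (\sum_(m <= k < n) c k * (ip y (u k))^*%C).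
  by rewrite /nsq {1}/y ip_suml; congr Re; apply: eq_bigr => k _; rewrite ipZl -ip_conj.
(* The weights in the inequality of the means are chosen so that the Bessel bound turns the second
   sum into [nsq y / 2], which is absorbed on the left. *)
have le1 : nsq y <= \sum_(m <= k < n) (K / 2 * cabs (c k) ^+ 2 + (2 * K)^-1 * cabs (ip y (u k)) ^+ 2).
  rewrite yE (le_trans (le_trans (ler_norm _) (Re_le_cabs _)))//.
  rewrite (le_trans (cabs_sum _ _ _))//; apply: ler_sum => k _.
  rewrite cabsM cabsJ; set p := cabs _; set q := cabs _.
  have -> : K / 2 * p ^+ 2 + (2 * K)^-1 * q ^+ 2 = (K * p - q) ^+ 2 / (2 * K) + p * q.
    by field; rewrite gt_eqF.
  by rewrite lerDr divr_ge0 ?sqr_ge0// mulr_ge0// ltW.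
have le2 : \sum_(m <= k < n) cabs (ip y (u k)) ^+ 2 <= K * nsq y.
  apply: le_trans (bu y n); rewrite -(big_mkord xpredT (fun k => cabs (ip y (u k)) ^+ 2)).
  case: (leqP m n) => [mn|nm].
    rewrite [leRHS](big_cat_nat (n := m))//= lerDr.
    by apply: sumr_ge0 => k _; exact: sqr_ge0.
  rewrite [leLHS]big_geq ?(ltnW nm)//; apply: sumr_ge0 => k _; exact: sqr_ge0.
move: le1; rewrite big_split /= -!mulr_sumr.
set P := \sum_(_ <= _ < _) _; set Q := \sum_(_ <= _ < _) _ in le2 *.
have : (2 * K)^-1 * Q <= nsq y / 2.
  rewrite mulrC ler_pdivrMr ?mulr_gt0//; lra.
by rewrite -/P; lra.
Qed.

Lemma synthesis (K : R) (c : nat -> C) (B : R) : hcomplete -> 0 < K -> bessel K ->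
  (forall n, \sum_(k < n) cabs (c k) ^+ 2 <= B) ->
  exists2 l, hconv (fun n => \sum_(k < n) c k *: u k) l & nsq l <= K * B.
Proof.
move=> hc K0 bu cB.
pose S n : R := \sum_(k < n) cabs (c k) ^+ 2.
have ndS : nondecreasing_seq S.
  apply/nondecreasing_seqP => n; rewrite /S big_ord_recr /= lerDl; exact: sqr_ge0.
have cvS : cvgn S.
  apply: nondecreasing_is_cvgn => //; exists B => _ [n _ <-]; exact: cB.
have SB n : S n <= limn S by exact: nondecreasing_cvgn_le.
have [l Hl] : exists l, hconv (fun n => \sum_(k < n) c k *: u k) l.
  apply: hc => e e0.
  have e' : 0 < e ^+ 2 / K by rewrite divr_gt0// exprn_gt0.
  have /cvgrPdist_lt/(_ _ e')[N _ HN] := cvS.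
  have key m n : (N <= m)%N -> (m <= n)%N ->
      nrm (\sum_(k < n) c k *: u k - \sum_(k < m) c k *: u k) < e.
    move=> Nm mn.
    rewrite -!(big_mkord xpredT (fun k => c k *: u k)) (big_cat_nat (n := m) (leq0n m) mn) /=.
    rewrite addrAC subrr add0r -(@ltr_pXn2r _ 2) ?nnegrE ?nrm_ge0 ?(ltW e0)// nrm_sqr.
    apply: le_lt_trans (bessel_dual K0 bu c m n) _.
    rewrite mulrC -ltr_pdivlMr//.
    have -> : \sum_(m <= k < n) cabs (c k) ^+ 2 = S n - S m.
      rewrite /S -!(big_mkord xpredT (fun k => cabs (c k) ^+ 2)).
      by rewrite [X in _ = X - _](big_cat_nat (n := m) (leq0n m) mn) /= addrAC subrr add0r.
    have := HN m Nm; rewrite /= ger0_norm ?subr_ge0//; have := SB n; lra.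
  exists N => m n Nm Nn; case: (leqP m n) => mn; first by rewrite nrmC key.
  by rewrite key// ltnW.
exists l => //; have KB : 0 <= K * B.
  by rewrite mulr_ge0 ?(ltW K0)// (le_trans _ (cB 0%N))// big_ord0.
rewrite -nrm_sqr -[leRHS]sqr_sqrtr// ler_pXn2r ?nnegrE ?nrm_ge0 ?sqrtr_ge0//.
apply: (conv_bound Hl) => n; rewrite ler_sqrt//.
rewrite -(big_mkord xpredT (fun k => c k *: u k)) (le_trans (bessel_dual K0 bu c 0 n))//.
by rewrite ler_pM2l// big_mkord.
Qed.

End Series.

Definition horthonormal (e : nat -> H) := forall j k, ip (e j) (e k) = (j == k)%:R.

Lemma ip_osum (u w : nat -> H) (c : nat -> C) n k :
  (forall i j, ip (u i) (w j) = (i == j)%:R) ->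
  ip (\sum_(i < n) c i *: u i) (w k) = if (k < n)%N then c k else 0.
Proof.
move=> uw; rewrite ip_suml; case: ltnP => kn.
  rewrite (bigD1 (Ordinal kn)) //= ipZl uw eqxx mulr1 big1 ?addr0// => i ik.
  rewrite ipZl uw (_ : (_ == _) = false) ?mulr0//.
  by apply/negbTE; apply: contra ik => /eqP ik; apply/eqP/val_inj.
rewrite big1// => i _; rewrite ipZl uw (_ : (_ == _) = false) ?mulr0//.
by apply/negbTE; rewrite neq_ltn (leq_trans (ltn_ord i)).
Qed.

Section Orthonormal.
Variable e : nat -> H.
Hypothesis oe : horthonormal e.

Lemma nsq_osum (c : nat -> C) n :
  nsq (\sum_(k < n) c k *: e k) = \sum_(k < n) cabs (c k) ^+ 2.
Proof.
rewrite /nsq ip_sumr.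
have -> : \sum_(i < n) ip (\sum_(k < n) c k *: e k) (c i *: e i) =
    \sum_(i < n) (cabs (c i) ^+ 2)%:C.
  apply: eq_bigr => i _; rewrite ipZr (ip_osum _ _ _ oe) ltn_ord mulrC.
  exact: mul_conjc.
by rewrite -rmorph_sum.
Qed.

Lemma nsq_residual x n : nsq (x - \sum_(k < n) ip x (e k) *: e k) =
  nsq x - \sum_(k < n) cabs (ip x (e k)) ^+ 2.
Proof.
rewrite nsqD nsqN (nsq_osum (fun k => ip x (e k))) ipNr ip_sumr.
have -> : \sum_(i < n) ip x (ip x (e i) *: e i) = \sum_(i < n) (cabs (ip x (e i)) ^+ 2)%:C.
  by apply: eq_bigr => i _; rewrite ipZr mulrC mul_conjc.
by rewrite -rmorph_sum cReN /=; lra.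
Qed.

Lemma bessel_orthonormal : bessel e 1.
Proof. by move=> x n; rewrite mul1r -subr_ge0 -nsq_residual nsq_ge0. Qed.

Definition hbasis := horthonormal e /\
  forall x, hconv (fun n => \sum_(k < n) ip x (e k) *: e k) x.

(** Bessel's inequality makes the Fourier series converge; its sum has the same coefficients as [x],
    so totality identifies the two. *)
Lemma total_basis : hcomplete -> (forall x, (forall k, ip x (e k) = 0) -> null x) -> hbasis.
Proof.
move=> hc tot; split => // x.
have [l Hl _] := @synthesis e 1 (fun k => ip x (e k)) (1 * nsq x) hc ltr01 bessel_orthonormal
  (bessel_orthonormal x).
apply: (conv_null Hl); apply: tot => k.
suff lE : ip l (e k) = ip x (e k) by rewrite ipBl lE subrr.
apply: (ip_conv_eq Hl).
by exists k.+1 => n kn; rewrite (ip_osum (fun k => ip x (e k)) _ _ oe) kn.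
Qed.

End Orthonormal.

End PreHilbertTheory.

(** * Riesz bases from biorthogonal Bessel systems *)

Section RieszBasis.
Variables (R : realType) (H : prehilbert R).
Local Notation C := R[i].
Implicit Types (x y z f : H) (a b : C) (A B : H -> H) (e u w : nat -> H) (M K : R).

(** The operators are obtained by choosing a limit for each vector, and a limit is determined only
    up to a null vector; so linearity can only hold modulo null vectors. *)
Definition lin_mod A := forall a b x y, null (A (a *: x + b *: y) - (a *: A x + b *: A y)).

Definition bnd_by A M := forall x, nrm (A x) <= M * nrm x.

Lemma lin_modB A x y : lin_mod A -> null (A (x - y) - (A x - A y)).
Proof. by move=> /(_ 1 (-1) x y); rewrite !scale1r !scaleN1r. Qed.

Lemma op_null A M x y : lin_mod A -> bnd_by A M -> null (x - y) -> null (A x - A y).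
Proof.
move=> lA bA xy; apply: nullP; rewrite -(nrm_eq (lin_modB x y lA)).
by rewrite (le_trans (bA _))// xy mulr0.
Qed.

Lemma op_sum A (c : nat -> C) u n : lin_mod A -> (exists M, bnd_by A M) ->
  null (A (\sum_(k < n) c k *: u k) - \sum_(k < n) c k *: A (u k)).
Proof.
move=> lA [M bA]; elim: n => [|n IH].
  rewrite !big_ord0 subr0; apply: nullP; rewrite (le_trans (bA _))//.
  by rewrite nrm0 mulr0.
rewrite !big_ord_recr /=.
have := lA 1 (c n) (\sum_(i < n) c i *: u i) (u n); rewrite !scale1r => h.
apply: null_trans h _.
by rewrite opprD addrACA subrr addr0.
Qed.

Lemma op_conv A M u l : lin_mod A -> bnd_by A M -> hconv u l -> hconv (fun n => A (u n)) (A l).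
Proof.
move=> lA bA ul e e0.
have e' : 0 < e / (`|M| + 1) by rewrite divr_gt0// ltr_wpDl.
have [N HN] := ul _ e'; exists N => n /HN.
rewrite -(nrm_eq (lin_modB (u n) l lA)) ltr_pdivlMr ?ltr_wpDl// => h.
apply: le_lt_trans (bA _) _; apply: le_lt_trans h.
rewrite mulrC ler_wpM2l ?nrm_ge0// (le_trans (ler_norm _))//; lra.
Qed.

Lemma synthesis_op e u K1 K2 : hcomplete H -> 0 < K1 -> 0 < K2 ->
  bessel e K1 -> bessel u K2 -> exists A, [/\ lin_mod A, bnd_by A (Num.sqrt (K2 * K1)) &
    forall x, hconv (fun n => \sum_(k < n) ip x (e k) *: u k) (A x)].
Proof.
move=> hc K10 K20 be bu.
have [A HA] : exists A, forall x,
    hconv (fun n => \sum_(k < n) ip x (e k) *: u k) (A x) /\ nsq (A x) <= K2 * (K1 * nsq x).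
  have ex (x : H) : exists l : H,
      hconv (fun n => \sum_(k < n) ip x (e k) *: u k) l /\ nsq l <= K2 * (K1 * nsq x).
    have [l Hl Bl] := @synthesis R H u K2 (fun k => ip x (e k)) _ hc K20 bu (be x).
    by exists l.
  by have [A HA] := choice ex; exists A.
exists A; split.
- move=> a b x y; apply: conv_unique (HA _).1 _.
  have := convD (convZ a (HA x).1) (convZ b (HA y).1); apply: eq_conv => n.
  rewrite !scaler_sumr -big_split /= -sumrB; apply: null_sum => k _.
  by rewrite ipDl !ipZl scalerDl !scalerA subrr; exact: null0.
- move=> x; rewrite -(@ler_pXn2r _ 2) ?nnegrE ?mulr_ge0 ?sqrtr_ge0 ?nrm_ge0//.
  rewrite nrm_sqr exprMn nrm_sqr sqr_sqrtr; last by rewrite mulr_ge0// ltW.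
  by rewrite -mulrA; have [] := HA x.
- by move=> x; have [] := HA x.
Qed.

(** [A] synthesizes with [u] the coefficients in [e], and [B] synthesizes with [e] the coefficients
    against [w]. [B A = 1] follows from biorthogonality and the expansion in [e]; [A B = 1] needs
    totality, both sides having the same coefficients against [w]. *)
Theorem riesz_criterion e u w K : hcomplete H -> hbasis e -> 0 < K ->
  bessel u K -> bessel w K -> (forall i j, ip (u i) (w j) = (i == j)%:R) ->
  (forall x, (forall k, ip x (w k) = 0) -> null x) ->
  exists A B M, [/\ lin_mod A, lin_mod B, bnd_by A M & bnd_by B M] /\
    [/\ forall x, null (A (B x) - x), forall x, null (B (A x) - x) &
        forall k, null (A (e k) - u k)].
Proof.
move=> hc [oe ce] K0 bu bw uw tot.
have [A [lA bA cA]] := synthesis_op hc ltr01 K0 (bessel_orthonormal oe) bu.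
have [B [lB bB cB]] := synthesis_op hc K0 ltr01 bw (bessel_orthonormal oe).
have ipA x k : ip (A x) (w k) = ip x (e k).
  apply: ip_conv_eq (cA x) _; exists k.+1 => n kn.
  by rewrite (ip_osum (fun k => ip x (e k)) _ _ uw) kn.
have ipB x k : ip (B x) (e k) = ip x (w k).
  apply: ip_conv_eq (cB x) _; exists k.+1 => n kn.
  by rewrite (ip_osum (fun k => ip x (w k)) _ _ oe) kn.
have AB x : null (A (B x) - x).
  by apply: tot => k; rewrite ipBl ipA ipB subrr.
have BA x : null (B (A x) - x).
  apply: conv_unique (cB _) _; have := ce x; apply: eq_conv => n.
  by rewrite -sumrB; apply: null_sum => k _; rewrite ipA subrr; exact: null0.
exists A, B, (Num.sqrt (K * 1)); split; first by split => //; rewrite mulrC.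
split => // k; apply: conv_unique (cA _) _ => r r0; exists k.+1 => n kn.
rewrite (bigD1 (Ordinal kn)) //= oe eqxx scale1r big1 ?addr0 ?subrr ?nrm0// => i ik.
rewrite oe (_ : (_ == _) = false) ?scale0r//.
by apply/negbTE; apply: contra ik => /eqP ik; apply/eqP/val_inj.
Qed.

(** When [f = A (B f)] is expanded along [u], only the [k]-th term survives in [ip f f], and its
    coefficient [ip (B f) (e k)] is at most [M * nrm f]. *)
Lemma riesz_functional_bound e u A B M k f : hbasis e -> lin_mod A -> bnd_by A M ->
  bnd_by B M -> (forall x, null (A (B x) - x)) -> (forall j, null (u j - A (e j))) ->
  (forall j, j != k -> ip (u j) f = 0) ->
  nsq f <= M * nrm f * cabs (ip (u k) f).
Proof.
move=> [oe ce] lA bA bB AB uA uf.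
have cA : hconv (fun n => \sum_(j < n) ip (B f) (e j) *: A (e j)) (A (B f)).
  have := op_conv lA bA (ce (B f)); apply: eq_conv => n.
  exact: (op_sum (fun j => ip (B f) (e j)) e n lA (ex_intro _ M bA)).
have ff : ip f f = ip (B f) (e k) * ip (u k) f.
  rewrite -(ip_eql _ (AB f)); apply: ip_conv_eq cA _; exists k.+1 => n kn.
  rewrite ip_suml (bigD1 (Ordinal kn)) //= ipZl -(ip_eql _ (uA k)) big1 ?addr0// => i ik.
  by rewrite ipZl -(ip_eql _ (uA i)) uf ?mulr0.
have -> : nsq f = cabs (ip f f) by rewrite ipxx cabs_real ger0_norm// nsq_ge0.
rewrite ff cabsM ler_wpM2r ?cabs_ge0// (le_trans (cauchy_schwarz _ _))//.
have -> : nrm (e k) = 1 by rewrite /nrm /nsq oe eqxx /= sqrtr1.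
by rewrite mulr1.
Qed.

(** Parseval: if the coordinates from [d] on carry at most a fraction [q < 1] of the squared norm,
    the first [d] coordinates cannot all vanish. This gives the finite dimension of the complement
    of the high root spaces. *)
Lemma low_coordinates_null e d (q : R) x : hbasis e -> q < 1 ->
  (forall n, \sum_(d <= k < n) cabs (ip x (e k)) ^+ 2 <= q * nsq x) ->
  (forall k, (k < d)%N -> ip x (e k) = 0) -> null x.
Proof.
move=> [oe ce] q1 tail low; apply/null_nsq/eqP; rewrite eq_le nsq_ge0 andbT.
suff : nsq x <= q * nsq x by have := nsq_ge0 x; nra.
apply/ler_addgt0Pr => r r0.
have [N HN] := ce x (Num.sqrt r) (ltac:(by rewrite sqrtr_gt0)).
have := HN (maxn N d) (leq_maxl _ _); rewrite nrmC.
rewrite -(@ltr_pXn2r _ 2) ?nnegrE ?nrm_ge0 ?sqrtr_ge0// nrm_sqr (sqr_sqrtr (ltW r0)).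
rewrite (nsq_residual oe) -(big_mkord xpredT (fun k => cabs (ip x (e k)) ^+ 2)).
rewrite (big_cat_nat (n := d))//= ?leq_maxr//.
rewrite (_ : \sum_(0 <= k < d) _ = 0) ?add0r; last rewrite big_nat big1//.
  by have := tail (maxn N d); lra.
by move=> k /andP[_ kd]; rewrite low// cabs0 expr0n.
Qed.

End RieszBasis.

(** * The space L^2([0, pi]) *)

Section GeometricSeries.
Variable R : realType.
Local Notation C := R[i].

Lemma cauchy_complex (s : nat -> C) (b : nat -> R) :
  b @ \oo --> (0 : R) -> (forall m n, (m <= n)%N -> cabs (s n - s m) <= b m) ->
  exists l, forall n, cabs (l - s n) <= b n.
Proof.
move=> b0 sb.
have key (h : C -> R) : (forall z w, `|h z - h w| <= cabs (z - w)) ->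
    exists l : R, (h (s n) @[n --> \oo] --> l).
  move=> hh; apply/cvg_ex/cauchy_cvgP/cauchy_exP => e e0.
  have /cvgrPdist_lt/(_ _ e0)[N _ HN] := b0.
  have bN : b N < e.
    by have := HN N (leqnn N); rewrite /= sub0r normrN; apply: le_lt_trans; exact: ler_norm.
  exists (h (s N)); exists N => // n /= Nn; rewrite /ball /= distrC.
  by rewrite (le_lt_trans (hh _ _))// (le_lt_trans (sb _ _ Nn)).
have [lr Hr] := key (@complex.Re R) (fun z w => ltac:(by rewrite -cReN -cReD Re_le_cabs)).
have [li Hi] := key (@complex.Im R) (fun z w => ltac:(by rewrite -cImN -cImD Im_le_cabs)).
exists (lr +i* li) => n; apply/ler_addgt0Pr => e e0.
have e20 : 0 < e / 2 by lra.
have /cvgrPdist_lt/(_ _ e20)[N1 _ H1] := Hr.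
have /cvgrPdist_lt/(_ _ e20)[N2 _ H2] := Hi.
pose N := maxn n (maxn N1 N2).
have := H1 N; rewrite /= !leq_max leqnn orbT => /(_ isT) h1.
have := H2 N; rewrite /= !leq_max leqnn !orbT => /(_ isT) h2.
have := sb n N (leq_maxl _ _).
have := cabsD (lr +i* li - s N) (s N - s n); rewrite addrA subrK.
have := cabs_le_ReIm (lr +i* li - s N); rewrite cReD cImD cReN cImN /=; lra.
Qed.

Lemma geometric_cvg0 (K r : R) : 0 <= r -> r < 1 -> (K * r ^+ n) @[n --> \oo] --> (0 : R).
Proof.
move=> r0 r1; rewrite -[X in _ --> X](mulr0 K); apply: cvgMr.
by apply: cvg_expr; rewrite ger0_norm.
Qed.

(** The common source of two limits with explicit error: the fast subsequence in [L2_complete] and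
    the iteration in [volterra_solve]. *)
Lemma geometric_complex (a : nat -> C) (M r : R) : 0 <= M -> 0 <= r -> r < 1 ->
  (forall j, cabs (a j) <= M * r ^+ j) ->
  exists l, forall n, cabs (l - \sum_(j < n) a j) <= M / (1 - r) * r ^+ n.
Proof.
move=> M0 r0 r1 aM; apply: cauchy_complex; first exact: geometric_cvg0.
have r10 : 0 < 1 - r by lra.
move=> m n mn; rewrite -(subnK mn) addnC.
elim: (n - m)%N => [|k IH].
  by rewrite addn0 subrr cabs0 mulr_ge0 ?exprn_ge0// divr_ge0// ltW.
(* The induction needs the exact partial sum of the geometric series, not its upper bound. *)
suff : cabs (\sum_(j < m + k.+1) a j - \sum_(j < m) a j) <=
    M / (1 - r) * (r ^+ m - r ^+ (m + k.+1)).
  move=> /le_trans; apply; rewrite ler_wpM2l ?divr_ge0 ?(ltW r10)//.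
  by rewrite gerBl exprn_ge0.
clear IH; elim: k => [|k IH].
  rewrite addn1 big_ord_recr /= addrAC subrr add0r (le_trans (aM _))//.
  suff -> : M / (1 - r) * (r ^+ m - r ^+ m.+1) = M * r ^+ m by [].
  by rewrite exprS; field; rewrite gt_eqF.
rewrite addnS big_ord_recr /= addrAC (le_trans (cabsD _ _))//.
have := aM (m + k.+1)%N; rewrite exprS.
have -> : M / (1 - r) * (r ^+ m - r * r ^+ (m + k.+1)) =
  M / (1 - r) * (r ^+ m - r ^+ (m + k.+1)) + M * r ^+ (m + k.+1).
  by field; rewrite gt_eqF.
lra.
Qed.

End GeometricSeries.

Section SquareIntegrable.
Variable R : realType.
Local Notation C := R[i].
Local Notation mu := (@lebesgue_measure R).
Local Notation Re := (@complex.Re R).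
Implicit Types (f g : R -> C).
Let mI := @measurable_I0pi R.

Lemma inL2P f : inL2 f <-> cmeas I0pi f /\ rint I0pi (fun x => cabs (f x) ^+ 2).
Proof.
have E x : cabs (f x) `^ 2 = cabs (f x) ^+ 2 by rewrite -powR_mulrn// cabs_ge0.
rewrite /inL2 /inLp.
have -> : (fun x => (cabs (f x) `^ 2)%:E) = (fun x => (cabs (f x) ^+ 2)%:E).
  by apply/funext => x; rewrite E.
split => -[mf h]; split => //.
- apply/integrableP; split.
    by apply/measurable_EFinP/measurable_funX; exact: cmeas_cabs.
  move: h; congr (_ < _)%E; apply: eq_integral => x _ /=.
  by rewrite ger0_norm// sqr_ge0.
- move/integrableP : h => [_]; congr (_ < _)%E; apply: eq_integral => x _ /=.
  by rewrite ger0_norm// sqr_ge0.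
Qed.

Lemma L2_meas f : inL2 f -> cmeas I0pi f.
Proof. by case/inL2P. Qed.

Lemma L2_sq f : inL2 f -> rint I0pi (fun x => cabs (f x) ^+ 2).
Proof. by case/inL2P. Qed.

Lemma L2_dom f (h : R -> R) : cmeas I0pi f -> rint I0pi h ->
  (forall x, I0pi x -> cabs (f x) ^+ 2 <= h x) -> inL2 f.
Proof.
move=> mf ih fh; apply/inL2P; split => //; apply: rint_dom ih => //.
- by apply: measurable_funX; exact: cmeas_cabs.
- by move=> x Ix; rewrite ger0_norm ?sqr_ge0// fh.
Qed.

Lemma sq_cabsD (z w : C) : cabs (z + w) ^+ 2 <= 2 * cabs z ^+ 2 + 2 * cabs w ^+ 2.
Proof.
have := cabsD z w; have := cabs_ge0 (z + w); have := cabs_ge0 z; have := cabs_ge0 w.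
set a := cabs z; set b := cabs w; set c := cabs _ => *.
have : c ^+ 2 <= (a + b) ^+ 2 by rewrite ler_pXn2r// nnegrE; lra.
by have := sqr_ge0 (a - b); rewrite !expr2; lra.
Qed.

Lemma L2D f g : inL2 f -> inL2 g -> inL2 (fun x => f x + g x).
Proof.
move=> f2 g2; apply: (@L2_dom _ (fun x => 2 * cabs (f x) ^+ 2 + 2 * cabs (g x) ^+ 2)).
- by apply: cmeasD; exact: L2_meas.
- by apply: rintD => //; apply: rintZ => //; exact: L2_sq.
- by move=> x _; exact: sq_cabsD.
Qed.

Lemma L2M f g (M : R) : cmeas I0pi f -> (forall x, I0pi x -> cabs (f x) <= M) ->
  inL2 g -> inL2 (fun x => f x * g x).
Proof.
move=> mf fM g2; apply: (@L2_dom _ (fun x => M ^+ 2 * cabs (g x) ^+ 2)).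
- by apply: cmeasM => //; exact: L2_meas.
- by apply: rintZ => //; exact: L2_sq.
- move=> x Ix; rewrite cabsM exprMn ler_wpM2r ?sqr_ge0// ler_pXn2r ?nnegrE ?cabs_ge0 ?fM//.
  exact: le_trans (cabs_ge0 _) (fM _ Ix).
Qed.

Lemma L2Z c f : inL2 f -> inL2 (fun x => c * f x).
Proof. by apply: (@L2M _ _ (cabs c)) => //; exact: cmeas_cst. Qed.

Lemma L2N f : inL2 f -> inL2 (fun x => - f x).
Proof. by move=> /(L2Z (-1)); under eq_fun do rewrite mulN1r. Qed.

Lemma L2J f : inL2 f -> inL2 (fun x => (f x)^*%C).
Proof.
move=> f2; apply: (L2_dom (cmeasJ (L2_meas f2)) (L2_sq f2)) => x _.
by rewrite cabsJ.
Qed.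

Lemma L2_bdd f (M : R) : cmeas I0pi f -> (forall x, I0pi x -> cabs (f x) <= M) -> inL2 f.
Proof.
move=> mf fM; apply: (@L2_dom _ (fun=> M ^+ 2)) => //; first exact: rint_cst.
move=> x Ix; rewrite ler_pXn2r ?nnegrE ?cabs_ge0 ?fM//.
exact: le_trans (cabs_ge0 _) (fM _ Ix).
Qed.

Lemma L2_ucont f : ucont f -> inL2 f.
Proof. by move=> uf; have [M _ HM] := ucont_bdd uf; apply: L2_bdd HM; exact: ucont_meas. Qed.

Lemma L2_0 : inL2 (fun=> 0 : C).
Proof. by apply: L2_ucont; exact: ucont_cst. Qed.

Lemma L2_prod f g : inL2 f -> inL2 g -> cintble I0pi (fun x => f x * g x).
Proof.
move=> f2 g2; apply: (@cintble_dom _ _ _ (fun x => cabs (f x) ^+ 2 + cabs (g x) ^+ 2)) => //.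
- by apply: cmeasM; exact: L2_meas.
- by apply: rintD => //; exact: L2_sq.
- move=> x _; rewrite cabsM; have := sqr_ge0 (cabs (f x) - cabs (g x)).
  have := sqr_ge0 (cabs (f x)); have := sqr_ge0 (cabs (g x)); rewrite !expr2; lra.
Qed.

Lemma L2_cintble f : inL2 f -> cintble I0pi f.
Proof.
move=> f2; have := L2_prod (L2_ucont (ucont_cst 1)) f2.
by apply: eq_cintble => // x _; rewrite mul1r.
Qed.

(** Representatives instead of classes: the module axioms hold pointwise, and almost everywhere
    equality comes back as [null] of a difference in [null_aeq]. *)
Record L2t := MkL2 { fn :> R -> C; fnP : inL2 fn }.

Lemma L2t_eq (f g : L2t) : (fn f = fn g) -> f = g.
Proof.
by case: f => f f2; case: g => g g2 /= fg; subst g; rewrite (Prop_irrelevance f2 g2).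
Qed.

HB.instance Definition _ := gen_eqMixin L2t.
HB.instance Definition _ := gen_choiceMixin L2t.

Definition L2add (f g : L2t) := MkL2 (L2D (fnP f) (fnP g)).
Definition L2opp (f : L2t) := MkL2 (L2N (fnP f)).
Definition L2zero := MkL2 L2_0.
Definition L2scale (c : C) (f : L2t) := MkL2 (L2Z c (fnP f)).
Definition L2conj (f : L2t) := MkL2 (L2J (fnP f)).

Let L2addA : associative L2add.
Proof. by move=> f g h; apply/L2t_eq/funext => x /=; rewrite addrA. Qed.
Let L2addC : commutative L2add.
Proof. by move=> f g; apply/L2t_eq/funext => x /=; rewrite addrC. Qed.
Let L2add0 : left_id L2zero L2add.
Proof. by move=> f; apply/L2t_eq/funext => x /=; rewrite add0r. Qed.
Let L2addN : left_inverse L2zero L2opp L2add.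
Proof. by move=> f; apply/L2t_eq/funext => x /=; rewrite addNr. Qed.

HB.instance Definition _ := GRing.isZmodule.Build L2t L2addA L2addC L2add0 L2addN.

Let L2scaleA a b (f : L2t) : L2scale a (L2scale b f) = L2scale (a * b) f.
Proof. by apply/L2t_eq/funext => x /=; rewrite mulrA. Qed.
Let L2scale1 : left_id 1 L2scale.
Proof. by move=> f; apply/L2t_eq/funext => x /=; rewrite mul1r. Qed.
Let L2scaleDr : right_distributive L2scale +%R.
Proof. by move=> a f g; apply/L2t_eq/funext => x /=; rewrite mulrDr. Qed.
Let L2scaleDl (f : L2t) : {morph L2scale^~ f : a b / a + b}.
Proof. by move=> a b; apply/L2t_eq/funext => x /=; rewrite mulrDl. Qed.

HB.instance Definition _ := GRing.Zmodule_isLmodule.Build C L2t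
  L2scaleA L2scale1 L2scaleDr L2scaleDl.

Definition L2ip (f g : L2t) : C := cI I0pi (fun x => f x * (g x)^*%C).

Let L2ip_lin a (f g h : L2t) : L2ip (a *: f + g) h = a * L2ip f h + L2ip g h.
Proof.
rewrite /L2ip -cI_Z//; last by apply: L2_prod; [exact: fnP|exact: L2J (fnP _)].
rewrite -cI_D//; last 2 first.
- by apply: cintbleZ => //; apply: L2_prod; [exact: fnP|exact: L2J (fnP _)].
- by apply: L2_prod; [exact: fnP|exact: L2J (fnP _)].
by apply: eq_cI => x _ /=; rewrite mulrDl mulrA.
Qed.

Lemma cI_conj (h : R -> C) : cintble I0pi h -> cI I0pi (fun x => (h x)^*%C) = (cI I0pi h)^*%C.
Proof.
move=> [h1 h2]; apply: complex_eq; rewrite ?cReJ ?cImJ /=.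
  by apply: eq_Rintegral => x _; rewrite cReJ.
rewrite -mulN1r -RintegralZl//; apply: eq_Rintegral => x _.
by rewrite cImJ mulN1r.
Qed.

Let L2ip_conj (f g : L2t) : L2ip g f = (L2ip f g)^*%C.
Proof.
rewrite /L2ip -cI_conj; last by apply: L2_prod; [exact: fnP|exact: L2J (fnP _)].
by apply: eq_cI => x _; rewrite rmorphM /= conjcK mulrC.
Qed.

Lemma L2ip_xx (f : L2t) : Re (L2ip f f) = \int[mu]_(x in I0pi) (cabs (f x) ^+ 2).
Proof. by rewrite /L2ip /=; apply: eq_Rintegral => x _; rewrite mul_conjc. Qed.

Let L2ip_ge0 (f : L2t) : 0 <= Re (L2ip f f).
Proof. by rewrite L2ip_xx; apply: Rintegral_ge0 => x _; exact: sqr_ge0. Qed.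

Definition L2H : prehilbert R := PreHilbert L2ip_lin L2ip_conj L2ip_ge0.

End SquareIntegrable.

Section L2Space.
Variable R : realType.
Local Notation C := R[i].
Local Notation mu := (@lebesgue_measure R).
Local Notation Re := (@complex.Re R).
Local Notation Im := (@complex.Im R).
Local Notation H := (L2H R).
Let mI := @measurable_I0pi R.

Lemma nsqE (f : H) : nsq f = \int[mu]_(x in I0pi) (cabs (f x) ^+ 2).
Proof. exact: L2ip_xx. Qed.

Lemma sqnormE (f : H) : sqnorm f = (nsq f)%:E.
Proof. by rewrite nsqE EFin_Rintegral//; exact: L2_sq (fnP f). Qed.

Lemma aeq_refl (f : R -> C) : aeq f f.
Proof. by apply: aeW. Qed.

Lemma aeq_sym (f g : R -> C) : aeq f g -> aeq g f.
Proof. by apply: aeS => x fg Ix; rewrite fg. Qed.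

Lemma aeq_trans (g f h : R -> C) : aeq f g -> aeq g h -> aeq f h.
Proof. by apply: aeS2 => x fg gh Ix; rewrite fg// gh. Qed.

Lemma null_aeq0 (f : H) : null f <-> aeq f (fun=> 0).
Proof.
have mf : measurable_fun I0pi (fun x => (cabs (f x) ^+ 2)%:E).
  apply/measurable_EFinP/measurable_funX; apply: cmeas_cabs => //.
  exact: L2_meas (fnP f).
have E : (\int[mu]_(x in I0pi) `|(cabs (f x) ^+ 2)%:E|)%E = (nsq f)%:E.
  rewrite -sqnormE; apply: eq_integral => x _ /=; rewrite ger0_norm//.
  exact: sqr_ge0.
rewrite null_nsq; split => [f0|f0].
- have : (\int[mu]_(x in I0pi) `|(cabs (f x) ^+ 2)%:E|)%E = 0%E by rewrite E f0.
  move/(ae_eq_integral_abs mu mI mf); apply: aeS => x h Ix.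
  by have /eqP := h Ix; rewrite /= eqe sqrf_eq0 cabs_eq0 => /eqP.
- have : (\int[mu]_(x in I0pi) `|(cabs (f x) ^+ 2)%:E|)%E = 0%E.
    apply/(ae_eq_integral_abs mu mI mf); apply: aeS f0 => x h Ix /=.
    by rewrite h// cabs0 expr0n.
  by rewrite E => /eqP; rewrite eqe => /eqP.
Qed.

Lemma null_aeq (f g : H) : null (f - g) <-> aeq f g.
Proof.
rewrite null_aeq0; split; apply: aeS => x h Ix /=.
- by apply/eqP; rewrite -subr_eq0; apply/eqP; exact: h.
- by rewrite h// subrr.
Qed.

(** Riesz-Fischer with an explicit rate. A subsequence with [nsq (d_ j) <= 16^-j] makes [Phi], the
    sum of the [4^j |d_ j|^2], integrable; wherever it is finite, [|d_ j| <= sqrt Phi / 2^j], so the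
    subsequence converges geometrically at that point. Squaring and integrating the pointwise error
    gives convergence in norm. *)
Lemma L2_complete : hcomplete H.
Proof.
move=> u cu.
have q0 j : 0 < (1 / 4 : R) ^+ j by apply: exprn_gt0; lra.
pose N_ j := xget 0%N [set N | forall m n, (N <= m)%N -> (N <= n)%N ->
  nrm (u m - u n) < (1 / 4) ^+ j].
have HN j m n : (N_ j <= m)%N -> (N_ j <= n)%N -> nrm (u m - u n) < (1 / 4) ^+ j.
  have [N HN] := cu _ (q0 j).
  exact: (@xgetPex _ 0%N [set N | forall m n, (N <= m)%N -> (N <= n)%N ->
    nrm (u m - u n) < (1 / 4) ^+ j] (ex_intro _ N HN)).
(* Summing the thresholds makes the chosen indices monotone. *)
pose k_ j := (\sum_(i < j.+1) N_ i)%N.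
have Nk j : (N_ j <= k_ j)%N by rewrite /k_ big_ord_recr /= leq_addl.
have kS j : (k_ j <= k_ j.+1)%N by rewrite /k_ [leqRHS]big_ord_recr /= leq_addr.
pose g_ j : H := u (k_ j).
pose d_ j : H := g_ j.+1 - g_ j.
have dq j : nsq (d_ j) <= (1 / 16) ^+ j.
  have -> : (1 / 16 : R) ^+ j = ((1 / 4) ^+ j) ^+ 2.
    by rewrite -!exprM mulnC exprM; congr (_ ^+ _); field.
  rewrite -nrm_sqr ler_pXn2r ?nnegrE ?nrm_ge0 ?(ltW (q0 j))//.
  by apply/ltW/HN => //; exact: leq_trans (Nk j) (kS j).
(* The weight [4^j] lies strictly between 1 and the decay [16^j] of the squared norms: the integrals
   remain summable, and finiteness of the sum still gives pointwise decay. *)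
pose a_ j x : R := 4 ^+ j * cabs (d_ j x) ^+ 2.
have a_ge0 j x : 0 <= a_ j x by rewrite /a_; apply: mulr_ge0; [exact: exprn_ge0|exact: sqr_ge0].
have ma j : measurable_fun I0pi (fun x => (a_ j x)%:E).
  apply/measurable_EFinP; apply: measurable_funM => //.
  by apply: measurable_funX; apply: cmeas_cabs => //; exact: L2_meas (fnP _).
pose Phi x := (\sum_(0 <= j <oo) (a_ j x)%:E)%E.
have mPhi : measurable_fun I0pi Phi.
  by apply: ge0_emeasurable_sum => // j x _ _; rewrite lee_fin.
have Phi_ge0 x : (0 <= Phi x)%E by apply: nneseries_ge0 => j _ _; rewrite lee_fin.
have PhiS J x : (\sum_(0 <= j < J) (a_ j x)%:E <= Phi x)%E.
  by apply: nneseries_lim_ge => j _ _; rewrite lee_fin.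
have iPhi : (\int[mu]_(x in I0pi) Phi x < +oo)%E.
  rewrite integral_nneseries//; last by move=> j x _; rewrite lee_fin.
  apply: (@le_lt_trans _ _ (2%:E)); last exact: ltry.
  apply: lime_le; first by apply: is_cvg_nneseries => j _ _; apply: integral_ge0 => x _; rewrite lee_fin.
  apply: nearW => n.
  have E j : (\int[mu]_(x in I0pi) (a_ j x)%:E)%E = (4 ^+ j * nsq (d_ j))%:E.
    rewrite EFinM -sqnormE.
    transitivity (\int[mu]_(x in I0pi) ((4 ^+ j)%:E * (cabs (d_ j x) ^+ 2)%:E))%E.
      by apply: eq_integral => x _; rewrite EFinM.
    apply: ge0_integralZl => //.
    - apply/measurable_EFinP; apply: measurable_funX; apply: cmeas_cabs => //.
      exact: L2_meas (fnP _).
    - by move=> x _; rewrite lee_fin sqr_ge0.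
  under eq_bigr do rewrite E.
  rewrite sumEFin lee_fin.
  apply: (@le_trans _ _ (\sum_(0 <= j < n) (1 / 4) ^+ j)).
    apply: ler_sum => j _.
    have -> : (1 / 4 : R) ^+ j = 4 ^+ j * (1 / 16) ^+ j.
      by rewrite -exprMn; congr (_ ^+ _); field.
    by rewrite ler_pM2l ?exprn_gt0.
  suff -> : \sum_(0 <= j < n) (1 / 4 : R) ^+ j = 4 / 3 * (1 - (1 / 4) ^+ n).
    by have := q0 n; lra.
  elim: n => [|n IH]; first by rewrite big_geq// expr0 subrr mulr0.
  by rewrite big_nat_recr//= IH exprS; field.
pose phi x : R := fine (Phi x).
have mphi : measurable_fun I0pi phi.
  exact: measurableT_comp mPhi.
have phi_ge0 x : 0 <= phi x by rewrite fine_ge0.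
have iphi : rint I0pi phi.
  apply/integrableP; split; first exact/measurable_EFinP.
  apply: le_lt_trans iPhi; apply: ge0_le_integral => //.
  - exact/measurable_EFinP/measurableT_comp.
  - move=> x _ /=; rewrite ger0_norm// /phi.
    by have := Phi_ge0 x; case: (Phi x) => [r| |] //= _; exact: leey.
have fin : {ae mu, forall x, I0pi x -> Phi x \is a fin_num}.
  apply: (integrable_ae (mu := mu)) => //; apply/integrableP; split => //.
  by under eq_integral do rewrite gee0_abs//.
have lim_ex x : exists l : C, Phi x \is a fin_num -> forall J,
    cabs (l - g_ J x) <= 2 * Num.sqrt (phi x) * (1 / 2) ^+ J.
  have [Pf|_] := boolP (Phi x \is a fin_num); last by exists 0.
  have dx j : cabs (d_ j x) <= Num.sqrt (phi x) * (1 / 2) ^+ j.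
    have h0 : 0 <= Num.sqrt (phi x) * (1 / 2) ^+ j by rewrite mulr_ge0 ?sqrtr_ge0// exprn_ge0//; lra.
    rewrite -(@ler_pXn2r _ 2) ?nnegrE ?cabs_ge0// exprMn sqr_sqrtr//.
    have -> : ((1 / 2 : R) ^+ j) ^+ 2 = (4 ^+ j)^-1.
      by rewrite -exprM mulnC exprM -exprVn; congr (_ ^+ _); field.
    rewrite ler_pdivlMr ?exprn_gt0// mulrC.
    rewrite -lee_fin fineK//; apply: le_trans (PhiS j.+1 x).
    rewrite big_nat_recr//= leeDr//; apply: sume_ge0 => i _.
    by rewrite lee_fin.
  have [l Hl] := geometric_complex (sqrtr_ge0 (phi x)) (ltac:(lra) : 0 <= (1 / 2 : R))
    (ltac:(lra)) dx.
  exists (l + g_ 0%N x) => _ J; have := Hl J.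
  have -> : \sum_(j < J) d_ j x = g_ J x - g_ 0%N x.
    elim: J => [|J IH]; first by rewrite big_ord0 subrr.
    by rewrite big_ord_recr /= IH; ring.
  rewrite opprB addrA => /le_trans; apply.
  by rewrite le_eqVlt; apply/orP; left; apply/eqP; field.
pose E0 := I0pi `&` [set x | (Phi x < +oo)%E].
have mE0 : measurable E0.
  by apply: emeasurable_fun_lt => //; exact: measurable_cst.
have E0fin x : E0 x -> Phi x \is a fin_num.
  by case=> _ Pf; rewrite ge0_fin_numE.
have [l Hl] := choice lim_ex.
(* Cutting off at the set where [Phi] is finite makes the convergence hold at every point of the
   interval, hence the limit measurable. *)
pose ind x : C := (\1_E0 x)%:C.
have mind : cmeas I0pi ind by split; [exact: measurable_indic|exact: measurable_cst].
pose g x := ind x * l x.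
have ind1 x : E0 x -> ind x = 1 by move=> Ex; rewrite /ind indicE mem_set.
have ind0 x : ~ E0 x -> ind x = 0 by move=> Ex; rewrite /ind indicE memNset.
have gJ J x : I0pi x -> cabs (g x - ind x * g_ J x) ^+ 2 <= 4 * phi x * (1 / 4) ^+ J.
  move=> Ix; have [Ex|nEx] := pselect (E0 x); last first.
    rewrite /g ind0// !mul0r subrr cabs0 expr0n /=.
    by rewrite !mulr_ge0// ltW.
  rewrite /g ind1// (mul1r (l x)) (mul1r (g_ J x)).
  have -> : 4 * phi x * (1 / 4) ^+ J = (2 * Num.sqrt (phi x) * (1 / 2) ^+ J) ^+ 2.
    rewrite [RHS]exprMn [X in _ = X * _]exprMn sqr_sqrtr//; congr (_ * _); first by ring.
    by rewrite -exprM mulnC exprM; congr (_ ^+ _); field.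
  have r0 : 0 <= 2 * Num.sqrt (phi x) * (1 / 2) ^+ J.
    by apply: mulr_ge0; [apply: mulr_ge0 => //; exact: sqrtr_ge0|apply: exprn_ge0; lra].
  rewrite ler_pXn2r ?nnegrE ?cabs_ge0//; apply: Hl; exact: E0fin.
have cvg_key x : I0pi x -> forall e : R, 0 < e -> exists N : nat, forall J, (N <= J)%N ->
    cabs (g x - ind x * g_ J x) < e.
  move=> Ix e e0.
  have h : (4 * phi x * (1 / 4) ^+ J) @[J --> \oo] --> (0 : R).
    by apply: geometric_cvg0; lra.
  have /cvgrPdist_lt/(_ _ (exprn_gt0 2 e0))[N _ HN'] := h.
  exists N => J NJ; rewrite -(@ltr_pXn2r _ 2) ?nnegrE ?cabs_ge0 ?(ltW e0)//.
  apply: le_lt_trans (gJ J x Ix) _.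
  by have := HN' J NJ; rewrite /= sub0r normrN; apply: le_lt_trans; exact: ler_norm.
have mg : cmeas I0pi g.
  have mgJ J : cmeas I0pi (fun x => ind x * g_ J x).
    by apply: cmeasM => //; exact: L2_meas (fnP _).
  split.
  - apply: (measurable_fun_cvg (fun J => (mgJ J).1)) => x Ix.
    apply/cvgrPdist_lt => e e0; have [N HN'] := cvg_key x Ix e e0.
    exists N => // J /HN'; apply: le_lt_trans; rewrite -cReN -cReD; exact: Re_le_cabs.
  - apply: (measurable_fun_cvg (fun J => (mgJ J).2)) => x Ix.
    apply/cvgrPdist_lt => e e0; have [N HN'] := cvg_key x Ix e e0.
    exists N => // J /HN'; apply: le_lt_trans; rewrite -cImN -cImD; exact: Im_le_cabs.
have ind_bd x : I0pi x -> cabs (ind x) <= 1.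
  move=> _; have [Ex|nEx] := pselect (E0 x); first by rewrite ind1// cabs1.
  by rewrite ind0// cabs0.
have g2 : inL2 g.
  have i0 := L2M mind ind_bd (fnP (g_ 0%N)).
  have d0 : inL2 (fun x => g x - ind x * g_ 0%N x).
    apply: (@L2_dom _ _ (fun x => 4 * phi x)).
    - by apply: cmeasB => //; exact: L2_meas i0.
    - exact: rintZ.
    - by move=> x /(gJ 0%N); rewrite expr0 mulr1.
  by have := L2D d0 i0; under eq_fun do rewrite subrK.
pose S := \int[mu]_(x in I0pi) phi x.
have S0 : 0 <= S by apply: Rintegral_ge0.
exists (MkL2 g2) => e e0.
have e20 : 0 < e / 2 by lra.
have h : (4 * S * (1 / 4) ^+ J) @[J --> \oo] --> (0 : R) by apply: geometric_cvg0; lra.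
have /cvgrPdist_lt/(_ _ (exprn_gt0 2 e20))[N1 _ HN1] := h.
have /cvgrPdist_lt/(_ _ e20)[N2 _ HN2] : ((1 * (1 / 4) ^+ J) @[J --> \oo] --> (0 : R)).
  by apply: geometric_cvg0; lra.
pose J := maxn N1 N2.
exists (k_ J) => n kn.
have b1 : nrm (g_ J - (MkL2 g2 : H)) < e / 2.
  rewrite nrmC -(@ltr_pXn2r _ 2) ?nnegrE ?nrm_ge0 ?(ltW e20)// nrm_sqr.
  apply: (@le_lt_trans _ _ (4 * S * (1 / 4) ^+ J)); last first.
    have := HN1 J (leq_maxl _ _); rewrite /= sub0r normrN; apply: le_lt_trans; exact: ler_norm.
  have -> : 4 * S * (1 / 4) ^+ J = (4 * (1 / 4) ^+ J) * S by ring.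
  pose w : H := MkL2 (L2D g2 (L2N (L2M mind ind_bd (fnP (g_ J))))).
  have -> : nsq ((MkL2 g2 : H) - g_ J) = nsq w.
    apply/eqP; rewrite -[_ == _](@eqr_sqrt _ _ _ (nsq_ge0 _) (nsq_ge0 _)); apply/eqP.
    apply: nrm_eq; apply/null_aeq; apply: aeS fin => x /[swap] Ix /(_ Ix) fx /=.
    rewrite ind1 ?mul1r//; split => //=.
    by move: fx; rewrite ge0_fin_numE.
  rewrite nsqE /S -RintegralZl//; apply: le_Rintegral => //.
  - exact: L2_sq (fnP w).
  - exact: rintZ.
  - by move=> x Ix; have := gJ J x Ix; rewrite mulrAC.
have b2 : nrm (u n - g_ J) < e / 2.
  apply: (@lt_trans _ _ ((1 / 4) ^+ J)); first by apply: HN => //; exact: leq_trans (Nk J) kn.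
  have := HN2 J (leq_maxr _ _); rewrite /= sub0r normrN mul1r.
  by apply: le_lt_trans; exact: ler_norm.
rewrite -(subrK (g_ J) (u n)) -addrA (le_lt_trans (nrmD _ _))//; lra.
Qed.

Definition bip (f g : H) : C := ip f (L2conj g : H).

Lemma bipE (f g : H) : bip f g = cI I0pi (fun x => f x * g x).
Proof. by apply: eq_cI => x _ /=; rewrite conjcK. Qed.

End L2Space.

(** * Second-order equations *)

Section Trigonometric.
Variable R : realType.
Local Notation C := R[i].
Implicit Types (x : R) (n : nat).

Lemma sin_ge_mul_cos (x : R) : 0 <= x -> x <= pi / 2 -> x * cos x <= sin x.
Proof.
move=> x0 xp; have [->|xn0] := eqVneq x 0; first by rewrite mul0r sin0.
have {xn0} x0' : 0 < x by rewrite lt_def xn0.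
have [c /itvP cx] := @MVT R sin cos 0 x x0' (fun y _ => is_derive_sin y)
  (continuous_subspaceT (@continuous_sin R)).
rewrite sin0 !subr0 => ->; rewrite mulrC ler_wpM2r//.
have p0 := @pi_gt0 R.
have cI : c \in `[0, pi] by rewrite in_itv /= (ltW _) ?cx//= (le_trans (ltW _) (le_trans xp _)) ?cx//; lra.
have xI : x \in `[0, pi] by rewrite in_itv /= x0 (le_trans xp)//; lra.
by rewrite leNgt ltr_cos// -leNgt ltW// cx.
Qed.

(** The inequality [x cos x <= sin x] at [x = pi/16]; three half-angle steps from [cos (pi/2) = 0]
    bound the cosine from below and the sine from above. The value 49/15 is sharp enough for the
    margins of the a priori estimates. *)
Lemma pi_le : (pi : R) <= 49 / 15.
Proof.
have p0 := @pi_gt0 R; have p2 := @pihalf_lt2 R.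
have dbl (t : R) : cos (t + t) = 2 * cos t ^+ 2 - 1.
  by rewrite cosD -!expr2; have := cos2Dsin2 t; lra.
have pos (t : R) : 0 <= t -> t <= pi / 4 -> 0 < cos t.
  by move=> t0 tp; apply: cos_gt0_pihalf; apply/andP; split; lra.
have sqle (a b : R) : 0 <= b -> a * a <= b * b -> a <= b.
  move=> b0; rewrite -!expr2 => ab; have [//|ba] := leP a b.
  have : b ^+ 2 < a ^+ 2 by rewrite ltr_pXn2r ?nnegrE// (le_trans b0 (ltW ba)).
  by rewrite ltNge ab.
have c4 : 7 / 10 <= cos (pi / 4 : R).
  have := dbl (pi / 4); rewrite (_ : pi / 4 + pi / 4 = pi / 2) ?cos_pihalf; last by field.
  have := pos (pi / 4) (ltac:(lra)) (ltac:(lra)).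
  by rewrite expr2; set c := cos _ => *; apply: sqle; lra.
have c8 : 23 / 25 <= cos (pi / 8 : R).
  have := dbl (pi / 8); rewrite (_ : pi / 8 + pi / 8 = pi / 4); last by field.
  have := pos (pi / 8) (ltac:(lra)) (ltac:(lra)).
  by rewrite expr2; move: c4; set c := cos _; set d := cos _ => *; apply: sqle; lra.
have := dbl (pi / 16); rewrite (_ : pi / 16 + pi / 16 = pi / 8); last by field.
have := @sin_ge_mul_cos (pi / 16) (ltac:(lra)) (ltac:(lra)).
have := pos (pi / 16) (ltac:(lra)) (ltac:(lra)).
have := cos2Dsin2 (pi / 16 : R); rewrite !expr2.
move: c8; set c := cos _; set d := cos (pi / 16); set s := sin _ => h1 h2 h3 h4 h5.
have d2 : 24 / 25 <= d * d by lra.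
have s2 : s * s <= 1 / 25 by lra.
have [//|h] := leP (pi : R) (49 / 15).
have q0 : 0 <= pi / 16 * d by apply: mulr_ge0; lra.
have := ler_pM q0 q0 h4 h4.
have -> : (pi / 16 * d) * (pi / 16 * d) = (pi / 16) * (pi / 16) * (d * d) by ring.
have r0 : (0 : R) <= 49 / 240 by lra.
have r1 : 49 / 240 <= pi / 16 :> R by lra.
have := ler_pM (mulr_ge0 r0 r0) (ltac:(lra) : (0 : R) <= 24 / 25)
  (ler_pM r0 r0 r1 r1) d2.
lra.
Qed.

Definition cn n x : C := (cos (n%:R * x))%:C.
Definition sn n x : C := (sin (n%:R * x))%:C.

Lemma hd_cn n x : hd (cn n) x (- n%:R * sn n x).
Proof.
have d : is_derive x 1 (fun t : R => cos (n%:R * t)) (- n%:R * sin (n%:R * x)).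
  by apply: is_derive_eq; rewrite !scaler1 /GRing.scale /=; ring.
have := @hd_ReIm R (fun t => cos (n%:R * t)) (fun=> 0) x (- n%:R * sin (n%:R * x)) 0
  (ex_derive (is_derive := d)) _ (derivable_cst _ _ _) _.
rewrite derive1E derive_val derive1_cst => /(_ erefl erefl).
suff -> : - n%:R * sn n x = (- n%:R * sin (n%:R * x))%:C by [].
by rewrite rmorphM rmorphN rmorph_nat.
Qed.

Lemma hd_sn n x : hd (sn n) x (n%:R * cn n x).
Proof.
have d : is_derive x 1 (fun t : R => sin (n%:R * t)) (n%:R * cos (n%:R * x)).
  by apply: is_derive_eq; rewrite !scaler1 /GRing.scale /=; ring.
have := @hd_ReIm R (fun t => sin (n%:R * t)) (fun=> 0) x (n%:R * cos (n%:R * x)) 0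
  (ex_derive (is_derive := d)) _ (derivable_cst _ _ _) _.
rewrite derive1E derive_val derive1_cst => /(_ erefl erefl).
suff -> : n%:R * cn n x = (n%:R * cos (n%:R * x))%:C by [].
by rewrite rmorphM rmorph_nat.
Qed.

Lemma cn_le1 n x : cabs (cn n x) <= 1.
Proof. by rewrite cabs_real ler_norml cos_geN1 cos_le1. Qed.

Lemma sn_le1 n x : cabs (sn n x) <= 1.
Proof. by rewrite cabs_real ler_norml sin_geN1 sin_le1. Qed.

Lemma cn2Dsn2 n x : cn n x * cn n x + sn n x * sn n x = 1.
Proof. by rewrite -!rmorphM -rmorphD /= -!expr2 cos2Dsin2. Qed.

Lemma cn0 n : cn n 0 = 1.
Proof. by rewrite /cn mulr0 cos0. Qed.

Lemma sn0 n : sn n 0 = 0.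
Proof. by rewrite /sn mulr0 sin0. Qed.

Lemma sn_pi n : sn n pi = 0.
Proof.
rewrite /sn; suff -> : sin (n%:R * pi : R) = 0 by [].
elim: n => [|n IH]; first by rewrite mul0r sin0.
by rewrite -natr1 mulrDl mul1r sinDpi IH oppr0.
Qed.

Lemma cn_pi n : cn n pi = (-1) ^+ n.
Proof.
rewrite /cn; suff -> : cos (n%:R * pi : R) = (-1) ^+ n by rewrite rmorphXn rmorphN1.
elim: n => [|n IH]; first by rewrite mul0r cos0 expr0.
by rewrite -natr1 mulrDl mul1r cosDpi IH exprS mulN1r.
Qed.

Lemma hd_ucont (F f : R -> C) (M : R) : 0 <= M ->
  (forall x, I0pi x -> hd F x (f x)) -> (forall x, I0pi x -> cabs (f x) <= M) -> ucont F.
Proof.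
move=> M0 hF fM; apply: AC_ucont; apply: (AC_lipschitz M0) => x y x0 xy yp.
exact: mean_value_bound hF fM.
Qed.

Lemma ucont_cn n : ucont (cn n).
Proof.
apply: (@hd_ucont _ _ n%:R) => // [x _|x _]; first exact: hd_cn.
rewrite cabsM cabsN -[X in cabs X](rmorph_nat (real_complex R)) cabs_real ger0_norm//.
by rewrite ler_piMr// sn_le1.
Qed.

Lemma ucont_sn n : ucont (sn n).
Proof.
apply: (@hd_ucont _ _ n%:R) => // [x _|x _]; first exact: hd_sn.
rewrite cabsM -[X in cabs X](rmorph_nat (real_complex R)) cabs_real ger0_norm//.
by rewrite ler_piMr// cn_le1.
Qed.

Lemma ucontZ (F : R -> C) c : ucont F -> ucont (fun x => c * F x).
Proof. by move=> uF; apply: ucontM => //; exact: ucont_cst. Qed.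

Lemma acd_cn n : acd (cn n) (fun x => - n%:R * sn n x).
Proof. by apply: acd_C1 => [x _|]; [exact: hd_cn|apply: ucontZ; exact: ucont_sn]. Qed.

Lemma acd_sn n : acd (sn n) (fun x => n%:R * cn n x).
Proof. by apply: acd_C1 => [x _|]; [exact: hd_sn|apply: ucontZ; exact: ucont_cn]. Qed.

Lemma cabs_nat n : cabs (n%:R : C) = n%:R.
Proof. by rewrite -(rmorph_nat (real_complex R)) cabs_real ger0_norm. Qed.

End Trigonometric.

Section SecondOrder.
Variable R : realType.
Local Notation C := R[i].
Implicit Types (y dy w g dg k : R -> C) (n : nat) (x : R).

(** The equation [y'' = w] in the sense of Caratheodory, as required for [w] that is merely
    integrable. *)
Definition sol2 y dy w := (forall x, I0pi x -> hd y x (dy x)) /\ acd dy w.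

Lemma eq_acd (F G f g : R -> C) : F = G -> f = g -> acd F f -> acd G g.
Proof. by move=> -> ->. Qed.

Lemma sol2_acd y dy w : sol2 y dy w -> acd y dy.
Proof. by move=> [hy [ay _ _]]; apply: acd_C1 => //; exact: AC_ucont. Qed.

Lemma acd_ucont (F f : R -> C) : acd F f -> ucont F.
Proof. by move=> [aF _ _]; exact: AC_ucont. Qed.

Lemma sol2_ucont y dy w : sol2 y dy w -> ucont y.
Proof. by move=> /sol2_acd/acd_ucont. Qed.

Lemma sol2D y dy w g dg k : sol2 y dy w -> sol2 g dg k ->
  sol2 (fun x => y x + g x) (fun x => dy x + dg x) (fun x => w x + k x).
Proof. by move=> [hy ay] [hg ag]; split; [move=> x Ix; apply: hdD; auto|exact: acdD]. Qed.

Lemma sol2Z y dy w c : sol2 y dy w ->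
  sol2 (fun x => c * y x) (fun x => c * dy x) (fun x => c * w x).
Proof. by move=> [hy ay]; split; [move=> x Ix; apply: hdZ; auto|exact: acdZ]. Qed.

Lemma sol2_cn n : sol2 (cn n) (fun x => - n%:R * sn n x) (fun x => - n%:R ^+ 2 * cn n x : C).
Proof.
split=> [x _|]; first exact: hd_cn.
by apply: eq_acd (acdZ (- n%:R) (acd_sn R n)) => //; apply/funext => x; ring.
Qed.

Lemma sol2_sn n : sol2 (sn n) (fun x => n%:R * cn n x) (fun x => - n%:R ^+ 2 * sn n x : C).
Proof.
split=> [x _|]; first exact: hd_sn.
by apply: eq_acd (acdZ (n%:R) (acd_cn R n)) => //; apply/funext => x; ring.
Qed.

Lemma lagrange y dy w g dg k : sol2 y dy w -> sol2 g dg k ->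
  acd (fun x => dy x * g x - y x * dg x) (fun x => w x * g x - y x * k x).
Proof.
move=> sy sg; have ay := sol2_acd sy; have ag := sol2_acd sg.
case: sy => _ ady; case: sg => _ adg.
by apply: eq_acd (acdB (acdM ady ag) (acdM ay adg)) => //; apply/funext => x; ring.
Qed.

Lemma lagrange_cI y dy w g dg k : sol2 y dy w -> sol2 g dg k ->
  cI I0pi (fun x => w x * g x - y x * k x) =
  (dy pi * g pi - y pi * dg pi) - (dy 0 * g 0 - y 0 * dg 0).
Proof. by move=> sy sg; rewrite (acd_cI (lagrange sy sg)). Qed.

(** The amplitudes of variation of constants: [y = va cos + vb sin] and [y'/n = vb cos - va sin] at
    frequency [n]. Both are constant when [y'' = - n^2 y]. *)
Definition va n y dy x : C := y x * cn n x - dy x / n%:R * sn n x.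
Definition vb n y dy x : C := y x * sn n x + dy x / n%:R * cn n x.

Section Variation.
Variables (n : nat) (y dy w : R -> C).
Hypotheses (n0 : (0 < n)%N) (sy : sol2 y dy w).
Let W x := w x + n%:R ^+ 2 * y x.
Let nC : (n%:R : C) != 0. Proof. by rewrite pnatr_eq0 -lt0n. Qed.

Lemma vaE x : y x = va n y dy x * cn n x + vb n y dy x * sn n x.
Proof. by rewrite -[LHS]mulr1 -(cn2Dsn2 n x) /va /vb; ring. Qed.

Lemma cintble_W : cintble I0pi W.
Proof.
have [_ [_ _ iw]] := sy; apply: cintbleD => //; first exact: measurable_I0pi.
by apply: ucont_cintble; apply: ucontZ; exact: sol2_ucont sy.
Qed.

(** The amplitude is [-1/n] times the Wronskian of [y] and [sn n], so Lagrange's identity gives its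
    derivative. *)
Lemma acd_va : acd (va n y dy) (fun x => - n%:R^-1 * (sn n x * W x)).
Proof.
have := acdZ (- n%:R^-1) (lagrange sy (sol2_sn n)); apply: eq_acd.
  by apply/funext => x; rewrite /va; field.
by apply/funext => x; rewrite /W; field.
Qed.

Lemma acd_vb : acd (vb n y dy) (fun x => n%:R^-1 * (cn n x * W x)).
Proof.
have := acdZ (n%:R^-1) (lagrange sy (sol2_cn n)); apply: eq_acd.
  by apply/funext => x; rewrite /vb; field.
by apply/funext => x; rewrite /W; field.
Qed.

Lemma acdB_cI (F f : R -> C) (x0 x1 : R) : acd F f -> 0 <= x0 -> x0 <= x1 -> x1 <= pi ->
  F x1 - F x0 = cI `]x0, x1]%classic f.
Proof.
move=> aF x00 x01 x1p; have [_ _ fi] := aF.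
have I0 : I0pi x0 by rewrite I0piE x00 (le_trans x01).
have I1 : I0pi x1 by rewrite I0piE x1p (le_trans x00).
rewrite (acd_FTC aF I1) (acd_FTC aF I0) opprD addrACA subrr add0r.
exact: primB.
Qed.

Lemma nI_oc (f : R -> C) (x0 x1 : R) : cintble I0pi f -> 0 <= x0 -> x1 <= pi ->
  nI `]x0, x1]%classic f = nI `[x0, x1]%classic f.
Proof.
move=> fi x00 x1p; rewrite /nI Rintegral_itv_obnd_cbnd//.
apply: cintble_cabs => //; apply: cintbleS fi => //; first exact: measurable_I0pi.
exact: sub_itvI0pi.
Qed.

Lemma variation_of_constants x0 x : I0pi x0 -> I0pi x ->
  cabs (y x - (va n y dy x0 * cn n x + vb n y dy x0 * sn n x)) <=
  n%:R^-1 * nI `[Num.min x0 x, Num.max x0 x]%classic W.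
Proof.
rewrite !I0piE => /andP[x00 x0p] /andP[x_0 xp].
set lo := Num.min _ _; set hi := Num.max _ _.
have l0 : 0 <= lo by rewrite le_min x00.
have hp : hi <= pi by rewrite ge_max x0p.
have lh : lo <= hi by rewrite ge_min !le_max lexx.
have mI := @measurable_I0pi R.
have iW : cintble `]lo, hi]%classic W.
  by apply: cintbleS cintble_W => //; exact: sub_itvI0pi.
have [e e1 ->] : exists2 e : C, cabs e = 1 & y x - (va n y dy x0 * cn n x + vb n y dy x0 * sn n x) =
    e * ((va n y dy hi - va n y dy lo) * cn n x + (vb n y dy hi - vb n y dy lo) * sn n x).
  rewrite {1}(vaE x) /lo /hi; case: (leP x0 x) => h.
    by exists 1; [exact: cabs1|ring].
  by exists (-1); [rewrite cabsN cabs1|ring].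
rewrite cabsM e1 mul1r.
rewrite (acdB_cI acd_va)// (acdB_cI acd_vb)//.
have ms (F : R -> C) : ucont F -> cmeas `]lo, hi]%classic F.
  move=> uF; apply: cintble_meas; apply: cintbleS (ucont_cintble uF) => //.
  exact: sub_itvI0pi.
(* The two amplitude increments are merged into the single kernel [sin n(x - t) / n] before moduli
   are taken, which keeps the constant [1/n]. *)
pose K t := n%:R^-1 * (cn n t * sn n x - sn n t * cn n x).
have KE t : K t = (n%:R^-1 * sin (n%:R * x - n%:R * t))%:C.
  rewrite sinB /K; rewrite rmorphM rmorphB !rmorphM /= fmorphV rmorph_nat.
  by rewrite /cn /sn; ring.
have K1 t : cabs (K t) <= n%:R^-1.
  rewrite KE cabs_real normrM ger0_norm ?invr_ge0// ler_piMr ?invr_ge0//.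
  by rewrite ler_norml sin_geN1 sin_le1.
have mK : cmeas `]lo, hi]%classic K.
  apply: ms; apply: ucontZ; apply: ucontD.
    by apply: ucontM; [exact: ucont_cn|exact: ucont_cst].
  have := ucontZ (-1) (ucontM (@ucont_sn R n) (@ucont_cst R (cn n x))).
  by under eq_fun do rewrite mulN1r.
have i1 : cintble `]lo, hi]%classic (fun t => - n%:R^-1 * (sn n t * W t)).
  have [_ _] := acd_va; apply: cintbleS => //; exact: sub_itvI0pi.
have i2 : cintble `]lo, hi]%classic (fun t => n%:R^-1 * (cn n t * W t)).
  have [_ _] := acd_vb; apply: cintbleS => //; exact: sub_itvI0pi.
rewrite ![cI _ _ * _]mulrC -!cI_Z// -cI_D//; last 2 first.
- exact: cintbleZ.
- exact: cintbleZ.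
have -> : cI `]lo, hi]%classic (fun t => cn n x * (- n%:R^-1 * (sn n t * W t)) +
    sn n x * (n%:R^-1 * (cn n t * W t))) = cI `]lo, hi]%classic (fun t => K t * W t).
  by apply: eq_cI => t _; rewrite /K; ring.
rewrite (le_trans (cabs_cI _ _))//; first by apply: (cintbleM_bdd _ mK (M := n%:R^-1)).
rewrite -nI_oc//; last exact: cintble_W.
exact: nI_bdd.
Qed.

End Variation.
End SecondOrder.

(** * The operator and its root spaces *)

Section Domain.
Variable R : realType.
Local Notation C := R[i].
Local Notation mu := (@lebesgue_measure R).
Implicit Types (f g h y dy w : R -> C) (x : R) (bc : bcond).
Let mI := @measurable_I0pi R.

Lemma near_point x (d : R) : I0pi x -> 0 < d ->
  exists t, [/\ I0pi t, t != x & `|t - x| < d].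
Proof.
rewrite I0piE => /andP[x0 xp] d0; have p0 := @pi_gt0 R.
have [h|h] := ltP x pi.
- pose e := Num.min (d / 2) (pi - x).
  have e0 : 0 < e by rewrite lt_min divr_gt0//= subr_gt0.
  have ed : e <= d / 2 by rewrite ge_min lexx.
  have ep : e <= pi - x by rewrite ge_min lexx orbT.
  exists (x + e); split.
  + by rewrite I0piE; apply/andP; split; lra.
  + by rewrite gt_eqF// ltrDl.
  + by rewrite addrAC subrr add0r gtr0_norm//; lra.
- pose e := Num.min (d / 2) pi.
  have e0 : 0 < e by rewrite lt_min divr_gt0.
  have ed : e <= d / 2 by rewrite ge_min lexx.
  have ep : e <= pi by rewrite ge_min lexx orbT.
  exists (x - e); split.
  + by rewrite I0piE; apply/andP; split; lra.
  + by rewrite lt_eqF// gtrDl oppr_lt0.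
  + by rewrite addrAC subrr add0r normrN gtr0_norm//; lra.
Qed.

Lemma hd_unique f x (l m : C) : I0pi x -> hd f x l -> hd f x m -> l = m.
Proof.
move=> Ix hl hm; apply/eqP; rewrite -subr_eq0 -cabs_eq0 eq_le cabs_ge0 andbT.
apply/ler_addgt0Pr => e e0; rewrite add0r; have e20 : 0 < e / 2 by lra.
have [d1 d10 H1] := hl _ e20; have [d2 d20 H2] := hm _ e20.
have d0 : 0 < Num.min d1 d2 by rewrite lt_min d10.
have [t [It tx]] := near_point Ix d0; rewrite lt_min => /andP[t1 t2].
have tx0 : 0 < `|t - x| by rewrite normr_gt0 subr_eq0.
rewrite -(ler_pM2r tx0) -cabs_real -cabsM cabs_real.
have -> : (l - m) * (t - x)%:C =
  (f t - f x - m * (t - x)%:C) - (f t - f x - l * (t - x)%:C) by ring.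
by rewrite (le_trans (cabsB _ _))//; have := H1 _ It t1; have := H2 _ It t2; lra.
Qed.

(** A nonzero value would persist on an interval ending at [x], and this interval would lie in a
    null set. *)
Lemma ucont_aeq0 f x : ucont f -> aeq f (fun=> 0) -> I0pi x -> f x = 0.
Proof.
move=> uf [N [mN N0 fN]] Ix; apply/eqP; rewrite -cabs_eq0 eq_le cabs_ge0 andbT leNgt.
apply/negP => fx0; have [d d0 H] := uf _ fx0.
have [t [It tx td]] := near_point Ix d0.
pose a := Num.min t x; pose b := Num.max t x.
have ab : a < b by rewrite /a /b; case: (ltgtP t x) tx.
have sub : `[a, b]%classic `<=` N.
  move=> z; rewrite /= in_itv /= => /andP[az zb]; apply: fN => /= fz.
  move: It Ix; rewrite !I0piE => /andP[t0 tp] /andP[x0 xp].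
  have Iz : I0pi z.
    rewrite I0piE; apply/andP; split; first by rewrite (le_trans _ az)// le_min t0.
    by rewrite (le_trans zb)// ge_max tp.
  have Ix' : I0pi x by rewrite I0piE x0.
  have := H z x Iz Ix'; rewrite (fz Iz) subr0 ltxx; suff -> : `|x - z| < d by move=> /(_ isT).
  apply: le_lt_trans td; move: az zb; rewrite /a /b.
  by case: (leP t x) => tx' az zb; rewrite distrC; [rewrite ler0_norm ?ler0_norm|rewrite ger0_norm ?ger0_norm]; lra.
have : (mu `[a, b]%classic <= mu N)%E.
  by apply: le_measure => //; rewrite inE//; exact: measurable_itv.
rewrite N0 lebesgue_measure_itv /= lte_fin ab lee_fin subr_le0.
by rewrite leNgt ab.
Qed.

Lemma ucontB f g : ucont f -> ucont g -> ucont (fun x => f x - g x).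
Proof.
move=> uf ug; have := ucontD uf (ucontZ (-1) ug).
by under eq_fun do rewrite mulN1r.
Qed.

Lemma ucont_aeq f g x : ucont f -> ucont g -> aeq f g -> I0pi x -> f x = g x.
Proof.
move=> uf ug fg Ix; apply/eqP; rewrite -subr_eq0; apply/eqP.
apply: (ucont_aeq0 (ucontB uf ug)) Ix.
by apply: aeS fg => z fg Iz; rewrite fg// subrr.
Qed.

Variable v : R -> C.
Hypothesis vi : cintble I0pi v.

(** [Lgraph] for the differentiable representative, with [y''] eliminated: [h = L y] is read as
    [y'' = v y - h]. *)
Definition dom bc y dy h := [/\ sol2 y dy (fun x => v x * y x - h x),
  satisfies_bc bc y dy & inL2 h].

Lemma mul_cintble y h : ucont y -> inL2 h -> cintble I0pi (fun x => v x * y x - h x).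
Proof.
move=> uy h2; apply: cintbleB => //; last exact: L2_cintble.
by apply: eq_cintble (ucontM_cintble uy vi) => // x _; rewrite mulrC.
Qed.

Lemma Lgraph_dom bc f h : Lgraph bc v f h -> exists y dy, aeq f y /\ dom bc y dy h.
Proof.
move=> [f2 [h2 [y [dy [w [fy hy [ay b] hdy hw]]]]]]; exists y, dy; split => //.
have hy' x : I0pi x -> hd y x (dy x) by move=> Ix; apply/has_derivP; exact: hy.
have uy : ucont y by apply: (acd_ucont (f := dy)); apply: acd_C1 => //; exact: AC_ucont.
split => //; split => //; split => //; last exact: mul_cintble.
apply: aeS2 hdy hw => x h1 h3 Ix; have := h3 Ix; have /has_derivP := h1 Ix.
by move=> h4 ->; congr hd : h4; ring.
Qed.

Lemma dom_Lgraph bc f h y dy k : inL2 f -> inL2 k -> aeq f y -> aeq k h ->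
  dom bc y dy h -> Lgraph bc v f k.
Proof.
move=> f2 k2 fy kh [[hy [ay hdy _]] b h2]; split => //; split => //.
exists y, dy, (fun x => v x * y x - h x); split => //.
- by move=> x Ix; apply/has_derivP; exact: hy.
- by apply: aeS hdy => x hx Ix; apply/has_derivP; exact: hx.
- by apply: aeS kh => x hx Ix; rewrite hx//; ring.
Qed.

Lemma dom_L2 bc y dy h : dom bc y dy h -> inL2 y.
Proof. by move=> [sy _ _]; apply: L2_ucont; exact: sol2_ucont sy. Qed.

Lemma dom_self bc y dy h : dom bc y dy h -> Lgraph bc v y h.
Proof.
move=> d; have [_ _ h2] := d.
by apply: (dom_Lgraph (dom_L2 d) h2 (aeq_refl _) (aeq_refl _) d).
Qed.

Lemma dom_aeq bc y dy h h2 : dom bc y dy h -> inL2 h2 -> aeq h h2 -> dom bc y dy h2.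
Proof.
move=> [sy b h2'] i2 hh; split => //.
have uy := sol2_ucont sy; case: sy => hy [ay hdy _]; split => //; split => //.
  by apply: aeS2 hdy hh => x e1 e2 Ix; rewrite -e2//; exact: e1.
exact: mul_cintble.
Qed.

Lemma domD bc y dy h y2 dy2 h2 : dom bc y dy h -> dom bc y2 dy2 h2 ->
  dom bc (fun x => y x + y2 x) (fun x => dy x + dy2 x) (fun x => h x + h2 x).
Proof.
move=> [s1 b1 l1] [s2 b2 l2]; split; last exact: L2D.
- have := sol2D s1 s2; congr (sol2 _ _ _); apply/funext => x; ring.
- case: bc b1 b2 => /= [] [e1 e2] [e3 e4]; split; rewrite ?e1 ?e2 ?e3 ?e4; ring.
Qed.

Lemma domZ bc y dy h c : dom bc y dy h ->
  dom bc (fun x => c * y x) (fun x => c * dy x) (fun x => c * h x).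
Proof.
move=> [s1 b1 l1]; split; last exact: L2Z.
- have := sol2Z c s1; congr (sol2 _ _ _); apply/funext => x; ring.
- case: bc b1 => /= [] [e1 e2]; split; rewrite ?e1 ?e2; ring.
Qed.

Lemma eq_dom bc y dy h y2 dy2 h2 : (forall x, y x = y2 x) -> (forall x, dy x = dy2 x) ->
  (forall x, h x = h2 x) -> dom bc y dy h -> dom bc y2 dy2 h2.
Proof. by move=> /funext -> /funext -> /funext ->. Qed.

Lemma dom_unique bc y dy h y2 dy2 h2 : dom bc y dy h -> dom bc y2 dy2 h2 -> aeq y y2 ->
  aeq h h2.
Proof.
move=> d1 d2 yy.
have [[hz [_ hdz _]] _ _] := domD d1 (domZ (-1) d2).
have [s1 _ _] := d1; have [s2 _ _] := d2.
have yE x : I0pi x -> y x = y2 x by apply: ucont_aeq => //; [exact: sol2_ucont s1|exact: sol2_ucont s2].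
have dzE x : I0pi x -> dy x + -1 * dy2 x = 0.
  move=> Ix; apply: (hd_unique Ix (hz x Ix)).
  by apply: (eq_hd Ix _ (hd_cst 0 x)) => t It; rewrite yE// mulN1r subrr.
apply: aeS hdz => x /[swap] Ix /(_ Ix) hx.
have := hd_unique Ix hx (eq_hd Ix (fun t It => esym (dzE t It)) (hd_cst 0 x)).
rewrite yE// => e; apply/eqP; rewrite -subr_eq0; apply/eqP.
by rewrite -[RHS]oppr0 -e; ring.
Qed.

Lemma Lgraph_unique bc f f2 h h2 : Lgraph bc v f h -> Lgraph bc v f2 h2 -> aeq f f2 ->
  aeq h h2.
Proof.
move=> /Lgraph_dom[y [dy [fy d1]]] /Lgraph_dom[y2 [dy2 [fy2 d2]]] ff.
apply: dom_unique d1 d2 _; apply: aeq_trans (aeq_sym fy) _.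
exact: aeq_trans ff fy2.
Qed.

Lemma LgraphD bc f f2 h h2 (a b : C) : Lgraph bc v f h -> Lgraph bc v f2 h2 ->
  Lgraph bc v (fun x => a * f x + b * f2 x) (fun x => a * h x + b * h2 x).
Proof.
move=> l1 l2; have [f2' [h2' _]] := l1; have [f22 [h22 _]] := l2.
have [y [dy [fy d1]]] := Lgraph_dom l1; have [y2 [dy2 [fy2 d2]]] := Lgraph_dom l2.
apply: dom_Lgraph (domD (domZ a d1) (domZ b d2)).
- by apply: L2D; exact: L2Z.
- by apply: L2D; exact: L2Z.
- by apply: aeS2 fy fy2 => x e1 e2 Ix; rewrite e1// e2.
- exact: aeq_refl.
Qed.

Lemma Lgraph_aeq bc f f2 h h2 : inL2 f2 -> inL2 h2 -> aeq f2 f -> aeq h2 h ->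
  Lgraph bc v f h -> Lgraph bc v f2 h2.
Proof.
move=> i1 i2 ff hh /Lgraph_dom[y [dy [fy d]]].
exact: (dom_Lgraph i1 i2 (aeq_trans ff fy) hh d).
Qed.

(** Lagrange's identity; under each of the three boundary conditions the boundary terms cancel. As
    nothing is conjugated, this holds for complex [v]. *)
Lemma dom_symmetric bc y dy h g dg k : dom bc y dy h -> dom bc g dg k ->
  cI I0pi (fun x => h x * g x) = cI I0pi (fun x => y x * k x).
Proof.
move=> d1 d2; have [s1 b1 h2] := d1; have [s2 b2 k2] := d2.
have := lagrange_cI s1 s2.
have -> : dy pi * g pi - y pi * dg pi - (dy 0 * g 0 - y 0 * dg 0) = 0.
  move: b1 b2; clear; rewrite /satisfies_bc.
  move: (y pi) (y 0) (g pi) (g 0) (dy pi) (dy 0) (dg pi) (dg 0) => a1 a2 a3 a4 a5 a6 a7 a8.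
  by case: bc => -[-> ->] [-> ->]; ring.
have i1 : cintble I0pi (fun x => h x * g x) := L2_prod h2 (dom_L2 d2).
have i2 : cintble I0pi (fun x => y x * k x) := L2_prod (dom_L2 d1) k2.
have -> : (fun x => (v x * y x - h x) * g x - y x * (v x * g x - k x)) =
  (fun x => y x * k x - h x * g x) by apply/funext => x; ring.
by rewrite cI_B// => /eqP; rewrite subr_eq0 => /eqP.
Qed.

Lemma Lgraph_symmetric bc f h g k : Lgraph bc v f h -> Lgraph bc v g k ->
  cI I0pi (fun x => h x * g x) = cI I0pi (fun x => f x * k x).
Proof.
move=> l1 l2; have [f2 [h2 _]] := l1; have [g2 [k2 _]] := l2.
have [y [dy [fy d1]]] := Lgraph_dom l1; have [z [dz [gz d2]]] := Lgraph_dom l2.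
have y2 := dom_L2 d1; have z2 := dom_L2 d2.
have mm a b : inL2 a -> inL2 b -> cmeas I0pi (fun x => a x * b x : C).
  by move=> a2 b2; apply: cmeasM; exact: L2_meas.
rewrite (@ae_cI _ _ _ (fun x => h x * z x))//; [|exact: mm|exact: mm|]; last first.
  by apply: aeS gz => x e Ix; rewrite e.
rewrite (dom_symmetric d1 d2); apply: ae_cI => //; [exact: mm|exact: mm|].
by apply: aeS fy => x e Ix; rewrite e.
Qed.

End Domain.

(** * Root spaces of dimension at most two *)

Section RootSpaces.
Variable R : realType.
Local Notation C := R[i].
Local Notation mu := (@lebesgue_measure R).
Implicit Types (f g h y dy : R -> C) (x : R) (bc : bcond) (a b l m : C).
Variable v : R -> C.
Hypothesis vi : cintble I0pi v.
Let mI := @measurable_I0pi R.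

(** The eigenfunction is the last nonnull member of the chain of the [(L - l)^j f]. *)
Lemma ker_pow_eigen bc l k f : in_ker_pow bc v l k f -> ~ aeq f (fun=> 0) ->
  exists g, [/\ ~ aeq g (fun=> 0), Lgraph bc v g (fun x => l * g x) & in_root_space bc v l g].
Proof.
elim: k f => [|k IH] f //= [h Lh kh] f0.
have [hl|hl] := pselect (aeq (fun x => h x - l * f x) (fun=> 0)); last exact: IH kh hl.
exists f; split => //; last by exists 1%N, h.
have [f2 _] := Lh; apply: (Lgraph_aeq vi f2 (L2Z l f2) (aeq_refl _) _ Lh).
by apply: aeS hl => x e Ix; apply/esym/eqP; rewrite -subr_eq0; apply/eqP; exact: e.
Qed.

Lemma in_ker_pow0 bc l k f : inL2 f -> aeq f (fun=> 0) ->
  in_ker_pow bc v l k f.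
Proof.
have d0 : dom v bc (fun=> 0) (fun=> 0) (fun=> 0 : C).
  split; last exact: L2_0.
    have := sol2Z 0 (sol2_cn R 0); congr sol2; apply/funext => x; rewrite ?mul0r ?mulr0 ?subr0//.
  by case: bc; split; rewrite /= ?oppr0.
elim: k f => [|k IH] f f2 f0 //=; exists (fun=> 0).
  exact: (dom_Lgraph f2 (@L2_0 R) f0 (aeq_refl _) d0).
apply: IH; first by apply: L2D; [exact: L2_0|apply: L2N; exact: L2Z].
by apply: aeS f0 => x e Ix; rewrite e// mulr0 subr0.
Qed.

Lemma eigen_root bc l f : Lgraph bc v f (fun x => l * f x) -> in_root_space bc v l f.
Proof.
move=> Lf; exists 1%N; exists (fun x => l * f x) => //=.
by apply: aeW => x _; rewrite subrr.
Qed.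

Lemma cI_0 : cI I0pi (fun=> 0 : C) = 0.
Proof.
by have := cI_Z 0 mI (ucont_cintble (@ucont_cst R 0)); rewrite mul0r mul0r.
Qed.

Lemma alg_mult1 bc l : alg_mult bc v l 1 -> exists y dy,
  [/\ dom v bc y dy (fun x => l * y x), ~ aeq y (fun=> 0) &
      forall f, in_root_space bc v l f -> exists c, aeq f (fun x => c * y x)].
Proof.
move=> [e [re fe se]].
have e0 : ~ aeq (e ord0) (fun=> 0).
  move=> e0; have /fe/(_ ord0) : aeq (fun x => \sum_(i < 1) 1 * e i x) (fun=> 0).
    by apply: aeS e0 => x h Ix; rewrite big_ord1 h// mulr0.
  by move/eqP; rewrite oner_eq0.
have [k ke] := re ord0; have [g [g0 Lg rg]] := ker_pow_eigen ke e0.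
have [y [dy [gy d]]] := Lgraph_dom vi Lg.
have dl : dom v bc y dy (fun x => l * y x).
  apply: (dom_aeq vi d (L2Z l (dom_L2 d))).
  by apply: aeS gy => x e1 Ix; rewrite e1.
exists y, dy; split => //.
  by move=> y0; apply: g0; exact: aeq_trans gy y0.
move=> f rf.
have [c1 h1] := se f rf; have [c2 h2] := se g rg.
have c20 : c2 ord0 != 0.
  apply/eqP => c20; apply: g0; apply: aeS h2 => x hx Ix; rewrite hx// big_ord1 c20 mul0r.
  by [].
exists (c1 ord0 / c2 ord0).
apply: (aeq_trans h1); apply: aeS2 h2 gy => x hx gx Ix.
by rewrite -gx// hx// !big_ord1; field.
Qed.

Lemma alg_mult0 bc l y dy : alg_mult bc v l 0 -> dom v bc y dy (fun x => l * y x) ->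
  aeq y (fun=> 0).
Proof.
move=> [e [_ _ se]] d; have [c h] := se y (eigen_root (dom_self d)).
by apply: aeq_trans h _; apply: aeW => x _; rewrite big_ord0.
Qed.

Definition indep f g := forall a b, aeq (fun x => a * f x + b * g x) (fun=> 0) -> a = 0 /\ b = 0.

(** Modulo [f], the operator [L - l] multiplies [g] by [b0], so no power of it kills a vector with a
    nonzero [g] component. It excludes a diagonal entry other than [l] in a double root space. *)
Lemma ker_pow_indep bc l f g a0 b0 a b j u : b0 != 0 -> b != 0 ->
  Lgraph bc v f (fun x => l * f x) ->
  Lgraph bc v g (fun x => l * g x + (a0 * f x + b0 * g x)) -> indep f g ->
  aeq u (fun x => a * f x + b * g x) -> in_ker_pow bc v l j u -> False.
Proof.
move=> b00 + Lf Lg ind; elim: j u a b => [|j IH] u a b bn0 uE /=.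
  by move=> /(aeq_trans (aeq_sym uE))/ind[_ /eqP]; rewrite (negbTE bn0).
move=> [h Lh kh]; apply: (IH _ (b * a0) (b * b0)) kh; first by rewrite mulf_neq0.
have := Lgraph_unique vi Lh (LgraphD vi a b Lf Lg) uE.
by apply: aeS2 uE => x h1 h2 Ix; rewrite h2// h1//; ring.
Qed.

(** A triangular form for both kinds of double eigenvalue: [c = 0] for two eigenfunctions, [c != 0]
    for a Jordan block. The diagonal entry of [g] is [l] because [L - l] is nilpotent on the root
    space. *)
Lemma alg_mult2 bc l : alg_mult bc v l 2 -> exists f df g dg c,
  [/\ dom v bc f df (fun x => l * f x), dom v bc g dg (fun x => l * g x + c * f x)
    & indep f g].
Proof.
move=> [e [re fe se]].
pose i1 : 'I_2 := lift ord0 ord0.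
have sumE (c : 'I_2 -> C) x : \sum_(i < 2) c i * e i x = c ord0 * e ord0 x + c i1 * e i1 x.
  by rewrite big_ord_recl big_ord1.
have e0 : ~ aeq (e ord0) (fun=> 0).
  move=> e0; have /fe/(_ ord0) : aeq (fun x => \sum_(i < 2) (fun i => (i == ord0)%:R) i * e i x) (fun=> 0).
    by apply: aeS e0 => x h Ix; rewrite sumE /= h// mulr0 mul0r addr0.
  by rewrite eqxx => /eqP; rewrite oner_eq0.
have [k ke] := re ord0; have [f [f0 Lf rf]] := ker_pow_eigen ke e0.
have [c hc] := se f rf.
have fE : aeq f (fun x => c ord0 * e ord0 x + c i1 * e i1 x).
  by apply: aeS hc => x h Ix; rewrite h.
(* Steinitz exchange: the eigenfunction [f] replaces a basis vector on which it has a nonzero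
   coordinate, and the other one remains as [e j]. *)
have [j [ind span]] : exists j : 'I_2, indep f (e j) /\
    forall u, in_root_space bc v l u -> exists a b, aeq u (fun x => a * f x + b * e j x).
  have fe2 a b : aeq (fun x => a * e ord0 x + b * e i1 x) (fun=> 0) -> a = 0 /\ b = 0.
    move=> h; pose d (i : 'I_2) := if i == ord0 then a else b.
    have /fe dd : aeq (fun x => \sum_(i < 2) d i * e i x) (fun=> 0).
      by apply: aeS h => x h Ix; rewrite sumE h.
    by split; [exact: (dd ord0)|exact: (dd i1)].
  have [c0|c0] := eqVneq (c ord0) 0; last first.
    exists i1; split.
      move=> a b h; have [] := fe2 (a * c ord0) (a * c i1 + b).
        apply: aeS2 fE h => x h1 h2 Ix; rewrite -h2// h1//; ring.
      move=> /eqP; rewrite mulf_eq0 (negbTE c0) orbF => /eqP ->.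
      by rewrite mul0r add0r.
    move=> u /se[d hd']; exists (d ord0 / c ord0), (d i1 - d ord0 / c ord0 * c i1).
    apply: aeS2 hd' fE => x h1 h2 Ix; rewrite h1// h2// sumE; by field.
  have c1 : c i1 != 0.
    apply/eqP => c1; apply: f0; apply: aeS fE => x h Ix.
    by rewrite h// c0 c1 !mul0r addr0.
  exists ord0; split.
    move=> a b h; have [] := fe2 b (a * c i1).
      by apply: aeS2 fE h => x h1 h2 Ix; rewrite -h2// h1// c0; ring.
    move=> -> /eqP; rewrite mulf_eq0 (negbTE c1) orbF => /eqP ->.
    by [].
  move=> u /se[d hd']; exists (d i1 / c i1), (d ord0).
  by apply: aeS2 hd' fE => x h1 h2 Ix; rewrite h1// h2// sumE c0; field.
have [kj kej] := re j.
have ej0 : ~ aeq (e j) (fun=> 0).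
  move=> h; have [] := ind 0 1; last by move=> _ /eqP; rewrite oner_eq0.
  by apply: aeS h => x h Ix; rewrite h// mulr0 mul0r addr0.
have [h [Lh rh]] : exists h, Lgraph bc v (e j) h /\
    in_root_space bc v l (fun x => h x - l * e j x).
  case: kj kej => [/ej0//|kj] /= [h Lh kh]; exists h; split => //; by exists kj.
have [a [b hE]] := span _ rh.
have [f2 _] := Lf; have [ej2 [h2 _]] := Lh.
have Lh' : Lgraph bc v (e j) (fun x => l * e j x + (a * f x + b * e j x)).
  apply: (Lgraph_aeq vi ej2 _ (aeq_refl _) _ Lh).
    exact: L2D (L2Z l ej2) (L2D (L2Z a f2) (L2Z b ej2)).
  by apply: aeS hE => x h1 Ix; rewrite -h1//; ring.
have b0 : b = 0.
  apply/eqP; have [//|bn0] := eqVneq b 0; exfalso.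
  apply: (ker_pow_indep bn0 (oner_neq0 _) Lf Lh' ind (a := 0) (u := e j)) kej.
  by apply: aeW => x _; ring.
have [y [dy [fy dF]]] := Lgraph_dom vi Lf.
have [z [dz [gz dG]]] := Lgraph_dom vi Lh'.
exists y, dy, z, dz, a; split.
- apply: (dom_aeq vi dF (L2Z l (dom_L2 dF))).
  by apply: aeS fy => x e1 Ix; rewrite e1.
- apply: (dom_aeq vi dG (L2D (L2Z l (dom_L2 dG)) (L2Z a (dom_L2 dF)))).
  by apply: aeS2 fy gz => x e1 e2 Ix; rewrite e1// e2// b0; ring.
- move=> c1 c2 h3; apply: ind; apply: aeq_trans h3.
  by apply: aeS2 fy gz => x e1 e2 Ix; rewrite e1// e2.
Qed.

End RootSpaces.

(** * Localization of the eigenvalues *)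

Section TrigIntegrals.
Variable R : realType.
Local Notation C := R[i].
Local Notation mu := (@lebesgue_measure R).
Implicit Types (n : nat) (x : R).
Let mI := @measurable_I0pi R.

Lemma cI_cst (c : C) : cI I0pi (fun=> c) = c * (pi%:C).
Proof.
have hid : acd (fun x : R => x%:C) (fun=> 1).
  apply: acd_C1 => [x _|]; last exact: ucont_cst.
  move=> e e0; exists 1 => // t _ _.
  rewrite mul1r (rmorphB (real_complex R)) subrr cabs0.
  by rewrite mulr_ge0// ltW.
have := acd_cI (acdZ c hid); under eq_fun do rewrite mulr1.
by move=> ->; rewrite mulr0 subr0.
Qed.

Lemma cI_cn2Dsn2 n : cI I0pi (fun x => cn n x * cn n x) + cI I0pi (fun x => sn n x * sn n x) = (pi : R)%:C.
Proof.
have uc := @ucont_cn R n; have us := @ucont_sn R n.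
rewrite -cI_D//; [|exact: ucont_cintble (ucontM uc uc)|exact: ucont_cintble (ucontM us us)].
by rewrite -[RHS]mul1r -cI_cst; apply: eq_cI => x _; rewrite cn2Dsn2.
Qed.

Lemma cI_cn_sn n : (0 < n)%N -> cI I0pi (fun x => cn n x * sn n x) = 0 :> C.
Proof.
move=> n0; have nC : (n%:R : C) != 0 by rewrite pnatr_eq0 -lt0n.
have := acd_cI (acdM (acd_sn R n) (acd_sn R n)).
rewrite sn_pi sn0 !mulr0 subrr => h; apply/eqP.
have : (2 * n%:R) * cI I0pi (fun x => cn n x * sn n x : C) = 0.
  rewrite -cI_Z//; last by apply/ucont_cintble/ucontM; [exact: ucont_cn|exact: ucont_sn].
  by rewrite -h; apply: eq_cI => x _; ring.
by move/eqP; rewrite mulf_eq0 mulf_eq0 pnatr_eq0 /= (negbTE nC).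
Qed.

Lemma cI_cn2 n : (0 < n)%N -> cI I0pi (fun x => cn n x * cn n x) = (pi / 2 : R)%:C.
Proof.
move=> n0; have nC : (n%:R : C) != 0 by rewrite pnatr_eq0 -lt0n.
have := acd_cI (acdM (acd_cn R n) (acd_sn R n)).
rewrite sn_pi sn0 !mulr0 subrr => h.
have uc := ucont_cintble (ucontM (@ucont_cn R n) (@ucont_cn R n)).
have us := ucont_cintble (ucontM (@ucont_sn R n) (@ucont_sn R n)).
have e : cI I0pi (fun x => cn n x * cn n x) - cI I0pi (fun x => sn n x * sn n x) = 0 :> C.
  apply: (mulfI nC); rewrite mulr0 -cI_B// -cI_Z//; last exact: cintbleB.
  by rewrite -h; apply: eq_cI => x _; ring.
have := cI_cn2Dsn2 n; move/eqP: e; rewrite subr_eq0 => /eqP <-.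
by move=> e; apply: (@mulfI _ 2); rewrite ?pnatr_eq0// mulr_natl mulr2n e; apply: complex_eq; rewrite ?cReM ?cImM /=; field.
Qed.

Lemma cI_sn2 n : (0 < n)%N -> cI I0pi (fun x => sn n x * sn n x) = (pi / 2 : R)%:C.
Proof.
move=> n0; have := cI_cn2Dsn2 n; rewrite cI_cn2//.
move=> /(canRL (addKr _)) ->; rewrite -rmorphN -rmorphD /=.
by congr _%:C; field.
Qed.

Lemma bc_cn n : satisfies_bc (per_of n) (@cn R n) (fun x => - n%:R * sn n x).
Proof.
rewrite /per_of; case: ifP => on /=; rewrite cn0 cn_pi sn0 sn_pi !mulr0 ?oppr0; split => //.
  by rewrite -signr_odd on ?expr1 ?expr0 ?mulr1 ?mulrN1 ?opprK.
by rewrite -signr_odd on ?expr1 ?expr0 ?mulr1 ?mulrN1 ?opprK.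
Qed.

Lemma bc_sn n : satisfies_bc (per_of n) (@sn R n) (fun x => n%:R * cn n x).
Proof.
rewrite /per_of; case: ifP => on /=; rewrite cn0 cn_pi sn0 sn_pi ?oppr0; split => //.
  by rewrite -signr_odd on ?expr1 ?expr0 ?mulr1 ?mulrN1 ?opprK.
by rewrite -signr_odd on ?expr1 ?expr0 ?mulr1 ?mulrN1 ?opprK.
Qed.

Lemma bc_neu_cn n : satisfies_bc Neu (@cn R n) (fun x => - n%:R * sn n x).
Proof. by rewrite /= sn0 sn_pi mulr0. Qed.

Lemma hd_dist (a x : R) : hd (fun t : R => (((t - a) * `|t - a|) / 2)%:C) x `|x - a|%:C.
Proof.
move=> e e0; exists (2 * e) => [|t _ td]; first by rewrite mulr_gt0.
rewrite -rmorphB -rmorphM -rmorphB cabs_real.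
apply: (@le_trans _ _ (`|t - x| * `|t - x| / 2)); last first.
  have := normr_ge0 (t - x); move: td; set r := `|t - x| => rd r0.
  suff : r * r <= (2 * e) * r by lra.
  by rewrite ler_wpM2r// ltW.
rewrite -normrM ger0_norm; last by rewrite -expr2 sqr_ge0.
have -> : t - x = (t - a) - (x - a) by ring.
move: (t - a) (x - a); clear => u w; rewrite ler_norml.
have := sqr_ge0 u; have := sqr_ge0 w; have := sqr_ge0 (u - w); rewrite !expr2.
case: (lerP 0 u) => u0; case: (lerP 0 w) => w0;
  rewrite ?(ger0_norm u0) ?(ger0_norm w0) ?(ltr0_norm u0) ?(ltr0_norm w0).
- by move=> *; apply/andP; split; lra.
- by have := mulr_ge0 u0 (ltW (ltac:(lra) : 0 < - w)) => *; apply/andP; split; lra.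
- by have := mulr_ge0 w0 (ltW (ltac:(lra) : 0 < - u)) => *; apply/andP; split; lra.
- by move=> *; apply/andP; split; lra.
Qed.

(** The mean distance to the midpoint is half of the largest one; the estimates of integrals against
    [y] use this gain over the sup bound. *)
Lemma nI_dist : nI I0pi (fun x : R => `|x - pi / 2|%:C) = pi ^+ 2 / 4.
Proof.
have u : ucont (fun x : R => `|x - pi / 2|%:C).
  move=> e e0; exists e => // x y _ _ xy; rewrite -rmorphB cabs_real.
  apply: le_lt_trans xy; apply: le_trans (ler_dist_dist _ _) _.
  by rewrite opprB addrA subrK.
have := acd_cI (acd_C1 (fun x _ => @hd_dist (pi / 2) x) u).
move=> /(congr1 (@complex.Re R)) /= h.
have -> : nI I0pi (fun x : R => `|x - pi / 2|%:C) = \int[mu]_(x in I0pi) `|x - pi / 2|.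
  by apply: eq_Rintegral => x _; rewrite cabs_real normr_id.
have p0 := @pi_gt0 R.
rewrite h sub0r normrN ger0_norm; last lra.
by rewrite ger0_norm; [rewrite expr2; field|lra].
Qed.

End TrigIntegrals.

Section Estimates.
Variable R : realType.
Local Notation C := R[i].
Local Notation mu := (@lebesgue_measure R).
Implicit Types (f g h y dy w : R -> C) (x : R) (bc : bcond) (n : nat) (l : C).
Let mI := @measurable_I0pi R.

Lemma nI_le_bound (a b M : R) f : 0 <= a -> a <= b -> b <= pi -> cintble I0pi f ->
  (forall x, I0pi x -> cabs (f x) <= M) -> nI `[a, b]%classic f <= M * (b - a).
Proof.
move=> a0 ab bp fi fM.
have sub : `[a, b]%classic `<=` (I0pi : set R) by exact: sub_itvI0pi.
have mab : measurable (`[a, b]%classic : set R) by exact: measurable_itv.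
apply: (@le_trans _ _ (\int[mu]_(x in `[a, b]) M)).
  apply: le_Rintegral => //.
  - by apply: cintble_cabs => //; exact: cintbleS fi.
  - exact: rint_cst.
  - by move=> x xab; exact: fM (sub _ xab).
rewrite (@Rintegral_cst _ _ _ mu _ mab).
suff E : mu `[a, b]%classic = (b - a)%:E by rewrite -[X in _ <= _ * X]/(fine (b - a)%:E) -E.
rewrite lebesgue_measure_itv /= lte_fin; case: ltP => // ba.
by congr (_%:E); apply/esym/eqP; rewrite subr_eq0 eq_le ab ba.
Qed.

Lemma nI_sub (a b : R) f : 0 <= a -> b <= pi -> cintble I0pi f ->
  nI `[a, b]%classic f <= nI I0pi f.
Proof.
move=> a0 bp fi.
have sub : `[a, b]%classic `<=` (I0pi : set R) by exact: sub_itvI0pi.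
have mab : measurable (`[a, b]%classic : set R) by exact: measurable_itv.
have fi' : cintble `[a, b]%classic f by exact: cintbleS fi.
rewrite -lee_fin /nI !EFin_Rintegral//; [|exact: cintble_cabs|exact: cintble_cabs].
apply: ge0_subset_integral => //.
  by apply/measurable_EFinP; apply: cmeas_cabs => //; exact: cintble_meas.
by move=> x _; rewrite lee_fin cabs_ge0.
Qed.

Lemma dist_norm_bound (A B c s : C) (r : R) : 0 <= r -> r ^+ 2 = cabs A ^+ 2 + cabs B ^+ 2 ->
  cabs c ^+ 2 + cabs s ^+ 2 = 1 -> cabs (A * c + B * s) <= r.
Proof.
move=> r0 rE cs; rewrite (le_trans (cabsD _ _))// !cabsM.
have := cabs_ge0 A; have := cabs_ge0 B; have := cabs_ge0 c; have := cabs_ge0 s.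
move: rE cs; set a := cabs A; set b := cabs B; set u := cabs c; set w := cabs s => rE cs *.
have le0 : 0 <= a * u + b * w by rewrite addr_ge0// mulr_ge0.
rewrite -(@ler_pXn2r _ 2) ?nnegrE//.
have : r ^+ 2 - (a * u + b * w) ^+ 2 = (a * w - b * u) ^+ 2.
  by rewrite rE -[a ^+ 2]mulr1 -[b ^+ 2 in LHS]mulr1 -cs; ring.
by have := sqr_ge0 (a * w - b * u); lra.
Qed.

Variable v : R -> C.
Hypothesis vi : cintble I0pi v.
Let V := nI I0pi v.

Lemma V_ge0 : 0 <= V. Proof. exact: nI_ge0. Qed.

Lemma nI_W y (z : R -> C) l n (Y Z a b : R) : ucont y -> ucont z ->
  (forall x, I0pi x -> cabs (y x) <= Y) -> (forall x, I0pi x -> cabs (z x) <= Z) ->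
  0 <= a -> a <= b -> b <= pi ->
  nI `[a, b]%classic (fun x => v x * y x - (l * y x + z x) + n%:R ^+ 2 * y x) <=
  Y * V + (cabs (n%:R ^+ 2 - l) * Y + Z) * (b - a).
Proof.
move=> uy uz yY zZ a0 ab bp.
have sub : `[a, b]%classic `<=` (I0pi : set R) by exact: sub_itvI0pi.
have mab : measurable (`[a, b]%classic : set R) by exact: measurable_itv.
have i1 : cintble I0pi (fun x => y x * v x) by exact: ucontM_cintble.
have u2 : ucont (fun x => (n%:R ^+ 2 - l) * y x - z x) by apply: ucontB => //; exact: ucontZ.
have i2 := ucont_cintble u2.
have -> : (fun x => v x * y x - (l * y x + z x) + n%:R ^+ 2 * y x) =
  (fun x => y x * v x + ((n%:R ^+ 2 - l) * y x - z x)) by apply/funext => x; ring.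
rewrite (le_trans (nI_D mab (cintbleS mI mab sub i1) (cintbleS mI mab sub i2)))//.
apply: lerD.
  apply: (le_trans (nI_sub a0 bp i1)).
  by apply: nI_bdd => //; exact: ucont_meas.
apply: nI_le_bound => // x Ix; rewrite (le_trans (cabsB _ _))// cabsM lerD ?zZ//.
by rewrite ler_wpM2l ?cabs_ge0// yY.
Qed.

(** Tests [L y = h] against a trigonometric function that satisfies the boundary conditions; the
    potential then enters only through an integral controlled by its L^1 norm. *)
Lemma free_symmetric bc y dy h phi dphi n : dom v bc y dy h ->
  sol2 phi dphi (fun x => - n%:R ^+ 2 * phi x) -> satisfies_bc bc phi dphi ->
  cI I0pi (fun x => h x * phi x) =
  cI I0pi (fun x => phi x * y x * v x) + n%:R ^+ 2 * cI I0pi (fun x => y x * phi x).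
Proof.
move=> [sy b1 h2] sp b2.
have := lagrange_cI sy sp.
have -> : dy pi * phi pi - y pi * dphi pi - (dy 0 * phi 0 - y 0 * dphi 0) = 0.
  move: b1 b2; clear; rewrite /satisfies_bc.
  move: (y pi) (y 0) (phi pi) (phi 0) (dy pi) (dy 0) (dphi pi) (dphi 0) => a1 a2 a3 a4 a5 a6 a7 a8.
  by case: bc => -[-> ->] [-> ->]; ring.
have uy := sol2_ucont sy; have up := sol2_ucont sp.
have i1 := ucontM_cintble (ucontM up uy) vi.
have i2 := L2_prod h2 (L2_ucont up).
have i3 := cintbleZ (n%:R ^+ 2) mI (ucont_cintble (ucontM uy up)).
have -> : (fun x => (v x * y x - h x) * phi x - y x * (- n%:R ^+ 2 * phi x)) =
  (fun x => phi x * y x * v x - h x * phi x + n%:R ^+ 2 * (y x * phi x)).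
  by apply/funext => x; ring.
rewrite cI_D//; last exact: cintbleB.
rewrite cI_B// cI_Z//; last exact: ucont_cintble (ucontM uy up).
by move=> e; apply/eqP; rewrite -subr_eq0 -oppr_eq0 opprB -e; apply/eqP; ring.
Qed.

End Estimates.

(** * A priori bound for periodic and antiperiodic eigenvalues *)

Section APriori.
Variable R : realType.
Local Notation C := R[i].
Local Notation mu := (@lebesgue_measure R).
Implicit Types (f g h y dy w : R -> C) (x : R) (bc : bcond) (n : nat) (l : C).
Let mI := @measurable_I0pi R.
Variable v : R -> C.
Hypothesis vi : cintble I0pi v.
Let V := nI I0pi v.

Lemma I0pi_half : I0pi (pi / 2 : R).
Proof. by rewrite I0piE; have := @pi_gt0 R => ?; apply/andP; split; lra. Qed.

Lemma bc_lin bc y dy g dg (a b : C) : satisfies_bc bc y dy -> satisfies_bc bc g dg ->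
  satisfies_bc bc (fun x => a * y x + b * g x) (fun x => a * dy x + b * dg x).
Proof.
rewrite /satisfies_bc.
move: (y pi) (y 0) (g pi) (g 0) (dy pi) (dy 0) (dg pi) (dg 0) => a1 a2 a3 a4 a5 a6 a7 a8.
by case: bc => -[-> ->] [-> ->]; split; ring.
Qed.

Section Center.
Variables (n : nat) (y dy : R -> C) (l : C) (Y : R).
Hypotheses (n0 : (0 < n)%N) (sy : sol2 y dy (fun x => v x * y x - l * y x)).
Hypotheses (ln : cabs (n%:R ^+ 2 - l) <= n%:R / 4).
Hypothesis yY : forall x, I0pi x -> cabs (y x) <= Y.
Let A := va n y dy (pi / 2).
Let B := vb n y dy (pi / 2).
Let p x := A * cn n x + B * sn n x.
Let n0R : 0 < (n%:R : R). Proof. by rewrite ltr0n. Qed.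
Let Y0 : 0 <= Y. Proof. exact: le_trans (cabs_ge0 _) (yY (I0pi_0 R)). Qed.
Let uy := sol2_ucont sy.

Lemma eigen_W_bound (a b : R) : 0 <= a -> a <= b -> b <= pi ->
  n%:R^-1 * nI `[a, b]%classic (fun x => v x * y x - l * y x + n%:R ^+ 2 * y x) <=
  Y * (V / n%:R + (b - a) / 4).
Proof.
move=> a0 ab bp.
have := nI_W vi l n uy (@ucont_cst R 0) yY (fun x _ => ltac:(by rewrite cabs0)) a0 ab bp (Z := 0).
under [X in nI _ X]eq_fun do rewrite addr0.
move=> h; rewrite mulrC ler_pdivrMr//; apply: (le_trans h).
have -> : Y * (V / n%:R + (b - a) / 4) * n%:R = Y * V + (n%:R / 4 * Y) * (b - a).
  by field; rewrite gt_eqF.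
by rewrite addr0 lerD2l ler_wpM2r ?subr_ge0// ler_wpM2r.
Qed.

(** Variation of constants started at the midpoint, so that the distance covered is at most
    [pi / 2]: with [|n^2 - l| <= n/4] the relative error is at most [V / n + pi / 8], less than 1/2
    for large [n]. *)
Lemma eigen_center x : I0pi x ->
  cabs (y x - p x) <= Y * (V / n%:R + `|x - pi / 2| / 4).
Proof.
move=> Ix; rewrite (le_trans (variation_of_constants n0 sy I0pi_half Ix))//.
move: (Ix) I0pi_half; rewrite !I0piE => /andP[x0 xp] /andP[h0 hp].
set lo := Num.min _ _; set hi := Num.max _ _.
have -> : `|x - pi / 2| = hi - lo.
  rewrite /lo /hi; case: (leP (pi / 2) x) => h; first by rewrite ger0_norm ?subr_ge0.
  by rewrite ltr0_norm ?opprB ?subr_lt0.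
apply: eigen_W_bound.
- by rewrite le_min h0.
- by rewrite ge_min !le_max lexx.
- by rewrite ge_max xp hp.
Qed.

Lemma ucont_p : ucont p.
Proof. by apply: ucontD; apply: ucontZ; [exact: ucont_cn|exact: ucont_sn]. Qed.

Lemma eigen_center_int : nI I0pi (fun x => y x - p x) <= Y * (pi * (V / n%:R) + pi ^+ 2 / 16).
Proof.
have i1 : rint I0pi (fun x : R => `|x - pi / 2|).
  have : ucont (fun x : R => `|x - pi / 2|%:C).
    move=> e e0; exists e => // x z _ _ xz; rewrite -rmorphB cabs_real.
    apply: le_lt_trans xz; apply: le_trans (ler_dist_dist _ _) _.
    by rewrite opprB addrA subrK.
  by move=> /ucont_cintble[].
have i2 : rint I0pi (fun x : R => Y * V / n%:R + Y / 4 * `|x - pi / 2|).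
  apply: rintD => //; [by apply: rint_cst|exact: rintZ].
apply: (@le_trans _ _ (\int[mu]_(x in I0pi) (Y * V / n%:R + Y / 4 * `|x - pi / 2|))).
  apply: le_Rintegral => //.
    by apply: cintble_cabs => //; apply: ucont_cintble; apply: ucontB => //; exact: ucont_p.
  by move=> x Ix; have := eigen_center Ix; rewrite -/(p x) mulrDr mulrA mulrCA mulrA; lra.
rewrite RintegralD//; [|by apply: rint_cst|exact: rintZ].
rewrite (@RintegralZl _ _ _ mu I0pi (fun x : R => `|x - pi / 2|) (Y / 4) mI i1).
have -> : \int[mu]_(x in I0pi) `|x - pi / 2| = pi ^+ 2 / 4.
  rewrite -nI_dist; apply: eq_Rintegral => x _.
  by rewrite cabs_real normr_id.
have -> : \int[mu]_(x in I0pi) (Y * V / n%:R) = Y * V / n%:R * pi.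
  have := cI_cst ((Y * V / n%:R)%:C : C); move/(congr1 (@complex.Re R)).
  by rewrite /= !mulr0 subr0.
by rewrite le_eqVlt; apply/orP; left; apply/eqP; field; rewrite gt_eqF.
Qed.

End Center.

Lemma exists_sup y : ucont y -> exists2 Y : R, 0 <= Y &
  (forall x, I0pi x -> cabs (y x) <= Y) /\ exists2 c, I0pi c & Y = cabs (y c).
Proof.
by move=> /ucont_max[c Ic H]; exists (cabs (y c)); [exact: cabs_ge0|split => //; exists c].
Qed.

Lemma cn_sn_sq n x : cabs (cn n x : C) ^+ 2 + cabs (sn n x : C) ^+ 2 = 1.
Proof. by rewrite !cabs_real !real_normK ?num_real// cos2Dsin2. Qed.

Lemma integral_dev f g (M : R) : ucont f -> ucont g -> (forall x, I0pi x -> cabs (g x) <= M) ->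
  cabs (cI I0pi (fun x => f x * g x)) <= M * nI I0pi f.
Proof.
move=> uf ug gM; apply: (le_trans (cabs_cI mI (ucont_cintble (ucontM uf ug)))).
have -> : (fun x => f x * g x) = (fun x => g x * f x) by apply/funext => x; rewrite mulrC.
by apply: nI_bdd => //; [exact: ucont_meas|exact: ucont_cintble].
Qed.

Lemma cIV_bound y phi (Y M : R) : ucont y -> ucont phi ->
  (forall x, I0pi x -> cabs (y x) <= Y) -> (forall x, I0pi x -> cabs (phi x) <= M) ->
  cabs (cI I0pi (fun x => phi x * y x * v x)) <= M * Y * V.
Proof.
move=> uy up yY pM; apply: (le_trans (cabs_cI mI (ucontM_cintble (ucontM up uy) vi))).
apply: nI_bdd => //; first exact: ucont_meas (ucontM up uy).
move=> x Ix; rewrite cabsM ler_pM ?cabs_ge0 ?pM ?yY//.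
Qed.

Lemma disc_dist n l : disc n l -> cabs (n%:R ^+ 2 - l) <= n%:R / 4.
Proof. by rewrite cabsC => /ltW. Qed.

(* Close to the trigonometric polynomial p with the same data at pi / 2, y is
   tested against the conjugate of p, which satisfies the boundary conditions. *)
Lemma eigen_per_apriori n y dy l : (0 < n)%N -> V / n%:R <= 1 / 640 -> disc n l ->
  dom v (per_of n) y dy (fun x => l * y x) -> ~ aeq y (fun=> 0) ->
  cabs (n%:R ^+ 2 - l) <= 6 * V.
Proof.
move=> n0 Vn /disc_dist ln d y0; have [sy _ _] := d.
have uy := sol2_ucont sy; have [Y Y0 [yY [c Ic Yc]]] := exists_sup uy.
have Yp : 0 < Y.
  rewrite lt_def Y0 andbT; apply/eqP => Ye; apply: y0; apply: aeW => x Ix.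
  by apply/eqP; rewrite -cabs_eq0 eq_le cabs_ge0 andbT -Ye yY.
have cen := eigen_center n0 sy ln yY; have ceni := eigen_center_int n0 sy ln yY.
set A := va n y dy (pi / 2) in cen ceni; set B := vb n y dy (pi / 2) in cen ceni.
pose p x := A * cn n x + B * sn n x.
pose S := cabs A ^+ 2 + cabs B ^+ 2.
have S0 : 0 <= S by rewrite addr_ge0// sqr_ge0.
pose s := Num.sqrt S.
have sS : s ^+ 2 = S by rewrite sqr_sqrtr.
have s0 : 0 <= s by rewrite sqrtr_ge0.
have ps x : cabs (p x) <= s by apply: dist_norm_bound => //; exact: cn_sn_sq.
have pi0 := @pi_gt0 R; have pi2 := @pi_ge2 R; have pile := pi_le R.
set eta := V / n%:R in Vn cen ceni.
(* The relative error is at most [1/640 + pi/8 <= 41/100]; at a point where [|y|] is maximal this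
   leaves 59/100 for the polynomial. *)
have YS : Y * (59 / 100) <= s.
  have := cen c Ic; rewrite -/(p c).
  have : `|c - pi / 2| <= pi / 2.
    by move: Ic; rewrite I0piE ler_norml => /andP[? ?]; apply/andP; split; lra.
  move=> h1 h2.
  have h3 : Y * (eta + `|c - pi / 2| / 4) <= Y * (41 / 100) by rewrite ler_wpM2l//; lra.
  have := cabsD (y c - p c) (p c); rewrite subrK -Yc; have := ps c; lra.
have sp : 0 < s by have := mulr_gt0 Yp (ltac:(lra) : (0 : R) < 59 / 100); lra.
pose phi x := A^*%C * cn n x + B^*%C * sn n x.
have cnJ x : (cn n x : C)^*%C = cn n x by rewrite /cn /= oppr0.
have snJ x : (sn n x : C)^*%C = sn n x by rewrite /sn /= oppr0.
have cJM (a b : C) : (a * b)^*%C = a^*%C * b^*%C by exact: rmorphM.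
have cJD (a b : C) : (a + b)^*%C = a^*%C + b^*%C by exact: rmorphD.
have phiE x : phi x = (p x)^*%C.
  by rewrite /p (cJD (A * cn n x) (B * sn n x)) (cJM A) (cJM B) cnJ snJ.
have uphi : ucont phi by apply: ucontD; apply: ucontZ; [exact: ucont_cn|exact: ucont_sn].
have phis x : cabs (phi x) <= s by rewrite phiE cabsJ.
have up : ucont p := @ucont_p n y dy.
have sphi := sol2D (sol2Z A^*%C (sol2_cn R n)) (sol2Z B^*%C (sol2_sn R n)).
have := free_symmetric vi d (phi := phi) (n := n) (dphi := fun x => A^*%C * (- n%:R * sn n x) + B^*%C * (n%:R * cn n x)).
have -> : (fun x => - n%:R ^+ 2 * phi x) = (fun x => A^*%C * (- n%:R ^+ 2 * cn n x) + B^*%C * (- n%:R ^+ 2 * sn n x)).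
  by apply/funext => x; rewrite /phi; ring.
move=> /(_ sphi).
have bphi : satisfies_bc (per_of n) phi (fun x => A^*%C * (- n%:R * sn n x) + B^*%C * (n%:R * cn n x)).
  exact: (bc_lin A^*%C B^*%C (bc_cn R n) (bc_sn R n)).
move=> /(_ bphi).
have iyp := ucont_cintble (ucontM uy uphi).
have -> : cI I0pi (fun x => l * y x * phi x) = l * cI I0pi (fun x => y x * phi x).
  by rewrite -cI_Z//; apply: eq_cI => x _; ring.
set E := cI I0pi (fun x => y x * phi x).
move=> id1.
have id2 : (n%:R ^+ 2 - l) * E = - cI I0pi (fun x => phi x * y x * v x).
  by rewrite mulrBl id1; ring.
have := cIV_bound uy uphi yY (fun x _ => phis x); rewrite -cabsN -id2 cabsM => le1.
have Epp : cI I0pi (fun x => p x * phi x) = (S * (pi / 2))%:C.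
  have -> : (fun x => p x * phi x) = (fun x => (A * A^*%C) * (cn n x * cn n x) +
      (B * B^*%C) * (sn n x * sn n x) + (A * B^*%C + B * A^*%C) * (cn n x * sn n x)).
    by apply/funext => x; rewrite /p /phi; ring.
  have icc := ucont_cintble (ucontM (@ucont_cn R n) (@ucont_cn R n)).
  have iss := ucont_cintble (ucontM (@ucont_sn R n) (@ucont_sn R n)).
  have ics := ucont_cintble (ucontM (@ucont_cn R n) (@ucont_sn R n)).
  have z1 := cintbleZ (A * A^*%C) mI icc; have z2 := cintbleZ (B * B^*%C) mI iss.
  have z3 := cintbleZ (A * B^*%C + B * A^*%C) mI ics.
  rewrite cI_D//; last exact: cintbleD.
  rewrite cI_D// !cI_Z// cI_cn2// cI_sn2// cI_cn_sn// mulr0 addr0 !mul_conjc.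
  by rewrite -!rmorphM -rmorphD /= -mulrDl.
have Edev : cabs (E - (S * (pi / 2))%:C) <= s * (Y * (pi * eta + pi ^+ 2 / 16)).
  rewrite -Epp -cI_B//; last exact: ucont_cintble (ucontM up uphi).
  have -> : (fun x => y x * phi x - p x * phi x) = (fun x => (y x - p x) * phi x).
    by apply/funext => x; ring.
  apply: (le_trans (integral_dev (ucontB uy up) uphi (fun x _ => phis x))).
  by rewrite ler_wpM2l.
(* With [Y <= (17/10) s] and [eta + pi/16 <= 103/500], the deviation is at most [0.3502 pi S], to be
   compared with the main term [pi S / 2]; the rest follows from [pi >= 2]. *)
have El : 29 / 100 * S <= cabs E.
  have h : S * (pi / 2) <= cabs E + s * (Y * (pi * eta + pi ^+ 2 / 16)).
    rewrite -[leLHS]ger0_norm; last by rewrite mulr_ge0//; lra.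
    rewrite -cabs_real; apply: le_trans (lerD (lexx _) Edev).
    by have := cabsB E (E - (S * (pi / 2))%:C); rewrite subKr.
  have Y17 : Y <= s * (17 / 10) by lra.
  have c1 : pi * eta + pi ^+ 2 / 16 <= pi * (103 / 500).
    by rewrite expr2 -mulrA -mulrDr ler_wpM2l//; lra.
  have c0 : 0 <= pi * eta + pi ^+ 2 / 16.
    apply: addr_ge0; last by rewrite divr_ge0// sqr_ge0.
    by rewrite mulr_ge0 ?(ltW pi0)// divr_ge0// V_ge0.
  have c2 : Y * (pi * eta + pi ^+ 2 / 16) <= s * (17 / 10) * (pi * (103 / 500)).
    by apply: ler_pM.
  have c3 : s * (Y * (pi * eta + pi ^+ 2 / 16)) <= S * pi * (17 / 10 * (103 / 500)).
    apply: (le_trans (ler_wpM2l s0 c2)).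
    by rewrite -sS expr2 le_eqVlt; apply/orP; left; apply/eqP; ring.
  have c4 : S * 2 <= S * pi by rewrite ler_wpM2l.
  by lra.
have Sp : 0 < S by rewrite -sS exprn_gt0.
have h5 : cabs (n%:R ^+ 2 - l) * (29 / 100 * S) <= 17 / 10 * V * S.
  apply: (le_trans (ler_wpM2l (cabs_ge0 _) El)); apply: (le_trans le1).
  have := V_ge0 v; rewrite -/V => V0.
  have -> : 17 / 10 * V * S = s * (s * (17 / 10)) * V by rewrite -sS; ring.
  by rewrite ler_wpM2r// ler_wpM2l//; lra.
have h6 : cabs (n%:R ^+ 2 - l) * (29 / 100) <= 17 / 10 * V.
  by have := h5; rewrite [leLHS]mulrA ler_pM2r.
by have := V_ge0 v; rewrite -/V => V0; lra.
Qed.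

End APriori.

(** * A priori bound for Neumann eigenvalues *)

Section APrioriNeumann.
Variable R : realType.
Local Notation C := R[i].
Implicit Types (f g h y dy w : R -> C) (x : R) (bc : bcond) (n : nat) (l : C).
Let mI := @measurable_I0pi R.
Variable v : R -> C.
Hypothesis vi : cintble I0pi v.
Let V := nI I0pi v.

Lemma vb_incr n y dy w : (0 < n)%N -> sol2 y dy w ->
  forall a b : R, 0 <= a -> a <= b -> b <= pi ->
  cabs (vb n y dy b - vb n y dy a) <= n%:R^-1 * nI `[a, b]%classic (fun x => w x + n%:R ^+ 2 * y x).
Proof.
move=> n0 sy a b a0 ab bp.
have sub : `]a, b]%classic `<=` (I0pi : set R) by exact: sub_itvI0pi.
have mab : measurable (`]a, b]%classic : set R) by exact: measurable_itv.
have aB := acd_vb n0 sy; have [_ _ iB] := aB.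
rewrite (acdB_cI aB)//; apply: (le_trans (cabs_cI mab (cintbleS mI mab sub iB))).
have iW := cintble_W n sy.
rewrite -(nI_oc iW a0 bp).
have -> : (fun x => n%:R^-1 * (cn n x * (w x + n%:R ^+ 2 * y x))) =
   (fun x => (n%:R^-1 * cn n x) * (w x + n%:R ^+ 2 * y x)) by apply/funext => x; rewrite mulrA.
apply: nI_bdd => //.
- apply: cintble_meas; apply: (cintbleS mI mab sub); apply: ucont_cintble.
  by apply: ucontZ; exact: ucont_cn.
- move=> x _; rewrite cabsM cabsV cabs_nat ler_piMr ?invr_ge0//; exact: cn_le1.
- exact: cintbleS mI mab sub iW.
Qed.

(** Of the two waves only the cosine satisfies the Neumann conditions, so the test function is
    [cn n] and the sine amplitude must be dominated: it vanishes at 0 because [y'(0) = 0], and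
    reaches at most 41/100 of [Y] at the midpoint. *)
Lemma eigen_neu_apriori n y dy l : (0 < n)%N -> V / n%:R <= 1 / 640 -> disc n l ->
  dom v Neu y dy (fun x => l * y x) -> ~ aeq y (fun=> 0) ->
  cabs (n%:R ^+ 2 - l) <= 118 * V.
Proof.
move=> n0 Vn /disc_dist ln d y0; have [sy [bc0 _] _] := d.
have uy := sol2_ucont sy; have [Y Y0 [yY [c Ic Yc]]] := exists_sup uy.
have Yp : 0 < Y.
  rewrite lt_def Y0 andbT; apply/eqP => Ye; apply: y0; apply: aeW => x Ix.
  by apply/eqP; rewrite -cabs_eq0 eq_le cabs_ge0 andbT -Ye yY.
have cen := eigen_center vi n0 sy ln yY; have ceni := eigen_center_int vi n0 sy ln yY.
have pi0 := @pi_gt0 R; have pi2 := @pi_ge2 R; have pile := pi_le R.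
have vb0 : vb n y dy 0 = 0 by rewrite /vb bc0 sn0 mulr0 !mul0r addr0.
have Bq := vb_incr n0 sy (lexx 0) (ltac:(lra) : 0 <= pi / 2 :> R) (ltac:(lra) : pi / 2 <= pi :> R).
have Bq2 := eigen_W_bound vi n0 sy ln yY (lexx 0) (ltac:(lra) : 0 <= pi / 2 :> R) (ltac:(lra) : pi / 2 <= pi :> R).
have {Bq Bq2} := le_trans Bq Bq2; rewrite vb0 !subr0 -/V => Bq.
set A := va n y dy (pi / 2) in cen ceni; set B := vb n y dy (pi / 2) in cen ceni Bq.
pose p x := A * cn n x + B * sn n x.
rewrite -/V in cen ceni; set eta := V / n%:R in Vn cen ceni Bq.
have eta0 : 0 <= eta by rewrite divr_ge0// V_ge0.
have {Bq} Bq : cabs B <= 41 / 100 * Y.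
  by apply: (le_trans Bq); rewrite mulrC ler_wpM2r//; lra.
pose s := Num.sqrt (cabs A ^+ 2 + cabs B ^+ 2).
have sS : s ^+ 2 = cabs A ^+ 2 + cabs B ^+ 2 by rewrite sqr_sqrtr// addr_ge0// sqr_ge0.
have s0 : 0 <= s by rewrite sqrtr_ge0.
have ps x : cabs (p x) <= s by apply: dist_norm_bound => //; exact: cn_sn_sq.
have YS : Y * (59 / 100) <= s.
  have := cen c Ic; rewrite -/(p c).
  have : `|c - pi / 2| <= pi / 2.
    by move: Ic; rewrite I0piE ler_norml => /andP[? ?]; apply/andP; split; lra.
  move=> h1 h2.
  have h3 : Y * (eta + `|c - pi / 2| / 4) <= Y * (41 / 100) by rewrite ler_wpM2l//; lra.
  have := cabsD (y c - p c) (p c); rewrite subrK -Yc; have := ps c; lra.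
have a0 := cabs_ge0 A.
(* The total amplitude is at least [(59/100) Y] and the sine part at most [(41/100) Y]; the squares
   differ by [0.18 Y^2], which exceeds [(25/59)^2 Y^2]. *)
have YA : Y <= 59 / 25 * cabs A.
  have h1 : (Y * (59 / 100)) ^+ 2 <= s ^+ 2 by rewrite ler_pXn2r ?nnegrE// mulr_ge0.
  have h2 : cabs B ^+ 2 <= (41 / 100 * Y) ^+ 2 by rewrite ler_pXn2r ?nnegrE ?cabs_ge0// mulr_ge0.
  rewrite -(@ler_pXn2r _ 2) ?nnegrE//; last by rewrite mulr_ge0.
  move: h1 h2; rewrite sS; have := sqr_ge0 (cabs A); rewrite !exprMn.
  by move: (Y ^+ 2) (cabs A ^+ 2) (cabs B ^+ 2) => Y2 A2 B2; lra.
have Ap : 0 < cabs A by lra.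
have uphi := @ucont_cn R n.
have up : ucont p := @ucont_p _ n y dy.
have iyp := ucont_cintble (ucontM uy uphi).
have := free_symmetric vi d (sol2_cn R n) (bc_neu_cn R n).
have -> : cI I0pi (fun x => l * y x * cn n x) = l * cI I0pi (fun x => y x * cn n x).
  by rewrite -cI_Z//; apply: eq_cI => x _; ring.
set E := cI I0pi (fun x => y x * cn n x).
move=> id1.
have id2 : (n%:R ^+ 2 - l) * E = - cI I0pi (fun x => cn n x * y x * v x).
  by rewrite mulrBl id1; ring.
have := cIV_bound vi uy uphi yY (fun x _ => @cn_le1 R n x); rewrite -cabsN -id2 cabsM mul1r => le1.
have Epp : cI I0pi (fun x => p x * cn n x) = A * (pi / 2)%:C.
  have -> : (fun x => p x * cn n x) = (fun x => A * (cn n x * cn n x) + B * (cn n x * sn n x)).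
    by apply/funext => x; rewrite /p; ring.
  have icc := ucont_cintble (ucontM (@ucont_cn R n) (@ucont_cn R n)).
  have ics := ucont_cintble (ucontM (@ucont_cn R n) (@ucont_sn R n)).
  have z1 := cintbleZ A mI icc; have z3 := cintbleZ B mI ics.
  by rewrite cI_D// !cI_Z// cI_cn2// cI_cn_sn// mulr0 addr0.
have Edev : cabs (E - A * (pi / 2)%:C) <= Y * (pi * eta + pi ^+ 2 / 16).
  rewrite -Epp -cI_B//; last exact: ucont_cintble (ucontM up uphi).
  have -> : (fun x => y x * cn n x - p x * cn n x) = (fun x => (y x - p x) * cn n x).
    by apply/funext => x; ring.
  apply: (le_trans (integral_dev (ucontB uy up) uphi (fun x _ => @cn_le1 R n x))).
  by rewrite mul1r.
(* The margin is thin: the deviation is at most [pi |A|] times [(59/25)(103/500) = 0.48616], against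
   the main term [pi |A| / 2]. The final constant is [118 = 50 (59/25)]. *)
have El : cabs A / 50 <= cabs E.
  have h : cabs A * (pi / 2) <= cabs E + Y * (pi * eta + pi ^+ 2 / 16).
    have -> : cabs A * (pi / 2) = cabs (A * (pi / 2)%:C).
      by rewrite cabsM cabs_real ger0_norm//; lra.
    apply: le_trans (lerD (lexx _) Edev).
    by have := cabsB E (E - A * (pi / 2)%:C); rewrite subKr.
  have c1 : pi * eta + pi ^+ 2 / 16 <= pi * (103 / 500).
    by rewrite expr2 -mulrA -mulrDr ler_wpM2l//; lra.
  have c0 : 0 <= pi * eta + pi ^+ 2 / 16.
    apply: addr_ge0; last by rewrite divr_ge0// sqr_ge0.
    by rewrite mulr_ge0 ?(ltW pi0).
  have c2 : Y * (pi * eta + pi ^+ 2 / 16) <= (59 / 25 * cabs A) * (pi * (103 / 500)).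
    by apply: ler_pM.
  have c4 : cabs A * 2 <= cabs A * pi by rewrite ler_wpM2l.
  have c3 : (59 / 25 * cabs A) * (pi * (103 / 500)) = (cabs A * pi) * (59 / 25 * (103 / 500)) by ring.
  by rewrite c3 in c2; lra.
have V0 : 0 <= V by exact: V_ge0.
have h5 : cabs (n%:R ^+ 2 - l) * (cabs A / 50) <= 59 / 25 * V * cabs A.
  apply: (le_trans (ler_wpM2l (cabs_ge0 _) El)); apply: (le_trans le1).
  have -> : 59 / 25 * V * cabs A = (59 / 25 * cabs A) * V by ring.
  by rewrite ler_wpM2r.
have h6 : cabs (n%:R ^+ 2 - l) / 50 <= 59 / 25 * V.
  rewrite -(ler_pM2r Ap); apply: le_trans h5; rewrite le_eqVlt; apply/orP; left; apply/eqP; ring.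
by lra.
Qed.

End APrioriNeumann.

(** * Asymptotics of the root functions *)

Lemma lin2_surj (F : fieldType) (p q r s : F) :
  (forall a b, a * p + b * q = 0 -> a * r + b * s = 0 -> a = 0 /\ b = 0) ->
  forall u w, exists a b, a * p + b * q = u /\ a * r + b * s = w.
Proof.
move=> inj u w; have [D0|D0] := eqVneq (p * s - q * r) 0.
  have [s0 /eqP] : s = 0 /\ - r = 0 by apply: inj; [rewrite -D0; ring|ring].
  rewrite oppr_eq0 => /eqP r0.
  have [q0 /eqP] : q = 0 /\ - p = 0 by apply: inj; rewrite ?r0 ?s0; ring.
  rewrite oppr_eq0 => /eqP p0.
  have [/eqP] : (1 : F) = 0 /\ (0 : F) = 0 by apply: inj; rewrite ?p0 ?q0 ?r0 ?s0; ring.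
  by rewrite oner_eq0.
exists ((u * s - w * q) / (p * s - q * r)), ((w * p - u * r) / (p * s - q * r)).
by split; field.
Qed.

Section Asymptotics.
Variable R : realType.
Local Notation C := R[i].
Implicit Types (f g h y dy z dz w : R -> C) (x : R) (bc : bcond) (n : nat) (l : C).
Let mI := @measurable_I0pi R.
Variable v : R -> C.
Hypothesis vi : cintble I0pi v.
Let V := nI I0pi v.

(** The second comparison, started at 0 where the boundary data are known; once [|n^2 - l|] is
    bounded the error is [O(1/n)]. The source [z] allows for functions that are not
    eigenfunctions. *)
Lemma wave_approx bc n y dy z l (k Y Z : R) x : (0 < n)%N ->
  dom v bc y dy (fun x => l * y x + z x) -> ucont z -> cabs (n%:R ^+ 2 - l) <= k ->
  (forall x, I0pi x -> cabs (y x) <= Y) -> (forall x, I0pi x -> cabs (z x) <= Z) ->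
  I0pi x -> cabs (y x - (y 0 * cn n x + dy 0 / n%:R * sn n x)) <=
  n%:R^-1 * (Y * V + (k * Y + Z) * (49 / 15)).
Proof.
move=> n0 [sy _ _] uz lk yY zZ Ix; have I0 := I0pi_0 R.
have := variation_of_constants n0 sy I0 Ix.
have -> : va n y dy 0 = y 0 by rewrite /va sn0 cn0 mulr1 mulr0 subr0.
have -> : vb n y dy 0 = dy 0 / n%:R by rewrite /vb sn0 cn0 mulr1 mulr0 add0r.
move/le_trans; apply; rewrite ler_wpM2l ?invr_ge0//.
have Y0 : 0 <= Y := le_trans (cabs_ge0 _) (yY _ I0).
have Z0 : 0 <= Z := le_trans (cabs_ge0 _) (zZ _ I0).
have k0 : 0 <= k := le_trans (cabs_ge0 _) lk.
move: (Ix); rewrite I0piE => /andP[x0 xp]; rewrite min_l// max_r//.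
apply: (le_trans (nI_W vi l n (sol2_ucont sy) uz yY zZ (lexx 0) x0 xp)).
rewrite lerD2l subr0 ler_pM//.
- by rewrite addr_ge0// mulr_ge0// cabs_ge0.
- by rewrite lerD2r ler_wpM2r.
- exact: le_trans xp (pi_le R).
Qed.

Lemma wave_norm n (p q : C) y (e : R) :
  (forall x, I0pi x -> cabs (y x - (p * cn n x + q * sn n x)) <= e) ->
  forall x, I0pi x -> cabs (y x) <= cabs p + cabs q + e.
Proof.
move=> H x Ix; have := cabsD (y x - (p * cn n x + q * sn n x)) (p * cn n x + q * sn n x).
rewrite subrK => /le_trans; apply; rewrite [leRHS]addrC lerD ?H//.
apply: (le_trans (cabsD _ _)); rewrite !cabsM lerD// ler_piMr ?cabs_ge0//; [exact: cn_le1|exact: sn_le1].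
Qed.

Lemma wave_coef n (p q : C) y (e : R) (b : bool) : (0 < n)%N -> ucont y ->
  (forall x, I0pi x -> cabs (y x - (p * cn n x + q * sn n x)) <= e) ->
  cabs (cI I0pi (fun x => y x * (if b then cn n x else sn n x)) - (if b then p else q) * (pi / 2)%:C) <= e * (49 / 15).
Proof.
move=> n0 uy H; pose phi x : C := if b then cn n x else sn n x.
have up : ucont phi by rewrite /phi; case: b {phi}; [exact: ucont_cn|exact: ucont_sn].
pose w x := p * cn n x + q * sn n x.
have uw : ucont w by apply: ucontD; apply: ucontZ; [exact: ucont_cn|exact: ucont_sn].
have e0 : 0 <= e := le_trans (cabs_ge0 _) (H _ (I0pi_0 R)).
have wE : cI I0pi (fun x => w x * phi x) = (if b then p else q) * (pi / 2)%:C.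
  have ic := @ucont_cn R n; have is_ := @ucont_sn R n.
  have i1 := ucont_cintble (ucontM ic up); have i2 := ucont_cintble (ucontM is_ up).
  have -> : (fun x => w x * phi x) = (fun x => p * (cn n x * phi x) + q * (sn n x * phi x)).
    by apply/funext => x; rewrite /w; ring.
  rewrite cI_D//; [|exact: cintbleZ|exact: cintbleZ].
  rewrite !cI_Z//; move: @phi {up i1 i2 uw}; case: b => /=.
    have -> : cI I0pi (fun x => sn n x * cn n x : C) = 0.
      by rewrite -[RHS](cI_cn_sn R n0); apply: eq_cI => x _; rewrite mulrC.
    by rewrite cI_cn2// mulr0 addr0.
  by rewrite cI_sn2// cI_cn_sn// mulr0 add0r.
rewrite -wE -cI_B//; [|exact: ucont_cintble (ucontM uy up)|exact: ucont_cintble (ucontM uw up)].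
have -> : (fun x => y x * phi x - w x * phi x) = (fun x => (y x - w x) * phi x).
  by apply/funext => x; ring.
have phi1 x : I0pi x -> cabs (phi x) <= 1.
  by move=> _; rewrite /phi; case: (b); [exact: cn_le1|exact: sn_le1].
apply: (le_trans (integral_dev (ucontB uy uw) up phi1)); rewrite mul1r.
have pi0 := @pi_gt0 R.
apply: (le_trans (nI_le_bound (lexx 0) (ltW pi0) (lexx pi) (ucont_cintble (ucontB uy uw)) H)).
by rewrite subr0 ler_wpM2l// pi_le.
Qed.

End Asymptotics.

(** * Uniform approximation on a two-dimensional root space *)

Section EigenSpan.
Variable R : realType.
Local Notation C := R[i].
Implicit Types (y dy z dz w : R -> C) (x : R) (bc : bcond) (l : C).
Let mI := @measurable_I0pi R.
Variable v : R -> C.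
Hypothesis vi : cintble I0pi v.
Let V := nI I0pi v.
Variables (n : nat) (f df g dg : R -> C) (lm lp c : C).
Hypotheses (n0 : (0 < n)%N) (Vn : V / n%:R <= 1 / 640).
Hypothesis domf : dom v (per_of n) f df (fun x => lm * f x).
Hypothesis domg : dom v (per_of n) g dg (fun x => lp * g x + c * f x).
Hypotheses (lmV : cabs (n%:R ^+ 2 - lm) <= 6 * V) (lpV : cabs (n%:R ^+ 2 - lp) <= 6 * V).
Let V0 : 0 <= V. Proof. exact: V_ge0. Qed.
Let n0R : 0 < (n%:R : R). Proof. by rewrite ltr0n. Qed.

Definition lc (a b : C) x := a * f x + b * g x.
Definition dlc (a b : C) x := a * df x + b * dg x.
(* z = (L - lm) y is annihilated by L - lp. *)
Let z b x := b * (c * f x + (lp - lm) * g x).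
Let dz b x := b * (c * df x + (lp - lm) * dg x).

Lemma dom_lc a b : dom v (per_of n) (lc a b) (dlc a b) (lc (a * lm + b * c) (b * lp)).
Proof. by apply: eq_dom (domD (domZ a domf) (domZ b domg)) => // x; rewrite /lc; ring. Qed.

Let dom_z b : dom v (per_of n) (z b) (dz b) (fun x => lp * z b x + 0).
Proof. by apply: eq_dom (domZ b (dom_lc c (lp - lm))) => // x; rewrite /z /lc; ring. Qed.

Let dom_y a b : dom v (per_of n) (lc a b) (dlc a b) (fun x => lm * lc a b x + z b x).
Proof. by apply: eq_dom (dom_lc a b) => // x; rewrite /z /lc; ring. Qed.

Let phi (t : bool) : R -> C := if t then @cn R n else @sn R n.
Let dphi (t : bool) : R -> C := if t then (fun x => - n%:R * sn n x) else (fun x => n%:R * cn n x).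

Let phi1 t x : cabs (phi t x) <= 1.
Proof. by rewrite /phi; case: t; [exact: cn_le1|exact: sn_le1]. Qed.

Let up t : ucont (phi t).
Proof. by rewrite /phi; case: t; [exact: ucont_cn|exact: ucont_sn]. Qed.

(** The numbers [c] and [lp - lm] in [z] are not controlled relative to [y]. But [z = (L - lm) y],
    so its integrals against the waves are expressed through [y] by symmetry and are bounded by the
    size of [y] alone. *)
Let z_phi a b t (Y : R) : (forall x, I0pi x -> cabs (lc a b x) <= Y) ->
  cabs (cI I0pi (fun x => z b x * phi t x)) <= Y * V * 21.
Proof.
move=> yY; have [sy _ _] := dom_y a b; have uy := sol2_ucont sy.
have [sz _ _] := dom_z b; have uz := sol2_ucont sz.
have Y0 : 0 <= Y := le_trans (cabs_ge0 _) (yY _ (I0pi_0 R)).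
have sp : sol2 (phi t) (dphi t) (fun x => - n%:R ^+ 2 * phi t x).
  by rewrite /phi /dphi; case: (t); [exact: sol2_cn|exact: sol2_sn].
have bp : satisfies_bc (per_of n) (phi t) (dphi t).
  by rewrite /phi /dphi; case: (t); [exact: bc_cn|exact: bc_sn].
have := free_symmetric vi (dom_y a b) sp bp.
have iz := ucont_cintble (ucontM uz (up t)); have iy := ucont_cintble (ucontM uy (up t)).
have -> : (fun x => (lm * lc a b x + z b x) * phi t x) =
   (fun x => lm * (lc a b x * phi t x) + z b x * phi t x) by apply/funext => x; ring.
rewrite cI_D ?cI_Z//; last exact: cintbleZ.
move=> e.
have -> : cI I0pi (fun x => z b x * phi t x) = cI I0pi (fun x => phi t x * lc a b x * v x) +
   (n%:R ^+ 2 - lm) * cI I0pi (fun x => lc a b x * phi t x).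
  by rewrite mulrBl addrA -e; ring.
apply: (le_trans (cabsD _ _)); rewrite cabsM.
have h1 := cIV_bound vi uy (up t) yY (fun x _ => phi1 t x).
have h2 : cabs (cI I0pi (fun x => lc a b x * phi t x)) <= Y * (49 / 15).
  apply: (le_trans (integral_dev uy (up t) (fun x _ => phi1 t x))); rewrite mul1r.
  apply: (le_trans (nI_le_bound (lexx 0) (ltW (pi_gt0 R)) (lexx pi) (ucont_cintble uy) yY)).
  by rewrite subr0 ler_wpM2l// pi_le.
have h3 := ler_pM (cabs_ge0 _) (cabs_ge0 _) lmV h2.
have YV : 0 <= Y * V by exact: mulr_ge0.
rewrite -/V mul1r in h1.
have e2 : 6 * V * (Y * (49 / 15)) = Y * V * (98 / 5) by field.
by rewrite e2 in h3; move: h1 h3 YV; move: (Y * V) => YV; lra.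
Qed.

(** Being annihilated by [L - lp], [z] is itself close to a wave whose two amplitudes are recovered
    from [z_phi]. The error is relative to the size of [z] and is absorbed, as [V / n <= 1/640]. *)
Let z_sup a b (Y : R) : (forall x, I0pi x -> cabs (lc a b x) <= Y) ->
  forall x, I0pi x -> cabs (z b x) <= 60 * (Y * V).
Proof.
move=> yY; have [sz _ _] := dom_z b; have uz := sol2_ucont sz.
have Y0 : 0 <= Y := le_trans (cabs_ge0 _) (yY _ (I0pi_0 R)).
have [Z Z0 [zZ _]] := exists_sup uz.
have [Z' Z'0 [zZ' [x1 Ix1 Z'E]]] := exists_sup uz.
have c0 : cabs (0 : C) <= 0 by rewrite cabs0.
have H x : I0pi x -> cabs (z b x - (z b 0 * cn n x + dz b 0 / n%:R * sn n x)) <= V / n%:R * Z' * 21.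
  move=> Ix.
  apply: (le_trans (wave_approx vi n0 (dom_z b) (@ucont_cst R 0) lpV zZ' (fun x _ => c0) Ix)).
  have : 0 <= V / n%:R * Z' by rewrite mulr_ge0// divr_ge0.
  rewrite -/V; have -> : n%:R^-1 * (Z' * V + (6 * V * Z' + 0) * (49 / 15)) = V / n%:R * Z' * (103 / 5).
    by field; rewrite gt_eqF.
  by rewrite -/V; move: (V / n%:R * Z') => X X0; lra.
have e0 : V / n%:R * Z' * 21 <= Z' * (21 / 640).
  by rewrite mulrAC [leRHS]mulrC ler_wpM2r//; move: Vn; move: (V / n%:R) => X; lra.
have half (t : bool) : cabs (if t then z b 0 else dz b 0 / n%:R) <= 21 * (Y * V) + V / n%:R * Z' * 21 * (49 / 15).
  have h1 := wave_coef t n0 uz H.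
  have h2 := z_phi t yY.
  have -> : cabs (if t then z b 0 else dz b 0 / n%:R) = cabs ((if t then z b 0 else dz b 0 / n%:R) * (pi / 2)%:C) / (pi / 2).
    rewrite cabsM cabs_real gtr0_norm ?divr_gt0 ?pi_gt0// mulfK// gt_eqF// divr_gt0// pi_gt0//.
  rewrite ler_pdivrMr; last by rewrite divr_gt0// pi_gt0.
  have -> : (if t then z b 0 else dz b 0 / n%:R) * (pi / 2)%:C =
     cI I0pi (fun x => z b x * phi t x) - (cI I0pi (fun x => z b x * phi t x) - (if t then z b 0 else dz b 0 / n%:R) * (pi / 2)%:C).
    by rewrite opprB addrC subrK.
  apply: (le_trans (cabsB _ _)).
  have -> : (fun x => z b x * phi t x) = (fun x => z b x * (if t then cn n x else sn n x)).
    by apply/funext => x; rewrite /phi; case: (t).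
  have p1 : 1 <= pi / 2 :> R by have := @pi_ge2 R; lra.
  have s0 : 0 <= 21 * (Y * V) + V / n%:R * Z' * 21 * (49 / 15).
    by rewrite addr_ge0// !mulr_ge0// divr_ge0.
  apply: le_trans (ler_wpM2l s0 p1); rewrite mulr1; apply: lerD => //.
  move: h2; rewrite [21 * _]mulrC.
  have -> : (fun x => z b x * phi t x) = (fun x => z b x * (if t then cn n x else sn n x)).
    by apply/funext => x; rewrite /phi; case: (t).
  by [].
have := wave_norm H Ix1; rewrite -Z'E; have := half true; have := half false => /=.
move=> h1 h2 h3 x Ix; apply: (le_trans (zZ' _ Ix)).
have YV : 0 <= Y * V by exact: mulr_ge0.
by move: h1 h2 h3 e0 YV; move: (V / n%:R * Z' * 21) (Y * V) => e YV; lra.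
Qed.

(** Uniform over the root space, however close to a Jordan block it is. The bound in terms of [Y]
    becomes one in terms of the data at 0 because [225/640 = 45/128], whence [Y] is at most 8/5 of
    these data, and [360 = 225 (8/5)]. *)
Lemma span_approx a b x : I0pi x ->
  cabs (lc a b x - (lc a b 0 * cn n x + dlc a b 0 / n%:R * sn n x)) <=
  360 * (V / n%:R) * (cabs (lc a b 0) + cabs (dlc a b 0 / n%:R)).
Proof.
have [sy _ _] := dom_y a b; have uy := sol2_ucont sy.
have [sz _ _] := dom_z b; have uz := sol2_ucont sz.
have [Y Y0 [yY [x1 Ix1 YE]]] := exists_sup uy.
have H t : I0pi t -> cabs (lc a b t - (lc a b 0 * cn n t + dlc a b 0 / n%:R * sn n t)) <=
    225 * (V / n%:R) * Y.
  move=> It; apply: (le_trans (wave_approx vi n0 (dom_y a b) uz lmV yY (z_sup yY) It)).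
  have : 0 <= V / n%:R * Y by rewrite mulr_ge0// divr_ge0.
  have -> : n%:R^-1 * (Y * V + (6 * V * Y + 60 * (Y * V)) * (49 / 15)) = V / n%:R * Y * (1083 / 5).
    by field; rewrite gt_eqF.
  by rewrite -mulrA; move: (V / n%:R * Y) => X X0; lra.
have h1 := wave_norm H Ix1; rewrite -YE in h1.
have h2 : 225 * (V / n%:R) * Y <= 45 / 128 * Y.
  by rewrite ler_wpM2r//; move: Vn; move: (V / n%:R) => X; lra.
move=> Ix; apply: (le_trans (H _ Ix)).
have -> : 360 * (V / n%:R) * (cabs (lc a b 0) + cabs (dlc a b 0 / n%:R)) =
  225 * (V / n%:R) * (8 / 5 * (cabs (lc a b 0) + cabs (dlc a b 0 / n%:R))) by field; rewrite gt_eqF.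
apply: ler_wpM2l; first by rewrite mulr_ge0 ?ler0n ?divr_ge0.
by lra.
Qed.

End EigenSpan.

Section Pair.
Variable R : realType.
Local Notation C := R[i].
Implicit Types (y dy z dz w : R -> C) (x : R) (bc : bcond) (l : C).
Let mI := @measurable_I0pi R.

(** The factor that normalizes [cn n] and [sn n] in L^2 for [n > 0]. *)
Definition kap : R := Num.sqrt (2 / pi).

Lemma kap_sqr : kap ^+ 2 = 2 / pi.
Proof. by rewrite sqr_sqrtr// divr_ge0// ltW// pi_gt0. Qed.

Lemma kap_ge0 : 0 <= kap. Proof. exact: sqrtr_ge0. Qed.

Lemma kap_le1 : kap <= 1.
Proof.
rewrite -(@ler_pXn2r _ 2) ?nnegrE ?kap_ge0// kap_sqr expr1n ler_pdivrMr ?pi_gt0// mul1r.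
exact: pi_ge2.
Qed.

Lemma kap_ge : 3 / 4 <= kap.
Proof.
rewrite -(@ler_pXn2r _ 2) ?nnegrE ?kap_ge0// kap_sqr ler_pdivlMr ?pi_gt0//.
by have := pi_le R; lra.
Qed.

Lemma kap_half : kap%:C * kap%:C * (pi / 2)%:C = 1 :> C.
Proof.
rewrite -!(rmorphM (real_complex R)) -expr2 kap_sqr.
have pi0 : pi != 0 :> R by rewrite gt_eqF// pi_gt0.
have -> : 2 / pi * (pi / 2) = 1 :> R by rewrite mulrA divfK// divff.
by [].
Qed.

(** Of the two roots, the one with nonnegative real part has [|s + 1| >= 1]; then
    [s^2 - 1 = (s - 1)(s + 1)] transfers the closeness to 1. *)
Lemma sqrt_near1 (w : C) (e : R) : cabs (w - 1) <= e -> e <= 1 / 10 ->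
  exists s : C, [/\ s * s = w, s != 0, cabs (s - 1) <= e & cabs s^-1 <= 10 / 9].
Proof.
move=> we e1; have [s sw sr] : exists2 s : C, s * s = w & 0 <= complex.Re s.
  have h : sqrtC w * sqrtC w = w by rewrite -expr2 sqrtCK.
  have [r0|r0] := leP 0 (complex.Re (sqrtC w)); first by exists (sqrtC w).
  by exists (- sqrtC w); rewrite ?mulrNN// cReN oppr_ge0 ltW.
have s1 : 1 <= cabs (s + 1).
  by apply: le_trans (Re_le_cabs _); rewrite cReD /= ger0_norm; lra.
have se : cabs (s - 1) <= e.
  have : cabs (s - 1) * cabs (s + 1) <= e.
    by rewrite -cabsM; apply: le_trans we; rewrite -sw le_eqVlt; apply/orP; left; apply/eqP; congr cabs; ring.
  by apply: le_trans; rewrite ler_peMr// cabs_ge0.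
have sl : 9 / 10 <= cabs s.
  by have := cabsB s (s - 1); rewrite subKr cabs1; lra.
have s0 : 0 < cabs s by lra.
exists s; split => //; first by rewrite -cabs_gt0.
by rewrite cabsV -[X in _ <= X]invrK lef_pV2 ?posrE// invf_div.
Qed.

Lemma product_approx y z (p q : R -> C) (e1 e2 M N : R) : ucont y -> ucont z -> ucont p -> ucont q ->
  (forall x, I0pi x -> cabs (y x - p x) <= e1) -> (forall x, I0pi x -> cabs (z x - q x) <= e2) ->
  (forall x, I0pi x -> cabs (p x) <= M) -> (forall x, I0pi x -> cabs (z x) <= N) ->
  cabs (cI I0pi (fun x => y x * z x) - cI I0pi (fun x => p x * q x)) <= (e1 * N + M * e2) * (49 / 15).
Proof.
move=> uy uz up uq ye ze pM zN; have I0 := I0pi_0 R.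
have uyz := ucontM uy uz; have upq := ucontM up uq; have ud := ucontB uyz upq.
rewrite -cI_B//; try exact: ucont_cintble.
have H x : I0pi x -> cabs (y x * z x - p x * q x) <= e1 * N + M * e2.
  move=> Ix; have -> : y x * z x - p x * q x = (y x - p x) * z x + p x * (z x - q x) by ring.
  by apply: (le_trans (cabsD _ _)); rewrite !cabsM lerD// ler_pM ?cabs_ge0 ?ye ?ze ?zN ?pM.
have E0 : 0 <= e1 * N + M * e2 := le_trans (cabs_ge0 _) (H _ I0).
apply: (le_trans (cabs_cI mI (ucont_cintble ud))).
apply: (le_trans (nI_le_bound (lexx 0) (ltW (pi_gt0 R)) (lexx pi) (ucont_cintble ud) H)).
by rewrite subr0 ler_wpM2l// pi_le.
Qed.

(** Change of basis for the triangular action [f -> lm f], [g -> lp g + c f]: Cramer's rule gives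
    the entries in the basis [x1 f + y1 g], [x2 f + y2 g], and trace and determinant do not
    change. *)
Lemma trace_det (K : fieldType) (x1 y1 x2 y2 lm lp c D : K) : D = x1 * y2 - y1 * x2 -> D != 0 ->
  let u1 := x1 * lm + y1 * c in let w1 := y1 * lp in
  let u2 := x2 * lm + y2 * c in let w2 := y2 * lp in
  let p := (u1 * y2 - w1 * x2) / D in let q := (x1 * w1 - y1 * u1) / D in
  let r := (u2 * y2 - w2 * x2) / D in let s := (x1 * w2 - y1 * u2) / D in
  [/\ p * x1 + q * x2 = u1, p * y1 + q * y2 = w1, r * x1 + s * x2 = u2, r * y1 + s * y2 = w2
    & p + s = lm + lp /\ p * s - q * r = lm * lp].
Proof. by move=> -> D0 /=; split; [field|field|field|field|split; field]. Qed.

Lemma small_quadratic7 (E : R) : 0 <= E -> E <= 1 / 200 ->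
  (E * (1 + E) + 1 * E) * (49 / 15) <= 7 * E.
Proof.
move=> E0 E1; have : E * E <= 1 / 200 * E by rewrite ler_wpM2r.
by rewrite mulrDr mulr1 mul1r; move: (E * E) => EE; lra.
Qed.

Lemma small_quadratic34 (E : R) : 0 <= E -> E <= 1 / 200 ->
  (9 * E * (1 + E) + 1 * E) * (49 / 15) <= 34 * E.
Proof.
move=> E0 E1; have : E * E <= 1 / 200 * E by rewrite ler_wpM2r.
by rewrite mulrDr mulr1 mul1r -mulrA; move: (E * E) => EE; lra.
Qed.

End Pair.

Section PairOfSpan.
Variable R : realType.
Local Notation C := R[i].
Implicit Types (y dy z dz w : R -> C) (x : R) (bc : bcond) (l : C).
Let mI := @measurable_I0pi R.
Let k : C := (kap R)%:C.
Variable v : R -> C.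
Variables (n : nat) (f df g dg : R -> C) (lm lp c : C) (e : R).
Hypothesis n0 : (0 < n)%N.
Hypothesis domf : dom v (per_of n) f df (fun x => lm * f x).
Hypothesis domg : dom v (per_of n) g dg (fun x => lp * g x + c * f x).
Hypothesis ifg : indep f g.
Hypotheses (e0 : 0 <= e) (e_small : e <= 1 / 200).
Hypothesis approx : forall a b x, I0pi x ->
  cabs (lc f g a b x - (lc f g a b 0 * cn n x + dlc df dg a b 0 / n%:R * sn n x)) <=
  e * (cabs (lc f g a b 0) + cabs (dlc df dg a b 0 / n%:R)).
Let n0C : (n%:R : C) != 0. Proof. by rewrite pnatr_eq0 -lt0n. Qed.

Let Y (a b : C) := lc f g a b.
Let dY (a b : C) := dlc df dg a b.
Let uY a b : ucont (Y a b).
Proof. by have [sy _ _] := dom_lc domf domg a b; exact: sol2_ucont sy. Qed.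

Let approxY a b x : I0pi x -> cabs (Y a b x - (Y a b 0 * cn n x + dY a b 0 / n%:R * sn n x)) <=
  e * (cabs (Y a b 0) + cabs (dY a b 0 / n%:R)).
Proof. exact: approx. Qed.

Let inj a b : Y a b 0 = 0 -> dY a b 0 / n%:R = 0 -> a = 0 /\ b = 0.
Proof.
move=> h1 h2; apply: ifg; apply: aeW => x Ix; apply/eqP.
have := approxY a b Ix; rewrite h1 h2 cabs0 !mul0r !addr0 subr0 mulr0 => h.
by rewrite -cabs_eq0 eq_le cabs_ge0 andbT.
Qed.

Let coords (u w : C) : exists a b, Y a b 0 = u /\ dY a b 0 / n%:R = w.
Proof.
have h a b : a * f 0 + b * g 0 = 0 -> a * (df 0 / n%:R) + b * (dg 0 / n%:R) = 0 -> a = 0 /\ b = 0.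
  by move=> h1 h2; apply: inj => //; rewrite /dY /dlc mulrDl -!mulrA.
have [a [b [h1 h2]]] := lin2_surj h u w.
by exists a, b; split => //; rewrite /dY /dlc mulrDl -!mulrA.
Qed.

Let k1 : cabs k <= 1.
Proof. by rewrite cabs_real ger0_norm ?kap_le1// kap_ge0. Qed.

Let ukc : ucont (fun x => k * cn n x). Proof. by apply: ucontZ; exact: ucont_cn. Qed.
Let uks : ucont (fun x => k * sn n x). Proof. by apply: ucontZ; exact: ucont_sn. Qed.

Let kc1 x : cabs (k * cn n x) <= 1.
Proof. by rewrite cabsM mulr_ile1 ?cabs_ge0// cn_le1. Qed.
Let ks1 x : cabs (k * sn n x) <= 1.
Proof. by rewrite cabsM mulr_ile1 ?cabs_ge0// sn_le1. Qed.

Let kcc : cI I0pi (fun x => (k * cn n x) * (k * cn n x)) = 1.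
Proof.
have -> : (fun x => (k * cn n x) * (k * cn n x)) = (fun x => (k * k) * (cn n x * cn n x)) by apply/funext => x; ring.
rewrite cI_Z//; last by apply: ucont_cintble; apply: ucontM; exact: ucont_cn.
by rewrite cI_cn2// kap_half.
Qed.
Let kss : cI I0pi (fun x => (k * sn n x) * (k * sn n x)) = 1.
Proof.
have -> : (fun x => (k * sn n x) * (k * sn n x)) = (fun x => (k * k) * (sn n x * sn n x)) by apply/funext => x; ring.
rewrite cI_Z//; last by apply: ucont_cintble; apply: ucontM; exact: ucont_sn.
by rewrite cI_sn2// kap_half.
Qed.
Let kcs : cI I0pi (fun x => (k * cn n x) * (k * sn n x)) = 0.
Proof.
have -> : (fun x => (k * cn n x) * (k * sn n x)) = (fun x => (k * k) * (cn n x * sn n x)) by apply/funext => x; ring.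
rewrite cI_Z//; last by apply: ucont_cintble; apply: ucontM; [exact: ucont_cn|exact: ucont_sn].
by rewrite cI_cn_sn// mulr0.
Qed.

Let normalize a b (phi : R -> C) (d1 d2 : R) : (forall x, I0pi x -> cabs (Y a b x - phi x) <= d1) ->
  (forall x, I0pi x -> cabs (phi x) <= 1) ->
  cabs (cI I0pi (fun x => Y a b x * Y a b x) - 1) <= d2 -> d2 <= 1 / 10 ->
  exists s : C, [/\ s != 0, cI I0pi (fun x => Y (a / s) (b / s) x * Y (a / s) (b / s) x) = 1 &
    forall x, I0pi x -> cabs (Y (a / s) (b / s) x - phi x) <= (d1 + d2) * (10 / 9)].
Proof.
move=> H p1 /sqrt_near1 h /h[s [sE s0 s1 si]]; exists s; split => //.
  have -> : (fun x => Y (a / s) (b / s) x * Y (a / s) (b / s) x) =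
     (fun x => s^-1 * s^-1 * (Y a b x * Y a b x)).
    by apply/funext => x; rewrite /Y /lc; field.
  rewrite cI_Z//; last exact: ucont_cintble (ucontM (uY a b) (uY a b)).
  by rewrite -sE; field.
move=> x Ix.
have -> : Y (a / s) (b / s) x - phi x = ((Y a b x - phi x) - (s - 1) * phi x) * s^-1.
  by rewrite /Y /lc; field.
rewrite cabsM ler_pM ?cabs_ge0//; apply: (le_trans (cabsB _ _)); rewrite lerD ?H//.
by rewrite cabsM; apply: le_trans s1; rewrite ler_piMr ?cabs_ge0// p1.
Qed.

Let combo a b a2 b2 t : Y (a - t * a2) (b - t * b2) = (fun x => Y a b x - t * Y a2 b2 x).
Proof. by apply/funext => x; rewrite /Y /lc; ring. Qed.

(** The data [(kap, 0)] and [(0, kap)] at 0 select the elements closest to the two waves;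
    Gram-Schmidt for the bilinear form does the rest. It begins with the cosine-like element, which
    is only rescaled and so keeps a vanishing derivative at 0. *)
Lemma pair_functions : exists a1 b1 a2 b2 : C,
  [/\ dlc df dg a1 b1 0 = 0,
      cI I0pi (fun x => lc f g a1 b1 x * lc f g a1 b1 x) = 1,
      cI I0pi (fun x => lc f g a1 b1 x * lc f g a2 b2 x) = 0 &
      cI I0pi (fun x => lc f g a2 b2 x * lc f g a2 b2 x) = 1] /\
  [/\ forall x, I0pi x -> cabs (lc f g a1 b1 x - (kap R)%:C * cn n x) <= 60 * e &
      forall x, I0pi x -> cabs (lc f g a2 b2 x - (kap R)%:C * sn n x) <= 60 * e].
Proof.
have e0' := e0; have es := e_small.
have [a [b [h1 h2]]] := coords k 0; have [a2 [b2 [h3 h4]]] := coords 0 k.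
have H1 x : I0pi x -> cabs (Y a b x - k * cn n x) <= e.
  move=> Ix; have := approxY a b Ix; rewrite h1 h2 mul0r addr0 cabs0 addr0 => /le_trans; apply.
  by rewrite ler_piMr.
have H2 x : I0pi x -> cabs (Y a2 b2 x - k * sn n x) <= e.
  move=> Ix; have := approxY a2 b2 Ix; rewrite h3 h4 mul0r add0r cabs0 add0r => /le_trans; apply.
  by rewrite ler_piMr.
have bd y phi x (d : R) : cabs (y x - phi x) <= d -> cabs (phi x : C) <= 1 -> cabs (y x) <= 1 + d.
  by move=> q1 q2; have := cabsD (y x - phi x) (phi x); rewrite subrK; lra.
have B1 : cabs (cI I0pi (fun x => Y a b x * Y a b x) - 1) <= 7 * e.
  rewrite -kcc; apply: (le_trans (product_approx (uY a b) (uY a b) ukc ukc H1 H1 (fun x _ => kc1 x)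
    (fun x Ix => bd (Y a b) (fun x => k * cn n x) _ _ (H1 x Ix) (kc1 x)))).
  exact: small_quadratic7 e0 e_small.
have B2 : cabs (cI I0pi (fun x => Y a2 b2 x * Y a2 b2 x) - 1) <= 7 * e.
  rewrite -kss; apply: (le_trans (product_approx (uY a2 b2) (uY a2 b2) uks uks H2 H2 (fun x _ => ks1 x)
    (fun x Ix => bd (Y a2 b2) (fun x => k * sn n x) _ _ (H2 x Ix) (ks1 x)))).
  exact: small_quadratic7 e0 e_small.
have e7 : 7 * e <= 1 / 10 by lra.
have [s [s0 N1 H1']] := normalize H1 (fun x _ => kc1 x) B1 e7.
set a1 := a / s in N1 H1'; set b1 := b / s in N1 H1'.
have {}H1' x : I0pi x -> cabs (Y a1 b1 x - k * cn n x) <= 9 * e by move=> Ix; have := H1' x Ix; lra.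
pose t := cI I0pi (fun x => Y a1 b1 x * Y a2 b2 x).
have tE : cabs t <= 34 * e.
  rewrite -[t]subr0 -kcs; apply: (le_trans (product_approx (uY a1 b1) (uY a2 b2) ukc uks H1' H2 (fun x _ => kc1 x)
    (fun x Ix => bd (Y a2 b2) (fun x => k * sn n x) _ _ (H2 x Ix) (ks1 x)))).
  exact: small_quadratic34 e0 e_small.
have B12 : cI I0pi (fun x => Y a2 b2 x * Y a1 b1 x) = t by apply: eq_cI => x _; rewrite mulrC.
(* Gram-Schmidt step; the correction [t] is [O(e)] and changes the square of the second function
   only by [t^2]. *)
pose a3 := a2 - t * a1; pose b3 := b2 - t * b1.
have i11 := ucont_cintble (ucontM (uY a1 b1) (uY a1 b1)).
have i12 := ucont_cintble (ucontM (uY a1 b1) (uY a2 b2)).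
have i22 := ucont_cintble (ucontM (uY a2 b2) (uY a2 b2)).
have O13 : cI I0pi (fun x => Y a1 b1 x * Y a3 b3 x) = 0.
  have -> : (fun x => Y a1 b1 x * Y a3 b3 x) = (fun x => Y a1 b1 x * Y a2 b2 x - t * (Y a1 b1 x * Y a1 b1 x)).
    by apply/funext => x; rewrite /a3 /b3 combo; ring.
  by rewrite cI_B//; [rewrite cI_Z// N1 mulr1 subrr|exact: cintbleZ].
have B3 : cI I0pi (fun x => Y a3 b3 x * Y a3 b3 x) = cI I0pi (fun x => Y a2 b2 x * Y a2 b2 x) - t * t.
  have -> : (fun x => Y a3 b3 x * Y a3 b3 x) =
     (fun x => (Y a2 b2 x * Y a2 b2 x - t * (Y a1 b1 x * Y a2 b2 x)) - t * (Y a1 b1 x * Y a3 b3 x)).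
    by apply/funext => x; rewrite /a3 /b3 combo; ring.
  have i13 := ucont_cintble (ucontM (uY a1 b1) (uY a3 b3)).
  have z12 := cintbleZ t mI i12; have z13 := cintbleZ t mI i13.
  by rewrite cI_B//; [rewrite cI_B// !cI_Z// O13 mulr0 subr0|exact: cintbleB].
have te : t * t = t ^+ 2 by rewrite expr2.
have t2 : cabs t ^+ 2 <= 6 * e.
  have h : cabs t ^+ 2 <= (34 * e) ^+ 2 by rewrite ler_pXn2r ?nnegrE ?cabs_ge0 ?mulr_ge0 ?ler0n.
  apply: (le_trans h); rewrite exprMn.
  have : e ^+ 2 <= 1 / 200 * e by rewrite expr2 ler_wpM2r.
  by move: (e ^+ 2) => ee; lra.
have N3 : cabs (cI I0pi (fun x => Y a3 b3 x * Y a3 b3 x) - 1) <= 13 * e.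
  rewrite B3 addrAC; apply: (le_trans (cabsB _ _)); rewrite te cabsX; lra.
have H3 x : I0pi x -> cabs (Y a3 b3 x - k * sn n x) <= 39 * e.
  move=> Ix; have -> : Y a3 b3 x - k * sn n x = (Y a2 b2 x - k * sn n x) - t * Y a1 b1 x.
    by rewrite /a3 /b3 combo; ring.
  apply: (le_trans (cabsB _ _)); rewrite cabsM.
  have q1 : cabs (Y a1 b1 x) <= 1 + 9 * e := bd (Y a1 b1) (fun x => k * cn n x) _ _ (H1' x Ix) (kc1 x).
  have q2 : cabs t * cabs (Y a1 b1 x) <= 34 * e * (1 + 9 / 200).
    by apply: ler_pM; rewrite ?cabs_ge0//; lra.
  by have := H2 x Ix; lra.
have e13 : 13 * e <= 1 / 10 by lra.
have [s' [s'0 N4 H4]] := normalize H3 (fun x _ => ks1 x) N3 e13.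
exists a1, b1, (a3 / s'), (b3 / s'); split; split => //.
- have : dY a b 0 = 0 by move/eqP: h2; rewrite mulf_eq0 invr_eq0 (negbTE n0C) orbF => /eqP.
  rewrite /dY /dlc /a1 /b1 => h; have -> : a / s * df 0 + b / s * dg 0 = (a * df 0 + b * dg 0) / s by field.
  by rewrite h mul0r.
- have -> : (fun x => lc f g a1 b1 x * lc f g (a3 / s') (b3 / s') x) =
     (fun x => s'^-1 * (Y a1 b1 x * Y a3 b3 x)) by apply/funext => x; rewrite /Y /lc; field.
  by rewrite cI_Z ?O13 ?mulr0//; exact: ucont_cintble (ucontM (uY a1 b1) (uY a3 b3)).
- by move=> x Ix; have := H1' x Ix; rewrite -/k -/(Y a1 b1 x); lra.
- by move=> x Ix; have := H4 x Ix; rewrite -/k -/(Y (a3 / s') (b3 / s') x); lra.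
Qed.

(** Symmetry of the operator for the bilinear form makes its matrix in an orthonormal basis
    symmetric; invariance of trace and determinant fixes the remaining entries. *)
Lemma pair_matrix a1 b1 a2 b2 :
  cI I0pi (fun x => lc f g a1 b1 x * lc f g a1 b1 x) = 1 ->
  cI I0pi (fun x => lc f g a1 b1 x * lc f g a2 b2 x) = 0 ->
  cI I0pi (fun x => lc f g a2 b2 x * lc f g a2 b2 x) = 1 ->
  exists al b : C, [/\ al ^+ 2 + b ^+ 2 = ((lp - lm) / 2) ^+ 2,
    dom v (per_of n) (lc f g a1 b1) (dlc df dg a1 b1)
      (fun x => ((lp + lm) / 2 + al) * lc f g a1 b1 x + b * lc f g a2 b2 x) &
    dom v (per_of n) (lc f g a2 b2) (dlc df dg a2 b2)
      (fun x => b * lc f g a1 b1 x + ((lp + lm) / 2 - al) * lc f g a2 b2 x)].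
Proof.
rewrite -/(Y a1 b1) -/(Y a2 b2) => N1 O12 N2.
have i11 := ucont_cintble (ucontM (uY a1 b1) (uY a1 b1)).
have i12 := ucont_cintble (ucontM (uY a1 b1) (uY a2 b2)).
have i22 := ucont_cintble (ucontM (uY a2 b2) (uY a2 b2)).
have O21 : cI I0pi (fun x => Y a2 b2 x * Y a1 b1 x) = 0 by rewrite -O12; apply: eq_cI => x _; rewrite mulrC.
have i21 : cintble I0pi (fun x => Y a2 b2 x * Y a1 b1 x) by exact: ucont_cintble (ucontM (uY a2 b2) (uY a1 b1)).
have BL (p q : C) : (forall x, p * Y a1 b1 x + q * Y a2 b2 x = 0) -> p = 0 /\ q = 0.
  move=> h; split.
    have : cI I0pi (fun x => (p * Y a1 b1 x + q * Y a2 b2 x) * Y a1 b1 x) = 0.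
      by rewrite -[RHS](cI_0 R); apply: eq_cI => x _; rewrite h mul0r.
    have -> : (fun x => (p * Y a1 b1 x + q * Y a2 b2 x) * Y a1 b1 x) =
      (fun x => p * (Y a1 b1 x * Y a1 b1 x) + q * (Y a2 b2 x * Y a1 b1 x)) by apply/funext => x; ring.
    have z1 := cintbleZ p mI i11; have z2 := cintbleZ q mI i21.
    by rewrite cI_D// !cI_Z// N1 O21 mulr1 mulr0 addr0.
  have : cI I0pi (fun x => (p * Y a1 b1 x + q * Y a2 b2 x) * Y a2 b2 x) = 0.
    by rewrite -[RHS](cI_0 R); apply: eq_cI => x _; rewrite h mul0r.
  have -> : (fun x => (p * Y a1 b1 x + q * Y a2 b2 x) * Y a2 b2 x) =
    (fun x => p * (Y a1 b1 x * Y a2 b2 x) + q * (Y a2 b2 x * Y a2 b2 x)) by apply/funext => x; ring.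
  have z1 := cintbleZ p mI i12; have z2 := cintbleZ q mI i22.
  by rewrite cI_D// !cI_Z// N2 O12 mulr1 mulr0 add0r.
pose D := a1 * b2 - b1 * a2.
(* If the determinant vanished, two orthonormal functions would be linearly dependent. *)
have D0 : D != 0.
  apply/eqP => D0.
  have [b20 /eqP] : b2 = 0 /\ - b1 = 0.
    apply: BL => x; rewrite /Y /lc; transitivity (D * f x); first by rewrite /D; ring.
    by rewrite D0 mul0r.
  rewrite oppr_eq0 => /eqP b10.
  have [a20 /eqP] : a2 = 0 /\ - a1 = 0.
    apply: BL => x; rewrite /Y /lc; transitivity (- D * g x); first by rewrite /D; ring.
    by rewrite D0 oppr0 mul0r.
  rewrite oppr_eq0 => /eqP a10.
  move/eqP: N1; rewrite a10 b10 /Y /lc.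
  rewrite -/(Y a1 b1) (_ : (fun x => _) = (fun=> 0)) ?cI_0 1?eq_sym ?oner_eq0//.
  by apply/funext => x; ring.
have [e1 e2 e3 e4 [e5 e6]] := @trace_det _ a1 b1 a2 b2 lm lp c D erefl D0.
move: e1 e2 e3 e4 e5 e6.
move: (_ / D) (_ / D) (_ / D) (_ / D) => s r q p e1 e2 e3 e4 e5 e6.
have d1 : dom v (per_of n) (Y a1 b1) (dY a1 b1) (fun x => p * Y a1 b1 x + q * Y a2 b2 x).
  apply: eq_dom (dom_lc domf domg a1 b1) => // x.
  by rewrite /Y /lc -e1 -e2; ring.
have d2 : dom v (per_of n) (Y a2 b2) (dY a2 b2) (fun x => r * Y a1 b1 x + s * Y a2 b2 x).
  apply: eq_dom (dom_lc domf domg a2 b2) => // x.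
  by rewrite /Y /lc -e3 -e4; ring.
have qr : q = r.
  have := dom_symmetric d1 d2.
  have -> : (fun x => (p * Y a1 b1 x + q * Y a2 b2 x) * Y a2 b2 x) =
    (fun x => p * (Y a1 b1 x * Y a2 b2 x) + q * (Y a2 b2 x * Y a2 b2 x)) by apply/funext => x; ring.
  have -> : (fun x => Y a1 b1 x * (r * Y a1 b1 x + s * Y a2 b2 x)) =
    (fun x => r * (Y a1 b1 x * Y a1 b1 x) + s * (Y a1 b1 x * Y a2 b2 x)) by apply/funext => x; ring.
  have z1 := cintbleZ p mI i12; have z2 := cintbleZ q mI i22.
  have z3 := cintbleZ r mI i11; have z4 := cintbleZ s mI i12.
  by rewrite !cI_D// !cI_Z// O12 N1 N2 !mulr0 !mulr1 add0r addr0.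
have two : (2 : C) != 0 by rewrite pnatr_eq0.
have lpE : lp = p + s - lm by rewrite e5; ring.
exists ((p - s) / 2), q; split.
- have : q * q = p * s - lm * lp by rewrite -e6 -qr; ring.
  by rewrite lpE !expr2 => ->; field.
- by apply: eq_dom d1 => // x; rewrite lpE; congr (_ + _); rewrite -/(Y a1 b1); field.
- by apply: eq_dom d2 => // x; rewrite lpE -qr; congr (_ + _); rewrite -/(Y a2 b2); field.
Qed.

End PairOfSpan.

Section DiscPair.
Variable R : realType.
Local Notation C := R[i].
Implicit Types (f g h y dy z dz w : R -> C) (x : R) (bc : bcond) (l nu lm lp : C) (n : nat).
Let mI := @measurable_I0pi R.
Let k : C := (kap R)%:C.
Variable v : R -> C.
Hypothesis vi : cintble I0pi v.
Let V := nI I0pi v.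

Lemma distinct_indep bc f df g dg lm lp : lm != lp -> dom v bc f df (fun x => lm * f x) ->
  dom v bc g dg (fun x => lp * g x) -> ~ aeq f (fun=> 0) -> ~ aeq g (fun=> 0) -> indep f g.
Proof.
move=> lm_lp d1 d2 f0 g0 a b h.
have e1 : aeq (fun x => a * (lm * f x) + b * (lp * g x)) (fun=> 0).
  have := dom_unique (domD (domZ a d1) (domZ b d2)) (domZ 0 d1).
  have q : aeq (fun x => a * f x + b * g x) (fun x => 0 * f x).
    by apply: aeq_trans h _; apply: aeW => x _; rewrite mul0r.
  move=> /(_ q) r; apply: aeq_trans r _.
  by apply: aeW => x _; rewrite mul0r.
have ex u w : aeq u (fun=> 0) -> aeq w (fun=> 0) -> forall c c' : C, aeq (fun x => c * u x + c' * w x) (fun=> 0).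
  by move=> uu ww c c'; apply: aeS2 uu ww => x q1 q2 Ix; rewrite q1// q2// !mulr0 addr0.
have cancel (c : C) u : ~ aeq u (fun=> 0) -> aeq (fun x => c * u x) (fun=> 0) -> c = 0.
  move=> u0 cu; apply: contrapT => /eqP c0; apply: u0; apply: aeS cu => x q Ix.
  by apply/eqP; have /eqP := q Ix; rewrite mulf_eq0 (negbTE c0).
have lml : lm - lp != 0 by rewrite subr_eq0.
split.
  have : a * (lm - lp) = 0.
    apply: (cancel _ f) => //; apply: aeS (ex _ _ e1 h 1 (- lp)) => x q Ix.
    by rewrite -[RHS](q Ix); ring.
  by move=> /eqP; rewrite mulf_eq0 (negbTE lml) orbF => /eqP.
have : b * (lp - lm) = 0.
  apply: (cancel _ g) => //; apply: aeS (ex _ _ e1 h 1 (- lm)) => x q Ix.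
  by rewrite -[RHS](q Ix); ring.
by move=> /eqP; rewrite mulf_eq0 subr_eq0 [lp == _]eq_sym (negbTE lm_lp) orbF => /eqP.
Qed.

(** Treats both kinds of spectrum in the disc at once: two simple eigenvalues give [c = 0], a double
    one the triangular form of [alg_mult2]. *)
Lemma disc_span n lm lp nu : (0 < n)%N -> V / n%:R <= 1 / 640 -> disc_eigenvalues v n lm lp nu ->
  exists f df g dg c, [/\ dom v (per_of n) f df (fun x => lm * f x),
    dom v (per_of n) g dg (fun x => lp * g x + c * f x), indep f g,
    cabs (n%:R ^+ 2 - lm) <= 6 * V & cabs (n%:R ^+ 2 - lp) <= 6 * V].
Proof.
move=> n0 Vn [[dm dp _] am _ _]; have := am _ dm; rewrite eqxx; case: eqVneq => [<-|ml] /= am1.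
  have [f [df [g [dg [c [d1 d2 ind]]]]]] := alg_mult2 vi am1.
  have f0 : ~ aeq f (fun=> 0).
    move=> f0; have [/eqP] : (1 : C) = 0 /\ (0 : C) = 0.
      by apply: ind; apply: aeS f0 => x q Ix; rewrite q// mulr0 mul0r addr0.
    by rewrite oner_eq0.
  have b := eigen_per_apriori vi n0 Vn dm d1 f0.
  by exists f, df, g, dg, c; split.
have := am _ dp; rewrite eqxx (negbTE (_ : lp != lm)) 1?eq_sym// => am2.
have [f [df [d1 f0 _]]] := alg_mult1 vi am1; have [g [dg [d2 g0 _]]] := alg_mult1 vi am2.
exists f, df, g, dg, 0; split.
- by [].
- by apply: eq_dom d2 => // x; rewrite mul0r addr0.
- exact: distinct_indep ml d1 d2 f0 g0.
- exact: (eigen_per_apriori vi n0 Vn dm d1 f0).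
- exact: (eigen_per_apriori vi n0 Vn dp d2 g0).
Qed.

(** As [y'(0) = 0], the amplitude at 0 is [y 0] alone, so it cannot vanish and may be normalized to
    [kap]. The constant 1080 is three times the 360 of [span_approx]. *)
Lemma disc_neumann n lm lp nu : (0 < n)%N -> V / n%:R <= 1 / 640 -> disc_eigenvalues v n lm lp nu ->
  exists y dy, dom v Neu y dy (fun x => nu * y x) /\
    forall x, I0pi x -> cabs (y x - k * cn n x) <= 1080 * (V / n%:R).
Proof.
move=> n0 Vn [[_ _ dn] _ am _]; have := am _ dn; rewrite eqxx => am1.
have [y [dy [d y0 _]]] := alg_mult1 vi am1; have [sy [dy0 _] _] := d.
have nuV := eigen_neu_apriori vi n0 Vn dn d y0.
have [Y Y0 [yY [x1 Ix1 YE]]] := exists_sup (sol2_ucont sy).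
have V0 : 0 <= V by exact: V_ge0.
have n0R : 0 < (n%:R : R) by rewrite ltr0n.
have X0 : 0 <= V / n%:R by rewrite divr_ge0// ltW.
have c0 : cabs (0 : C) <= 0 by rewrite cabs0.
have d' : dom v Neu y dy (fun x => nu * y x + 0) by apply: eq_dom d => // x; rewrite addr0.
have H x : I0pi x -> cabs (y x - (y 0 * cn n x + 0 * sn n x)) <= 387 * (V / n%:R) * Y.
  move=> Ix; have := wave_approx vi n0 d' (@ucont_cst R 0) nuV yY (fun x _ => c0) Ix.
  rewrite dy0 mul0r => /le_trans; apply.
  rewrite -/V; have -> : n%:R^-1 * (Y * V + (118 * V * Y + 0) * (49 / 15)) = V / n%:R * Y * (5797 / 15).
    by field; rewrite gt_eqF.
  have : 0 <= V / n%:R * Y by rewrite mulr_ge0.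
  by rewrite -mulrA; move: (V / n%:R * Y) => Z Z0; lra.
have h1 := wave_norm H Ix1; rewrite -YE cabs0 addr0 in h1.
have h2 : 387 * (V / n%:R) * Y <= 39 / 64 * Y.
  by rewrite ler_wpM2r//; move: Vn; move: (V / n%:R) => Z; lra.
have YA : Y <= 13 / 5 * cabs (y 0) by lra.
have A0 : y 0 != 0.
  rewrite -cabs_gt0 lt_def cabs_ge0 andbT; apply/eqP => A0; apply: y0; apply: aeW => x Ix.
  apply/eqP; rewrite -cabs_eq0 eq_le cabs_ge0 andbT; apply: (le_trans (yY _ Ix)).
  by rewrite A0 mulr0 in YA.
exists (fun x => k / y 0 * y x), (fun x => k / y 0 * dy x); split.
  by apply: eq_dom (domZ (k / y 0) d) => // x; ring.
move=> x Ix; have -> : k / y 0 * y x - k * cn n x = k * ((y x - (y 0 * cn n x + 0 * sn n x)) / y 0) by field.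
rewrite cabsM; have : cabs k <= 1 by rewrite cabs_real ger0_norm ?kap_le1// kap_ge0.
move=> k1; apply: (@le_trans _ _ (1 * cabs ((y x - (y 0 * cn n x + 0 * sn n x)) / y 0))).
  by rewrite ler_wpM2r// cabs_ge0.
rewrite mul1r cabsM cabsV ler_pdivrMr ?cabs_gt0//; apply: (le_trans (H _ Ix)).
apply: (@le_trans _ _ (387 * (V / n%:R) * (13 / 5 * cabs (y 0)))).
  by apply: ler_wpM2l; [rewrite mulr_ge0 ?ler0n|].
have : 0 <= V / n%:R * cabs (y 0) by rewrite mulr_ge0// cabs_ge0.
have -> : 387 * (V / n%:R) * (13 / 5 * cabs (y 0)) = V / n%:R * cabs (y 0) * (387 * 13 / 5) by ring.
by rewrite -mulrA; move: (V / n%:R * cabs (y 0)) => Z Z0; lra.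
Qed.

Lemma neumann_shift (p q b s : C) (e : R) : 0 <= e -> e <= 1 / 500 -> s * p = b * q ->
  cabs (p - 1) <= 210 * e -> cabs q <= 210 * e -> cabs s <= 420 * e * cabs b.
Proof.
move=> e0 e1 sp p1 qe; have pl : 1 / 2 <= cabs p.
  by have := cabsB p (p - 1); rewrite subKr cabs1; lra.
have h : cabs s * cabs p = cabs b * cabs q by rewrite -!cabsM sp.
have h1 : cabs s * (1 / 2) <= cabs s * cabs p by rewrite ler_wpM2l// cabs_ge0.
have h2 : cabs b * cabs q <= cabs b * (210 * e) by rewrite ler_wpM2l// cabs_ge0.
rewrite mulrC; have -> : cabs b * (420 * e) = 2 * (cabs b * (210 * e)) by ring.
by lra.
Qed.

Lemma small_quadratic210 (E : R) : 0 <= E -> E <= 1 / 500 ->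
  (60 * E * (1 + 3 * E) + 1 * (3 * E)) * (49 / 15) <= 210 * E.
Proof.
move=> E0 E1; have : E * E <= 1 / 500 * E by rewrite ler_wpM2r.
have -> : 60 * E * (1 + 3 * E) + 1 * (3 * E) = 63 * E + 180 * (E * E) by ring.
by move: (E * E) => EE; lra.
Qed.

Lemma disc_pair n lm lp nu : let e := 360 * (V / n%:R) in
  (0 < n)%N -> e <= 1 / 500 -> disc_eigenvalues v n lm lp nu ->
  exists G dG H dH al b,
  [/\ dom v (per_of n) G dG (fun x => ((lp + lm) / 2 + al) * G x + b * H x),
      dom v (per_of n) H dH (fun x => b * G x + ((lp + lm) / 2 - al) * H x),
      cI I0pi (fun x => G x * G x) = 1, cI I0pi (fun x => G x * H x) = 0 &
      cI I0pi (fun x => H x * H x) = 1] /\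
  [/\ al ^+ 2 + b ^+ 2 = ((lp - lm) / 2) ^+ 2,
      cabs (nu - (lp + lm) / 2 - al) <= 420 * e * cabs b,
      forall x, I0pi x -> cabs (G x - k * cn n x) <= 60 * e &
      forall x, I0pi x -> cabs (H x - k * sn n x) <= 60 * e].
Proof.
move=> e n0 e1 de.
have V0 : 0 <= V by exact: V_ge0.
have n0R : 0 < (n%:R : R) by rewrite ltr0n.
have X0 : 0 <= V / n%:R by rewrite divr_ge0// ltW.
have e0 : 0 <= e by rewrite mulr_ge0 ?ler0n.
have Vn : V / n%:R <= 1 / 640 by move: e1; rewrite /e; move: (V / n%:R) => Z; lra.
have [f [df [g [dg [c [d1 d2 ind lm6 lp6]]]]]] := disc_span n0 Vn de.
have app := span_approx vi n0 Vn d1 d2 lm6 lp6.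
have e2 : e <= 1 / 200 by lra.
have [a1 [b1 [a2 [b2 [[G0 N1 O12 N2] [sG sH]]]]]] := pair_functions n0 d1 d2 ind e0 e2 app.
have [al [b [alb dG dH]]] := pair_matrix d1 d2 N1 O12 N2.
exists (lc f g a1 b1), (dlc df dg a1 b1), (lc f g a2 b2), (dlc df dg a2 b2), al, b.
split; first by split.
split => //.
have [y [dy [dY yE]]] := disc_neumann n0 Vn de.
have {}yE x : I0pi x -> cabs (y x - k * cn n x) <= 3 * e.
  by move=> Ix; have := yE x Ix; rewrite /e; move: (V / n%:R) => Z; lra.
set G := lc f g a1 b1 in N1 O12 sG dG dH *; set H := lc f g a2 b2 in O12 N2 sH dG dH *.
(* Periodicity or antiperiodicity carries [G' = 0] from 0 to [pi]. *)
have dGn : dom v Neu G (dlc df dg a1 b1) (fun x => ((lp + lm) / 2 + al) * G x + b * H x).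
  case: dG => s bcG l2; split => //; split => //; move: bcG; rewrite /per_of; case: (odd n) => -[_].
    by rewrite G0 => /eqP; rewrite eq_sym oppr_eq0 => /eqP.
  by rewrite G0.
have uG : ucont G by case: dG => s _ _; exact: sol2_ucont s.
have uH : ucont H by case: dH => s _ _; exact: sol2_ucont s.
have uy : ucont y by case: dY => s _ _; exact: sol2_ucont s.
have uc : ucont (fun x => k * cn n x) by apply: ucontZ; exact: ucont_cn.
have us : ucont (fun x => k * sn n x) by apply: ucontZ; exact: ucont_sn.
have k1 : cabs k <= 1 by rewrite cabs_real ger0_norm ?kap_le1// kap_ge0.
have kc1 x : I0pi x -> cabs (k * cn n x) <= 1.
  by move=> _; rewrite cabsM mulr_ile1 ?cabs_ge0// cn_le1.
have ks1 x : I0pi x -> cabs (k * sn n x) <= 1.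
  by move=> _; rewrite cabsM mulr_ile1 ?cabs_ge0// sn_le1.
have y1 x : I0pi x -> cabs (y x) <= 1 + 3 * e.
  move=> Ix; have := cabsD (y x - k * cn n x) (k * cn n x); rewrite subrK.
  by have := yE x Ix; have := kc1 x Ix; lra.
have GY : cabs (cI I0pi (fun x => G x * y x) - 1) <= 210 * e.
  have -> : 1 = cI I0pi (fun x => (k * cn n x) * (k * cn n x)).
    have -> : (fun x => (k * cn n x) * (k * cn n x)) = (fun x => (k * k) * (cn n x * cn n x)) by apply/funext => x; ring.
    rewrite cI_Z//; last by apply: ucont_cintble; apply: ucontM; exact: ucont_cn.
    by rewrite cI_cn2// kap_half.
  apply: (le_trans (product_approx uG uy uc uc sG yE kc1 y1)).
  exact: small_quadratic210.
have HY : cabs (cI I0pi (fun x => H x * y x)) <= 210 * e.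
  rewrite -[cI I0pi _]subr0.
  have -> : 0 = cI I0pi (fun x => (k * sn n x) * (k * cn n x)).
    have -> : (fun x => (k * sn n x) * (k * cn n x)) = (fun x => (k * k) * (cn n x * sn n x)) by apply/funext => x; ring.
    rewrite cI_Z//; last by apply: ucont_cintble; apply: ucontM; [exact: ucont_cn|exact: ucont_sn].
    by rewrite cI_cn_sn// mulr0.
  apply: (le_trans (product_approx uH uy us uc sH yE ks1 y1)).
  exact: small_quadratic210.
(* It remains to prove the exact identity [(nu - m - al) B(G, y) = b B(H, y)] for the Neumann
   eigenfunction [y], where [B(G, y)] is close to 1 and [B(H, y)] to 0. *)
apply: neumann_shift e0 e1 _ GY HY.
have := dom_symmetric dGn dY.
have iG := ucont_cintble (ucontM uG uy); have iH := ucont_cintble (ucontM uH uy).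
set m := (lp + lm) / 2.
have -> : (fun x => ((m + al) * G x + b * H x) * y x) =
   (fun x => (m + al) * (G x * y x) + b * (H x * y x)) by apply/funext => x; ring.
have -> : (fun x => G x * (nu * y x)) = (fun x => nu * (G x * y x)) by apply/funext => x; ring.
have z1 := cintbleZ (m + al) mI iG; have z2 := cintbleZ b mI iH.
rewrite cI_D// !cI_Z//; move: (cI _ _) (cI _ _) => p q h.
have -> : (nu - m - al) * q = nu * q - (m + al) * q by ring.
by rewrite -h; ring.
Qed.

End DiscPair.

(** * Completeness of the trigonometric systems *)

Section TrigTotality.
Variable R : realType.
Local Notation C := R[i].
Local Notation mu := (@lebesgue_measure R).
Implicit Types (f g Y : R -> C) (x t s : R) (n m : nat) (w z : int).
Let mI := @measurable_I0pi R.
Let i0 : 'i != 0 :> C. Proof. by rewrite eq_complex /= oner_eq0 andbF. Qed.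

Definition cis s : C := cos s +i* sin s.

Lemma cisD s t : cis (s + t) = cis s * cis t.
Proof. by rewrite /cis cosD sinD; apply: complex_eq; rewrite ?cReM ?cImM /=; ring. Qed.

Definition em w t : C := cis (w%:~R * t).

Lemma emD w z t : em (w + z) t = em w t * em z t.
Proof. by rewrite /em intrD mulrDl cisD. Qed.

Lemma em0 t : em 0 t = 1.
Proof. by rewrite /em mul0r /cis cos0 sin0. Qed.

Lemma emE w : exists c : C, forall t, em w t = cn `|w|%N t + c * sn `|w|%N t.
Proof.
case: w => n; [exists 'i|exists (- 'i)] => t; rewrite /em /cis /cn /sn.
  by apply: complex_eq; rewrite ?cReD ?cImD ?cReM ?cImM /=; ring.
rewrite NegzE intrN mulNr cosN sinN.
by apply: complex_eq; rewrite ?cReD ?cImD ?cReM ?cImM /=; ring.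
Qed.

Lemma hd_em w t : hd (em w) t ('i * w%:~R * em w t).
Proof.
have H n : hd (fun s => cn n s + 'i * sn n s) t ('i * n%:R * (cn n t + 'i * sn n t)).
  have := hdD (hd_cn n t) (hdZ 'i (hd_sn n t)); congr hd.
  have i2 : 'i * 'i = -1 :> C by rewrite -expr2 sqr_i.
  rewrite mulrDr; have -> : 'i * n%:R * ('i * sn n t) = ('i * 'i) * n%:R * sn n t by ring.
  by rewrite i2; ring.
have H' n : hd (fun s => cn n s - 'i * sn n s) t (- 'i * n%:R * (cn n t - 'i * sn n t)).
  have := hdB (hd_cn n t) (hdZ 'i (hd_sn n t)); congr hd.
  have i2 : 'i * 'i = -1 :> C by rewrite -expr2 sqr_i.
  rewrite mulrBr; have -> : - 'i * n%:R * ('i * sn n t) = - ('i * 'i) * n%:R * sn n t by ring.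
  by rewrite i2; ring.
case: w => n.
  have -> : em (Posz n) = (fun s => cn n s + 'i * sn n s) by apply/funext => s; rewrite /em /cis /cn /sn;
    apply: complex_eq; rewrite ?cReD ?cImD ?cReM ?cImM /=; ring.
  exact: H.
have -> : em (Negz n) = (fun s => cn n.+1 s - 'i * sn n.+1 s).
  apply/funext => s; rewrite /em /cis /cn /sn NegzE intrN mulNr cosN sinN;
  by apply: complex_eq; rewrite ?cReD ?cImD ?cReN ?cImN ?cReM ?cImM /=; ring.
by have := H' n.+1; rewrite NegzE intrN mulrN mulNr.
Qed.

Lemma ucont_em w : ucont (em w).
Proof.
have [c h] := emE w; rewrite (funext h).
by apply: ucontD; [exact: ucont_cn|apply: ucontZ; exact: ucont_sn].
Qed.

Definition bump x0 (d : R) t : R := 1 + cos (2 * (t - x0)) - cos (2 * d).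

Lemma bump_em x0 d t : (bump x0 d t)%:C =
  (1 - cos (2 * d))%:C * em 0 t + (cis (- (2 * x0)) / 2) * em 2 t + (cis (2 * x0) / 2) * em (- 2) t.
Proof.
have -> : (cis (- (2 * x0)) / 2) * em 2 t = cis (2 * (t - x0)) / 2.
  by rewrite mulrAC -cisD; congr (cis _ / _); ring.
have -> : (cis (2 * x0) / 2) * em (- 2) t = cis (- (2 * (t - x0))) / 2.
  by rewrite mulrAC -cisD; congr (cis _ / _); rewrite rmorphN /=; ring.
rewrite em0 mulr1 -addrA -[X in _ = _ + X]mulrDl /cis cosN sinN /bump.
have -> : cos (2 * (t - x0)) +i* sin (2 * (t - x0)) + cos (2 * (t - x0)) +i* - sin (2 * (t - x0))
  = (cos (2 * (t - x0)))%:C * 2.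
  apply: complex_eq; rewrite ?cReD ?cImD ?cReM ?cImM /=; ring.
rewrite mulfK ?pnatr_eq0// -rmorphD/=; congr _%:C; ring.
Qed.

Lemma ucont_bump x0 d m : ucont (fun t => (bump x0 d t)%:C ^+ m).
Proof.
elim: m => [|m IH]; first by under eq_fun do rewrite expr0; exact: ucont_cst.
under eq_fun do rewrite exprS; apply: ucontM => //.
under eq_fun do rewrite bump_em.
by apply: ucontD; [apply: ucontD|]; apply: ucontZ; exact: ucont_em.
Qed.

(** Multiplying by [bump] shifts an even frequency by 0, 2 or -2, so orthogonality to all even
    frequencies is preserved. *)
Lemma bump_orth Y x0 d m w : ucont Y -> (forall z, cI I0pi (fun t => Y t * em (2 * z) t) = 0) ->
  cI I0pi (fun t => Y t * (bump x0 d t)%:C ^+ m * em (2 * w) t) = 0.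
Proof.
move=> uY h; elim: m w => [|m IH] w.
  by rewrite -[RHS](h w); apply: eq_cI => t _; rewrite expr0 mulr1.
have -> : (fun t => Y t * (bump x0 d t)%:C ^+ m.+1 * em (2 * w) t) = (fun t =>
   (1 - cos (2 * d))%:C * (Y t * (bump x0 d t)%:C ^+ m * em (2 * w) t) +
   (cis (- (2 * x0)) / 2) * (Y t * (bump x0 d t)%:C ^+ m * em (2 * (w + 1)) t) +
   (cis (2 * x0) / 2) * (Y t * (bump x0 d t)%:C ^+ m * em (2 * (w - 1)) t)).
  apply/funext => t; rewrite exprSr.
  have e1 : em (2 * (w + 1)) t = em (2 * w) t * em 2 t by rewrite -emD mulrDr mulr1.
  have e2 : em (2 * (w - 1)) t = em (2 * w) t * em (- 2) t by rewrite -emD mulrDr mulrN1.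
  by rewrite e1 e2 [X in _ * (_ * X)]bump_em em0; ring.
have i z c : cintble I0pi (fun t => c * (Y t * (bump x0 d t)%:C ^+ m * em (2 * z) t)).
  apply: cintbleZ => //; apply: ucont_cintble; apply: ucontM; last exact: ucont_em.
  by apply: ucontM => //; exact: ucont_bump.
have i1 := cintbleD mI (i w (1 - cos (2 * d))%:C) (i (w + 1) (cis (- (2 * x0)) / 2)).
have ii z := i z 1.
have j z : cintble I0pi (fun t => Y t * (bump x0 d t)%:C ^+ m * em (2 * z) t).
  by have := ii z; under eq_fun do rewrite mul1r.
by rewrite !cI_D// !cI_Z// !IH !mulr0 !addr0.
Qed.

Lemma cos_le_cos (a b : R) : 0 <= a -> a <= b -> b <= pi -> cos b <= cos a.
Proof.
move=> a0 ab bp; rewrite le_eqVlt; have [->|ne] := eqVneq a b; first by rewrite eqxx.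
apply/orP; right; rewrite ltr_cos ?in_itv/= ?a0 ?bp ?(le_trans ab) ?(le_trans a0)//.
by rewrite lt_neqAle ne.
Qed.

Lemma cos2_norm x0 t : cos (2 * (t - x0)) = cos (2 * `|t - x0|).
Proof. by case: (ger0P (t - x0)) => // _; rewrite mulrN cosN. Qed.

Lemma bump_far x0 d t : 0 < d -> d <= x0 -> x0 <= pi - d -> I0pi t -> d <= `|t - x0| ->
  `|bump x0 d t| <= 1.
Proof.
move=> d0 dx xd; rewrite I0piE => /andP[t0 tp] dt.
have up : `|t - x0| <= pi - d by rewrite ler_norml; apply/andP; split; lra.
have h : cos (2 * (t - x0)) <= cos (2 * d).
  rewrite cos2_norm; move: (`|t - x0|) dt up => u dt up.
  have [uh|uh] := leP (2 * u) pi; first by apply: cos_le_cos => //; lra.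
  (* Beyond half a period the cosine is reflected, which is where [x0] must keep the distance [d]
     from both ends. *)
  have -> : cos (2 * u) = cos (pi *+ 2 - 2 * u) by rewrite addrC cosD2pi cosN.
  by apply: cos_le_cos; rewrite mulr2n; lra.
rewrite /bump ler_norml; apply/andP; split; last by lra.
by have := cos_geN1 (2 * (t - x0)); have := cos_le1 (2 * d); lra.
Qed.

Lemma bump_near x0 d t : 0 < d -> d <= pi / 2 -> `|t - x0| <= d -> 1 <= bump x0 d t.
Proof.
move=> d0 dp td; rewrite /bump cos2_norm.
have : cos (2 * d) <= cos (2 * `|t - x0|) by apply: cos_le_cos; rewrite ?mulr_ge0//; lra.
by lra.
Qed.

Lemma bump_center x0 d t : 0 < d -> d <= pi / 2 -> `|t - x0| <= d / 2 ->
  1 + (cos d - cos (2 * d)) <= bump x0 d t.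
Proof.
move=> d0 dp td; rewrite /bump cos2_norm.
have : cos d <= cos (2 * `|t - x0|) by apply: cos_le_cos; rewrite ?mulr_ge0//; lra.
by lra.
Qed.

Lemma bernoulli (r : R) m : 0 <= r -> 1 + m%:R * r <= (1 + r) ^+ m.
Proof.
move=> r0; elim: m => [|m IH]; first by rewrite mul0r addr0 expr0.
rewrite exprS; apply: le_trans (ler_wpM2l _ IH); last by lra.
rewrite -natr1; have : 0 <= m%:R * (r * r) by rewrite !mulr_ge0.
have -> : (1 + r) * (1 + m%:R * r) = 1 + (m%:R + 1) * r + m%:R * (r * r) by ring.
by lra.
Qed.

Lemma nI_ge (a b K : R) f : 0 <= K -> 0 <= a -> a <= b -> b <= pi -> cintble I0pi f ->
  (forall x, a <= x <= b -> K <= cabs (f x)) -> K * (b - a) <= nI I0pi f.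
Proof.
move=> K0 a0 ab bp fi H; apply: le_trans (nI_sub a0 bp fi).
have mab : measurable (`[a, b]%classic : set R) by exact: measurable_itv.
have sub : `[a, b]%classic `<=` (I0pi : set R) by exact: sub_itvI0pi.
apply: (@le_trans _ _ (\int[mu]_(x in `[a, b]) K)).
  rewrite Rintegral_cst//; have := lebesgue_measure_itv (`[a, b]%R : interval R); rewrite /= lte_fin => ->.
  by case: ifP => // h; move: ab; rewrite le_eqVlt h orbF => /eqP ->; rewrite subrr.
apply: le_Rintegral => //; first exact: rint_cst.
  by apply: cintble_cabs => //; exact: cintbleS fi.
Qed.

(* If Re Y x0 > 0, the powers of a trigonometric polynomial that exceeds 1 only
   near x0 make the integral of Re Y against them tend to infinity. *)
Lemma orth_nonpos Y x0 : ucont Y -> 0 < x0 -> x0 < pi ->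
  (forall z, cI I0pi (fun t => Y t * em (2 * z) t) = 0) -> complex.Re (Y x0) <= 0.
Proof.
move=> uY x00 x0p orth; rewrite leNgt; apply/negP => a0.
set a := complex.Re (Y x0) in a0.
have Ix0 : I0pi x0 by rewrite I0piE !ltW.
have a20 : 0 < a / 2 by lra.
have [d1 d10 H1] := uY _ a20.
have [M M0 YM] := ucont_bdd uY.
pose m1 : R := Num.min x0 (pi - x0).
pose d : R := Num.min (d1 / 2) m1.
have d0 : 0 < d by rewrite !lt_min x00 subr_gt0 x0p divr_gt0.
have dd1 : d <= d1 / 2 by rewrite ge_min lexx.
have dm : d <= m1 by rewrite ge_min lexx orbT.
have dx : d <= x0 by apply: (le_trans dm); rewrite ge_min lexx.
have xd : x0 <= pi - d by have : d <= pi - x0 by [apply: (le_trans dm); rewrite ge_min lexx orbT]; lra.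
have near t : I0pi t -> `|t - x0| <= d -> a / 2 <= complex.Re (Y t).
  move=> It td; have := H1 x0 t Ix0 It (le_lt_trans td (ltac:(lra) : d < d1)).
  have := Re_le_cabs (Y t - Y x0); rewrite cReD cReN -/a.
  by have := ler_norm (- (complex.Re (Y t) - a)); rewrite normrN; lra.
have dp : d <= pi / 2 by lra.
pose r := cos d - cos (2 * d).
have r0 : 0 < r by rewrite subr_gt0 ltr_cos ?in_itv/=; [lra|apply/andP; split; lra..].
have main m : (a / 2 * (1 + m%:R * r)) * d <= M * pi.
  pose q t := bump x0 d t ^+ m.
  have uq : ucont (fun t => Y t * (bump x0 d t)%:C ^+ m) by apply: ucontM => //; exact: ucont_bump.
  (* Adding [M] makes the integrand nonnegative, because the oscillating factor has modulus at most
     1 wherever [Re Y] may be negative; its integral is [M pi] by orthogonality. *)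
  pose G t : C := (complex.Re (Y t) * q t + M)%:C.
  have G0 t : I0pi t -> 0 <= complex.Re (Y t) * q t + M.
    move=> It; have [td|/ltW td] := leP `|t - x0| d.
      apply: addr_ge0 => //; apply: mulr_ge0; first by have := near t It td; lra.
      by rewrite exprn_ge0//; have := bump_near d0 dp td; lra.
    have q1 : `|q t| <= 1 by rewrite normrX exprn_ile1// bump_far.
    have : `|complex.Re (Y t) * q t| <= M * 1.
      by rewrite normrM ler_pM//; apply: le_trans (Re_le_cabs _) (YM _ It).
    by have := ler_norm (- (complex.Re (Y t) * q t)); rewrite normrN; lra.
  have ReE t : complex.Re (Y t * (bump x0 d t)%:C ^+ m) = complex.Re (Y t) * q t.
    by rewrite -(rmorphXn (real_complex R)) cReM /= mulr0 subr0.
  have iq := ucont_cintble uq.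
  have iM := ucont_cintble (@ucont_cst R M%:C).
  have iG : cintble I0pi G.
    have [h1 h2] := cintbleD mI iq iM.
    split; first by move: h1; congr rint; apply/funext => t; rewrite cReD ReE.
    exact: (iM.2).
  have <- : nI I0pi G = M * pi.
    have := orth 0; have := cI_D mI iq iM.
    have -> : cI I0pi (fun t => Y t * (bump x0 d t)%:C ^+ m) = 0.
      by rewrite -(bump_orth x0 d m 0 uY orth); apply: eq_cI => t _; rewrite mulr0 em0 mulr1.
    rewrite cI_cst add0r => /(congr1 (@complex.Re R)).
    rewrite cReM /= mulr0 subr0 => <- _; apply: eq_Rintegral => t.
    by rewrite inE => It; rewrite /G cabs_real ger0_norm ?G0// cReD ReE.
  have -> : d = (x0 + d / 2) - (x0 - d / 2) by lra.
  apply: nI_ge => //; try lra.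
    by rewrite mulr_ge0 ?(ltW a20)// addr_ge0// mulr_ge0// ltW.
  move=> t /andP[t1 t2].
  have It : I0pi t by rewrite I0piE; apply/andP; split; lra.
  have td : `|t - x0| <= d / 2 by rewrite ler_norml; apply/andP; split; lra.
  rewrite /G cabs_real ger0_norm ?G0//.
  apply: (@le_trans _ _ (complex.Re (Y t) * q t)); last by lra.
  apply: ler_pM; first by lra.
  - by rewrite addr_ge0// mulr_ge0// ltW.
  - by apply: near => //; lra.
  apply: (le_trans (bernoulli m (ltW r0))).
  have bc := bump_center d0 dp td; rewrite -/r in bc.
  by apply: lerXn2r => //; rewrite nnegrE; lra.
have c0 : 0 < a / 2 * r * d by rewrite !mulr_gt0.
have := archi_boundP (divr_ge0 (mulr_ge0 M0 (ltW (pi_gt0 R))) (ltW c0)).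
set m := Num.bound _; rewrite ltr_pdivrMr// => hm.
have := main m; have : 0 < a / 2 * d by rewrite mulr_gt0.
have -> : a / 2 * (1 + m%:R * r) * d = a / 2 * d + m%:R * (a / 2 * r * d) by ring.
by lra.
Qed.

Lemma orth_zero Y x : ucont Y ->
  (forall z, cI I0pi (fun t => Y t * em (2 * z) t) = 0) -> 0 < x < pi -> Y x = 0.
Proof.
move=> uY orth /andP[x0 xp]; apply/eqP; rewrite -cabs_eq0 eq_le cabs_ge0 andbT.
have [u u1 uE] := cphase (Y x).
have uu : ucont (fun t => u * Y t) by exact: ucontZ.
have := @orth_nonpos (fun t => u * Y t) x uu x0 xp; rewrite uE /=; apply => z.
have -> : (fun t => u * Y t * em (2 * z) t) = (fun t => u * (Y t * em (2 * z) t)).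
  by apply/funext => t; rewrite mulrA.
by rewrite cI_Z ?orth ?mulr0//; apply: ucont_cintble; apply: ucontM => //; exact: ucont_em.
Qed.

Lemma acd_em w : acd (em w) (fun t => 'i * w%:~R * em w t).
Proof. by apply: acd_C1 => [t _|]; [exact: hd_em|apply: ucontZ; exact: ucont_em]. Qed.

Lemma em_pi z : em (2 * z) pi = 1.
Proof.
have h n : cn n pi = (-1) ^+ n :> C by exact: cn_pi.
have [c ->] := emE (2 * z); rewrite sn_pi mulr0 addr0 h abszM /= exprM sqrrN expr1n.
by rewrite expr1n.
Qed.

Lemma em_0 z : em z 0 = 1.
Proof. by rewrite /em mulr0 /cis cos0 sin0. Qed.

(** Passes to the primitive, which is continuous. Orthogonality to constants gives [F pi = 0], so
    integration by parts leaves no boundary term; after subtraction of its mean, [F] is orthogonal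
    to all even frequencies, hence constant. *)
Lemma fourier_total_even f : cintble I0pi f ->
  (forall z, cI I0pi (fun t => f t * em (2 * z) t) = 0) -> aeq f (fun=> 0).
Proof.
move=> fi orth; pose F := prim f; have aF : acd F f by exact: acd_prim.
have Fpi : F pi = 0.
  have := acd_cI aF; rewrite {2}/F prim0 subr0 => <-.
  by rewrite -(orth 0); apply: eq_cI => t _; rewrite mulr0 em0 mulr1.
have uF := acd_ucont aF.
have orthF z : z != 0 -> cI I0pi (fun t => F t * em (2 * z) t) = 0.
  move=> z0; have := acd_cI (acdM aF (acd_em (2 * z))).
  rewrite Fpi mul0r {2}/F prim0 mul0r subr0.
  have i1 : cintble I0pi (fun t => f t * em (2 * z) t).
    apply: eq_cintble (ucontM_cintble (ucont_em (2 * z)) fi) => // t _; by rewrite mulrC.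
  have i2 := ucont_cintble (ucontM uF (ucont_em (2 * z))).
  have -> : (fun t => f t * em (2 * z) t + F t * ('i * (2 * z)%:~R * em (2 * z) t)) =
    (fun t => f t * em (2 * z) t + ('i * (2 * z)%:~R) * (F t * em (2 * z) t)).
    by apply/funext => t; ring.
  rewrite cI_D//; last exact: cintbleZ.
  rewrite cI_Z// orth add0r => /eqP; rewrite !mulf_eq0 (negbTE i0) intr_eq0 mulf_eq0 (negbTE z0) /=.
  by move/eqP.
pose c := cI I0pi F / (pi : R)%:C.
have pi0 : (pi : R)%:C != 0 by rewrite -cabs_eq0 cabs_real normr_eq0 gt_eqF// pi_gt0.
have iF := ucont_cintble uF.
have orthc z : cI I0pi (fun t => (F t - c) * em (2 * z) t) = 0.
  have ie := ucont_cintble (ucont_em (2 * z)).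
  have iFe := ucont_cintble (ucontM uF (ucont_em (2 * z))).
  have -> : (fun t => (F t - c) * em (2 * z) t) = (fun t => F t * em (2 * z) t - c * em (2 * z) t).
    by apply/funext => t; ring.
  rewrite cI_B//; last exact: cintbleZ.
  rewrite cI_Z//; have [->|z0] := eqVneq z 0.
    have -> : (fun t => F t * em (2 * 0) t) = F by apply/funext => t; rewrite mulr0 em0 mulr1.
    have -> : em (2 * 0) = (fun=> 1) by apply/funext => t; rewrite mulr0 em0.
    by rewrite cI_cst mul1r /c divfK// subrr.
  rewrite orthF//; have := acd_cI (acd_em (2 * z)).
  rewrite em_pi em_0 subrr cI_Z// => /eqP; rewrite !mulf_eq0 (negbTE i0) intr_eq0 mulf_eq0 (negbTE z0) /=.
  by move=> /eqP ->; rewrite mulr0 subrr.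
have uc : ucont (fun t => F t - c) by apply: ucontB => //; exact: ucont_cst.
have Fc x : 0 < x < pi -> F x - c = 0 by exact: (orth_zero uc orthc).
have [_ dF _] := aF.
have [Fc' Fe] : (fun t => F t - c) 0 = 0 /\ forall x, I0pi x -> F x - c = 0.
  have all x : I0pi x -> F x - c = 0.
    apply: (ucont_aeq0 uc).
    apply: aeS2 (ae_neq 0) (ae_neq pi) => t t0 tp; rewrite I0piE => /andP[h1 h2].
    by apply: Fc; rewrite !lt_neqAle h1 h2 tp eq_sym t0.
  by split => //; apply: all; exact: I0pi_0.
apply: aeS dF => x hx Ix; apply: (hd_unique Ix (hx Ix)).
apply: (@eq_hd _ (fun=> c)) => //; last exact: hd_cst.
by move=> t It; apply/esym/eqP; rewrite -subr_eq0 Fe.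
Qed.

(* Multiplication by e^{ipt} turns the frequencies of parity p into the even ones. *)
Lemma fourier_total p f : cintble I0pi f ->
  (forall n, odd n = odd p -> cI I0pi (fun t => f t * cn n t) = 0 /\ cI I0pi (fun t => f t * sn n t) = 0) ->
  aeq f (fun=> 0).
Proof.
move=> fi orth; have ifs u : ucont u -> cintble I0pi (fun t => f t * u t).
  by move=> uu; apply: eq_cintble (ucontM_cintble uu fi) => // t _; rewrite mulrC.
have : aeq (fun t => f t * em p t) (fun=> 0).
  apply: fourier_total_even; first by apply: ifs; exact: ucont_em.
  move=> z; have [c cE] := emE (Posz p + 2 * z).
  have -> : (fun t => f t * em p t * em (2 * z) t) =
     (fun t => f t * cn `|(Posz p + 2 * z)%R|%N t + c * (f t * sn `|(Posz p + 2 * z)%R|%N t)).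
    by apply/funext => t; rewrite -mulrA -emD cE; ring.
  have [q1 q2] : cI I0pi (fun t => f t * cn `|(Posz p + 2 * z)%R|%N t) = 0 /\
    cI I0pi (fun t => f t * sn `|(Posz p + 2 * z)%R|%N t) = 0.
    apply: orth; lia.
  rewrite cI_D//; [|exact: (ifs _ (ucont_cn _))|apply: cintbleZ => //; exact: (ifs _ (ucont_sn _))].
  by rewrite cI_Z ?q1 ?q2 ?mulr0 ?addr0//; exact: (ifs _ (ucont_sn _)).
apply: aeS => t h It; have := h It => /eqP; rewrite mulf_eq0 => /orP[/eqP //|/eqP e].
have : em p t * em (- Posz p) t = 1 by rewrite -emD subrr em0.
by rewrite e mul0r => /esym/eqP; rewrite oner_eq0.
Qed.

End TrigTotality.

(** * Orthonormal trigonometric bases of a given parity *)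

Section TrigBasis.
Variable R : realType.
Local Notation C := R[i].
Local Notation H := (L2H R).
Implicit Types (f g y dy : R -> C) (x t : R) (n m j k : nat) (p : bool).
Let mI := @measurable_I0pi R.

Lemma cI_distinct_freq bc n m y dy g dg : n != m ->
  sol2 y dy (fun x => - n%:R ^+ 2 * y x) -> sol2 g dg (fun x => - m%:R ^+ 2 * g x) ->
  satisfies_bc bc y dy -> satisfies_bc bc g dg -> cI I0pi (fun x => y x * g x) = 0.
Proof.
move=> nm sy sg by_ bg; have := lagrange_cI sy sg.
have -> : dy pi * g pi - y pi * dg pi - (dy 0 * g 0 - y 0 * dg 0) = 0.
  move: by_ bg; rewrite /satisfies_bc; move: (y pi) (dy pi) (y 0) (dy 0) (g pi) (dg pi) (g 0) (dg 0).
  by case: bc => a1 a2 a3 a4 a5 a6 a7 a8 [-> ->] [-> ->]; ring.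
have -> : (fun x => - n%:R ^+ 2 * y x * g x - y x * (- m%:R ^+ 2 * g x)) =
  (fun x => (m%:R ^+ 2 - n%:R ^+ 2) * (y x * g x)) by apply/funext => x; ring.
rewrite cI_Z//; last first.
  by apply: ucont_cintble; apply: ucontM; [exact: sol2_ucont sy|exact: sol2_ucont sg].
move=> /eqP; rewrite mulf_eq0 subr_sqr mulf_eq0 subr_eq0 eqr_nat eq_sym (negbTE nm) /=.
rewrite -natrD pnatr_eq0 addn_eq0 => /orP[/andP[/eqP m0 /eqP n0]|/eqP//].
by rewrite m0 n0 in nm.
Qed.

Definition tcoef n : R := if n == 0%N then Num.sqrt (1 / pi) else kap R.

(** Indices of parity [p] carry cosines and the others sines, shifted by one. Thus a frequency
    [n > 0] occupies the adjacent indices [n] and [n.-1], and the constant function has index 0. *)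
Definition freq p j : nat := if odd j == p then j else j.+1.

Definition tfun p j t : C := (tcoef (freq p j))%:C * (if odd j == p then cn j t else sn j.+1 t).

Lemma ucont_tfun p j : ucont (tfun p j).
Proof. by apply: ucontZ; case: (odd j == p); [exact: ucont_cn|exact: ucont_sn]. Qed.

Definition tbase p j : H := MkL2 (L2_ucont (ucont_tfun p j)).

Lemma tfunJ p j t : (tfun p j t)^*%C = tfun p j t.
Proof. by rewrite /tfun /cn /sn; apply: complex_eq; case: ifP => _; rewrite ?cReJ ?cImJ ?cImM /=; ring. Qed.

Lemma ip_tbase p f (f2 : inL2 f) j : ip (MkL2 f2 : H) (tbase p j) = cI I0pi (fun t => f t * tfun p j t).
Proof. by apply: eq_cI => t _; rewrite /= tfunJ. Qed.

Lemma odd_freq p j : odd (freq p j) = p.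
Proof. by rewrite /freq; case: (boolP (odd j == p)) => [/eqP //|]; rewrite /=; case: (odd j); case: p. Qed.

Lemma tbase_orthonormal p : horthonormal (tbase p).
Proof.
move=> j k; rewrite /tbase ip_tbase.
have ucs n : ucont (@cn R n) by exact: ucont_cn.
have uss n : ucont (@sn R n) by exact: ucont_sn.
have bcp n : odd n = p -> per_of n = if p then PerM else PerP by rewrite /per_of => ->.
have cc n m : odd n = p -> odd m = p -> n != m -> cI I0pi (fun t => cn n t * cn m t : C) = 0.
  move=> np mp nm; apply: (cI_distinct_freq nm (sol2_cn R n) (sol2_cn R m) (bc := per_of n)); first exact: bc_cn.
  by rewrite (bcp _ np) -(bcp _ mp); exact: bc_cn.
have ss n m : odd n = p -> odd m = p -> n != m -> cI I0pi (fun t => sn n t * sn m t : C) = 0.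
  move=> np mp nm; apply: (cI_distinct_freq nm (sol2_sn R n) (sol2_sn R m) (bc := per_of n)); first exact: bc_sn.
  by rewrite (bcp _ np) -(bcp _ mp); exact: bc_sn.
have cs n m : odd n = p -> odd m = p -> (0 < m)%N -> cI I0pi (fun t => cn n t * sn m t : C) = 0.
  move=> np mp m0; have [->|nm] := eqVneq n m; first exact: cI_cn_sn.
  apply: (cI_distinct_freq nm (sol2_cn R n) (sol2_sn R m) (bc := per_of n)); first exact: bc_cn.
  by rewrite (bcp _ np) -(bcp _ mp); exact: bc_sn.
have fac (a b : C) (u w : R -> C) : ucont u -> ucont w ->
  cI I0pi (fun t => a * u t * (b * w t)) = a * b * cI I0pi (fun t => u t * w t).
  move=> uu uw; rewrite -cI_Z//; last exact: ucont_cintble (ucontM uu uw).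
  by apply: eq_cI => t _; ring.
have oddS n : (odd n == p) = false -> odd n.+1 = p by rewrite /=; case: (odd n); case: (p).
rewrite /tfun /freq.
case: (boolP (odd j == p)) => [/eqP jp|/negbTE jp]; case: (boolP (odd k == p)) => [/eqP kp|/negbTE kp].
- rewrite fac//; have [<-|jk] := eqVneq j k; last by rewrite cc// mulr0.
  rewrite /tcoef; case: posnP => j0.
    rewrite j0 /=; have -> : (fun t => cn 0 t * cn 0 t : C) = (fun=> 1).
      by apply/funext => t; rewrite /cn mul0r cos0 mul1r.
    have pi0 : 0 < pi^-1 :> R by rewrite invr_gt0 pi_gt0.
    rewrite cI_cst mul1r -!(rmorphM (real_complex R)) -expr2 mul1r sqr_sqrtr ?(ltW pi0)//.
    by rewrite mulVf ?gt_eqF ?pi_gt0.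
  by rewrite cI_cn2// kap_half.
- rewrite fac//; rewrite cs ?mulr0//; last exact: oddS.
  by have [jk|//] := eqVneq j k; move: kp; rewrite -jk jp eqxx.
- rewrite fac//; rewrite (_ : (fun t => sn j.+1 t * cn k t) = (fun t => cn k t * sn j.+1 t)); last first.
    by apply/funext => t; rewrite mulrC.
  rewrite cs ?mulr0//; last exact: oddS.
  by have [jk|//] := eqVneq j k; move: jp; rewrite jk kp eqxx.
- rewrite fac//; have [<-|jk] := eqVneq j k; last by rewrite ss ?mulr0 ?oddS.
  by rewrite cI_sn2// kap_half.
Qed.

Lemma tcoef_neq0 n : (tcoef n)%:C != 0 :> C.
Proof.
rewrite -cabs_eq0 cabs_real normr_eq0 gt_eqF// /tcoef; case: ifP => _.
  by rewrite sqrtr_gt0 divr_gt0// pi_gt0.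
by have := kap_ge R; lra.
Qed.

Lemma tbase_hbasis p : hbasis (tbase p).
Proof.
apply: total_basis; [exact: tbase_orthonormal|exact: L2_complete|].
move=> [f f2] h; apply/null_aeq0 => /=; apply: (@fourier_total _ p); first exact: L2_cintble.
have st j : cI I0pi (fun t => f t * (if odd j == p then cn j t else sn j.+1 t)) = 0.
  have := h j; rewrite ip_tbase /tfun.
  have -> : (fun t => f t * ((tcoef (freq p j))%:C * (if odd j == p then cn j t else sn j.+1 t))) =
   (fun t => (tcoef (freq p j))%:C * (f t * (if odd j == p then cn j t else sn j.+1 t))).
    by apply/funext => t; ring.
  rewrite cI_Z//; first by move/eqP; rewrite mulf_eq0 (negbTE (tcoef_neq0 _)) => /eqP.
  have uu : ucont (fun t => if odd j == p then cn j t else sn j.+1 t : C).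
    by case: (odd j == p); [exact: ucont_cn|exact: ucont_sn].
  by apply: eq_cintble (ucontM_cintble uu (L2_cintble f2)) => // t _; rewrite mulrC.
move=> n; rewrite oddb => np; split; first by have := st n; rewrite np eqxx.
case: n np => [_|n np]; last first.
  have := st n; have -> : (odd n == p) = false by move: np => /=; case: (odd n); case: p {h st}.
  by [].
rewrite -[RHS](cI_0 R); apply: eq_cI => t _.
by rewrite /sn mul0r sin0 mulr0.
Qed.

End TrigBasis.

(** * The resolvent *)

Section Volterra.
Variable R : realType.
Local Notation C := R[i].
Implicit Types (f g h y dy W q : R -> C) (x t : R).
Let mI := @measurable_I0pi R.

Lemma prim_lin (a b : C) f g x : cintble I0pi f -> cintble I0pi g -> I0pi x ->
  prim (fun t => a * f t + b * g t) x = a * prim f x + b * prim g x.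
Proof.
rewrite I0piE => fi gi /andP[x0 xp].
have mab : measurable (`[0, x]%classic : set R) by exact: measurable_itv.
have sub : `[0, x]%classic `<=` (I0pi : set R) by exact: sub_itvI0pi.
have f' := cintbleS mI mab sub fi; have g' := cintbleS mI mab sub gi.
by rewrite /prim cI_D//; [rewrite !cI_Z|exact: cintbleZ|exact: cintbleZ].
Qed.

Lemma prim_le f x : cintble I0pi f -> I0pi x -> cabs (prim f x) <= nI I0pi f.
Proof.
move=> fi; rewrite I0piE => /andP[x0 xp].
have := primB_le fi (lexx 0) x0 xp; rewrite prim0 subr0 => /le_trans; apply.
exact: nI_sub.
Qed.

Lemma hd_prim_ucont f x : ucont f -> I0pi x -> hd (prim f) x (f x).
Proof.
move=> uf Ix e e0; have e20 : 0 < e / 2 by lra.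
have [d d0 H] := uf _ e20; exists d => // t It tx.
have fi := ucont_cintble uf.
have step a b : I0pi a -> I0pi b -> a <= b -> `|a - x| < d -> `|b - x| < d ->
   cabs (prim f b - prim f a - f x * (b - a)%:C) <= e / 2 * (b - a).
  move=> Ia Ib ab da db; move: (Ia) (Ib); rewrite !I0piE => /andP[a0 ap] /andP[b0 bp].
  have mab : measurable (`]a, b]%classic : set R) by exact: measurable_itv.
  have sub : `]a, b]%classic `<=` (I0pi : set R) by exact: sub_itvI0pi.
  have ic := ucont_cintble (@ucont_cst R (f x)).
  have cE : prim (fun=> f x) b - prim (fun=> f x) a = f x * (b - a)%:C.
    have hid u : hd (fun t : R => f x * t%:C) u (f x).
      move=> r r0; exists 1 => // s _ _.
      have -> : f x * s%:C - f x * u%:C - f x * (s - u)%:C = 0.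
        by rewrite (rmorphB (real_complex R)); ring.
      by rewrite cabs0 mulr_ge0// ltW.
    have aid : acd (fun t : R => f x * t%:C) (fun=> f x).
      by apply: acd_C1 => [u _|]; [exact: hid|exact: ucont_cst].
    rewrite primB// -(acdB_cI aid)// (rmorphB (real_complex R)); ring.
  have -> : prim f b - prim f a - f x * (b - a)%:C = cI `]a, b]%classic (fun t => f t - f x).
    rewrite -cE (primB fi a0 ab bp) (primB ic a0 ab bp).
    by rewrite -(cI_B mab (cintbleS mI mab sub fi) (cintbleS mI mab sub ic)).
  have id : cintble I0pi (fun t => f t - f x) by exact: cintbleB.
  apply: (le_trans (cabs_cI mab (cintbleS mI mab sub id))).
  rewrite (nI_oc id a0 bp).
  apply: (@le_trans _ _ (\int[@lebesgue_measure R]_(x in `[a, b]) (e / 2))).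
    have mab' : measurable (`[a, b]%classic : set R) by exact: measurable_itv.
    have sub' : `[a, b]%classic `<=` (I0pi : set R) by exact: sub_itvI0pi.
    apply: le_Rintegral => //; [by apply: cintble_cabs => //; exact: cintbleS id|exact: rint_cst|].
    move=> s; rewrite /= in_itv /= => /andP[s1 s2]; apply/ltW/H => //.
      by rewrite I0piE; apply/andP; split; lra.
    by move: da db; rewrite !ltr_norml => /andP[? ?] /andP[? ?]; apply/andP; split; lra.
  rewrite Rintegral_cst//; have := lebesgue_measure_itv (`[a, b]%R : interval R); rewrite /= lte_fin => ->.
  by case: ifP => // h; move: ab; rewrite le_eqVlt h orbF => /eqP ->; rewrite subrr.
have dx : `|x - x| < d by rewrite subrr normr0.
have [xt|/ltW tx'] := leP x t.
  apply: (le_trans (step x t Ix It xt dx tx)); rewrite ger0_norm ?subr_ge0// ler_wpM2r ?subr_ge0//; lra.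
have := step t x It Ix tx' tx dx.
have -> : prim f x - prim f t - f x * (x - t)%:C = - (prim f t - prim f x - f x * (t - x)%:C).
  by rewrite !(rmorphB (real_complex R)); ring.
rewrite cabsN distrC => /le_trans; apply.
by rewrite ger0_norm ?subr_ge0// ler_wpM2r ?subr_ge0//; lra.
Qed.

(** Up to a constant [F] is the primitive of its derivative, and the primitive of a continuous
    function is differentiable everywhere. *)
Lemma acd_hd F f x : acd F f -> ucont f -> I0pi x -> hd F x (f x).
Proof.
move=> aF uf Ix.
have ap : acd (prim f) f by apply: acd_prim; exact: ucont_cintble.
have h t : I0pi t -> prim f t + F 0 = F t.
  move=> It; have z : acd (fun s => F s - prim f s) (fun=> 0).
    by apply: eq_acd (acdB aF ap) => //; apply/funext => s; rewrite subrr.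
  have := acd_zero z It; rewrite prim0 subr0 => <-; ring.
apply: (eq_hd Ix h).
by have := hdD (hd_prim_ucont uf Ix) (hd_cst (F 0) x); rewrite addr0.
Qed.

Variable n : nat.
Hypothesis n0 : (0 < n)%N.
Let nC : (n%:R : C) != 0. Proof. by rewrite pnatr_eq0 -lt0n. Qed.

(* Duhamel's formula for y'' + n^2 y = W, with kernel sin n(x - t) / n. *)
Definition volt W x : C := n%:R^-1 * (sn n x * prim (fun t => cn n t * W t) x - cn n x * prim (fun t => sn n t * W t) x).
Definition dvolt W x : C := cn n x * prim (fun t => cn n t * W t) x + sn n x * prim (fun t => sn n t * W t) x.

Let icW W : cintble I0pi W -> cintble I0pi (fun t => cn n t * W t).
Proof. by move=> Wi; exact: ucontM_cintble (@ucont_cn R n) Wi. Qed.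
Let isW W : cintble I0pi W -> cintble I0pi (fun t => sn n t * W t).
Proof. by move=> Wi; exact: ucontM_cintble (@ucont_sn R n) Wi. Qed.

Lemma sol2_volt W : cintble I0pi W -> sol2 (volt W) (dvolt W) (fun x => W x - n%:R ^+ 2 * volt W x).
Proof.
move=> Wi; have ac := acd_prim (icW Wi); have as_ := acd_prim (isW Wi).
have a1 : acd (volt W) (dvolt W).
  apply: eq_acd (acdZ n%:R^-1 (acdB (acdM (acd_sn R n) ac) (acdM (acd_cn R n) as_))) => //.
  by apply/funext => x; rewrite /dvolt; field.
have a2 : acd (dvolt W) (fun x => W x - n%:R ^+ 2 * volt W x).
  apply: eq_acd (acdD (acdM (acd_cn R n) ac) (acdM (acd_sn R n) as_)) => //.
  apply/funext => x; rewrite /volt.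
  transitivity ((cn n x * cn n x + sn n x * sn n x) * W x - n%:R * (sn n x * prim (fun t => cn n t * W t) x - cn n x * prim (fun t => sn n t * W t) x)).
    by ring.
  by rewrite cn2Dsn2; field.
split => // x Ix; apply: acd_hd => //; exact: acd_ucont a2.
Qed.

Lemma volt0 W : volt W 0 = 0 /\ dvolt W 0 = 0.
Proof. by rewrite /volt /dvolt !prim0 !mulr0 subr0 addr0 mulr0. Qed.

Lemma volt_lin (a b : C) f g x : cintble I0pi f -> cintble I0pi g -> I0pi x ->
  volt (fun t => a * f t + b * g t) x = a * volt f x + b * volt g x.
Proof.
move=> fi gi Ix; rewrite /volt.
have -> : (fun t => cn n t * (a * f t + b * g t)) = (fun t => a * (cn n t * f t) + b * (cn n t * g t)).
  by apply/funext => t; ring.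
have -> : (fun t => sn n t * (a * f t + b * g t)) = (fun t => a * (sn n t * f t) + b * (sn n t * g t)).
  by apply/funext => t; ring.
rewrite !prim_lin//; [ring|exact: isW|exact: isW|exact: icW|exact: icW].
Qed.

Lemma volt_le W x : cintble I0pi W -> I0pi x -> cabs (volt W x) <= 2 / n%:R * nI I0pi W.
Proof.
move=> Wi Ix; rewrite /volt cabsM cabsV cabs_nat mulrAC [leRHS]mulrC ler_wpM2l ?invr_ge0//.
have h1 : cabs (prim (fun t => cn n t * W t) x) <= nI I0pi W.
  apply: (le_trans (prim_le (icW Wi) Ix)); rewrite -[leRHS]mul1r.
  by apply: nI_bdd => //; [apply: ucont_meas; exact: ucont_cn|move=> t _; exact: cn_le1].
have h2 : cabs (prim (fun t => sn n t * W t) x) <= nI I0pi W.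
  apply: (le_trans (prim_le (isW Wi) Ix)); rewrite -[leRHS]mul1r.
  by apply: nI_bdd => //; [apply: ucont_meas; exact: ucont_sn|move=> t _; exact: sn_le1].
apply: (le_trans (cabsB _ _)); rewrite !cabsM mulr_natl mulr2n; apply: lerD.
  by apply: le_trans h1; rewrite ler_piMl ?cabs_ge0// sn_le1.
by apply: le_trans h2; rewrite ler_piMl ?cabs_ge0// cn_le1.
Qed.

Variable q : R -> C.
Hypothesis qi : cintble I0pi q.
Hypothesis q_small : 2 / n%:R * nI I0pi q <= 1 / 2.

Let iq y : ucont y -> cintble I0pi (fun t => q t * y t).
Proof.
by move=> uy; apply: eq_cintble (ucontM_cintble uy qi) => // t _; rewrite mulrC.
Qed.

Let volt_half y (M : R) x : 0 <= M -> ucont y -> (forall t, I0pi t -> cabs (y t) <= M) -> I0pi x ->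
  cabs (volt (fun t => q t * y t) x) <= 1 / 2 * M.
Proof.
move=> M0 uy yM Ix; apply: (le_trans (volt_le (iq uy) Ix)).
apply: (@le_trans _ _ (2 / n%:R * nI I0pi q * M)); last by rewrite ler_wpM2r.
rewrite -[leRHS]mulrA ler_wpM2l ?divr_ge0// [leRHS]mulrC.
have -> : (fun t => q t * y t) = (fun t => y t * q t) by apply/funext => t; rewrite mulrC.
by apply: nI_bdd => //; exact: ucont_meas.
Qed.

(** The Neumann series. The smallness of [q] relative to [n] makes the integral operator a
    contraction with factor 1/2, so a geometric series suffices in place of iterated kernel
    estimates. *)
Lemma volterra_solve y0 : ucont y0 -> exists2 y, ucont y &
  forall x, I0pi x -> y x = y0 x + volt (fun t => q t * y t) x.
Proof.
move=> u0; pose d := fix d k := if k is j.+1 then volt (fun t => q t * d j t) else y0.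
have [M M0 yM] := ucont_bdd u0.
have ud k : ucont (d k) /\ forall x, I0pi x -> cabs (d k x) <= M * (1 / 2) ^+ k.
  elim: k => [|k [IH1 IH2]]; first by split => // x Ix; rewrite expr0 mulr1 yM.
  split; first by have [s _] := sol2_volt (iq IH1); exact: sol2_ucont (sol2_volt (iq IH1)).
  move=> x Ix; apply: (le_trans (volt_half _ IH1 IH2 Ix)).
    by rewrite mulr_ge0// exprn_ge0//; lra.
  by rewrite exprS mulrCA.
have h2 : 1 / 2 < 1 :> R by lra.
have h20 : 0 <= 1 / 2 :> R by lra.
(* Off the interval the limit is arbitrary; only its values on [I0pi] matter. *)
have ex x : exists l, I0pi x -> forall m, cabs (l - \sum_(j < m) d j x) <= M / (1 - 1 / 2) * (1 / 2) ^+ m.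
  have [Ix|nIx] := pselect (I0pi x); last by exists 0.
  have [l hl] := geometric_complex M0 h20 h2 (fun j => (ud j).2 x Ix).
  by exists l.
have [y yP] := choice ex; pose S m x := \sum_(j < m) d j x.
have uS m : ucont (S m).
  rewrite /S; elim: m => [|m IH].
    by have -> : (fun x => \sum_(j < 0) d j x) = (fun=> 0) by [apply/funext => x; rewrite big_ord0]; exact: ucont_cst.
  have -> : (fun x => \sum_(j < m.+1) d j x) = (fun x => \sum_(j < m) d j x + d m x).
    by apply/funext => x; rewrite big_ord_recr.
  by apply: ucontD => //; exact: (ud m).1.
pose b m : R := M / (1 - 1 / 2) * (1 / 2) ^+ m.
have b_small e : 0 < e -> exists m, b m < e.
  move=> e0; have /cvgrPdist_lt/(_ _ e0) := geometric_cvg0 (M / (1 - 1 / 2)) h20 h2.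
  move=> [m _ /(_ m (leqnn m))] /=; rewrite sub0r normrN => hm; exists m.
  by apply: le_lt_trans hm; exact: ler_norm.
have uy : ucont y.
  move=> e e0; have e30 : 0 < e / 3 by lra.
  have [m bm] := b_small _ e30; have [r r0 H] := uS m _ e30; exists r => // s t Is It st.
  have -> : y t - y s = (y t - S m t) + (S m t - S m s) - (y s - S m s) by ring.
  have := cabsB (y t - S m t + (S m t - S m s)) (y s - S m s).
  have := cabsD (y t - S m t) (S m t - S m s).
  have := yP t It m; have := yP s Is m; have := H s t Is It st.
  by rewrite -/(S m t) -/(S m s) -/(b m); lra.
exists y => // x Ix; apply/eqP; rewrite -subr_eq0 -cabs_eq0 eq_le cabs_ge0 andbT.
apply/ler_addgt0Pr => e e0; rewrite add0r; have e20 : 0 < e / 2 by lra.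
have [m bm] := b_small _ e20.
have Srec : forall t, I0pi t -> S m.+1 t = y0 t + volt (fun s => q s * S m s) t.
  move=> t It; rewrite /S big_ord_recl /=; congr (_ + _); clear bm; elim: m => [|m IH].
    rewrite big_ord0; have -> : (fun s => q s * \sum_(j < 0) d j s) = (fun s => 0 * q s + 0 * q s).
      by apply/funext => s; rewrite big_ord0 mulr0 mul0r addr0.
    by rewrite volt_lin// !mul0r addr0.
  rewrite big_ord_recr /= IH.
  have -> : (fun s => q s * \sum_(j < m.+1) d j s) = (fun s => 1 * (q s * \sum_(j < m) d j s) + 1 * (q s * d m s)).
    by apply/funext => s; rewrite big_ord_recr /=; ring.
  rewrite volt_lin ?mul1r//; apply: iq; [exact: uS|exact: (ud m).1].
have -> : y x - (y0 x + volt (fun t => q t * y t) x) = (y x - S m.+1 x) - volt (fun t => q t * (y t - S m t)) x.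
  have -> : (fun t => q t * (y t - S m t)) = (fun t => 1 * (q t * y t) + (- 1) * (q t * S m t)).
    by apply/funext => t; ring.
  rewrite volt_lin//; [rewrite Srec//; ring|exact: iq|exact: iq].
have h1 := yP x Ix m.+1.
have h3 : cabs (volt (fun t => q t * (y t - S m t)) x) <= 1 / 2 * b m.
  apply: volt_half => //; first by apply: le_trans (cabs_ge0 _) (yP x Ix m).
    exact: ucontB.
  by move=> t It; exact: yP.
have h4 : b m.+1 = 1 / 2 * b m by rewrite /b exprS; ring.
have := cabsB (y x - S m.+1 x) (volt (fun t => q t * (y t - S m t)) x).
by move: h1; rewrite -/(S m.+1 x) -/(b m.+1) h4; lra.
Qed.

End Volterra.

(** * Initial and boundary value problems *)

Section BoundaryValue.
Variable R : realType.
Local Notation C := R[i].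
Implicit Types (f g h y dy W q : R -> C) (x t : R) (bc : bcond) (z : C).
Let mI := @measurable_I0pi R.
Variable v : R -> C.
Hypothesis vi : cintble I0pi v.

(** The equation is treated as a perturbation of [y'' + n^2 y = 0]; the frequency [n] is a parameter
    that makes the perturbation [v - z + n^2] small. *)
Lemma initial_value n z h (a b : C) : (0 < n)%N -> cintble I0pi h ->
  2 / n%:R * nI I0pi (fun x => v x - z + n%:R ^+ 2) <= 1 / 2 ->
  exists y dy, [/\ sol2 y dy (fun x => v x * y x - (z * y x + h x)), y 0 = a & dy 0 = b].
Proof.
move=> n0 hi qs; have nC : (n%:R : C) != 0 by rewrite pnatr_eq0 -lt0n.
pose q x := v x - z + n%:R ^+ 2.
have qi : cintble I0pi q.
  by apply: cintbleD => //; [apply: cintbleB => //|]; exact: ucont_cintble (@ucont_cst R _).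
have s0 : sol2 (fun x => a * cn n x + b / n%:R * sn n x)
  (fun x => a * (- n%:R * sn n x) + b / n%:R * (n%:R * cn n x))
  (fun x => a * (- n%:R ^+ 2 * cn n x) + b / n%:R * (- n%:R ^+ 2 * sn n x)).
  exact: sol2D (sol2Z a (sol2_cn R n)) (sol2Z (b / n%:R) (sol2_sn R n)).
have nhi := cintbleZ (- 1) mI hi.
have s1 := sol2D s0 (sol2_volt n0 nhi).
have [y uy yE] := volterra_solve n0 qi qs (sol2_ucont s1).
have qyi : cintble I0pi (fun t => q t * y t).
  by apply: eq_cintble (ucontM_cintble uy qi) => // t _; rewrite mulrC.
have s2 := sol2D s1 (sol2_volt n0 qyi).
set Y := (fun x => _ + _ + volt n (fun t => q t * y t) x) in s2.
have YE x : I0pi x -> Y x = y x by move=> Ix; rewrite yE.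
have [u1 u2] := volt0 n (fun x => - 1 * h x); have [u3 u4] := volt0 n (fun t => q t * y t).
set dY := (fun x => _ + _ + dvolt n (fun t => q t * y t) x) in s2.
exists Y, dY; split; first last.
- by rewrite /dY u2 u4 sn0 cn0 !mulr0 mulr1 add0r !addr0 divfK.
- by rewrite /Y u1 u3 sn0 cn0 mulr0 mulr1 !addr0.
case: s2 => hy [ac hd2 _]; split; first exact: hy.
have uY : ucont Y by apply: (acd_ucont (f := _)); exact: acd_C1 hy (AC_ucont ac).
split => //; last first.
  apply: cintbleB => //; first by apply: eq_cintble (ucontM_cintble uY vi) => // x _; rewrite mulrC.
  by apply: cintbleD => //; apply: ucont_cintble; exact: ucontZ.
apply: aeS hd2 => x H Ix; move: (H Ix); congr hd.
rewrite -(YE x Ix) /Y /q; ring.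
Qed.

Lemma hd_zero y x (l : C) : (forall t, I0pi t -> y t = 0) -> I0pi x -> hd y x l -> l = 0.
Proof.
move=> y0 Ix h; apply: (hd_unique Ix h); apply: (@eq_hd _ (fun=> 0)) => //; last exact: hd_cst.
by move=> t It; rewrite y0.
Qed.

(** A particular solution is corrected by the two fundamental solutions. The 2x2 system for the
    boundary values is injective since [z] is not an eigenvalue, hence solvable. *)
Lemma resolvent bc n z h : (0 < n)%N -> bc <> Neu -> inL2 h -> alg_mult bc v z 0 ->
  2 / n%:R * nI I0pi (fun x => v x - z + n%:R ^+ 2) <= 1 / 2 ->
  exists y dy, dom v bc y dy (fun x => z * y x + h x).
Proof.
move=> n0 bcn h2 am qs; have hi := L2_cintble h2.
have [yp [dyp [sp _ _]]] := initial_value 0 0 n0 hi qs.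
have zi := ucont_cintble (@ucont_cst R 0).
have [y1 [dy1 [s1 y10 dy10]]] := initial_value 1 0 n0 zi qs.
have [y2 [dy2 [s2 y20 dy20]]] := initial_value 0 1 n0 zi qs.
(* Both boundary conditions read [y 0 = sg * y pi] and [y' 0 = sg * y' pi]. *)
pose sg : C := if bc is PerM then - 1 else 1.
have bcE y dy : y 0 - sg * y pi = 0 -> dy 0 - sg * dy pi = 0 -> satisfies_bc bc y dy.
  move=> /eqP; rewrite subr_eq0 => /eqP e1 /eqP; rewrite subr_eq0 => /eqP e2.
  by move: bcn e1 e2; rewrite /sg; case: (bc) => //= _ -> ->; rewrite ?mul1r ?mulN1r.
have [a b h1 h3|a [b [ha hb]]] := @lin2_surj _ (y1 0 - sg * y1 pi) (y2 0 - sg * y2 pi)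
   (dy1 0 - sg * dy1 pi) (dy2 0 - sg * dy2 pi) _ (- (yp 0 - sg * yp pi)) (- (dyp 0 - sg * dyp pi)).
  have s := sol2D (sol2Z a s1) (sol2Z b s2).
  set Y := (fun x => a * y1 x + _) in s; set dY := (fun x => a * dy1 x + _) in s.
  have d : dom v bc Y dY (fun x => z * Y x).
    split; last by apply: L2Z; apply: L2_ucont; exact: sol2_ucont s.
    - by move: s; congr sol2; apply/funext => x; rewrite /Y; ring.
    - by apply: bcE; [rewrite -h1 /Y; ring|rewrite -h3 /dY; ring].
  have Y0 : forall x, I0pi x -> Y x = 0.
    by move=> x; apply: ucont_aeq0; [exact: sol2_ucont s|exact: alg_mult0 am d].
  split; first by have := Y0 0 (I0pi_0 R); rewrite /Y y10 y20 mulr1 mulr0 addr0.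
  have := hd_zero Y0 (I0pi_0 R) (s.1 0 (I0pi_0 R)).
  by rewrite /dY dy10 dy20 mulr1 mulr0 add0r.
have s := sol2D sp (sol2D (sol2Z a s1) (sol2Z b s2)).
exists (fun x => yp x + (a * y1 x + b * y2 x)), (fun x => dyp x + (a * dy1 x + b * dy2 x)).
split.
- by move: s; congr sol2; apply/funext => x; ring.
- apply: bcE.
    by have := congr1 (fun u => u + (yp 0 - sg * yp pi)) ha; rewrite addNr => <-; ring.
  by have := congr1 (fun u => u + (dyp 0 - sg * dyp pi)) hb; rewrite addNr => <-; ring.
- by apply: L2D; [apply: L2Z; apply: L2_ucont; exact: sol2_ucont s|exact: h2].
Qed.

End BoundaryValue.

(** * The bilinear form on root functions *)

Section Bilinear.
Variable R : realType.
Local Notation C := R[i].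
Local Notation H := (L2H R).
Implicit Types (x y z : H) (a b c : C).
Let mI := @measurable_I0pi R.

Lemma bipC x y : bip x y = bip y x.
Proof. by rewrite !bipE; apply: eq_cI => t _; rewrite mulrC. Qed.

Lemma bipDl x y z : bip (x + y) z = bip x z + bip y z. Proof. exact: ipDl. Qed.
Lemma bipZl a x z : bip (a *: x) z = a * bip x z. Proof. exact: ipZl. Qed.
Lemma bipBl x y z : bip (x - y) z = bip x z - bip y z. Proof. exact: ipBl. Qed.
Lemma bipDr x y z : bip z (x + y) = bip z x + bip z y. Proof. by rewrite !(bipC z) bipDl. Qed.
Lemma bipZr a x z : bip z (a *: x) = a * bip z x. Proof. by rewrite !(bipC z) bipZl. Qed.
Lemma bipBr x y z : bip z (x - y) = bip z x - bip z y. Proof. by rewrite !(bipC z) bipBl. Qed.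
Lemma bip_suml (I : Type) (r : seq I) (P : pred I) (F : I -> H) z :
  bip (\sum_(i <- r | P i) F i) z = \sum_(i <- r | P i) bip (F i) z.
Proof. exact: ip_suml. Qed.
Lemma bip_sumr (I : Type) (r : seq I) (P : pred I) (F : I -> H) z :
  bip z (\sum_(i <- r | P i) F i) = \sum_(i <- r | P i) bip z (F i).
Proof. by rewrite bipC bip_suml; apply: eq_bigr => i _; rewrite bipC. Qed.

Lemma nrm_conj x : nrm (L2conj x : H) = nrm x.
Proof.
rewrite /nrm; congr Num.sqrt; rewrite !nsqE; apply: eq_Rintegral => t _.
by rewrite /= cabsJ.
Qed.

Lemma conjK x : L2conj (L2conj x) = x.
Proof. by apply: L2t_eq; apply/funext => t; apply: complex_eq; rewrite /= ?cReJ ?cImJ ?opprK. Qed.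

Lemma bip_bound x y : cabs (bip x y) <= nrm x * nrm y.
Proof. by rewrite -(nrm_conj y); exact: cauchy_schwarz. Qed.

Lemma bip_conj x : bip x (L2conj x) = (nsq x)%:C.
Proof. by rewrite /bip conjK ipxx. Qed.

Lemma bip_eql x y z : null (x - y) -> bip x z = bip y z.
Proof. exact: ip_eql. Qed.

Lemma bip_eqr x y z : null (x - y) -> bip z x = bip z y.
Proof. by move=> h; rewrite bipC (bip_eql _ h) bipC. Qed.

Lemma bip_zero x : (forall y, bip x y = 0) -> null x.
Proof.
move=> h; apply/null_nsq; have := h (L2conj x); rewrite bip_conj => /(congr1 (@complex.Re R)).
by [].
Qed.

Lemma nrm_sup x (M : R) : (forall t, I0pi t -> cabs (x t) <= M) -> nrm x <= 2 * M.
Proof.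
move=> xM; have M0 : 0 <= M := le_trans (cabs_ge0 _) (xM _ (I0pi_0 R)).
rewrite -(@ler_pXn2r _ 2) ?nnegrE ?nrm_ge0 ?mulr_ge0 ?ler0n// nrm_sqr nsqE exprMn.
have h : \int[@lebesgue_measure R]_(t in I0pi) (cabs (x t) ^+ 2) <= M ^+ 2 * pi.
  have := nI_le_bound (lexx 0) (ltW (pi_gt0 R)) (lexx pi)
    (bdd_cintble (cmeasM (L2_meas (fnP x)) (L2_meas (fnP (L2conj x)))) _) (_ : forall t, I0pi t -> cabs (x t * (L2conj x) t) <= M ^+ 2).
  have q t : I0pi t -> cabs (x t * (L2conj x) t) <= M ^+ 2.
    by move=> It; rewrite /= cabsM cabsJ -expr2 ler_pXn2r ?nnegrE ?cabs_ge0 ?xM.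
  move=> /(_ _ q q); rewrite subr0; apply: le_trans; rewrite le_eqVlt; apply/orP; left; apply/eqP.
  by apply: eq_Rintegral => t _; rewrite /= cabsM cabsJ expr2.
apply: (le_trans h); rewrite [leRHS]mulrC ler_wpM2l ?sqr_ge0//.
by have := pi_le R; rewrite expr2; lra.
Qed.

(** Induction on both nilpotency orders: with [hh = L x] and [gg = L y], the forms of [hh - l x]
    against [y] and of [x] against [gg - m y] vanish, and symmetry leaves [(l - m) B(x, y) = 0]. *)
Lemma root_symmetric2 (v : R -> C) bc l m j k x y : cintble I0pi v -> l != m ->
  in_ker_pow bc v l j x -> in_ker_pow bc v m k y -> bip x y = 0.
Proof.
move=> vi lm; elim: j k x y => [|j IHj] k x y /=.
  by move=> /null_aeq0 x0 _; exact: ip_nulll.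
move=> [h Lh kh]; elim: k y => [|k IHk] y /=.
  by move=> /null_aeq0 y0; rewrite bipC; exact: ip_nulll.
move=> [g Lg kg].
have [x2 [h2 _]] := Lh; have [y2 [g2 _]] := Lg.
pose hh : H := MkL2 h2; pose gg : H := MkL2 g2.
have e1 : bip (hh - l *: x) y = 0.
  by apply: (IHj k.+1) => //=; exists g.
have e2 : bip x (gg - m *: y) = 0 by exact: IHk.
have e3 : bip hh y = bip x gg by rewrite !bipE; exact: Lgraph_symmetric Lh Lg.
move: e1 e2; rewrite bipBl bipBr bipZl bipZr e3 => /eqP; rewrite subr_eq0 => /eqP -> /eqP.
by rewrite -mulrBl mulf_eq0 subr_eq0 (negbTE lm) /= => /eqP.
Qed.

End Bilinear.

Section Discs.
Variable R : realType.
Local Notation C := R[i].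

(** The centers are at least [n + m] apart, more than the sum of the radii. *)
Lemma disc_disjoint n m (z w : C) : n != m -> disc n z -> disc m w -> z != w.
Proof.
wlog nm : n m z w / (n < m)%N.
  move=> H nm dz dw; case: (ltngtP n m) nm => // h _; first by apply: (H n m); rewrite ?ltn_eqF.
  by rewrite eq_sym; apply: (H m n); rewrite ?ltn_eqF.
rewrite /disc /= => _ dz dw; apply/eqP => zw; rewrite -{}zw in dw.
have h : cabs (m%:R ^+ 2 - n%:R ^+ 2 : C) < n%:R / 4 + m%:R / 4.
  have -> : m%:R ^+ 2 - n%:R ^+ 2 = (z - n%:R ^+ 2) - (z - m%:R ^+ 2) by ring.
  by apply: le_lt_trans (cabsB _ _) _; exact: ltrD.
have e : cabs (m%:R ^+ 2 - n%:R ^+ 2 : C) = (m ^ 2 - n ^ 2)%:R.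
  by rewrite -!natrX -natrB ?cabs_nat// leq_exp2r// ltnW.
rewrite e in h.
have : (n + m)%:R <= (m ^ 2 - n ^ 2)%:R :> R by rewrite ler_nat; nia.
have : 0 < (m%:R : R) by rewrite ltr0n; lia.
have : 0 <= (n%:R : R) by rewrite ler0n.
by rewrite natrD; lra.
Qed.

Lemma eventually_small (K e : R) : 0 <= K -> 0 < e -> exists N, forall n, (N <= n)%N -> (0 < n)%N /\ K / n%:R <= e.
Proof.
move=> K0 e0; have := archi_boundP (divr_ge0 K0 (ltW e0)); set m := Num.bound _ => hm.
exists m.+1 => n mn; have n0 : (0 < n)%N by lia.
split => //; rewrite ler_pdivrMr ?ltr0n// mulrC -ler_pdivrMr//; apply: (le_trans (ltW hm)).
by rewrite ler_nat ltnW.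
Qed.

End Discs.

Section PairData.
Variable R : realType.
Local Notation C := R[i].
Local Notation H := (L2H R).
Variable v : R -> C.
Hypothesis vi : cintble I0pi v.
Variables (N : nat) (lamm lamp nu : nat -> C).
Hypothesis hspec : forall n, (N <= n)%N -> disc_eigenvalues v n (lamm n) (lamp n) (nu n).

(* In the basis (G, F) of the root space, L has the matrix m + [[al, b], [b, -al]],
   whose eigenvalues are m + xi and m - xi with xi^2 = al^2 + b^2. *)
Definition pair_of (p : bool) n (C1 : R) (G F : H) (al b : C) :=
  let m := (lamp n + lamm n) / 2 in
  [/\ exists dG, dom v (per_of n) G dG (fun x => (m + al) * G x + b * F x),
      exists dF, dom v (per_of n) F dF (fun x => b * G x + (m - al) * F x),
      bip G G = 1, bip G F = 0 & bip F F = 1] /\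
  [/\ al ^+ 2 + b ^+ 2 = ((lamp n - lamm n) / 2) ^+ 2,
      cabs (nu n - m - al) <= 1 / 4 * cabs b,
      nrm (G - tbase R p n) <= C1 / n%:R &
      nrm (F - tbase R p n.-1) <= C1 / n%:R].

Lemma pair_exists : exists N1 C1, [/\ (N <= N1)%N, (0 < N1)%N, 0 < C1 &
  forall n, (N1 <= n)%N -> exists G F al b, pair_of (odd n) n C1 G F al b].
Proof.
pose V := nI I0pi v; have V0 : 0 <= V by exact: nI_ge0.
have K0 : 0 <= 360 * V by rewrite mulr_ge0 ?ler0n.
(* This threshold makes the Neumann error [420 e] at most 1/4, and also gives [e <= 1/500]. *)
have e0 : 0 < 1 / 4 / 420 :> R by rewrite !divr_gt0 ?ltr0n.
have [N0 hN0] := eventually_small K0 e0.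
(* [120] is the sup distance factor 60 times the factor 2 of [nrm_sup]; the summand 1 makes the
   constant positive. *)
exists (maxn N N0.+1), (120 * (360 * V) + 1); split; [exact: leq_maxl|by rewrite leq_max ltn0Sn orbT| |].
  by apply: ltr_wpDl; [rewrite mulr_ge0 ?ler0n|exact: ltr01].
move=> n; rewrite geq_max => /andP[Nn /ltnW/hN0[n0]].
rewrite ler_pdivlMr ?ltr0n// => en.
have en' : 420 * (360 * (V / n%:R)) <= 1 / 4.
  have <- : 360 * V / n%:R * 420 = 420 * (360 * (V / n%:R)) by ring.
  exact: en.
have e500 : 360 * (V / n%:R) <= 1 / 500.
  by move: en'; move: (V / n%:R) => X; lra.
have [G [dG [F [dF [al [b [[q1 q2 q3 q4 q5] [q6 q7 q8 q9]]]]]]]] := disc_pair vi n0 e500 (hspec Nn).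
have [s1 _ _] := q1; have [s2 _ _] := q2.
exists (MkL2 (L2_ucont (sol2_ucont s1))), (MkL2 (L2_ucont (sol2_ucont s2))), al, b.
have nR : 0 < (n%:R : R) by rewrite ltr0n.
have C1E : 2 * (60 * (360 * (V / n%:R))) <= (120 * (360 * V) + 1) / n%:R.
  have -> : (120 * (360 * V) + 1) / n%:R = 2 * (60 * (360 * (V / n%:R))) + n%:R^-1 by field; rewrite gt_eqF.
  by rewrite lerDl invr_ge0.
split; split; rewrite ?bipE//.
- exists dG; exact: q1.
- exists dF; exact: q2.
- apply: (le_trans q7); rewrite ler_wpM2r ?cabs_ge0//.
- apply: le_trans C1E; apply: nrm_sup => t It /=.
  have := q8 t It; rewrite /tfun /freq /tcoef eqxx.
  by case: posnP n0 => // n0 _; rewrite -/(V).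
- apply: le_trans C1E; apply: nrm_sup => t It /=.
  have := q9 t It; rewrite /tfun /freq /tcoef prednK//.
  have -> : (odd n.-1 == odd n) = false by case: (n) n0 => //= k _; case: (odd k).
  by case: posnP n0 => // n0 _.
Qed.

End PairData.

(** * Finite-dimensional invariant subspaces *)

Section GeneralizedEigenvectors.
Variable F : closedFieldType.

Definition nilrow r (A : 'M[F]_r) (l : F) k (x : 'rV[F]_r) : Prop :=
  iter k (fun y => y *m (A - l%:M)) x = 0.

Lemma iter_horner r (A : 'M[F]_r.+1) l k (x : 'rV[F]_r.+1) :
  iter k (fun y => y *m (A - l%:M)) x = x *m horner_mx A (('X - l%:P) ^+ k).
Proof.
elim: k => [|k IH]; first by rewrite expr0 rmorph1 mulmx1.
by rewrite iterS IH exprSr rmorphM /= mulmxA rmorphB /= horner_mx_X horner_mx_C.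
Qed.

Definition gen_rows r (A : 'M[F]_r) m (M : 'M[F]_(m, r)) :=
  forall i, exists l k, nilrow A l k (row i M).

Lemma gen_rows_col r (A : 'M[F]_r) m1 m2 (M1 : 'M[F]_(m1, r)) (M2 : 'M[F]_(m2, r)) :
  gen_rows A M1 -> gen_rows A M2 -> gen_rows A (col_mx M1 M2).
Proof.
move=> h1 h2 i; case: (splitP i) => j ij.
  by rewrite (_ : i = lshift m2 j) ?rowKu//; exact: val_inj.
by rewrite (_ : i = rshift m1 j) ?rowKd//; exact: val_inj.
Qed.

(** Primary decomposition, one root at a time: a Bezout relation between [('X - a%:P) ^+ m] and the
    cofactor [q] splits [x] into a part killed by [q], left to the induction, and a generalized
    eigenvector. *)
Lemma killed_gen_rows r (A : 'M[F]_r.+1) (p : {poly F}) (x : 'rV[F]_r.+1) : p != 0 ->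
  x *m horner_mx A p = 0 -> exists m (M : 'M[F]_(m, r.+1)), gen_rows A M /\ (x <= M)%MS.
Proof.
have [n] := ubnP (size p); elim: n p x => // n IH p x /ltnSE sp p0 xp.
have [s1|s1] := boolP (size p == 1%N).
  have [c c0 pE] := size_poly1P p s1.
  exists 0%N, 0; split; first by case.
  move: xp; rewrite pE horner_mx_C mul_mx_scalar => /eqP; rewrite scalemx_eq0 (negbTE c0) /= => /eqP ->.
  exact: sub0mx.
have [a ra] := closed_rootP p s1.
have [m [q qa pE]] := multiplicity_XsubC p a; rewrite p0 /= in qa.
have q0 : q != 0 by apply: contraNneq p0 => q0; rewrite pE q0 mul0r.
have m0 : (0 < m)%N by case: m pE => // pE; move: ra; rewrite pE expr0 mulr1 (negbTE qa).
have sq : (size q < n)%N.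
  apply: leq_trans sp; rewrite pE size_Mmonic ?monic_exp ?monicXsubC// size_exp_XsubC addnS.
  by rewrite -[ltnLHS]addn0 ltn_add2l.
have cop : coprimep (('X - a%:P) ^+ m) q.
  by rewrite coprimep_expl// coprimep_sym coprimep_XsubC.
have /Bezout_eq1_coprimepP[[u w] /= uw] := cop.
pose x1 := x *m horner_mx A (u * ('X - a%:P) ^+ m).
pose x2 := x *m horner_mx A (w * q).
have xE : x = x1 + x2 by rewrite -mulmxDr -rmorphD uw rmorph1 mulmx1.
have k1 : x1 *m horner_mx A q = 0.
  rewrite /x1 -mulmxA -[_ *m horner_mx A q](rmorphM (horner_mx A)) -mulrA [_ ^+ _ * q]mulrC -pE.
  by rewrite [u * p]mulrC rmorphM /= [_ * _]/(_ *m _) mulmxA xp mul0mx.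
have k2 : nilrow A a m x2.
  rewrite /nilrow iter_horner /x2 -mulmxA -[_ *m horner_mx A _](rmorphM (horner_mx A)) -mulrA -pE.
  by rewrite [w * p]mulrC rmorphM /= [_ * _]/(_ *m _) mulmxA xp mul0mx.
have [m1 [M [gM sM]]] := IH q x1 sq q0 k1.
exists (m1 + 1)%N, (col_mx M x2); split.
  apply: gen_rows_col => // i; exists a, m; rewrite (_ : row i x2 = x2)//.
  by apply/rowP => j; rewrite mxE (ord1 i).
rewrite xE; apply: addmx_sub; first by apply: submx_trans sM _; rewrite -addsmxE addsmxSl.
by rewrite -addsmxE addsmxSr.
Qed.

(** By Cayley-Hamilton every unit row is killed by the characteristic polynomial; stacking their
    decompositions gives a matrix of full rank, from which a basis is selected. *)
Lemma gen_eigenbasis r (A : 'M[F]_r) : exists2 P : 'M[F]_r, P \in unitmx & gen_rows A P.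
Proof.
case: r A => [|r] A; first by exists 1%:M; [exact: unitmx1|case].
have cp0 : char_poly A != 0 by exact: monic_neq0 (char_poly_monic A).
have all : forall k, exists m (M : 'M[F]_(m, r.+1)), gen_rows A M /\
   forall i : 'I_r.+1, (i < k)%N -> (row i 1%:M <= M)%MS.
  elim=> [|k [m [M [gM sM]]]]; first by exists 0%N, 0; split; [case|].
  have [kr|kr] := ltnP k r.+1; last first.
    by exists m, M; split => // i _; apply: sM; apply: leq_trans (ltn_ord i) kr.
  have xp : row (Ordinal kr) 1%:M *m horner_mx A (char_poly A) = 0 by rewrite Cayley_Hamilton mulmx0.
  have [m2 [M2 [gM2 sM2]]] := killed_gen_rows cp0 xp.
  exists (m + m2)%N, (col_mx M M2); split; first exact: gen_rows_col.
  move=> i; rewrite ltnS leq_eqVlt => /orP[/eqP ik|ik]; rewrite -addsmxE.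
    by rewrite (_ : i = Ordinal kr) ?(submx_trans sM2) ?addsmxSr//; exact: val_inj.
  by rewrite (submx_trans (sM i ik)) ?addsmxSl.
have [m [M [gM sM]]] := all r.+1.
have fM : row_full M by rewrite -sub1mx; apply/row_subP => i; exact: sM.
exists (rowsub (fullrankfun fM) M); first by rewrite -row_full_unit; exact: fullrowsub_full.
by move=> i; have [l [k h]] := gM (fullrankfun fM i); exists l, k; rewrite row_rowsub.
Qed.

End GeneralizedEigenvectors.

Section FiniteBasis.
Variables (R : realType) (H : prehilbert R).
Local Notation C := R[i].
Implicit Types (x y z : H) (w e : nat -> H).

Definition indep_fam r w := forall c : 'I_r -> C, null (\sum_(i < r) c i *: w i) -> forall i, c i = 0.
Definition span_fam (S : H -> Prop) r w := forall x, S x -> exists c : 'I_r -> C, null (x - \sum_(i < r) c i *: w i).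

(** A space on which the first [d] coordinates are injective has dimension at most [d]: if
    coordinate [d] does not vanish on [S], its kernel is treated by induction and one vector off the
    kernel is added. *)
Lemma fin_basis (S : H -> Prop) e d : (forall (a : C) x y, S x -> S y -> S (a *: x + y)) ->
  (forall x, S x -> (forall k, (k < d)%N -> ip x (e k) = 0) -> null x) ->
  exists r w, [/\ forall i, (i < r)%N -> S (w i), indep_fam r w & span_fam S r w].
Proof.
elim: d S => [|d IH] S Sl Sn.
  exists 0%N, (fun=> 0); split => //; first by move=> c _ [].
  by move=> x Sx; exists (fun=> 0); rewrite big_ord0 subr0; apply: Sn.
have [h|] := pselect (forall x, S x -> ip x (e d) = 0).
  apply: IH => // x Sx hx; apply: Sn => // k; rewrite ltnS leq_eqVlt => /orP[/eqP ->|]; [exact: h|exact: hx].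
move=> /existsNP[x0 /not_implyP[Sx0 /eqP x00]].
pose S0 x := S x /\ ip x (e d) = 0.
have [||r [w [wS wi ws]]] := IH S0.
- by move=> a x y [Sx ex] [Sy ey]; split; [exact: Sl|rewrite ipDl ipZl ex ey mulr0 addr0].
- move=> x [Sx ex] hx; apply: Sn => // k; rewrite ltnS leq_eqVlt => /orP[/eqP -> //|]; exact: hx.
pose w' i := if (i < r)%N then w i else x0.
have sumE (c : 'I_r.+1 -> C) : \sum_(i < r.+1) c i *: w' i =
   \sum_(i < r) c (widen_ord (leqnSn r) i) *: w i + c ord_max *: x0.
  rewrite big_ord_recr /= {2}/w' ltnn; congr (_ + _).
  by apply: eq_bigr => i _; rewrite /w' /= ltn_ord.
have ipw (c : 'I_r -> C) : ip (\sum_(i < r) c i *: w i) (e d) = 0.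
  by rewrite ip_suml big1// => i _; rewrite ipZl; have [_ ->] := wS i (ltn_ord i); rewrite mulr0.
exists r.+1, w'; split.
- by move=> i _; rewrite /w'; case: ifP => // /wS[].
- move=> c; rewrite sumE => nc.
  have c0 : c ord_max = 0.
    have := ip_nulll (e d) nc; rewrite ipDl ipw add0r ipZl => /eqP.
    by rewrite mulf_eq0 (negbTE x00) orbF => /eqP.
  rewrite c0 scale0r addr0 in nc; have ci := wi _ nc.
  move=> i; have [ir|ir] := ltnP i r.
    by rewrite -(ci (Ordinal ir)); congr c; exact: val_inj.
  by rewrite -c0; congr c; apply: val_inj => /=; apply/eqP; rewrite eqn_leq ir -ltnS ltn_ord.
- move=> x Sx; pose a := ip x (e d) / ip x0 (e d).
  have [|c cx] := ws (x - a *: x0).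
    split; first by rewrite addrC -scaleNr; exact: Sl.
    by rewrite ipBl ipZl divfK// subrr.
  exists (fun i => oapp c a (insub (val i))).
  rewrite sumE /= insubF ?ltnn//=.
  have -> : \sum_(i < r) oapp c a (insub (val i)) *: w i = \sum_(i < r) c i *: w i.
    by apply: eq_bigr => i _; rewrite valK.
  by rewrite [_ + a *: _]addrC opprD addrA.
Qed.

End FiniteBasis.

Section RootBasis.
Variable R : realType.
Local Notation C := R[i].
Local Notation H := (L2H R).
Implicit Types (x y : H) (w f : nat -> H).
Variables (v : R -> C) (vi : cintble I0pi v) (bc : bcond).

Lemma sum_fn r (c : 'I_r -> C) w : fn (\sum_(i < r) c i *: w i : H) = (fun t => \sum_(i < r) c i * w i t).
Proof.
elim: r c => [|r IH] c; first by rewrite big_ord0; apply/funext => t; rewrite big_ord0.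
rewrite big_ord_recr; apply/funext => t; rewrite big_ord_recr /=; congr (_ + _).
by rewrite IH.
Qed.

Lemma Lgraph_sum r (c : 'I_r -> C) (w g : 'I_r -> H) : (forall i, Lgraph bc v (w i) (g i)) ->
  Lgraph bc v (\sum_(i < r) c i *: w i : H) (\sum_(i < r) c i *: g i : H).
Proof.
elim: r c w g => [|r IH] c w g h.
  rewrite !big_ord0.
  have := @in_ker_pow0 _ v bc 0 1 _ (@L2_0 R) (aeq_refl _) => -[k Lk].
  move=> /= kk; apply: (Lgraph_aeq vi (fnP (0 : H)) (fnP (0 : H)) (aeq_refl _) _ Lk).
  by apply: aeq_sym; apply: aeS kk => t kt It; have := kt It; rewrite mul0r subr0.
rewrite !big_ord_recr /=.
have := LgraphD vi 1 (c ord_max) (IH (fun i => c (widen_ord (leqnSn r) i)) _ _ (fun i => h (widen_ord (leqnSn r) i))) (h ord_max).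
by congr (Lgraph bc v _ _); apply/funext => t; rewrite mul1r.
Qed.

Variables (S : H -> Prop) (r : nat) (w : nat -> H) (z : C).
Hypothesis wS : forall i, (i < r)%N -> S (w i).
Hypothesis wi : indep_fam r w.
Hypothesis ws : span_fam S r w.
Hypothesis Ssum : forall s (q : 'I_s -> H) (a : 'I_s -> C), (forall i, S (q i)) -> S (\sum_(i < s) a i *: q i).
Hypothesis res : forall h, S h -> exists y, S y /\ Lgraph bc v y (z *: y + h : H).

(** The unbounded operator is handled through its resolvent at [z], which maps [S] to itself and so
    has a matrix; a basis of generalized eigenvectors is then found by linear algebra. *)
Lemma root_basis : exists f, [/\ forall i, (i < r)%N -> S (f i) /\ exists l, in_root_space bc v l (f i),
  indep_fam r f & span_fam S r f].
Proof.
have [y yP] := choice (fun i : 'I_r => res (wS (ltn_ord i))).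
have [T TP] := choice (fun i : 'I_r => ws (yP i).1).
pose Tm : 'M[C]_r := \matrix_(i, j) T i j.
pose comb (p : 'rV[C]_r) : H := \sum_(i < r) p 0 i *: w i.
have combD p q : comb (p + q) = comb p + comb q.
  by rewrite /comb -big_split /=; apply: eq_bigr => i _; rewrite mxE scalerDl.
have combZ a p : comb (a *: p) = a *: comb p.
  by rewrite /comb scaler_sumr; apply: eq_bigr => i _; rewrite mxE scalerA.
have comb0 : comb 0 = 0 by rewrite -(scale0r (0 : 'rV[C]_r)) combZ scale0r.
have comb_mul (p : 'rV[C]_r) (M : 'M[C]_r) : \sum_(i < r) p 0 i *: comb (row i M) = comb (p *m M).
  rewrite /comb; under eq_bigr do rewrite scaler_sumr.
  rewrite exchange_big /=; apply: eq_bigr => j _; rewrite mxE scaler_suml.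
  by apply: eq_bigr => i _; rewrite scalerA mxE.
have combT i : null (y i - comb (row i Tm)).
  have := TP i; congr null; congr (_ - _); apply: eq_bigr => j _; by rewrite !mxE.
have sumT (p : 'rV[C]_r) : null (\sum_(i < r) p 0 i *: y i - comb (p *m Tm)).
  rewrite -comb_mul -sumrB; apply: null_sum => i _.
  by rewrite -scalerBr; apply: nullZ.
have sumL (p : 'rV[C]_r) : Lgraph bc v (\sum_(i < r) p 0 i *: y i : H)
    (z *: (\sum_(i < r) p 0 i *: y i) + comb p : H).
  have := Lgraph_sum (fun i => p 0 i) (fun i => (yP i).2).
  have -> : \sum_(i < r) p 0 i *: (z *: y i + w i) = z *: (\sum_(i < r) p 0 i *: y i) + comb p.
    rewrite /comb scaler_sumr -big_split /=; apply: eq_bigr => i _.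
    by rewrite scalerDr !scalerA mulrC.
  by [].
have L0 : Lgraph bc v (0 : H) (0 : H).
  by have := @Lgraph_sum 0 (fun=> 0) (fun=> 0) (fun=> 0); rewrite !big_ord0; apply => -[].
(* If [p *m Tm = 0], the combination of the [y i] is null; its image under [L] is then null too, and
   differs from [comb p] by a null vector. *)
have Tu : Tm \in unitmx.
  rewrite -row_free_unit; apply: inj_row_free => p pT.
  have x0 : null (\sum_(i < r) p 0 i *: y i).
    by have := sumT p; rewrite pT comb0 subr0.
  have : null (z *: (\sum_(i < r) p 0 i *: y i) + comb p).
    apply/null_aeq0; apply: (Lgraph_unique vi (sumL p) L0); exact/null_aeq0.
  move=> n1; have n2 : null (comb p).
    by have := nullD n1 (nullN (nullZ z x0)); rewrite addrC addKr.
  by apply/rowP => i; rewrite (wi n2) mxE.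
(* From [(L - z) y = w] and [y = Tm w] the operator on [S] has the matrix [z + Tm^-1]. *)
pose A : 'M[C]_r := z%:M + invmx Tm.
have LA p : Lgraph bc v (comb p) (comb (p *m A)).
  apply: (Lgraph_aeq vi (fnP _) (fnP _) _ _ (sumL (p *m invmx Tm))).
    by apply/null_aeq/nullC; have := sumT (p *m invmx Tm); rewrite mulmxKV.
  apply/null_aeq/nullC; rewrite /A mulmxDr combD mul_mx_scalar combZ opprD addrACA subrr addr0 -scalerBr.
  by apply: nullZ; have := sumT (p *m invmx Tm); rewrite mulmxKV.
have kerA l k p : nilrow A l k p -> in_ker_pow bc v l k (comb p).
  elim: k p => [|k IH] p; rewrite /nilrow.
    by move=> /= ->; apply/null_aeq0; rewrite comb0; exact: null0.
  rewrite iterSr => /IH h /=; exists (comb (p *m A)); first exact: LA.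
  have e : comb (p *m (A - l%:M)) = comb (p *m A) - l *: comb p.
    by rewrite mulmxBr mul_mx_scalar -scaleNr -scalerN combD combZ scalerN scaleNr.
  by move: h; rewrite e.
have [P Pu Pg] := gen_eigenbasis A.
have rowP0 (c : 'I_r -> C) : \sum_(i < r) c i *: comb (row i P) = comb ((\row_i c i) *m P).
  by rewrite -comb_mul; apply: eq_bigr => i _; rewrite mxE.
pose f k : H := comb (if insub k is Some i then row (i : 'I_r) P else 0).
have fE (i : 'I_r) : f i = comb (row i P) by rewrite /f valK.
have sumf (c : 'I_r -> C) : \sum_(i < r) c i *: f i = comb ((\row_i c i) *m P).
  by rewrite -rowP0; apply: eq_bigr => i _; rewrite fE.
exists f; split.
- move=> i ir; rewrite (_ : i = val (Ordinal ir))// fE; split.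
    have S0 : forall s (q : 'I_s -> H) (a : 'I_s -> C), (forall i, S (q i)) -> S (\sum_(i < s) a i *: q i).
      exact: Ssum.
    by apply: S0 => j; apply: wS.
  by have [l [k h]] := Pg (Ordinal ir); exists l, k; exact: kerA.
- move=> c; rewrite sumf => /wi h.
  have : (\row_i c i) *m P = 0 by apply/rowP => i; rewrite h mxE.
  move=> /(congr1 (mulmx^~ (invmx P))); rewrite mulmxK// mul0mx => /rowP e i.
  by have := e i; rewrite !mxE.
- move=> x /ws[c cx]; exists (fun i => ((\row_i c i) *m invmx P) 0 i).
  rewrite sumf (_ : \row_i _ = (\row_i c i) *m invmx P); last by apply/rowP => i; rewrite mxE.
  rewrite mulmxKV//; move: cx; congr null; congr (_ - _); apply: eq_bigr => i _; by rewrite mxE.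
Qed.

End RootBasis.

(** * Riesz bases of root functions *)

Section Assembly.
Variable R : realType.
Local Notation C := R[i].
Local Notation H := (L2H R).
Implicit Types (x y g : H).

Lemma sum_ord_le (a : nat -> R) m n : (forall k, 0 <= a k) -> (m <= n)%N ->
  \sum_(k < m) a k <= \sum_(k < n) a k.
Proof.
move=> a0 mn; rewrite -(subnKC mn) big_split_ord /= lerDl; apply: sumr_ge0 => k _; exact: a0.
Qed.

Definition app r (f h : nat -> H) k := if (k < r)%N then f k else h (k - r)%N.

Lemma app_low r f h (i : 'I_r) : app r f h i = f i. Proof. by rewrite /app ltn_ord. Qed.
Lemma app_high r f h k : app r f h (r + k) = h k.
Proof. by rewrite /app ltnNge leq_addr /= addKn. Qed.

Lemma bessel_app r f h (K : R) : bessel h K -> bessel (app r f h) (\sum_(i < r) nsq (f i) + K).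
Proof.
move=> bh x n; have a0 k : 0 <= cabs (ip x (app r f h k)) ^+ 2 by exact: sqr_ge0.
apply: (le_trans (sum_ord_le a0 (leq_addl r n))).
rewrite big_split_ord /= mulrDl mulr_suml; apply: lerD.
  apply: ler_sum => i _; rewrite app_low; have := cauchy_schwarz x (f i).
  rewrite -!nrm_sqr -exprMn mulrC => h1; apply: lerXn2r => //; rewrite nnegrE ?cabs_ge0//.
  by rewrite mulr_ge0 ?nrm_ge0.
by under eq_bigr do rewrite app_high; exact: bh.
Qed.

Lemma bessel_conj (h : nat -> H) (K : R) : bessel h K -> bessel (fun k => L2conj (h k) : H) K.
Proof.
move=> bh x n; have := bh (L2conj x) n; rewrite -!nrm_sqr nrm_conj.
by under eq_bigr => k _ do rewrite -(conjK (h k)) -[ip _ _]/(bip (L2conj x) (L2conj (h k))) bipC /bip conjK ip_conj cabsJ.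
Qed.

Section Assemble.
Variables (h : nat -> H) (K : R).
Hypotheses (K0 : 0 < K) (bh : bessel h K) (oh : forall i j, bip (h i) (h j) = (i == j)%:R).
Let S x := forall k, bip x (h k) = 0.

(** Here [l] is the oblique projection of [g], the sum of the [bip g (h k) *: h k]; it converges
    because [h] and its conjugate are Bessel, and [h] is its own dual for the bilinear form. *)
Lemma complement_decomp g : exists2 l : H, S (g - l) & forall x, S x -> bip x l = 0.
Proof.
have bw := bessel_conj bh.
have [l lc _] := @synthesis _ H h K (fun k => ip g (L2conj (h k))) _ (@L2_complete R) K0 bh (bw g).
exists l => [k|x Sx].
  rewrite bipBl; have -> : bip l (h k) = bip g (h k).
    apply: (ip_conv_eq lc); exists k.+1 => n kn.
    have := @ip_osum _ H h (fun k => L2conj (h k) : H) (fun k => ip g (L2conj (h k))) n k oh.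
    by rewrite kn.
  by rewrite subrr.
rewrite bipC; apply: (ip_conv_eq lc); exists 0%N => n _.
rewrite ip_suml big1// => i _; rewrite ipZl (_ : ip (h i) _ = 0) ?mulr0//.
by have := Sx i; rewrite bipC.
Qed.

(** A bilinear form may degenerate on a subspace; it does not on [S], because every vector is the
    sum of one in [S] and one orthogonal to [S]. *)
Lemma complement_nondeg x : S x -> (forall y, S y -> bip x y = 0) -> null x.
Proof.
move=> Sx hx; apply: bip_zero => g; have [l Sl hl] := complement_decomp g.
by rewrite -[g](subrK l) bipDr hx// hl// addr0.
Qed.

Variables (r : nat) (f : nat -> H).
Hypotheses (fS : forall i, (i < r)%N -> S (f i)) (fi : indep_fam r f) (fs : span_fam S r f).

Let Ssum (c : 'I_r -> C) : S (\sum_(i < r) c i *: f i).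
Proof. by move=> k; rewrite bip_suml big1// => i _; rewrite bipZl fS ?mulr0. Qed.

(** Nondegeneracy on [S] makes the Gram matrix of [f] invertible; its inverse gives the dual basis,
    and this basis lies in [S]. *)
Lemma dual_family : exists f', (forall i, (i < r)%N -> S (f' i)) /\
  (forall i j, (i < r)%N -> (j < r)%N -> bip (f i) (f' j) = (i == j)%:R) /\
  (forall x, S x -> (forall j, (j < r)%N -> bip x (f' j) = 0) -> null x).
Proof.
pose G : 'M[C]_r := \matrix_(i, j) bip (f i) (f j).
have Gu : G \in unitmx.
  rewrite -row_free_unit; apply: inj_row_free => p pG.
  have n0 : null (\sum_(i < r) p 0 i *: f i).
    apply: complement_nondeg; first exact: Ssum.
    move=> y /fs[c cy]; rewrite (bip_eqr _ cy) bip_sumr big1// => j _.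
    rewrite bipZr bip_suml; have := congr1 (fun M : 'rV[C]_r => M 0 j) pG; rewrite !mxE => e.
    under eq_bigr do rewrite bipZl; rewrite -[RHS](mulr0 (c j)); congr (_ * _).
    by apply: etrans e; apply: eq_bigr => i _; rewrite mxE.
  by apply/rowP => i; rewrite (fi n0) mxE.
pose f'' (j : 'I_r) : H := \sum_(k < r) invmx G k j *: f k.
pose f' k : H := oapp f'' 0 (insub k).
have f'E (j : 'I_r) : f' j = f'' j by rewrite /f' valK.
have dual (i j : 'I_r) : bip (f i) (f'' j) = (i == j)%:R.
  rewrite /f'' bip_sumr; under eq_bigr do rewrite bipZr mulrC.
  have := congr1 (fun M : 'M[C]_r => M i j) (mulmxV Gu); rewrite !mxE => <-.
  by apply: eq_bigr => k _; rewrite mxE.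
exists f'; split; [|split].
- by move=> i ir; rewrite (f'E (Ordinal ir)); exact: Ssum.
- by move=> i j ir jr; rewrite (f'E (Ordinal jr)) (dual (Ordinal ir)).
- move=> x /fs[c cx] hx.
  have ci (j : 'I_r) : c j = 0.
    have := hx j (ltn_ord j); rewrite f'E (bip_eql _ cx) bip_suml (bigD1 j)//= bipZl dual eqxx mulr1.
    rewrite big1 ?addr0// => i ij; rewrite bipZl dual (negbTE ij) mulr0//.
  by move: cx; rewrite big1 ?subr0// => i _; rewrite ci scale0r.
Qed.

(** The low family with its dual basis and the self-dual high family are orthogonal to each other.
    Conjugation turns the bilinear duality into the Hermitian biorthogonality of
    [riesz_criterion]. *)
Lemma riesz_assembly e : hbasis e -> exists A B M, [/\ lin_mod A, lin_mod B, bnd_by A M & bnd_by B M] /\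
    [/\ forall x, null (A (B x) - x), forall x, null (B (A x) - x) &
        forall k, null (A (e k) - app r f h k)].
Proof.
move=> he; have [f' [f'S [dual tot]]] := dual_family.
pose w k : H := L2conj (app r f' h k).
have bu := bessel_app r f bh; have bw := bessel_conj (bessel_app r f' bh).
pose K1 := \sum_(i < r) nsq (f i) + K; pose K2 := \sum_(i < r) nsq (f' i) + K.
have K10 : 0 < K1 by rewrite ltr_wpDl// sumr_ge0// => i _; exact: nsq_ge0.
have K20 : 0 < K2 by rewrite ltr_wpDl// sumr_ge0// => i _; exact: nsq_ge0.
have bm (u : nat -> H) L L' : bessel u L -> L <= L' -> bessel u L'.
  by move=> b ll x n; apply: (le_trans (b x n)); rewrite ler_wpM2r ?nsq_ge0.
apply: (@riesz_criterion _ H e _ w (K1 + K2) (@L2_complete R) he).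
- exact: addr_gt0.
- by apply: bm bu _; rewrite lerDl ltW.
- by apply: bm bw _; rewrite lerDr ltW.
- move=> i j; rewrite -[ip _ _]/(bip _ _) /app.
  have [ir|ri] := ltnP i r; have [jr|rj] := ltnP j r.
  + exact: dual.
  + by rewrite fS// ltn_eqF// (leq_trans ir).
  + by rewrite bipC f'S// gtn_eqF// (leq_trans jr).
  + by rewrite oh -(eqn_add2r r) !subnK.
- move=> x hx.
  have Sx : S x by move=> k; have := hx (r + k)%N; rewrite /w app_high.
  apply: tot => // j jr; have := hx j; rewrite /w /app jr; exact.
Qed.

End Assemble.
End Assembly.

(** * Bounded eigenvectors of the symmetric 2x2 block *)

Section Rotation.
Variable R : realType.
Local Notation C := R[i].

Definition rot_eigen (al b xi x y : C) := [/\ x ^+ 2 + y ^+ 2 = 1, al * x + b * y = xi * x & b * x - al * y = xi * y].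

(** Division by a square root of [u^2 + w^2]; the lower bound on this sum keeps the quotients
    bounded. *)
Lemma rot_normalize (al b xi u w : C) (D : R) : xi != 0 ->
  al * u + b * w = xi * u -> b * u - al * w = xi * w ->
  2 * cabs xi ^+ 2 <= cabs (u ^+ 2 + w ^+ 2) -> cabs u <= D * cabs xi -> cabs w <= D * cabs xi ->
  exists x y, [/\ rot_eigen al b xi x y, cabs x <= D & cabs y <= D].
Proof.
move=> xi0 e1 e2 ge ud wd; pose s := sqrtC (u ^+ 2 + w ^+ 2).
have sE : s ^+ 2 = u ^+ 2 + w ^+ 2 by rewrite sqrtCK.
have xp : 0 < cabs xi by rewrite cabs_gt0.
have sx : cabs xi <= cabs s.
  rewrite -(@ler_pXn2r _ 2) ?nnegrE ?cabs_ge0// -[leRHS]cabsX sE.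
  by apply: le_trans ge; have := sqr_ge0 (cabs xi); lra.
have s0 : s != 0 by rewrite -cabs_gt0; lra.
have bd a : cabs a <= D * cabs xi -> cabs (a / s) <= D.
  move=> ad; have D0 : 0 <= D by rewrite -(pmulr_lge0 _ xp); apply: le_trans ad; exact: cabs_ge0.
  rewrite cabsM cabsV ler_pdivrMr ?cabs_gt0//; apply: (le_trans ad).
  by rewrite ler_wpM2l.
exists (u / s), (w / s); split; [split|exact: bd|exact: bd].
- by rewrite !expr_div_n -mulrDl -sE divff// expf_neq0.
- by rewrite !mulrA -mulrDl e1.
- by rewrite !mulrA -mulrBl e2.
Qed.

(** [|b| <= |xi| + |al|] comes from the determinant and [|al| <= |xi| + |dl| + |b|/4] from the
    Neumann shift; the pair of inequalities closes because 1/4 is less than 1. *)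
Lemma matrix_bound (al b xi s dl : C) (K : R) : al ^+ 2 + b ^+ 2 = xi ^+ 2 ->
  cabs s <= 1 / 4 * cabs b -> dl = xi - al - s -> cabs dl <= K * cabs (xi *+ 2) ->
  cabs al <= (2 + 4 * K) * cabs xi /\ cabs b <= (3 + 4 * K) * cabs xi.
Proof.
move=> e sb dE dK.
rewrite -mulr_natl in dK.
have x2 : cabs (2 * xi) = 2 * cabs xi by rewrite cabsM cabs_nat.
rewrite x2 in dK.
have bx : cabs b <= cabs xi + cabs al.
  rewrite -(@ler_pXn2r _ 2) ?nnegrE ?addr_ge0 ?cabs_ge0// -cabsX.
  have -> : b ^+ 2 = xi ^+ 2 - al ^+ 2 by rewrite -e; ring.
  apply: (le_trans (cabsB _ _)); rewrite !cabsX sqrrD -addrA lerD2l lerDr.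
  by rewrite mulrn_wge0 ?mulr_ge0 ?cabs_ge0.
have ax : cabs al <= cabs xi + cabs dl + cabs s.
  have -> : al = xi - dl - s by rewrite dE; ring.
  apply: (le_trans (cabsB _ _)); rewrite lerD2r; exact: cabsB.
have d0 := cabs_ge0 dl; have x0 := cabs_ge0 xi.
have e1 : K * (2 * cabs xi) = 2 * (K * cabs xi) by ring.
rewrite e1 in dK; rewrite !mulrDl -!mulrA.
by move: (K * cabs xi) dK => KX dK; split; lra.
Qed.

(** The eigenvectors [(al + xi, b)] and [(b, xi - al)] have squares [2 xi (xi + al)] and
    [2 xi (xi - al)]. As [xi + al] and [xi - al] add up to [2 xi], one of them has modulus at least
    [|xi|], and that eigenvector is normalized. *)
Lemma rotation (al b xi s dl : C) (K : R) : 0 <= K -> xi != 0 -> al ^+ 2 + b ^+ 2 = xi ^+ 2 ->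
  cabs s <= 1 / 4 * cabs b -> dl = xi - al - s -> cabs dl <= K * cabs (xi *+ 2) ->
  exists x y, [/\ rot_eigen al b xi x y, cabs x <= 3 + 4 * K & cabs y <= 3 + 4 * K].
Proof.
move=> K0 xi0 e sb dE dK; have [al_le b_le] := matrix_bound e sb dE dK.
have xp : 0 < cabs xi by rewrite cabs_gt0.
have x2 : cabs (2 * xi) = 2 * cabs xi by rewrite cabsM cabs_nat.
have Dal u : u = al + xi \/ u = xi - al -> cabs u <= (3 + 4 * K) * cabs xi.
  have -> : (3 + 4 * K) * cabs xi = (2 + 4 * K) * cabs xi + cabs xi by ring.
  case=> ->; [have := cabsD al xi|have := cabsB xi al]; lra.
have [h|h] := leP (cabs xi) (cabs (al + xi)).
  apply: (@rot_normalize _ _ _ (al + xi) b) => //; last by apply: Dal; left.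
  - have -> : al * (al + xi) + b * b = al ^+ 2 + b ^+ 2 + al * xi by ring.
    by rewrite e; ring.
  - by ring.
  - have -> : (al + xi) ^+ 2 + b ^+ 2 = al ^+ 2 + b ^+ 2 + 2 * al * xi + xi ^+ 2 by ring.
    rewrite e; have -> : xi ^+ 2 + 2 * al * xi + xi ^+ 2 = 2 * xi * (al + xi) by ring.
    by rewrite cabsM x2 expr2 mulrA ler_wpM2l ?mulr_ge0 ?cabs_ge0.
have h2 : cabs xi <= cabs (xi - al).
  have := cabsD (al + xi) (xi - al); have -> : al + xi + (xi - al) = 2 * xi by ring.
  by rewrite x2; lra.
apply: (@rot_normalize _ _ _ b (xi - al)) => //; last by apply: Dal; right.
- by ring.
- have -> : b * b - al * (xi - al) = al ^+ 2 + b ^+ 2 - al * xi by ring.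
  by rewrite e; ring.
- have -> : b ^+ 2 + (xi - al) ^+ 2 = al ^+ 2 + b ^+ 2 - 2 * al * xi + xi ^+ 2 by ring.
  rewrite e; have -> : xi ^+ 2 - 2 * al * xi + xi ^+ 2 = 2 * xi * (xi - al) by ring.
  by rewrite cabsM x2 expr2 mulrA ler_wpM2l ?mulr_ge0 ?cabs_ge0.
Qed.

End Rotation.

Section PairRoots.
Variable R : realType.
Local Notation C := R[i].
Local Notation H := (L2H R).
Variable v : R -> C.
Hypothesis vi : cintble I0pi v.
Variables (bc : bcond) (G F : H) (dG dF : R -> C) (m al b : C).
Hypothesis domG : dom v bc G dG (fun x => (m + al) * G x + b * F x).
Hypothesis domF : dom v bc F dF (fun x => b * G x + (m - al) * F x).

Lemma dom_pair (x y : C) : dom v bc (x *: G + y *: F : H) (fun t => x * dG t + y * dF t)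
  (fun t => m * (x *: G + y *: F : H) t + ((al * x + b * y) *: G + (b * x - al * y) *: F : H) t).
Proof. by apply: eq_dom (domD (domZ x domG) (domZ y domF)) => // t /=; ring. Qed.

(** For [xi = 0] the block minus [m] has square [al^2 + b^2 = 0], so every combination is a root
    function of order 2; otherwise an eigenvector is required. *)
Lemma pair_root (xi x y : C) : al ^+ 2 + b ^+ 2 = xi ^+ 2 ->
  xi = 0 \/ (al * x + b * y = xi * x /\ b * x - al * y = xi * y) ->
  in_root_space bc v (m + xi) (x *: G + y *: F : H).
Proof.
move=> e [xi0|[e1 e2]].
  exists 2%N; rewrite xi0 addr0 /=; have d1 := dom_pair x y; have d2 := dom_pair (al * x + b * y) (b * x - al * y).
  eexists; first exact: dom_self d1.
  exists (fun t => m * ((al * x + b * y) *: G + (b * x - al * y) *: F : H) t + 0).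
    apply: dom_self; apply: eq_dom d2 => // t /=; first by ring.
    congr (_ + _); have -> : (al * (al * x + b * y) + b * (b * x - al * y)) * G t = (al ^+ 2 + b ^+ 2) * x * G t by ring.
    have -> : (b * (al * x + b * y) - al * (b * x - al * y)) * F t = (al ^+ 2 + b ^+ 2) * y * F t by ring.
    by rewrite e xi0 expr0n !mul0r addr0.
  by apply: aeW => t _ /=; ring.
apply: eigen_root; apply: dom_self; apply: eq_dom (dom_pair x y) => // t /=.
by rewrite e1 e2; ring.
Qed.

End PairRoots.

Section GoodPairs.
Variable R : realType.
Local Notation C := R[i].
Local Notation H := (L2H R).
Variable v : R -> C.
Hypothesis vi : cintble I0pi v.
Variables (N : nat) (lamm lamp nu : nat -> C) (p : bool).

(** [x] and [y] rotate [(G, F)] into root functions of norm controlled by [D]. The last clause says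
    that the orthogonal complement of the pair for the bilinear form is invariant under the
    resolvent. *)
Definition good_pair (C1 D : R) n (G F : H) (x y : C) : Prop :=
  [/\ bip G G = 1, bip G F = 0, bip F F = 1, x ^+ 2 + y ^+ 2 = 1 & cabs x <= D /\ cabs y <= D] /\
  [/\ nrm (G - tbase R p n) <= C1 / n%:R, nrm (F - tbase R p n.-1) <= C1 / n%:R,
    in_root_space (per_of n) v (lamp n) (x *: G + y *: F : H),
    in_root_space (per_of n) v (lamm n) (- y *: G + x *: F : H) &
    forall z (h u : H), z != lamm n -> z != lamp n -> Lgraph (per_of n) v u (z *: u + h : H) ->
      bip h G = 0 -> bip h F = 0 -> bip u G = 0 /\ bip u F = 0].

Lemma pair_good C1 K n G F al b : 0 <= K -> odd n = p ->
  pair_of v lamm lamp nu (odd n) n C1 G F al b ->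
  (lamp n - lamm n != 0 -> cabs (lamp n - nu n) <= K * cabs (lamp n - lamm n)) ->
  exists x y, good_pair C1 (3 + 4 * K) n G F x y.
Proof.
move=> K0 np [[[dG q1] [dF q2] q3 q4 q5] [q6 q7 q8 q9]] hK; rewrite np in q8 q9.
set m := (lamp n + lamm n) / 2 in q1 q2 q7.
pose xi := (lamp n - lamm n) / 2.
have two : (2 : C) != 0 by rewrite pnatr_eq0.
have lpE : lamp n = m + xi by rewrite /m /xi; field.
have lmE : lamm n = m + - xi by rewrite /m /xi; field.
have [x [y [xy xr [Dx Dy]]]] : exists x y, [/\ x ^+ 2 + y ^+ 2 = 1,
    xi = 0 \/ (al * x + b * y = xi * x /\ b * x - al * y = xi * y) & cabs x <= 3 + 4 * K /\ cabs y <= 3 + 4 * K].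
  have [xi0|xi0] := eqVneq xi 0.
    exists 1, 0; split; [by rewrite expr1n expr0n addr0|by left|].
    by rewrite cabs1 cabs0; split; lra.
  have g0 : lamp n - lamm n != 0.
    by apply: contraNneq xi0 => g0; rewrite /xi g0 mul0r.
  have dE : lamp n - nu n = xi - al - (nu n - m - al) by rewrite lpE; ring.
  have dK := hK g0.
  have gE : lamp n - lamm n = xi *+ 2 by rewrite -mulr_natl /xi; field.
  rewrite gE in dK.
  have [x [y [[e1 e2 e3] h1 h2]]] := rotation K0 xi0 q6 q7 dE dK.
  by exists x, y; split => //; right.
exists x, y; split; split => //.
- by rewrite lpE; apply: (pair_root q1 q2) => //.
- rewrite lmE; apply: (pair_root q1 q2); first by rewrite sqrrN.
  case: xr => [->|[e1 e2]]; first by left; rewrite oppr0.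
  right; split.
    have -> : al * - y + b * x = b * x - al * y by ring.
    by rewrite e2; ring.
  have -> : b * - y - al * x = - (al * x + b * y) by ring.
  by rewrite e1; ring.
- move=> z h u zm zp Lu hG hF.
  have e1 := Lgraph_symmetric vi Lu (dom_self q1).
  have e2 := Lgraph_symmetric vi Lu (dom_self q2).
  have {}e1 : bip (z *: u + h) G = bip u ((m + al) *: G + b *: F) by rewrite !bipE; exact: e1.
  have {}e2 : bip (z *: u + h) F = bip u (b *: G + (m - al) *: F) by rewrite !bipE; exact: e2.
  move: e1 e2; rewrite !bipDl !bipZl hG hF !bipDr !bipZr !addr0.
  move: (bip u G) (bip u F) => P Q e1 e2.
  (* [P] and [Q] solve a homogeneous 2x2 system with this determinant. *)
  have D0 : (lamp n - z) * (lamm n - z) != 0 by rewrite mulf_neq0// subr_eq0 eq_sym.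
  have DE : (lamp n - z) * (lamm n - z) = (m + al - z) * (m - al - z) - b ^+ 2.
    have -> : b ^+ 2 = xi ^+ 2 - al ^+ 2 by rewrite -q6; ring.
    by rewrite lpE lmE; ring.
  have z1 : (m + al) * P + b * Q - z * P = 0 by rewrite -e1 subrr.
  have z2 : b * P + (m - al) * Q - z * Q = 0 by rewrite -e2 subrr.
  split; apply/eqP; rewrite -(mulrI_eq0 _ (lregP D0)) DE; apply/eqP.
    transitivity ((m - al - z) * ((m + al) * P + b * Q - z * P) - b * (b * P + (m - al) * Q - z * Q)); first by ring.
    by rewrite z1 z2 !mulr0 subrr.
  transitivity ((m + al - z) * (b * P + (m - al) * Q - z * Q) - b * ((m + al) * P + b * Q - z * P)); first by ring.
  by rewrite z1 z2 !mulr0 subrr.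
Qed.

End GoodPairs.

(** * The system of root functions of high frequency *)

Section HighSystem.
Variable R : realType.
Local Notation C := R[i].
Local Notation H := (L2H R).
Variable v : R -> C.
Hypothesis vi : cintble I0pi v.
Variables (lamm lamp : nat -> C) (p : bool) (C1 D : R) (d : nat).
Variables (G F : nat -> H) (x y : nat -> C).
Hypothesis dp : odd d != p.
Hypothesis d_big : C1 ^+ 2 * 2 < d%:R.
Hypothesis d1 : (0 < d)%N.
Hypothesis gd : forall n, (d < n)%N -> odd n = p -> good_pair v lamm lamp p C1 D n (G n) (F n) (x n) (y n).
Hypothesis discs : forall n, (d < n)%N -> disc n (lamm n) /\ disc n (lamp n).

(** [gsys] is close to the trigonometric basis, [hsys] consists of root functions; the Bessel bounds
    are proved for the former and transferred. Both use the indexing of [tbase]. *)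
Definition gsys j : H := if (j < d)%N then 0 else if odd j == p then G (freq p j) else F (freq p j).
Definition hsys j : H := let n := freq p j in
  if odd j == p then x n *: G n + y n *: F n else - y n *: G n + x n *: F n.

(** The parity of [d] differs from [p], so the cut never separates the indices [n.-1] and [n] of one
    frequency. *)
Lemma freq_gt j : (d <= j)%N -> (d < freq p j)%N.
Proof.
move=> dj; rewrite /freq; case: (eqVneq (odd j) p) => [jp|//].
by rewrite ltn_neqAle dj andbT; apply: contraNneq dp => ->; rewrite jp.
Qed.

Let gdj j (dj : (d <= j)%N) := gd (freq_gt dj) (odd_freq p j).

Lemma gsys_near j : (d <= j)%N -> nrm (gsys j - tbase R p j) <= C1 / j%:R.
Proof.
move=> dj; have [_ [h1 h2 _ _ _]] := gdj dj; rewrite /gsys ltnNge dj /=.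
have j0 : 0 < (j%:R : R) by rewrite ltr0n; lia.
have C10 : 0 <= C1.
  have f0 : 0 < ((freq p j)%:R : R) by rewrite ltr0n (leq_ltn_trans _ (freq_gt dj)).
  by have := le_trans (nrm_ge0 _) h1; rewrite pmulr_lge0 ?invr_gt0.
have fj : C1 / (freq p j)%:R <= C1 / j%:R.
  have jf : (j <= freq p j)%N by rewrite /freq; case: ifP.
  by rewrite ler_wpM2l// lef_pV2 ?posrE ?ltr0n ?ler_nat//; lia.
apply: le_trans fj; move: h1 h2; rewrite /freq; case: ifP => //.
Qed.

(** Telescoping with [1/k^2 <= 1/(k - 1) - 1/k]; the exact remainder is kept in the induction. *)
Lemma inv_sq_sum n : \sum_(k < n) (if (k < d)%N then 0 else (k%:R ^+ 2)^-1) <= 2 / d%:R :> R.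
Proof.
have d0 : 0 < (d%:R : R) by rewrite ltr0n.
have H1 : forall m, (d < m)%N -> \sum_(k < m) (if (k < d)%N then 0 else (k%:R ^+ 2)^-1) <= 2 / d%:R - (m.-1%:R)^-1 :> R.
  elim=> [//|m IH]; rewrite ltnS leq_eqVlt => /orP[/eqP <-|dm].
    rewrite big_ord_recr /= ltnn big1 ?add0r; last by move=> k _; rewrite ltn_ord.
    have -> : 2 / d%:R - d%:R^-1 = d%:R^-1 :> R by ring.
    by rewrite lef_pV2 ?posrE ?exprn_gt0// expr2 ler_pMl// ler1n.
  rewrite big_ord_recr /= ltnNge (ltnW dm) /=; apply: (le_trans (lerD (IH dm) (lexx _))).
  have m0 : 0 < (m.-1%:R : R) by rewrite ltr0n; lia.
  have -> : m%:R = m.-1%:R + 1 :> R by rewrite natr1 prednK//; lia.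
  set t := m.-1%:R; rewrite -subr_ge0.
  have -> : 2 / d%:R - (t + 1)^-1 - (2 / d%:R - t^-1 + ((t + 1) ^+ 2)^-1) = (t * (t + 1) ^+ 2)^-1.
    by field; rewrite ?gt_eqF ?addr_gt0 ?ltr01.
  by rewrite invr_ge0 mulr_ge0 ?sqr_ge0 ?ltW.
apply: (@le_trans _ _ (\sum_(k < n + d.+1) (if (k < d)%N then 0 else (k%:R ^+ 2)^-1))).
  apply: (@sum_ord_le R (fun k => if (k < d)%N then 0 else (k%:R ^+ 2)^-1)); last exact: leq_addr.
  by move=> k; case: ifP => // _; rewrite invr_ge0 sqr_ge0.
apply: (le_trans (H1 _ _)); first by lia.
by rewrite gerBl invr_ge0.
Qed.

Lemma sq_le (a b : R) : 0 <= a -> a <= b -> a ^+ 2 <= b ^+ 2.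
Proof. by move=> a0 ab; apply: lerXn2r => //; rewrite nnegrE//; apply: le_trans ab. Qed.

(** Quadratic closeness to an orthonormal system: the system itself contributes 2, and the squared
    deviations at most 2 by the choice of [d]. *)
Lemma gsys_bessel : bessel gsys 4.
Proof.
move=> f n.
have step k : cabs (ip f (gsys k)) ^+ 2 <= 2 * cabs (ip f (tbase R p k)) ^+ 2 +
   2 * (C1 ^+ 2 * nsq f) * (if (k < d)%N then 0 else (k%:R ^+ 2)^-1).
  have [kd|dk] := ltnP k d.
    by rewrite /gsys kd ip0r cabs0 expr0n /= mulr0 addr0 mulr_ge0// sqr_ge0.
  have -> : ip f (gsys k) = ip f (tbase R p k) + ip f (gsys k - tbase R p k) by rewrite ipBr addrC subrK.
  apply: (le_trans (sq_cabsD _ _)); rewrite lerD2l -mulrA ler_wpM2l//.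
  have h1 : cabs (ip f (gsys k - tbase R p k)) <= nrm f * (C1 / k%:R).
    by apply: (le_trans (cauchy_schwarz _ _)); rewrite ler_wpM2l ?nrm_ge0 ?gsys_near.
  apply: (le_trans (sq_le (cabs_ge0 _) h1)).
  by rewrite !exprMn exprVn nrm_sqr mulrCA mulrA.
apply: (le_trans (ler_sum _ (fun (k : 'I_n) _ => step k))).
rewrite big_split /= -!mulr_sumr.
have h1 := bessel_orthonormal (@tbase_orthonormal R p) f n.
have h2 := inv_sq_sum n.
have f0 := nsq_ge0 f.
have h3 : 2 * (C1 ^+ 2 * nsq f) * (\sum_(k < n) (if (k < d)%N then 0 else (k%:R ^+ 2)^-1)) <= 2 * (C1 ^+ 2 * nsq f) * (2 / d%:R).
  by rewrite ler_wpM2l// mulr_ge0// mulr_ge0// sqr_ge0.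
have h4 : 2 * (C1 ^+ 2 * nsq f) * (2 / d%:R) <= 2 * nsq f.
  have -> : 2 * (C1 ^+ 2 * nsq f) * (2 / d%:R) = 2 * nsq f * (C1 ^+ 2 * 2 / d%:R) by ring.
  rewrite -[leRHS]mulr1 ler_wpM2l ?mulr_ge0// ler_pdivrMr ?ltr0n// mul1r; exact: ltW.
rewrite mul1r in h1; move: h1 h3 h4; set s1 := \sum_(_ < _) _; set s2 := \sum_(_ < _) _.
by move: (2 * (C1 ^+ 2 * nsq f) * s2) (2 * (C1 ^+ 2 * nsq f) * (2 / d%:R)) => q1 q2; lra.
Qed.

(* The two indices of frequency n are n (cosine) and n.-1 (sine). *)
Lemma hsys_gsys j : (d <= j)%N -> exists a b k, [/\ hsys j = a *: gsys j + b *: gsys k, cabs a <= D, cabs b <= D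
  & k = j.-1 \/ k = j.+1].
Proof.
move=> dj; have [[_ _ _ _ [Dx Dy]] _] := gdj dj; have dn := freq_gt dj.
move: Dx Dy dn; rewrite /hsys /gsys /freq (_ : (j < d)%N = false); last by lia.
case: (eqVneq (odd j) p) => [jp|jp] Dx Dy dn.
  exists (x j), (y j), j.-1; split => //; last by left.
  have jE : j.-1.+1 = j by rewrite prednK//; lia.
  have -> : (j.-1 < d)%N = false by lia.
  have -> : (odd j.-1 == p) = false by apply/negbTE; move: jp; rewrite -{1}jE /= => <-; case: (odd j.-1).
  by rewrite jE.
exists (x j.+1), (- y j.+1), j.+1; split; [|by []|by rewrite cabsN|by right].
have -> : (j.+1 < d)%N = false by lia.
have -> : odd j.+1 == p by move: jp => /=; case: (odd j); case: (p).
by rewrite addrC.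
Qed.

(** Each root function involves its own index and one neighbour, so the sum is dominated by three
    shifted copies of the sum for [gsys], each at most [4 * nsq f]. *)
Lemma hsys_bessel : 0 < D -> bessel (fun k => hsys (d + k)) (2 * D ^+ 2 * 16).
Proof.
move=> D0 f n; pose a k := cabs (ip f (gsys k)) ^+ 2.
have a0 k : 0 <= a k by exact: sqr_ge0.
have B m : \sum_(k < m) a k <= 4 * nsq f by exact: gsys_bessel.
have step k : cabs (ip f (hsys (d + k))) ^+ 2 <= 2 * D ^+ 2 * (a (d + k)%N + (a (d + k).-1 + a (d + k).+1)).
  have [c1 [c2 [j [-> h1 h2 hj]]]] := hsys_gsys (leq_addr k d).
  rewrite ipDr !ipZr; apply: (le_trans (sq_cabsD _ _)).
  have t (c : C) (i : nat) : cabs c <= D -> cabs (c^*%C * ip f (gsys i)) ^+ 2 <= D ^+ 2 * a i.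
    move=> cD; rewrite cabsM cabsJ exprMn; apply: ler_wpM2r; first exact: sqr_ge0.
    exact: sq_le (cabs_ge0 _) cD.
  have t1 := t _ (d + k)%N h1; have t2 := t _ j h2.
  have aj : a j <= a (d + k).-1 + a (d + k).+1.
    by case: hj => ->; rewrite ?lerDl ?lerDr.
  have t3 : D ^+ 2 * a j <= D ^+ 2 * (a (d + k).-1 + a (d + k).+1) by rewrite ler_wpM2l ?sqr_ge0.
  rewrite -mulrA [D ^+ 2 * (_ + _)]mulrDr; lra.
apply: (le_trans (ler_sum _ (fun (k : 'I_n) _ => step k))).
rewrite -mulr_sumr -[leRHS]mulrA; apply: ler_wpM2l; first by rewrite mulr_ge0 ?ler0n ?sqr_ge0.
rewrite !big_split /=.
have h1 : \sum_(k < n) a (d + k)%N <= 4 * nsq f.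
  apply: le_trans (B (d + n)%N); rewrite [leRHS]big_split_ord /= lerDr; exact: sumr_ge0.
have h2 : \sum_(k < n) a (d + k).-1 <= 4 * nsq f.
  apply: le_trans (B (d.-1 + n)%N); rewrite [leRHS]big_split_ord /=.
  rewrite (eq_bigr (fun k : 'I_n => a (d.-1 + k)%N)); last by move=> k _; congr a; lia.
  by rewrite lerDr; exact: sumr_ge0.
have h3 : \sum_(k < n) a (d + k).+1 <= 4 * nsq f.
  apply: le_trans (B (d.+1 + n)%N); rewrite [leRHS]big_split_ord /= lerDr; exact: sumr_ge0.
have := nsq_ge0 f; lra.
Qed.

Let lam j := if odd j == p then lamp (freq p j) else lamm (freq p j).

Lemma hsys_root j : (d <= j)%N -> in_root_space (per_of (freq p j)) v (lam j) (hsys j).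
Proof. by move=> dj; have [_ [_ _ r1 r2 _]] := gdj dj; rewrite /lam /hsys; case: ifP. Qed.

(** For distinct frequencies the eigenvalues lie in disjoint discs; for equal ones the rotation
    preserves the bilinear form. *)
Lemma hsys_orthonormal i j : (d <= i)%N -> (d <= j)%N -> bip (hsys i) (hsys j) = (i == j)%:R.
Proof.
move=> di dj; have [fij|fij] := eqVneq (freq p i) (freq p j); last first.
  have [ij|ij] := eqVneq i j; first by rewrite ij eqxx in fij.
  have [k hi] := hsys_root di; have [l hj] := hsys_root dj.
  have bcE : per_of (freq p j) = per_of (freq p i) by rewrite /per_of !odd_freq.
  rewrite bcE in hj; apply: (root_symmetric2 vi _ hi hj).
  have [d3 d4] := discs (freq_gt di); have [d5 d6] := discs (freq_gt dj).
  by rewrite /lam; case: ifP => _; case: ifP => _; exact: disc_disjoint fij _ _.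
have [[n1 n2 n3 n4 _] _] := gdj di; have n2' := n2; rewrite bipC in n2'.
rewrite /hsys -fij; move: fij n1 n2 n2' n3 n4; set n := freq p i.
move: (G n) (F n) (x n) (y n) => g f a b fij n1 n2 n2' n3 n4.
have bE (a1 b1 a2 b2 : C) : bip (a1 *: g + b1 *: f) (a2 *: g + b2 *: f) = a1 * a2 + b1 * b2.
  by rewrite bipDl !bipDr !bipZl !bipZr n1 n2 n2' n3; ring.
move: fij; rewrite /n /freq.
case: (eqVneq (odd i) p) => ip_; case: (eqVneq (odd j) p) => jp fij; rewrite bE.
- by rewrite fij eqxx -n4 !expr2.
- rewrite (_ : (i == j) = false); last by apply/eqP => e; rewrite e in fij; lia.
  by rewrite mulr0n; ring.
- rewrite (_ : (i == j) = false); last by apply/eqP => e; rewrite e in fij; lia.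
  by rewrite mulr0n; ring.
- case: fij => ->; rewrite eqxx -[RHS]n4; ring.
Qed.

Lemma hsys_orth f j : (d <= j)%N -> (forall k, bip f (hsys (d + k)) = 0) ->
  bip f (G (freq p j)) = 0 /\ bip f (F (freq p j)) = 0.
Proof.
move=> dj h; have [[_ _ _ n4 _] _] := gdj dj; set n := freq p j in n4 *.
have hn k : (d <= k)%N -> bip f (hsys k) = 0 by move=> dk; have := h (k - d)%N; rewrite subnKC.
have nn : odd n = p by exact: odd_freq.
have dn : (d < n)%N by exact: freq_gt.
have n0 : n.-1.+1 = n by rewrite prednK//; lia.
have e1 : x n * bip f (G n) + y n * bip f (F n) = 0.
  have := hn n (ltnW dn); rewrite /hsys /freq nn eqxx bipDr !bipZr //.
have e2 : - y n * bip f (G n) + x n * bip f (F n) = 0.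
  have := hn n.-1 _; rewrite /hsys /freq.
  have -> : (odd n.-1 == p) = false by apply/negbTE; rewrite -nn -{2}n0 /=; case: (odd n.-1).
  rewrite n0 bipDr !bipZr; apply; lia.
split; rewrite -[LHS]mul1r -n4.
  transitivity (x n * (x n * bip f (G n) + y n * bip f (F n)) - y n * (- y n * bip f (G n) + x n * bip f (F n))); first by ring.
  by rewrite e1 e2 !mulr0 subrr.
transitivity (y n * (x n * bip f (G n) + y n * bip f (F n)) + x n * (- y n * bip f (G n) + x n * bip f (F n))); first by ring.
by rewrite e1 e2 !mulr0 addr0.
Qed.

(** Orthogonality to [hsys] is orthogonality to [gsys], so a high trigonometric coordinate of [f]
    equals its form against a small difference; together these coordinates carry less than the whole
    squared norm. *)
Lemma complement_finite f : (forall k, bip f (hsys (d + k)) = 0) ->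
  (forall k, (k < d)%N -> ip f (tbase R p k) = 0) -> null f.
Proof.
move=> h low; have d0 : 0 < (d%:R : R) by rewrite ltr0n.
apply: (@low_coordinates_null _ H (tbase R p) d (C1 ^+ 2 * 2 / d%:R) f (@tbase_hbasis R p)) => //.
  by rewrite ltr_pdivrMr// mul1r.
move=> n; have f0 := nsq_ge0 f.
have step k : (d <= k)%N -> cabs (ip f (tbase R p k)) ^+ 2 <= C1 ^+ 2 * nsq f * (k%:R ^+ 2)^-1.
  move=> dk; have gk : bip f (gsys k) = 0.
    by have [z1 z2] := hsys_orth dk h; rewrite /gsys ltnNge dk /=; case: ifP.
  have cj : L2conj (tbase R p k) = tbase R p k.
    by apply: L2t_eq; apply/funext => t; exact: tfunJ.
  have -> : ip f (tbase R p k) = - bip f (gsys k - tbase R p k).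
    by rewrite bipBr gk sub0r opprK /bip cj.
  rewrite cabsN; have h1 : cabs (bip f (gsys k - tbase R p k)) <= nrm f * (C1 / k%:R).
    by apply: (le_trans (bip_bound _ _)); rewrite ler_wpM2l ?nrm_ge0 ?gsys_near.
  apply: (le_trans (sq_le (cabs_ge0 _) h1)).
  by rewrite !exprMn exprVn nrm_sqr mulrCA mulrA.
have h2 := inv_sq_sum n.
apply: (@le_trans _ _ (C1 ^+ 2 * nsq f * \sum_(k < n) (if (k < d)%N then 0 else (k%:R ^+ 2)^-1))).
  rewrite mulr_sumr -(big_mkord xpredT (fun k => C1 ^+ 2 * nsq f * (if (k < d)%N then 0 else (k%:R ^+ 2)^-1))).
  have [nd|dn] := leqP n d.
    rewrite [leLHS]big_geq//; apply: sumr_ge0 => k _; apply: mulr_ge0; first by rewrite mulr_ge0 ?sqr_ge0.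
    by case: ifP => // _; rewrite invr_ge0 sqr_ge0.
  rewrite [leRHS](@big_cat_nat _ _ _ d)//=; last exact: ltnW.
  rewrite (_ : \sum_(0 <= i < d) _ = 0) ?add0r; last first.
    by rewrite big_nat_cond big1// => k /andP[/andP[_ ->] _]; rewrite mulr0.
  rewrite big_nat_cond [leRHS]big_nat_cond; apply: ler_sum => k /andP[/andP[dk _] _].
  by rewrite ltnNge dk /=; exact: step.
have -> : C1 ^+ 2 * 2 / d%:R * nsq f = C1 ^+ 2 * nsq f * (2 / d%:R) by ring.
by rewrite ler_wpM2l// mulr_ge0// sqr_ge0.
Qed.

End HighSystem.

(** * Passage between vectors and functions *)

Section ToRieszBasis.
Variable R : realType.
Local Notation C := R[i].
Local Notation H := (L2H R).

(** Functions that are not square integrable get the value 0; [bounded_operator] only looks at the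
    others. *)
Definition lift_op (A : H -> H) (f : R -> C) : R -> C :=
  if pselect (inL2 f) is left f2 then A (MkL2 f2) else (fun=> 0).

Lemma lift_opE A (f : H) : lift_op A f = A f.
Proof.
rewrite /lift_op; case: pselect => [f2|n]; last by case: n; exact: fnP.
by congr (fn (A _)); exact: L2t_eq.
Qed.

Lemma lift_op_bounded A (M : R) : lin_mod A -> bnd_by A M -> bounded_operator (lift_op A).
Proof.
move=> lA bA; split.
- by move=> f f2; rewrite (lift_opE A (MkL2 f2)); exact: fnP.
- move=> a b f g f2 g2; pose F : H := MkL2 f2; pose G : H := MkL2 g2.
  rewrite (lift_opE A F) (lift_opE A G) (lift_opE A (a *: F + b *: G)).
  by have /null_aeq := lA a b F G.
- exists (M ^+ 2) => f f2; pose F : H := MkL2 f2.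
  rewrite (lift_opE A F) (sqnormE (A F)) (sqnormE F) -EFinM lee_fin -!nrm_sqr -exprMn.
  apply: lerXn2r; rewrite ?nnegrE ?nrm_ge0//; apply: le_trans (bA F); exact: nrm_ge0.
Qed.

Lemma hbasis_orthonormal (e : nat -> H) : hbasis e -> orthonormal_basis (fun k => fn (e k)).
Proof.
move=> [oe ce]; split; [by move=> k; exact: fnP|exact: oe|].
move=> f f2; pose F : H := MkL2 f2.
have E n : sqnorm (fun x => f x - \sum_(k < n) inner f (e k) * e k x) =
   (nsq (F - \sum_(k < n) ip F (e k) *: e k))%:E.
  rewrite -sqnormE; congr (sqnorm _); apply/funext => x /=; congr (_ - _).
  by rewrite sum_fn.
apply/fine_cvgP; split; first by apply: nearW => n; rewrite E.
apply/cvgrPdist_lt => r r0; have sr : 0 < Num.sqrt r by rewrite sqrtr_gt0.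
have [n0 h] := ce F _ sr; exists n0 => // n /= n0n; rewrite E /= sub0r normrN ger0_norm ?nsq_ge0//.
rewrite -nrm_sqr -(sqr_sqrtr (ltW r0)) ltr_pXn2r ?nnegrE ?nrm_ge0 ?(ltW sr)//.
by rewrite nrmC; apply: h.
Qed.

Lemma to_riesz_basis (e u : nat -> H) A B (M : R) : hbasis e -> lin_mod A -> lin_mod B ->
  bnd_by A M -> bnd_by B M -> (forall x, null (A (B x) - x)) -> (forall x, null (B (A x) - x)) ->
  (forall k, null (A (e k) - u k)) -> riesz_basis (fun k => fn (u k)).
Proof.
move=> he lA lB bA bB AB BA Au; split; first by move=> k; exact: fnP.
exists (fun k => fn (e k)), (lift_op A); split.
- exact: hbasis_orthonormal.
- split; first exact: lift_op_bounded lA bA.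
  exists (lift_op B); first exact: lift_op_bounded lB bB.
  move=> f f2; pose F : H := MkL2 f2.
  rewrite (lift_opE B F) (lift_opE A (B F)) (lift_opE A F) (lift_opE B (A F)).
  by split; [have /null_aeq := AB F|have /null_aeq := BA F].
- by move=> k; rewrite lift_opE; apply/aeq_sym/null_aeq.
Qed.

Lemma riesz_nonnull (e u : nat -> H) A B (M : R) k : hbasis e -> lin_mod B -> bnd_by B M ->
  (forall x, null (B (A x) - x)) -> null (A (e k) - u k) -> ~ null (u k).
Proof.
move=> [oe _] lB bB BA Au u0.
have n1 : null (A (e k)) by rewrite -[A _](subrK (u k)); exact: nullD.
have n2 : null (B (A (e k))).
  by apply: nullP; apply: (le_trans (bB _)); rewrite n1 mulr0.
have n3 : null (e k) by have := nullD n2 (nullN (BA (e k))); rewrite opprB addrC subrK.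
have := oe k k; rewrite eqxx ip_nulll// => /esym/eqP; by rewrite oner_eq0.
Qed.

End ToRieszBasis.

Section ResolventPoint.
Variable R : realType.
Local Notation C := R[i].
Local Notation H := (L2H R).
Let mI := @measurable_I0pi R.
Variable v : R -> C.
Hypothesis vi : cintble I0pi v.
Variables (N : nat) (lamm lamp nu : nat -> C).
Hypothesis hspec : forall n, (N <= n)%N -> disc_eigenvalues v n (lamm n) (lamp n) (nu n).

Lemma avoid2 (a b c : C) : exists2 k : nat, (k < 3)%N & (a + k%:R != b) && (a + k%:R != c).
Proof.
have [h0|] := boolP ((a + 0%:R != b) && (a + 0%:R != c)); first by exists 0%N.
have [h1|] := boolP ((a + 1%:R != b) && (a + 1%:R != c)); first by exists 1%N.
have inj (i j : nat) : a + i%:R = a + j%:R -> i = j by move/addrI/eqP; rewrite eqr_nat => /eqP.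
rewrite !negb_and !negbK => /orP[] /eqP e1 /orP[] /eqP e0; exists 2%N => //.
- by have := inj 1%N 0%N; rewrite e1 e0 => /(_ erefl).
- by apply/andP; split; apply/eqP; rewrite -?e1 -?e0 => /inj.
- by apply/andP; split; apply/eqP; rewrite -?e1 -?e0 => /inj.
- by have := inj 1%N 0%N; rewrite e1 e0 => /(_ erefl).
Qed.

(** One of [n0^2], [n0^2 + 1], [n0^2 + 2] avoids both eigenvalues; it lies in the disc, where no
    others exist, and leaves the perturbation [v - k] with [k <= 2], small relative to [n0]. *)
Lemma resolvent_point p : exists n0 z, [/\ (N <= n0)%N, odd n0 = p, disc n0 z, z != lamm n0 & z != lamp n0] /\
  forall h : H, exists u : H, Lgraph (per_of n0) v u (z *: u + h : H).
Proof.
pose V := nI I0pi v; have V0 : 0 <= V by exact: nI_ge0.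
(* [7] bounds the L^1 norm of a constant of modulus at most 2; the resulting [n0 >= 28] also puts
   [n0^2 + 2] into the disc. *)
have K0 : 0 <= 2 * (V + 7) by rewrite mulr_ge0 ?ler0n ?addr_ge0 ?ler0n.
have e0 : 0 < 1 / 2 :> R by lra.
have [N0 hN0] := eventually_small K0 e0.
have [n0 [nN nN0 np]] : exists n0, [/\ (N <= n0)%N, (N0 <= n0)%N & odd n0 = p].
  exists ((N + N0).*2 + p)%N; split; [lia|lia|by rewrite oddD odd_double /= oddb].
have [n00 small] := hN0 n0 nN0.
have nR : 0 < (n0%:R : R) by rewrite ltr0n.
have n28 : 28 <= (n0%:R : R).
  by move: small; rewrite ler_pdivrMr//; lra.
have [k k3 /andP[km kp]] := avoid2 (n0%:R ^+ 2) (lamm n0) (lamp n0).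
have k2 : (k%:R : R) <= 2 by rewrite ler_nat.
set z := n0%:R ^+ 2 + k%:R in km kp.
have dz : disc n0 z.
  by rewrite /disc /= /z addrAC subrr add0r cabs_nat; lra.
exists n0, z; split; first by split.
have [_ am _ _] := hspec nN; have := am z dz; rewrite (negbTE km) (negbTE kp) /= => am0.
move=> h; have [y [dy d]] : exists y dy, dom v (per_of n0) y dy (fun x => z * y x + h x).
  apply: (resolvent vi n00 _ (fnP h) am0); first by rewrite /per_of; case: ifP.
  have -> : (fun x => v x - z + n0%:R ^+ 2) = (fun x => v x + - k%:R).
    by apply/funext => x; rewrite /z; ring.
  apply: le_trans small; rewrite mulrAC ler_wpM2r ?invr_ge0 ?(ltW nR)// ler_wpM2l ?ler0n//.
  have ic := ucont_cintble (@ucont_cst R (- k%:R)).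
  apply: (le_trans (nI_D mI vi ic)); rewrite lerD2l.
  have := nI_le_bound (lexx 0) (ltW (pi_gt0 R)) (lexx pi) ic (fun x _ => _ : cabs (- k%:R) <= 2).
  rewrite cabsN cabs_nat subr0 => /(_ k2) h1; apply: (le_trans h1).
  by have := pi_le R; lra.
have uy : inL2 y by case: d => s _ _; apply: L2_ucont; exact: sol2_ucont s.
by exists (MkL2 uy); exact: dom_self d.
Qed.

End ResolventPoint.

(** * A bounded ratio yields a Riesz basis *)

Section IfDirection.
Variable R : realType.
Local Notation C := R[i].
Local Notation H := (L2H R).
Variable v : R -> C.
Hypothesis vi : cintble I0pi v.
Variables (N : nat) (lamm lamp nu : nat -> C).
Hypothesis hspec : forall n, (N <= n)%N -> disc_eigenvalues v n (lamm n) (lamp n) (nu n).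

Lemma riesz_if p (K : R) :
  (forall n, (N <= n)%N -> odd n = p -> lamp n - lamm n != 0 ->
    cabs (lamp n - nu n) <= K * cabs (lamp n - lamm n)) ->
  has_riesz_basis_of_root_functions (if p then PerM else PerP) v.
Proof.
move=> hK; set bc := if p then _ else _.
have bcE n : odd n = p -> per_of n = bc by rewrite /per_of => ->.
have [N1 [C1 [NN1 N10 C10 pairs]]] := pair_exists vi hspec.
pose K0 := Num.max K 0; have K00 : 0 <= K0 by rewrite le_max lexx orbT.
have KK0 : K <= K0 by rewrite le_max lexx.
pose D := 3 + 4 * K0; have D0 : 0 < D by rewrite /D; lra.
(* Doubling and adding [~~ p] gives [d] the parity opposite to [p]. *)
pose m := (Num.bound (C1 ^+ 2 * 2) + N1)%N; pose d := (m.*2 + ~~ p)%N.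
have dp : odd d != p by rewrite /d oddD odd_double /= oddb; case: (p).
have dN : (N1 <= d)%N by rewrite /d /m; lia.
have d1 : (0 < d)%N by lia.
have dbig : C1 ^+ 2 * 2 < d%:R.
  apply: (lt_le_trans (archi_boundP _)); first by rewrite mulr_ge0 ?ler0n ?sqr_ge0.
  by rewrite ler_nat /d /m; lia.
have ex n : exists t : H * H * C * C, (d < n)%N -> odd n = p ->
    good_pair v lamm lamp p C1 D n t.1.1.1 t.1.1.2 t.1.2 t.2.
  have [dn|nd] := ltnP d n; last by exists (0, 0, 0, 0).
  have [np|np] := eqVneq (odd n) p; last by exists (0, 0, 0, 0) => _ e; rewrite e eqxx in np.
  have nN1 : (N1 <= n)%N by lia.
  have [G [F [al [b pr]]]] := pairs n nN1.
  have hK' : lamp n - lamm n != 0 -> cabs (lamp n - nu n) <= K0 * cabs (lamp n - lamm n).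
    move=> g0; apply: (le_trans (hK n (leq_trans NN1 nN1) np g0)).
    by rewrite ler_wpM2r// cabs_ge0.
  have [x [y gp]] := pair_good vi K00 np pr hK'.
  by exists (G, F, x, y).
have [t tP] := choice ex.
pose G n := (t n).1.1.1; pose F n := (t n).1.1.2; pose x n := (t n).1.2; pose y n := (t n).2.
have gd n : (d < n)%N -> odd n = p -> good_pair v lamm lamp p C1 D n (G n) (F n) (x n) (y n) by exact: tP.
have discs n : (d < n)%N -> disc n (lamm n) /\ disc n (lamp n).
  move=> dn; have Nn : (N <= n)%N by lia.
  by have [[h1 h2 _] _ _ _] := hspec Nn.
pose h k := hsys p G F x y (d + k).
have bh : bessel h (2 * D ^+ 2 * 16) by exact: (hsys_bessel dp dbig d1 gd D0).
have Kh : 0 < 2 * D ^+ 2 * 16 by rewrite mulr_gt0 ?ltr0n// mulr_gt0 ?ltr0n// exprn_gt0.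
have oh i j : bip (h i) (h j) = (i == j)%:R.
  by rewrite (hsys_orthonormal vi dp dbig d1 gd discs) ?leq_addr// eqn_add2l.
pose S f := forall k, bip f (h k) = 0.
have Sl (a : C) f g : S f -> S g -> S (a *: f + g).
  by move=> Sf Sg k; rewrite bipDl bipZl Sf Sg mulr0 addr0.
have Sn f : S f -> (forall k, (k < d)%N -> ip f (tbase R p k) = 0) -> null f.
  by move=> Sf; exact: (complement_finite dp dbig d1 gd Sf).
have [r [w [wS wi ws]]] := fin_basis Sl Sn.
have [n0 [z [[Nn0 n0p dz zm zp] res]]] := resolvent_point vi hspec p.
(* The complement is invariant under the resolvent: [z] avoids the eigenvalues of its own disc by
   choice and those of the other high discs by disjointness. *)
have Sres f : S f -> exists u, S u /\ Lgraph bc v u (z *: u + f : H).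
  move=> Sf; have [u Lu] := res f; rewrite (bcE n0 n0p) in Lu; exists u; split => // k.
  have dk : (d <= d + k)%N by exact: leq_addr.
  set n := freq p (d + k); have np : odd n = p by exact: odd_freq.
  have dn : (d < n)%N by exact: (freq_gt dp dk).
  have [z1 z2] : z != lamm n /\ z != lamp n.
    have [->|nn0] := eqVneq n n0; first by [].
    have [q1 q2] := discs n dn.
    by split; rewrite eq_sym; [exact: disc_disjoint nn0 q1 dz|exact: disc_disjoint nn0 q2 dz].
  have [fG fF] := hsys_orth dp dbig d1 gd dk Sf.
  have [_ [_ _ _ _ inv]] := gd n dn np.
  rewrite -(bcE n np) in Lu.
  have [uG uF] := inv z f u z1 z2 Lu fG fF.
  rewrite /h /hsys -/n; case: ifP => _; rewrite bipDr !bipZr uG uF !mulr0 addr0//.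
have Ssum s (q : 'I_s -> H) (a : 'I_s -> C) : (forall i, S (q i)) -> S (\sum_(i < s) a i *: q i).
  by move=> Sq k; rewrite bip_suml big1// => i _; rewrite bipZl Sq mulr0.
have [f [fP fi fs]] := root_basis vi wS wi ws Ssum Sres.
have fS i : (i < r)%N -> S (f i) by move=> /fP[].
have [A [B [M [[lA lB bA bB] [AB BA Au]]]]] := riesz_assembly Kh bh oh fS fi fs (@tbase_hbasis R p).
exists (fun k => fn (app r f h k)).
  exact: (to_riesz_basis (@tbase_hbasis R p) lA lB bA bB AB BA Au).
move=> k; split.
  by move=> /null_aeq0; exact: (riesz_nonnull (@tbase_hbasis R p) lB bB BA (Au k)).
rewrite /app; case: ltnP => kr; first by have [] := fP k kr.
have := hsys_root dp gd (leq_addr (k - r) d); rewrite bcE ?odd_freq// => hr.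
by eexists; exact: hr.
Qed.

End IfDirection.

(** * Riesz bases force the ratio bound *)

Section OnlyIf.
Variable R : realType.
Local Notation C := R[i].
Local Notation H := (L2H R).
Let mI := @measurable_I0pi R.

Lemma Lp_cintble (p : R) (v : R -> C) : 1 < p -> inLp p v -> cintble I0pi v.
Proof.
move=> p1 [mv iv]; apply: (@cintble_dom _ _ _ (fun x => 1 + cabs (v x) `^ p)) => //.
  apply: rintD => //; first by apply: rint_cst.
  apply/integrableP; split.
    apply/measurable_EFinP; apply: (measurableT_comp (measurable_powR p)); exact: cmeas_cabs.
  move: iv; congr (_ < _)%E; apply: eq_integral => x _ /=.
  by rewrite ger0_norm// powR_ge0.
move=> x _; have [h|h] := leP (cabs (v x)) 1.
  by apply: (le_trans h); rewrite lerDl powR_ge0.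
apply: (@le_trans _ _ (cabs (v x) `^ p)); last by rewrite lerDr.
by rewrite -{1}[cabs (v x)]powRr1 ?cabs_ge0// ler_powR// ltW.
Qed.

Lemma orthonormal_hbasis (e : nat -> R -> C) (e2 : forall k, inL2 (e k)) : orthonormal_basis e ->
  hbasis (fun k => MkL2 (e2 k) : H).
Proof.
move=> [_ oe ce]; split; first exact: oe.
move=> F r r0; pose eH k : H := MkL2 (e2 k).
have E n : sqnorm (fun x => F x - \sum_(k < n) inner F (e k) * e k x) =
   (nsq (F - \sum_(k < n) ip F (eH k) *: eH k))%:E.
  rewrite -sqnormE; congr (sqnorm _); apply/funext => x /=; congr (_ - _).
  by rewrite sum_fn.
have /fine_cvgP[_ /cvgrPdist_lt] := ce F (fnP F).
move=> /(_ _ (exprn_gt0 2 r0)) [n0 _ h]; exists n0 => n n0n; have := h n n0n.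
rewrite /= E /= sub0r normrN ger0_norm ?nsq_ge0// -nrm_sqr ltr_pXn2r ?nnegrE ?nrm_ge0 ?(ltW r0)//.
by rewrite nrmC.
Qed.

Lemma bounded_lift A : bounded_operator A -> exists AH : H -> H, exists M : R,
  [/\ 0 <= M, forall x, fn (AH x) = A x, lin_mod AH & bnd_by AH M].
Proof.
move=> [A2 Al [M AM]]; pose AH (x : H) : H := MkL2 (A2 x (fnP x)).
pose M' := Num.max M 0; have M0 : 0 <= M' by rewrite le_max lexx orbT.
exists AH, (Num.sqrt M'); split => //.
  by move=> a b x y; apply/null_aeq; exact: Al (fnP x) (fnP y).
move=> x; rewrite -(@ler_pXn2r _ 2) ?nnegrE ?nrm_ge0 ?mulr_ge0 ?sqrtr_ge0 ?nrm_ge0//.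
rewrite exprMn !nrm_sqr sqr_sqrtr//.
have := AM x (fnP x); rewrite (sqnormE x) (sqnormE (AH x)) -EFinM lee_fin => /le_trans; apply.
by rewrite ler_wpM2r ?nsq_ge0// le_max lexx.
Qed.

Lemma riesz_basis_lift (u : nat -> R -> C) : riesz_basis u -> exists (e uH : nat -> H) A B (M : R),
  [/\ hbasis e, lin_mod A, lin_mod B, bnd_by A M & bnd_by B M] /\
  [/\ 0 <= M, forall x, null (A (B x) - x), forall x, null (B (A x) - x),
      forall k, null (uH k - A (e k)) & forall k, fn (uH k) = u k].
Proof.
move=> [u2 [e [A0 [oe [bA [B0 bB AB]] uA]]]]; have [e2 _ _] := oe.
have [A [M1 [M10 AE lA bA']]] := bounded_lift bA.
have [B [M2 [M20 BE lB bB']]] := bounded_lift bB.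
exists (fun k => MkL2 (e2 k)), (fun k => MkL2 (u2 k)), A, B, (M1 + M2); split; split => //.
- exact: orthonormal_hbasis.
- by move=> x; apply: (le_trans (bA' x)); rewrite ler_wpM2r ?nrm_ge0// lerDl.
- by move=> x; apply: (le_trans (bB' x)); rewrite ler_wpM2r ?nrm_ge0// lerDr.
- exact: addr_ge0.
- by move=> x; apply/null_aeq; rewrite AE BE; have [] := AB x (fnP x).
- by move=> x; apply/null_aeq; rewrite BE AE; have [] := AB x (fnP x).
- by move=> k; apply/null_aeq; rewrite AE /=; exact: uA.
Qed.

Variable v : R -> C.
Hypothesis vi : cintble I0pi v.

(* A simple eigenfunction E is a multiple of one u_k and, since L is symmetric
   for bip, bip-orthogonal to the others. *)
Lemma simple_eigen_bound bc (l : C) (E : H) (e u : nat -> H) A B (M : R) : hbasis e -> lin_mod A -> lin_mod B ->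
  bnd_by A M -> bnd_by B M -> 0 <= M ->
  (forall x, null (A (B x) - x)) -> (forall x, null (B (A x) - x)) -> (forall k, null (u k - A (e k))) ->
  (forall k, exists m, in_root_space bc v m (u k)) ->
  in_root_space bc v l E -> ~ null E ->
  (forall f : H, in_root_space bc v l f -> exists c, null (f - c *: E)) ->
  nsq E <= M ^+ 2 * cabs (bip E E).
Proof.
move=> he lA lB bA bB M0 AB BA uA ur [j Ej] E0 sE; have [oe _] := he.
have [m mP] := choice ur.
have orth k : m k != l -> ip (u k) (L2conj E) = 0.
  by have [i ki] := mP k => ml; exact: (root_symmetric2 vi ml ki Ej).
have nc : nsq (L2conj E : H) = nsq E by rewrite -!nrm_sqr nrm_conj.
have Bu k : null (B (u k) - e k).
  by apply: null_trans (op_null lB bB (uA k)) (BA (e k)).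
have [k mk] : exists k, m k = l.
  apply: contrapT => nk; apply: E0; apply/null_nsq.
  have h0 i : ip (u i) (L2conj E) = 0 by apply: orth; apply/eqP => mi; apply: nk; exists i.
  have := riesz_functional_bound he lA bA bB AB uA (k := 0%N) (f := L2conj E : H) (fun i _ => h0 i).
  rewrite h0 cabs0 mulr0 nc => h; apply/eqP; rewrite eq_le h; exact: nsq_ge0.
have unn i : ~ null (u i).
  move=> n0; have n1 : null (B (u i)) by apply: nullP; apply: (le_trans (bB _)); rewrite n0 mulr0.
  have n2 : null (e i) by have := nullD n1 (nullN (Bu i)); rewrite opprB addrC subrK.
  by have := oe i i; rewrite eqxx ip_nulll// => /esym/eqP; rewrite oner_eq0.
have mult i : m i = l -> exists c, null (u i - c *: E).
  by move=> mi; apply: sE; have := mP i; rewrite mi.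
have [c uc] := mult k mk.
have c0 : c != 0.
  by apply/eqP => c0; apply: (unn k); move: uc; rewrite c0 scale0r subr0.
(* A second member for [l] would be proportional to [u k]; applying [B] contradicts the independence
   of [e i] and [e k]. *)
have others i : i != k -> ip (u i) (L2conj E) = 0.
  move=> ik; apply: orth; apply/eqP => mi; have [c' uc'] := mult i mi.
  have n1 : null (c *: u i - c' *: u k).
    apply: (@null_trans _ _ (c *: (c' *: E))).
      by rewrite -scalerBr; exact: nullZ.
    by rewrite scalerA mulrC -scalerA -scalerBr; apply: nullZ; exact: nullC.
  have n2 : null (B (c *: u i - c' *: u k)) by apply: nullP; apply: (le_trans (bB _)); rewrite n1 mulr0.
  have n3 : null (c *: B (u i) - c' *: B (u k)).
    have := lB c (- c') (u i) (u k); rewrite !scaleNr => n3.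
    by have := nullD n2 (nullN n3); rewrite opprB addrC subrK.
  have n4 : ip (c *: B (u i) - c' *: B (u k)) (e i) = c.
    rewrite ipBl !ipZl (ip_eql _ (Bu i)) (ip_eql _ (Bu k)) !oe eqxx mulr1 eq_sym (negbTE ik) mulr0 subr0 //.
  by move: c0; rewrite -n4 ip_nulll// eqxx.
have := riesz_functional_bound he lA bA bB AB uA others.
rewrite nc nrm_conj -[ip (u k) _]/(bip (u k) E) (bip_eql _ uc) bipZl cabsM => h; apply: (le_trans h).
(* [c *: E] agrees with [u k], the image of a unit vector under [A]. *)
have cE : nrm E * cabs c <= M.
  rewrite mulrC -nrmZ -(nrm_eq uc) (nrm_eq (uA k)); apply: (le_trans (bA _)).
  by rewrite (_ : nrm (e k) = 1) ?mulr1// /nrm /nsq oe eqxx /= sqrtr1.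
rewrite -mulrA mulrA expr2 -!mulrA ler_wpM2l// mulrA ler_wpM2r ?cabs_ge0//.
Qed.

Lemma orthonormal_pair_norm (e1 e2 : H) (x y : C) : ip e1 e1 = 1 -> ip e2 e2 = 1 -> ip e1 e2 = 0 ->
  nsq (x *: e1 + y *: e2) = cabs x ^+ 2 + cabs y ^+ 2.
Proof.
move=> h1 h2 h12; rewrite nsqD !nsqZ ipZl ipZr h12 !mulr0 addr0.
by rewrite /nsq h1 h2 /= !mulr1.
Qed.

Variables (N : nat) (lamm lamp nu : nat -> C).
Hypothesis hspec : forall n, (N <= n)%N -> disc_eigenvalues v n (lamm n) (lamp n) (nu n).

Lemma rot_vector (al b xi : C) : xi != 0 -> al ^+ 2 + b ^+ 2 = xi ^+ 2 ->
  exists x y, [/\ (x != 0) || (y != 0), al * x + b * y = xi * x & b * x - al * y = xi * y].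
Proof.
move=> xi0 e; have [h|h] := eqVneq (al + xi) 0; last first.
  exists (al + xi), b; rewrite h; split => //.
    have -> : al * (al + xi) + b * b = al ^+ 2 + b ^+ 2 + al * xi by ring.
    by rewrite e; ring.
  by ring.
exists b, (xi - al); split; first last.
- have -> : b * b - al * (xi - al) = al ^+ 2 + b ^+ 2 - al * xi by ring.
  by rewrite e; ring.
- by ring.
apply/orP; right; have -> : xi - al = 2 * xi by rewrite -[al](addrK xi) h; ring.
by rewrite mulf_neq0// pnatr_eq0.
Qed.

(** The eigenvector determines the matrix: [al (x^2 + y^2) = xi (x^2 - y^2)] and
    [b (x^2 + y^2) = 2 xi x y]. If it is not nearly isotropic, both entries are at most [M |xi|]. *)
Lemma ratio_algebra (al b xi x y s dl : C) (M q : R) : 0 <= M ->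
  al * x + b * y = xi * x -> b * x - al * y = xi * y ->
  q = cabs x ^+ 2 + cabs y ^+ 2 -> 0 < q -> q <= M * cabs (x ^+ 2 + y ^+ 2) ->
  cabs s <= 1 / 4 * cabs b -> dl = xi - al - s -> cabs dl <= (1 + 2 * M) * cabs xi.
Proof.
move=> M0 e1 e2 qE q0 qM sb ->.
have p0 : 0 < cabs (x ^+ 2 + y ^+ 2).
  by rewrite lt_def cabs_ge0 andbT; apply/eqP => h; rewrite h mulr0 in qM; lra.
have t2 : 2 * (cabs x * cabs y) <= q.
  by rewrite qE; have := sqr_ge0 (cabs x - cabs y); rewrite sqrrB -mulr_natl; lra.
have bound (c d : C) : c * (x ^+ 2 + y ^+ 2) = xi * d -> cabs d <= q -> cabs c <= M * cabs xi.
  move=> ed dq; rewrite -(ler_pM2r p0) -cabsM ed cabsM mulrAC mulrC.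
  by rewrite ler_wpM2r ?cabs_ge0//; apply: le_trans dq qM.
have a_le : cabs al <= M * cabs xi.
  apply: (@bound _ (x ^+ 2 - y ^+ 2)).
    transitivity (x * (al * x + b * y) - y * (b * x - al * y)); first by ring.
    by rewrite e1 e2; ring.
  by rewrite qE -!cabsX; exact: cabsB.
have b_le : cabs b <= M * cabs xi.
  apply: (@bound _ (2 * (x * y))).
    transitivity (y * (al * x + b * y) + x * (b * x - al * y)); first by ring.
    by rewrite e1 e2; ring.
  by rewrite !cabsM cabs_nat.
have := cabsB (xi - al) s; have := cabsB xi al; rewrite mulrDl mul1r -mulrA.
have := cabs_ge0 b; move: (M * cabs xi) a_le b_le => Mx; lra.
Qed.

Lemma only_if p : has_riesz_basis_of_root_functions (if p then PerM else PerP) v ->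
  exists K : R, forall n, (N <= n)%N -> odd n = p -> lamp n - lamm n != 0 ->
    cabs (lamp n - nu n) <= K * cabs (lamp n - lamm n).
Proof.
set bc := if p then _ else _; move=> [u0 /riesz_basis_lift[e [u [A [B [M [[he lA lB bA bB] [M0 AB BA uA uE]]]]]]] ur].
have bcE n : odd n = p -> per_of n = bc by rewrite /per_of => ->.
have ur' k : exists m, in_root_space bc v m (u k) by rewrite uE; have [] := ur k.
have [N1 [C1 [NN1 N10 C10 pairs]]] := pair_exists vi hspec.
have e4 : 0 < 1 / 4 :> R by lra.
(* At distance at most 1/4 from the orthonormal waves, [G] and [F] still satisfy
   [nrm E >= sqrt q / 2]; this is the source of the factor 4 in [K1]. *)
have [N2 hN2] := eventually_small (ltW C10) e4.
pose N3 := (maxn N1 N2); pose K1 := 1 + 2 * (4 * M ^+ 2).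
have K10 : 0 <= K1 by rewrite addr_ge0 ?ler01// mulr_ge0 ?ler0n// mulr_ge0 ?ler0n// sqr_ge0.
have high n : (N3 <= n)%N -> odd n = p -> lamp n - lamm n != 0 ->
    cabs (lamp n - nu n) <= K1 * cabs (lamp n - lamm n).
  rewrite geq_max => /andP[n1 n2] np g0; have Nn := leq_trans NN1 n1.
  have [n00 small] := hN2 n n2.
  have [G [F [al [b [[[dG q1] [dF q2] q3 q4 q5] [q6 q7 q8 q9]]]]]] := pairs n n1.
  pose m := (lamp n + lamm n) / 2; pose xi := (lamp n - lamm n) / 2.
  have two : (2 : C) != 0 by rewrite pnatr_eq0.
  have xi0 : xi != 0 by rewrite mulf_neq0// invr_eq0.
  have lpE : lamp n = m + xi by rewrite /m /xi; field.
  have [x [y [xy0 e1 e2]]] := rot_vector xi0 q6.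
  pose E : H := x *: G + y *: F.
  have Er : in_root_space bc v (lamp n) E.
    by rewrite -(bcE n np) lpE; apply: (pair_root q1 q2 q6); right.
  pose q := cabs x ^+ 2 + cabs y ^+ 2.
  have q0 : 0 < q.
    case/orP: xy0 => h; first by rewrite ltr_pwDl ?sqr_ge0// exprn_gt0// cabs_gt0.
    by rewrite ltr_wpDl ?sqr_ge0// exprn_gt0// cabs_gt0.
  have o12 : ip (tbase R p n) (tbase R p n.-1) = 0.
    have nn1 : (n == n.-1) = false by apply: gtn_eqF; rewrite ltn_predL.
    by rewrite tbase_orthonormal nn1.
  have oo j : ip (tbase R p j) (tbase R p j) = 1 by rewrite tbase_orthonormal eqxx.
  have qs := orthonormal_pair_norm x y (oo n) (oo n.-1) o12.
  rewrite np in q8 q9.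
  have sq : Num.sqrt q ^+ 2 = q by rewrite sqr_sqrtr// ltW.
  have s0 : 0 <= Num.sqrt q by exact: sqrtr_ge0.
  have xs : cabs x <= Num.sqrt q.
    by rewrite -(@ler_pXn2r _ 2) ?nnegrE ?cabs_ge0// sq lerDl sqr_ge0.
  have ys : cabs y <= Num.sqrt q.
    by rewrite -(@ler_pXn2r _ 2) ?nnegrE ?cabs_ge0// sq lerDr sqr_ge0.
  (* Replacing [G] and [F] by the orthonormal waves changes the norm by at most [2 (1/4) sqrt q]. *)
  have near : Num.sqrt q <= 2 * nrm E.
    have nE := nrmB E (x *: (G - tbase R p n) + y *: (F - tbase R p n.-1)).
    have nD := nrmD (x *: (G - tbase R p n)) (y *: (F - tbase R p n.-1)).
    rewrite !nrmZ in nD.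
    have t1 : cabs x * nrm (G - tbase R p n) <= Num.sqrt q * (1 / 4).
      by apply: ler_pM => //; rewrite ?cabs_ge0 ?nrm_ge0//; apply: le_trans q8 small.
    have t2 : cabs y * nrm (F - tbase R p n.-1) <= Num.sqrt q * (1 / 4).
      by apply: ler_pM => //; rewrite ?cabs_ge0 ?nrm_ge0//; apply: le_trans q9 small.
    have sE : Num.sqrt q = nrm (E - (x *: (G - tbase R p n) + y *: (F - tbase R p n.-1))).
      rewrite (_ : E - _ = x *: tbase R p n + y *: tbase R p n.-1); last first.
        by rewrite /E !scalerBr addrACA -opprD subKr.
      by rewrite /nrm qs.
    by rewrite -sE in nE; lra.
  have qE4 : q <= 4 * nsq E.
    rewrite -sq -nrm_sqr; have -> : 4 * nrm E ^+ 2 = (2 * nrm E) ^+ 2 by rewrite exprMn; ring.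
    by apply: lerXn2r => //; rewrite nnegrE ?mulr_ge0 ?ler0n ?nrm_ge0.
  have E0 : ~ null E by move=> /null_nsq h; rewrite h mulr0 in qE4; lra.
  have [[_ dp _] am _ _] := hspec Nn.
  have lpm : lamp n != lamm n by rewrite -subr_eq0.
  have := am _ dp; rewrite eqxx (negbTE lpm) (bcE n np) /= => am1.
  have [f [df [d f0 mul]]] := alg_mult1 vi am1.
  have [c0 Ec] := mul E Er.
  have c00 : c0 != 0.
    apply/eqP => c00; apply: E0; apply/null_aeq0; apply: aeq_trans Ec _.
    by apply: aeW => t _; rewrite c00 mul0r.
  have sE (k : H) : in_root_space bc v (lamp n) k -> exists c, null (k - c *: E).
    move=> /mul[c kc]; exists (c / c0); apply/null_aeq; apply: aeq_trans kc _.
    apply: aeq_sym; apply: aeS Ec => t h It.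
    rewrite -[LHS]/(c / c0 * E t) (h It); field; exact: c00.
  have bnd := simple_eigen_bound he lA lB bA bB M0 AB BA uA ur' Er E0 sE.
  have EE : bip E E = x ^+ 2 + y ^+ 2.
    rewrite /E bipDl !bipDr !bipZl !bipZr [bip F G]bipC q3 q4 q5; ring.
  rewrite EE in bnd.
  have qM : q <= 4 * M ^+ 2 * cabs (x ^+ 2 + y ^+ 2).
    by rewrite -mulrA; apply: (le_trans qE4); rewrite ler_wpM2l ?ler0n.
  have dE : lamp n - nu n = xi - al - (nu n - m - al) by rewrite lpE; ring.
  have M4 : 0 <= 4 * M ^+ 2 by rewrite mulr_ge0 ?ler0n ?sqr_ge0.
  have := ratio_algebra M4 e1 e2 erefl q0 qM q7 dE => /le_trans; apply.
  rewrite -/K1 ler_wpM2l// /xi cabsM cabsV cabs_nat ler_piMr ?cabs_ge0//; lra.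
(* The finitely many indices below [N3] are covered by adding all their ratios to the constant; a
   vanishing gap contributes the value 0 of a division by zero. *)
pose r k := cabs (lamp k - nu k) / cabs (lamp k - lamm k).
have r0 k : 0 <= r k by rewrite divr_ge0 ?cabs_ge0.
exists (K1 + \sum_(k < N3) r k) => n Nn np g0.
have gp : 0 < cabs (lamp n - lamm n) by rewrite cabs_gt0.
have [n3|n3] := leqP N3 n.
  apply: (le_trans (high n n3 np g0)); rewrite ler_wpM2r ?cabs_ge0// lerDl; exact: sumr_ge0.
rewrite -ler_pdivrMr//; apply: (@le_trans _ _ (\sum_(k < N3) r k)); last by rewrite lerDr.
by rewrite (bigD1 (Ordinal n3))//= lerDl; exact: sumr_ge0.
Qed.

End OnlyIf.

Section SupremumBound.
Variable R : realType.

Lemma sup_bound (P : nat -> Prop) (r : nat -> R) : (forall n, P n -> 0 <= r n) ->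
  (ereal_sup [set (r n)%:E | n in [set n | P n]] < +oo)%E <-> exists K, forall n, P n -> r n <= K.
Proof.
move=> r0; split=> [h|[K hK]]; last first.
  by apply: (@le_lt_trans _ _ K%:E); [apply: ge_ereal_sup => _ [n /= Pn <-]; rewrite lee_fin hK|rewrite ltry].
set s := ereal_sup _ in h *; have ub n : P n -> ((r n)%:E <= s)%E.
  by move=> Pn; apply: ereal_sup_ubound; exists n.
case: s h ub => [K|//|] h ub; first by exists K => n /ub; rewrite lee_fin.
(* The supremum is [-oo] exactly when there is no admissible index. *)
by exists 0 => n /ub.
Qed.

End SupremumBound.

Theorem theorem2 (R : realType) (p : R) (v : R -> R[i]) (hp : 1 < p)
    (hv : inLp p v)
    (N : nat) (lamm lamp nu : nat -> R[i])
    (hspec : forall n : nat, (N <= n)%N ->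
       disc_eigenvalues v n (lamm n) (lamp n) (nu n)) :
  let gamma : nat -> R[i] := fun n => lamp n - lamm n in
  let delta : nat -> R[i] := fun n => lamp n - nu n in
  let ratio : nat -> R := fun n => cabs (delta n) / cabs (gamma n) in
  (has_riesz_basis_of_root_functions PerP v <->
     (ereal_sup [set (ratio n)%:E | n in
        [set n : nat | [/\ (N <= n)%N, ~~ odd n & (gamma n != 0)%R]]] < +oo)%E)
  /\
  (has_riesz_basis_of_root_functions PerM v <->
     (ereal_sup [set (ratio n)%:E | n in
        [set n : nat | [/\ (N <= n)%N, odd n & (gamma n != 0)%R]]] < +oo)%E).
Proof.
move=> gamma delta ratio; have vi := Lp_cintble hp hv.
(* The parity is a boolean parameter, so the periodic and the antiperiodic case are two instances of
   one statement. *)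
have main b (P : nat -> Prop) : (forall n, P n <-> [/\ (N <= n)%N, odd n = b & gamma n != 0]) ->
    has_riesz_basis_of_root_functions (if b then PerM else PerP) v <->
    (ereal_sup [set (ratio n)%:E | n in [set n | P n]] < +oo)%E.
  move=> PE; have r0 n : P n -> 0 <= ratio n by move=> _; rewrite divr_ge0 ?cabs_ge0.
  split=> [/(only_if vi hspec)[K hK]|/(sup_bound r0)[K hK]].
    apply/(sup_bound r0); exists K => n /PE[Nn nb g0].
    by rewrite /ratio ler_pdivrMr ?cabs_gt0//; exact: hK.
  apply: (riesz_if vi hspec (K := K)) => n Nn nb g0.
  by rewrite -ler_pdivrMr ?cabs_gt0//; apply: hK; apply/PE.
split; [apply: (main false)|apply: (main true)] => n; split=> -[h1 h2 h3]; split => //.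
- exact: negbTE.
- by rewrite h2.
Qed.
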